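(* Let $\Omega\subset\mathbb{R}^N$ be a smooth bounded domain and let $\lambda_1$ be the smallest eigenvalue of the Dirichlet Laplacian $-\Delta$ on $\Omega$. Let $A$ be an $n\times n$ real matrix with constant coefficients having only real eigenvalues $\xi_1>\xi_2\ge\dots\ge\xi_n$, and assume that the largest eigenvalue $\xi_1$ is positive, algebraically and geometrically simple, and that the associated eigenvector $X_1$ has only non-zero components. Write $A=PJP^{-1}$ with $J$ the (lower triangular) Jordan canonical form of $A$ and $P=(p_{ij})$ the change of basis matrix, as described in the context. Let $F=(f_1,\dots,f_n)^T$ with $f_i\in L^q(\Omega)$ for $1\le i\le n$, where $q>N$ if $N\ge 2$ and $q=2$ if $N=1$, and assume that the first component $\tilde f_1$ of $\tilde F=P^{-1}F$ satisfies $\tilde f_1\ge 0$, $\tilde f_1\not\equiv 0$. Set $\mu_{11}=\lambda_1-\xi_1$. Then there exists $\delta>0$, independent of $\mu$, such that for every $\mu$ with $\mu_{11}-\delta<\mu<\mu_{11}$, the components $u_i$ ($1\le i\le n$) of the solution $U=(u_1,\dots,u_n)^T$ to $$-\Delta U=AU+\mu U+F\ \text{ in }\Omega,\qquad U=0\ \text{ on }\partial\Omega,$$ have the sign of $p_{i1}$ in $\Omega$ (that is, $p_{i1}u_i>0$ in $\Omega$), and the outward normal derivatives $\frac{\partial u_i}{\partial\nu}$ have the sign of $-p_{i1}$ on $\partial\Omega$ (that is, $p_{i1}\frac{\partial u_i}{\partial \nu}<0$ on $\partial\Omega$).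
   Context: The matrix $A$ is not assumed to be cooperative: its off-diagonal entries may have any sign. $-\Delta$ acts componentwise on vector-valued functions. Jordan decomposition convention: $A=PJP^{-1}$ with $P$ a real invertible matrix and $J$ the lower triangular Jordan canonical form, i.e. $J$ is block diagonal with blocks having one eigenvalue of $A$ repeated on the diagonal, $1$'s on the first subdiagonal, and zeros elsewhere; the diagonal entries of $J$ are the eigenvalues of $A$ in decreasing order $\xi_1>\xi_2\ge\dots\ge\xi_n$. In particular, since $\xi_1$ is simple, the first block is the $1\times1$ block $(\xi_1)$, and the first column $(p_{11},\dots,p_{n1})^T$ of $P$ is an eigenvector $X_1$ of $A$ for $\xi_1$ (so all $p_{i1}\ne 0$). Solutions are understood in the usual weak sense ($U\in H_0^1(\Omega)^n$); by elliptic regularity they are $\mathcal{C}^1$ up to the boundary, so the normal derivatives make sense. $\nu$ denotes the outward unit normal on $\partial\Omega$. *)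

(* Defs.v *)
From HB Require Import structures.
From mathcomp Require Import all_boot all_order all_algebra.
From mathcomp Require Import all_classical all_reals all_analysis.

Set Implicit Arguments.
Unset Strict Implicit.
Unset Printing Implicit Defensive.

Import Order.TTheory GRing.Theory Num.Theory.
Import numFieldNormedType.Exports.

Local Open Scope classical_set_scope.
Local Open Scope ring_scope.

(* MathComp-Analysis, over an arbitrary [R : realType]; points of R^N are row
   vectors. The norm the library puts on ['rV[R]_N] is the sup norm: it is used
   only through the topology and boundedness; Euclidean quantities go through
   [dotrv]. *)

(* Borel sigma-algebra of R^n, as the product of the Borel sigma-algebras. *)
Definition measure_rV_display : measure_display -> measure_display.
Proof. exact. Qed.

Section measurable_rV.
Context {d : measure_display} {T : measurableType d} {n : nat}.

Let coord (i : 'I_n) (x : 'rV[T]_n) : T := x ord0 i.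

Let rV_measurable0 : g_sigma_preimage coord set0.
Proof. exact: sigma_algebra0. Qed.

Let rV_measurableC A : g_sigma_preimage coord A ->
  g_sigma_preimage coord (~` A).
Proof. exact: sigma_algebraC. Qed.

Let rV_measurable_bigcup (F : (set _)^nat) :
  (forall i, g_sigma_preimage coord (F i)) ->
  g_sigma_preimage coord (\bigcup_i F i).
Proof. exact: sigma_algebra_bigcup. Qed.

HB.instance Definition _ := @isMeasurable.Build (measure_rV_display d)
  'rV[T]_n (g_sigma_preimage coord)
  rV_measurable0 rV_measurableC rV_measurable_bigcup.

End measurable_rV.

Lemma measurable_fun_rVP d1 d (T1 : measurableType d1) (T : measurableType d)
    n (f : T1 -> 'rV[T]_n) :
  (forall i, measurable_fun setT (fun x => f x ord0 i)) ->
  measurable_fun setT f.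
Proof.
move=> mf; suff: g_sigma_preimage (fun i x => f x ord0 i) `<=` measurable.
  move=> prefS _ A mA; apply: prefS.
  have -> : (fun i x => f x ord0 i) =
      (fun i => (fun v : 'rV[T]_n => v ord0 i) \o f) by [].
  by rewrite g_sigma_preimage_comp; exists A.
apply: smallest_sub; first exact: sigma_algebra_measurable.
case: n => [|n] in f mf *; first by rewrite big_ord0.
rewrite -bigcup_mkord_ord; apply: bigcup_sub => i Ii.
by move=> A [B mB <-]; exact: mf.
Qed.

Lemma measurable_coord d (T : measurableType d) n (i : 'I_n) :
  measurable_fun setT (fun v : 'rV[T]_n => v ord0 i).
Proof.
move=> _ Y mY; rewrite setTI; apply: sub_sigma_algebra => /=.
rewrite -bigcup_seq/=; exists i => /=; first by rewrite mem_index_enum.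
by exists Y => //; rewrite setTI.
Qed.

(* The library registers sigma-finiteness of product measures canonically only
   for subprobabilities. *)
Lemma sigma_finite_prod d1 d2 (T1 : measurableType d1) (T2 : measurableType d2)
    (R : realType) (m1 : {sigma_finite_measure set T1 -> \bar R})
    (m2 : {sigma_finite_measure set T2 -> \bar R}) :
  sigma_finite setT (m1 \x m2)%E.
Proof.
have /sigma_finiteP[F [TF ndF Foo]] := sigma_finiteT m1.
have /sigma_finiteP[G [TG ndG Goo]] := sigma_finiteT m2.
exists (fun n => F n `*` G n).
  rewrite -setXTT TF TG predeqE => -[x y]; split.
    move=> [/= [n _ Fnx] [k _ Gky]]; exists (maxn n k) => //; split.
    - by move: x Fnx; exact/subsetPset/ndF/leq_maxl.
    - by move: y Gky; exact/subsetPset/ndG/leq_maxr.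
  by move=> [n _ []/= ? ?]; split; exists n.
move=> k; have [? ?] := Foo k; have [? ?] := Goo k.
split; first exact: measurableX.
by rewrite product_measure1E// lte_mul_pinfty// ge0_fin_numE.
Qed.

Section lebesgue_rV.
Variable R : realType.

Definition rV_cons n (x : measurableTypeR R * 'rV[R]_n) : 'rV[R]_n.+1 :=
  \row_i oapp (x.2 ord0) x.1 (unlift ord0 i).

Definition rV_uncons n (v : 'rV[R]_n.+1) : measurableTypeR R * 'rV[R]_n :=
  (v ord0 ord0, \row_i v ord0 (lift ord0 i)).

Lemma rV_consK n : cancel (@rV_cons n) (@rV_uncons n).
Proof.
move=> [x v]; rewrite /rV_uncons /rV_cons !mxE unlift_none /=; congr pair.
by apply/rowP => i; rewrite !mxE liftK.
Qed.

Lemma measurable_rV_cons n : measurable_fun setT (@rV_cons n).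
Proof.
apply: measurable_fun_rVP => i; rewrite /rV_cons.
have [j ij|i0] := unliftP ord0 i.
- rewrite [X in measurable_fun _ X](_ : _ =
      (fun v : 'rV[R]_n => v ord0 j) \o snd); last first.
    by apply/funext => x; rewrite mxE ij liftK.
  apply: measurableT_comp; last exact: measurable_snd.
  exact: measurable_coord.
- rewrite [X in measurable_fun _ X](_ : _ = fst); last first.
    by apply/funext => x; rewrite mxE i0 unlift_none.
  exact: measurable_fst.
Qed.

Lemma measurable_rV_uncons n : measurable_fun setT (@rV_uncons n).
Proof.
apply/measurable_fun_pair; first exact: measurable_coord.
apply: measurable_fun_rVP => i; under eq_fun do rewrite mxE.
exact: measurable_coord.
Qed.

Section succ.
Variables (n : nat) (mu : {sigma_finite_measure set 'rV[R]_n -> \bar R}).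

Definition lebesgue_rV_succ : set 'rV[R]_n.+1 -> \bar R :=
  pushforward (@lebesgue_measure R \x mu)%E (@rV_cons n).

Let preimageM A : measurable A -> measurable (@rV_cons n @^-1` A).
Proof. by move=> mA; rewrite -[X in measurable X]setTI; exact: measurable_rV_cons. Qed.

Let lebesgue_rV_succ0 : lebesgue_rV_succ set0 = 0%E.
Proof. by rewrite /lebesgue_rV_succ /pushforward preimage_set0 measure0. Qed.

Let lebesgue_rV_succ_ge0 A : (0 <= lebesgue_rV_succ A)%E.
Proof. by rewrite /lebesgue_rV_succ /pushforward; apply: measure_ge0. Qed.

Let lebesgue_rV_succ_sigma_additive : semi_sigma_additive lebesgue_rV_succ.
Proof.
move=> F mF /trivIsetP tF mUF; rewrite /lebesgue_rV_succ /pushforward.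
rewrite preimage_bigcup; apply: measure_semi_sigma_additive.
- by move=> k; exact: preimageM.
- apply/trivIsetP => i j _ _ ij.
  by rewrite -preimage_setI tF// preimage_set0.
- by rewrite -preimage_bigcup; exact: preimageM.
Qed.

HB.instance Definition _ := isMeasure.Build _ _ _ lebesgue_rV_succ
  lebesgue_rV_succ0 lebesgue_rV_succ_ge0 lebesgue_rV_succ_sigma_additive.

Let lebesgue_rV_succ_sigma_finite : sigma_finite setT lebesgue_rV_succ.
Proof.
have [F FT Foo] := sigma_finite_prod (@lebesgue_measure R) mu.
exists (fun k => @rV_uncons n @^-1` F k).
  by rewrite -preimage_bigcup -FT preimage_setT.
move=> k; have [mF Fk] := Foo k; split.
  by rewrite -[X in measurable X]setTI; exact: measurable_rV_uncons.
rewrite /lebesgue_rV_succ /pushforward -comp_preimage.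
by rewrite (_ : _ \o _ = id)//; apply/funext => x /=; rewrite rV_consK.
Qed.

HB.instance Definition _ := Measure_isSigmaFinite.Build _ _ _
  lebesgue_rV_succ lebesgue_rV_succ_sigma_finite.

End succ.

(* Lebesgue measure on the Borel subsets of R^n: iterated product of the
   one-dimensional one, R^0 being a point of mass 1. *)
Fixpoint lebesgue_rV n : {sigma_finite_measure set 'rV[R]_n -> \bar R} :=
  if n is k.+1 then lebesgue_rV_succ (lebesgue_rV k)
  else \d_(0 : 'rV[R]_0).

End lebesgue_rV.

(* The usual formula vol(box) = product of side lengths; it pins down
   [lebesgue_rV]. *)
Lemma lebesgue_rV_box (R : realType) n (a b : 'I_n -> R) :
  (forall i, a i <= b i) ->
  lebesgue_rV R n [set x : 'rV[R]_n | forall i, a i <= x ord0 i <= b i] =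
  (\prod_(i < n) (b i - a i))%:E.
Proof.
elim: n a b => [|n IH] a b ab.
  by rewrite big_ord0 /= diracE mem_set// => -[].
rewrite /= /lebesgue_rV_succ /pushforward.
pose B : set 'rV[R]_n :=
  [set x | forall i, a (lift ord0 i) <= x ord0 i <= b (lift ord0 i)].
have mB : measurable B.
  rewrite [B](_ : _ = \bigcap_(i in [set: 'I_n])
    ((fun v : 'rV[R]_n => v ord0 i) @^-1`
      `[a (lift ord0 i), b (lift ord0 i)])).
    apply: fin_bigcap_measurable => // i _.
    by rewrite -[X in measurable X]setTI; exact: measurable_coord.
  apply/seteqP; split=> [x xab i _|x xab i] /=.
    by rewrite in_itv/= xab.
  by have := xab i I; rewrite /= in_itv.
have lab : lebesgue_measure (`[a ord0, b ord0] : set R) =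
    (b ord0 - a ord0)%:E.
  rewrite lebesgue_measure_itv/= lte_fin.
  have [//|ba] := ltP (a ord0) (b ord0).
  have -> : b ord0 = a ord0 by apply/le_anti; rewrite ba ab.
  by rewrite subrr.
transitivity ((@lebesgue_measure R \x lebesgue_rV R n)%E
    (`[a ord0, b ord0] `*` B)); last first.
  transitivity (lebesgue_measure (`[a ord0, b ord0] : set R) *
      lebesgue_rV R n B)%E; first exact: product_measure1E.
  by rewrite lab IH// big_ord_recl.
congr (_ _).
apply/seteqP; split=> [[x v] /= xab|[x v] /= [xab vab] i].
  split=> [|i].
    by have := xab ord0; rewrite /rV_cons mxE unlift_none /= in_itv.
  by have := xab (lift ord0 i); rewrite /rV_cons mxE liftK.
rewrite /rV_cons mxE; case: unliftP => [j ->|->] /=; first exact: vab.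
by move: xab; rewrite in_itv.
Qed.

Section calculus.
Context {R : realType} {N : nat}.
Implicit Types (O V : set 'rV[R]_N) (u v rho phi : 'rV[R]_N -> R).
Implicit Types (g G : 'rV[R]_N -> 'rV[R]_N) (x nu : 'rV[R]_N).

Definition dotrv (x y : 'rV[R]_N) : R := \sum_i x ord0 i * y ord0 i.

Definition pderiv (i : 'I_N) u : 'rV[R]_N -> R :=
  fun x => 'D_(delta_mx ord0 i) u x.

Definition grad u x : 'rV[R]_N := \row_i pderiv i u x.

(* C^infty on the open set V: all iterated partial derivatives exist and are
   continuous on V. *)
Definition smooth_on V u :=
  forall (s : seq 'I_N) x, V x ->
    {for x, continuous (foldr pderiv u s)} /\
    forall i, derivable (foldr pderiv u s) x (delta_mx ord0 i).

(* Near x, O is the region rho < 0, with d rho <> 0 at x: the boundary is a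
   smooth hypersurface near x and O lies on one side of it. *)
Definition local_defining_function O x rho :=
  exists V, [/\ open V, V x, smooth_on V rho, grad rho x != 0 &
    forall y, V y -> (O y <-> rho y < 0)].

Definition boundary O : set 'rV[R]_N := closure O `\` interior O.

Definition smooth_bounded_domain O :=
  [/\ O !=set0, open O, connected O, bounded_set O &
    forall x, boundary O x -> exists rho, local_defining_function O x rho].

(* nu = grad rho / |grad rho| does not depend on rho. *)
Definition outward_unit_normal O x nu :=
  exists2 rho, local_defining_function O x rho &
    nu = (Num.sqrt (dotrv (grad rho x) (grad rho x)))^-1 *: grad rho x.

(* u is C^1 on the closure of O: G is the gradient of u on O and extends it
   continuously to the closure. Only the values of u and G on the closure of O
   matter, and there u determines G. *)
Definition C1_upto_boundary O u G :=
  [/\ {within closure O, continuous u}, {within closure O, continuous G} &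
    forall x, O x -> differentiable u x /\ grad u x = G x].

(* Derivative along nu at a boundary point of a function that is C^1 up to the
   boundary, from the continuous extension G of its gradient. *)
Definition normal_derivative G x nu : R := dotrv (G x) nu.

End calculus.

Section sobolev.
Context {R : realType} {N : nat}.
Implicit Types (O : set 'rV[R]_N) (u v f phi : 'rV[R]_N -> R).
Implicit Types (g : 'rV[R]_N -> 'rV[R]_N).

Let leb := lebesgue_rV R N.

(* Functions are defined on all of R^N, but only their restriction to O
   matters; elements of L^p(O), H^1(O) are represented by Borel functions, so
   equality in these spaces is equality a.e. in O. *)
Definition Lp_norm O (p : R) f : \bar R := 'N[leb]_p%:E[EFin \o (f \_ O)].

Definition in_Lp O (p : R) f := measurable_fun O f /\ (Lp_norm O p f < +oo)%E.

Definition test_function O phi :=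
  [/\ smooth_on setT phi, compact (closure [set x | phi x != 0]) &
    closure [set x | phi x != 0] `<=` O].

(* u is in H^1(O), with weak gradient g. *)
Definition in_H1 O u g :=
  [/\ in_Lp O 2 u, forall i, in_Lp O 2 (fun x => g x ord0 i) &
    forall phi, test_function O phi -> forall i,
      \int[leb]_(x in O) (u x * pderiv i phi x) =
      - \int[leb]_(x in O) (g x ord0 i * phi x)].

(* H^1_0(O) is the closure in H^1(O) of the test functions. *)
Definition in_H10 O u g :=
  in_H1 O u g /\
  exists phi : nat -> 'rV[R]_N -> R,
    [/\ forall k, test_function O (phi k),
      (fun k => Lp_norm O 2 (fun x => phi k x - u x)) @ \oo --> 0%E &
      forall i, (fun k => Lp_norm O 2
        (fun x => pderiv i (phi k) x - g x ord0 i)) @ \oo --> 0%E].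

(* u is a weak solution of - Laplacian u = h in O, u = 0 on the boundary. *)
Definition weak_dirichlet_solution O u h :=
  exists2 g, in_H10 O u g &
    forall v gv, in_H10 O v gv ->
      \int[leb]_(x in O) dotrv (g x) (gv x) = \int[leb]_(x in O) (h x * v x).

Definition ae_in O (P : 'rV[R]_N -> Prop) := {ae leb, forall x, O x -> P x}.

Definition dirichlet_eigenvalue O (l : R) :=
  exists2 phi, ~ ae_in O (fun x => phi x = 0) &
    weak_dirichlet_solution O phi (fun x => l * phi x).

Definition smallest_dirichlet_eigenvalue O (l : R) :=
  dirichlet_eigenvalue O l /\ forall l', dirichlet_eigenvalue O l' -> l <= l'.

(* - Laplacian U = A U + mu U + F in O, U = 0 on the boundary, componentwise. *)
Definition weak_system_solution n O (A : 'M[R]_n) (mu : R)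
    (F U : 'rV[R]_N -> 'cV[R]_n) :=
  forall i, weak_dirichlet_solution O (fun x => U x i ord0)
    (fun x => (A *m U x + mu *: U x + F x) i ord0).

End sobolev.

Section jordan.
Context {R : realType}.

Definition lower_jordan_block m (a : R) : 'M[R]_m :=
  \matrix_(i, j) (if i == j then a else if i == j.+1 :> nat then 1 else 0).

(* The sum of the block sizes p b is only propositionally equal to n, hence the
   cast. *)
Definition lower_jordan_form n (J : 'M[R]_n) :=
  exists k (p : 'I_k -> nat) (a : 'I_k -> R) (e : (\sum_b p b)%N = n),
    J = castmx (e, e) (\mxdiag_b lower_jordan_block (p b) (a b)).

End jordan.

(* Main.v *)
Require Import Defs.
From HB Require Import structures.
From mathcomp Require Import all_boot all_order all_algebra ring lra.
From mathcomp Require Import all_classical all_reals all_analysis measurable_realfun.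

(* In the coordinates P^-1 U the system is triangular: since J is lower Jordan,
   its j-th equation is - Lap u_j = (xi_j + mu) u_j + s_j u_(j-1) + f~_j, with
   s_1 = 0 because xi_1 is simple. For j >= 1 the coefficient stays away from
   lambda1, so |u_j| <= C d with C independent of mu, where d is the distance to
   the boundary. For j = 0 let v solve - Lap v = f~_1 and let phi > 0 be a first
   eigenfunction; by Hopf's lemma v >= e phi, hence v + s phi with
   s = c e / (lambda1 - c), c = xi_1 + mu, is a subsolution of the equation of u_0
   and u_0 >= s phi >= k d / (mu11 - mu). For mu close to mu11 this term dominates
   u_i = sum_j P_ij u_j, whence p_i1 u_i >= k' d; the sign of the normal
   derivative follows from this bound and C^1 regularity up to the boundary.
   Regularity is obtained from convolutions with radial kernels k: at a point x,
   (conv u k) x = Int u(y) k(y - x), so Lap u = - f turns derivatives in the scale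
   of k into averages of f, which satisfy a Morrey bound. At the boundary one
   subtracts the reflected kernel. *)

Set Implicit Arguments.
Unset Strict Implicit.
Unset Printing Implicit Defensive.

Import Order.TTheory GRing.Theory Num.Theory.
Import numFieldNormedType.Exports.
Local Open Scope classical_set_scope.
Local Open Scope ring_scope.

(** Everything rests on two radial kernels with d/dt psi_t = t Lap theta_t and psi_t of mass 1: the
    means of u then change with the scale only through f. No compact embedding is used. The first
    eigenfunction is the limit, as s -> 0, of the solutions of -Lap v = (l - s) v + s, formally the
    projection of the constant 1 onto the eigenspace; their norms decrease with s, which makes the
    family Cauchy, while Picone's identity and the supremum bound keep the limit non-zero. The
    obstacle at the boundary is circularity: a kernel that vanishes on the tangent hyperplane leaves
    an error in a slab of thickness O(t^2), which is harmless only if |u| <= L d is already known.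
    The expansion so obtained returns L/2 + K in place of L; barriers give some finite L when f is
    bounded, iteration then yields 2K, free of that first L, and truncation reaches f in L^q. The
    condition q > N enters through the Morrey exponent al = 1 - N/q > 0. *)

Section smooth1.
Context {R : realType}.
Implicit Types (b c:R->R) (t s:R).

(** The flat function exp(-1/t) multiplied by powers of 1/t: the powers make the family stable under
    differentiation. All bumps, cutoffs and smooth positive parts below are built from it. *)
Definition expinv (n:nat) (t:R) : R :=
 if 0<t then t^-1^+n * expR (- t^-1) else 0.

(** A syntax of smooth functions of one variable. Stability under derivation ([smooth1_derive]) is
    one induction on it, and derivatives of every order follow. *)
Inductive smooth1 : (R->R)->Prop :=
| smooth1_id : smooth1 id
| smooth1_cst a : smooth1 (fun=> a)
| smooth1_exp : smooth1 expR
| smooth1_expinv n : smooth1 (expinv n)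
| smooth1D b c : smooth1 b->smooth1 c->smooth1 (fun t=>b t+c t)
| smooth1M b c : smooth1 b->smooth1 c->smooth1 (fun t=>b t * c t)
| smooth1_comp b c : smooth1 b->smooth1 c->smooth1 (fun t=>b (c t))
| smooth1V b : smooth1 b->(forall t, b t != 0)->smooth1 (fun t=>(b t)^-1).

Lemma is_derive1P b t (d:R) : is_derive t 1 b d <->
 forall e, 0<e->exists2 r : R, 0<r &
  forall h, `|h| < r -> `|b (t+h)-b t-d * h| <= e * `|h|.
have E (h:R) : h != 0 -> `|b (t+h)-b t-d * h| =
  `|d-h^-1 *: ((b \o shift t) (h *: 1)-b t)| * `|h|.
 move=> h0; rewrite -normrM distrC; congr `|_|.
 have E1: h *: (1:R) = h:=mulr1 h.
 by rewrite /= E1 [h+t]addrC /GRing.scale/=; field.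
split=> [[/cvg_ex[l /= L] dE]|H].
 have ld: l = d by rewrite -dE /derive; apply/esym/cvg_lim.
 subst l; move=> e e0.
 move/cvgrPdist_le : L => /(_ e e0)[r /= r0 Hr].
 exists r => // h hr; have [->|h0]:=eqVneq h 0.
  by rewrite addr0 subrr mulr0 subr0 normr0 mulr0.
 rewrite E// ler_wpM2r//; apply: Hr => //=; rewrite sub0r normrN//.
have C: h^-1 *: ((b \o shift t) (h *: 1)-b t) @[h --> 0^'] --> d.
 apply/cvgrPdist_le=>e e0; have [r r0 Hr]:=H e e0.
 exists r => //= h; rewrite /= sub0r normrN=>hr h0.
 by rewrite -(@ler_pM2r _ `|h|) ?normr_gt0// -E// Hr.
by apply: DeriveDef; [apply/cvg_ex; exists d|apply/cvg_lim].
Qed.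

Lemma is_derive_exprn n t : is_derive t 1 (fun s:R=>s^+n.+1) (n.+1%:R * t^+n).
have -> : (fun s:R=>s^+n.+1) = (id:R->R)^+n.+1.
 by apply/funext=>s; rewrite exprfctE.
by apply: is_derive_eq (is_deriveX n.+1 (is_derive_id t 1)) _; rewrite /GRing.scale/= mulr1.
Qed.

Lemma expR_geXn n s : 0<=s->s^+n<=n`!%:R * expR s.
move=> s0; elim: n=>[|n IH] in s s0 *.
 by rewrite expr0 fact0 mul1r -expR0 ler_expR.
pose h (x:R):=n.+1`!%:R * expR x-x^+n.+1.
have dh (x:R) : is_derive x 1 h (n.+1`!%:R * expR x-n.+1%:R * x^+n).
 rewrite /h; rewrite /h; apply: is_deriveB; exact: is_derive_exprn.
have : h 0<=h s.
 apply: (@ger0_derive1_ndecr _ h 0 s) => //.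
 - move=> x xi; rewrite derive1E derive_val; rewrite in_itv/= in xi.
  rewrite factS natrM -mulrA -mulrBr mulr_ge0// subr_ge0 IH//.
  by case/andP: xi => /ltW.
 - apply: continuous_subspaceT=>x; apply: differentiable_continuous.
  by apply/derivable1_diffP; apply: ex_derive.
rewrite {1}/h expr0n/= subr0 expR0 mulr1=>H.
rewrite -subr_ge0; apply: le_trans H; exact: ler0n.
Qed.

(** The bound [expR_geXn] at 1/t beats the factor t^-n by two more powers of t; this quadratic
    smallness gives derivative 0 at the origin. *)
Lemma expinv_le n t : expinv n t<=n.+2`!%:R * t^+2.
rewrite /expinv; case: ifPn=>t0; last by rewrite mulr_ge0// sqr_ge0.
have := @expR_geXn n.+2 t^-1 (ltW _); rewrite invr_gt0 => /(_ t0) H.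
rewrite expRN -subr_ge0.
have -> : n.+2`!%:R * t^+2-t^-1^+n/expR t^-1 =
 (n.+2`!%:R * expR t^-1-t^-1^+n.+2)*(t^+2/expR t^-1).
 have -> : t^-1^+n.+2 = t^-1^+n * t ^- 2 by rewrite -exprVn -exprD addn2.
 have : expR t^-1 != 0 by rewrite gt_eqF ?expR_gt0.
 have : t != 0 by rewrite gt_eqF.
 by move: (_`!%:R) (t^-1^+n) (expR _)=>c p e t1 e1; field; rewrite t1 e1.
by rewrite mulr_ge0// ?subr_ge0// divr_ge0 ?sqr_ge0// expR_ge0.
Qed.

Lemma expinv_ge0 n t : 0<=expinv n t.
rewrite /expinv; case: ifPn=>t0 //.
by rewrite mulr_ge0 ?expR_ge0// exprn_ge0// invr_ge0 ltW.
Qed.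

Lemma is_derive_expinv n t :
 is_derive t 1 (expinv n) (- n%:R * expinv n.+1 t+expinv n.+2 t).
have [t0|t0|t0]:=ltgtP t 0.
- have E: {near t, (fun=> 0) =1 expinv n}.
  have:=lt_nbhsl t0; apply: filterS=>s s0.
  by rewrite /expinv ltNge (ltW s0).
 apply: (near_eq_is_derive E) => //.
 have -> : - n%:R * expinv n.+1 t+expinv n.+2 t = 0.
  by rewrite /expinv ltNge (ltW t0)/= mulr0 addr0.
 exact: is_derive_cst.
- have E: {near t, (fun s=>s^-1^+n * expR (- s^-1)) =1 expinv n}.
  have:=lt_nbhsr t0; apply: filterS=>s s0.
  by rewrite /expinv s0.
 apply: (near_eq_is_derive E) => //.
 have tn: t != 0 by rewrite gt_eqF.
 have D1: is_derive t 1 (fun s:R=>s^-1) (- t ^- 2).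
  by have := @is_deriveV _ id t 1 1 tn _ ; rewrite /GRing.scale/= mulr1; apply.
 have D2: is_derive t 1 (fun s:R=>expR (- s^-1)) (expR (- t^-1) * t ^- 2).
  have D3: is_derive t 1 (fun s:R => - s^-1) (t ^- 2).
   by rewrite -(opprK (t ^- 2)); exact: is_deriveN.
  exact: (is_derive1_comp (is_derive_expR _) D3).
 have D4:=is_deriveX n D1.
 have D5:=is_deriveM D4 D2.
 have:=D5; rewrite mulrfctE exprfctE; move/(@is_derive_eq _ _ _ _ _ _ _); apply.
 rewrite /GRing.scale/= /expinv t0 /=.
 case: n {D4 D5 E} => [|n].
  by rewrite /= expr0 exprVn; move: (expR _)=>e; field.
 by rewrite /= !exprS; move: (expR _) (t^-1^+n)=>e p; field.
- subst t; have -> : - n%:R * expinv n.+1 0+expinv n.+2 0 = 0 :> R.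
  by rewrite /expinv ltxx mulr0 addr0.
 apply/is_derive1P=>e e0.
 exists (e/n.+2`!%:R); first by rewrite divr_gt0// ltr0n fact_gt0.
 move=> h hd; rewrite add0r mul0r subr0 {2}/expinv ltxx subr0.
 rewrite ger0_norm ?expinv_ge0//; apply: (le_trans (expinv_le n h)).
 rewrite -[h^+2]ger0_norm ?sqr_ge0// normrX expr2 mulrA ler_wpM2r//.
 rewrite mulrC -ler_pdivlMr ?ltr0n ?fact_gt0//; exact: ltW.
Qed.

Lemma smooth1_derive b : smooth1 b->exists2 b', smooth1 b' & forall t, is_derive t 1 b (b' t).
elim=> [|a||n|c d _ [c' Sc Dc] _ [d' Sd Dd]|c d Sc [c' Sc' Dc] Sd [d' Sd' Dd]|c d Sc [c' Sc' Dc] Sd [d' Sd' Dd]|c Sc [c' Sc' Dc] c0].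
- by exists (fun=> 1); [exact: smooth1_cst|move=> t; exact: is_derive_id].
- by exists (fun=> 0); [exact: smooth1_cst|move=> t; exact: is_derive_cst].
- by exists expR; [exact: smooth1_exp|move=> t; exact: is_derive_expR].
- exists (fun t => - n%:R * expinv n.+1 t+expinv n.+2 t); last exact: is_derive_expinv.
 by apply: smooth1D (smooth1_expinv _); apply: smooth1M (smooth1_expinv _); exact: smooth1_cst.
- by exists (fun t=>c' t+d' t); [exact: smooth1D|move=> t; exact: is_deriveD].
- exists (fun t=>c t * d' t+d t * c' t).
  by apply: smooth1D; apply: smooth1M.
 by move=> t; exact: is_deriveM.
- exists (fun t=>c' (d t) * d' t).
  by apply: smooth1M => //; exact: smooth1_comp.
 by move=> t; exact: is_derive1_comp.
- exists (fun t=>(- 1)*((c t)^-1*(c t)^-1) * c' t).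
  apply: smooth1M => //; apply: smooth1M; first exact: smooth1_cst.
  by apply: smooth1M; exact: smooth1V.
 move=> t; have:=is_deriveV (c0 t) (Dc t).
 by rewrite /GRing.scale/= mulN1r -expr2 exprVn.
Qed.

Lemma smooth1_derive1 b : smooth1 b->smooth1 (derive1 b) /\ forall t, is_derive t 1 b (derive1 b t).
move=> /smooth1_derive[b' Sb' Db]; suff -> : derive1 b = b' by [].
by apply/funext=>t; rewrite derive1E derive_val.
Qed.

Lemma smooth1_cont b : smooth1 b->continuous b.
move=> /smooth1_derive1[_ Db] t; apply: differentiable_continuous.
by apply/derivable1_diffP; apply: ex_derive.
Qed.

End smooth1.

(** * Mean value bounds, partial derivatives and Euclidean geometry *)

Section mean_value.
Context {R : realType}.

Lemma mvt_le (g dg:R->R) (a b e:R) : a<=b ->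
 (forall s, a<=s<=b->is_derive s 1 g (dg s)) ->
 (forall s, a<=s<=b -> `|dg s| <= e) -> `|g b-g a| <= e*(b-a).
rewrite le_eqVlt => /predU1P[<- _ _|ab dgE dg_le]; first by rewrite !subrr normr0 mulr0.
have [s| |c] := @MVT R g dg a b ab.
- by rewrite in_itv/= => /andP[/ltW sa /ltW sb]; apply: dgE; rewrite sa.
- apply: derivable_within_continuous=>s; rewrite in_itv/= => sab.
 by have:=dgE _ sab => ?; apply: ex_derive.
- rewrite in_itv/= => /andP[/ltW ac /ltW cb] ->.
 have ba: 0<=b-a by rewrite subr_ge0 ltW.
 by rewrite normrM (ger0_norm ba) ler_wpM2r ?dg_le ?ac.
Qed.

Lemma mvt_le_sym (g dg:R->R) (h e:R) :
 (forall s:R, `|s| <= `|h| -> is_derive s 1 g (dg s)) ->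
 (forall s:R, `|s| <= `|h| -> `|dg s| <= e) -> `|g h-g 0| <= e * `|h|.
move=> dgE dg_le; have [h0|h0]:=leP 0 h.
 rewrite (ger0_norm h0) -[X in e*X]subr0; apply: (mvt_le h0 (dg:=dg))=>s /andP[s0 sh].
  by apply: dgE; rewrite !ger0_norm.
 by apply: dg_le; rewrite !ger0_norm.
rewrite distrC (ltr0_norm h0); have -> : e * - h = e*(0-h) by rewrite sub0r.
apply: (mvt_le (ltW h0) (dg:=dg))=>s /andP[sh s0].
 by apply: dgE; rewrite (ler0_norm s0) (ltr0_norm h0) lerN2.
by apply: dg_le; rewrite (ler0_norm s0) (ltr0_norm h0) lerN2.
Qed.

End mean_value.

Section calc.
Context {R : realType} {N : nat}.
Notation rV := 'rV[R]_N.
Notation ee i := (delta_mx ord0 i : 'rV[R]_N).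
Implicit Types (f g:rV->R) (x y:rV) (i j : 'I_N).

Lemma eeE i j : (ee i) ord0 j = (j == i)%:R.
by rewrite mxE eqxx. Qed.

Lemma derive_line f x v (t:R) :
 (fun h:R=>h^-1 *: (((fun s:R=>f (s *: v+x)) \o shift t) (h *: (1:R))
  - f (t *: v+x))) =
 (fun h:R=>h^-1 *: ((f \o shift (t *: v+x)) (h *: v)-f (t *: v+x))).
apply/funext=>h /=; have -> : h *: (1:R) = h:=mulr1 h.
by rewrite scalerDl addrA.
Qed.

Lemma is_derive_lineP f x v (t d:R) :
 is_derive t 1 (fun s:R=>f (s *: v+x)) d <-> is_derive (t *: v+x) v f d.
by split=> -[D E]; apply: DeriveDef; move: D E; rewrite /derivable/derive derive_line.
Qed.

Lemma is_derive_line f x v (d:R) :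
 is_derive (0:R) 1 (fun s:R=>f (s *: v+x)) d <-> is_derive x v f d.
by rewrite is_derive_lineP scale0r add0r. Qed.

Lemma is_derive_comp1 (b:R->R) f x v (d e:R) :
 is_derive (f x) 1 b d->is_derive x v f e->is_derive x v (fun y=>b (f y)) (d * e).
move=> Db /is_derive_line Df; apply/is_derive_line.
apply: (@is_derive1_comp _ b (fun s:R=>f (s *: v+x))) => //.
by rewrite scale0r add0r.
Qed.

Lemma is_derive_affine f (c:R) d x i (e:R) :
 is_derive (c *: x+d) (ee i) f e->is_derive x (ee i) (fun y=>f (c *: y+d)) (c * e).
move=> Df; apply/is_derive_line.
have E: (fun s:R=>f (c *: (s *: ee i+x)+d)) =
  (fun s:R=>(fun r:R=>f (r *: ee i+(c *: x+d))) (c * s)).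
 by apply/funext=>s; rewrite scalerDr scalerA addrA.
rewrite E mulrC; apply: (@is_derive1_comp _ (fun r:R=>f (r *: ee i+(c *: x+d))) (fun s=>c * s)).
 by rewrite mulr0; apply/is_derive_line.
have:=is_deriveZ c (is_derive_id (0:R) 1); rewrite /GRing.scale/= mulr1; exact.
Qed.

Lemma is_derive_coord i j x : is_derive x (ee i) (fun y:rV=>y ord0 j) (i == j)%:R.
apply/is_derive_line.
have -> : (fun s:R=>(s *: ee i+x) ord0 j) = (fun s=>(i == j)%:R * s+x ord0 j).
 by apply/funext=>s; rewrite !mxE eqxx/= mulrC eq_sym.
rewrite -[X in is_derive _ _ _ X]addr0; apply: is_deriveD.
have:=is_deriveZ (i == j)%:R (is_derive_id (0:R) 1); rewrite /GRing.scale/= mulr1; exact.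
Qed.

Record sm f : Prop:=Sm { sm_smooth : smooth_on setT f }.

(** Generators of smooth functions, closed under partial derivatives by [smg_pderiv]. An induction
    on the list of derivatives then proves [smg_sm], so smoothness of an expression is read off its
    shape. *)
Inductive smg : (rV->R)->Prop :=
| smg_base f : sm f->smg f
| smg_cst (a:R) : smg (fun=> a)
| smg_coord j : smg (fun y=>y ord0 j)
| smgD f g : smg f->smg g->smg (fun y=>f y+g y)
| smgM f g : smg f->smg g->smg (fun y=>f y * g y)
| smg_comp b f : smooth1 b->smg f->smg (fun y=>b (f y))
| smg_affine (c:R) d f : smg f->smg (fun y=>f (c *: y+d)).

Lemma sm_cont f : sm f->continuous f.
by case=> H x; have []:=H [::] x I. Qed.

Lemma sm_derivable f x i : sm f->derivable f x (ee i).
by case=> H; have [_]:=H [::] x I; exact. Qed.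

Lemma is_derive_pderiv f x i : sm f->is_derive x (ee i) f (pderiv i f x).
by move=> H; apply: DeriveDef => //; exact: sm_derivable. Qed.

Lemma pderivE f f' i : (forall x, is_derive x (ee i) f (f' x))->pderiv i f = f'.
by move=> H; apply/funext=>x; rewrite /pderiv derive_val. Qed.

Lemma sm_pderiv f i : sm f->sm (pderiv i f).
by case=> H; split=> s x _; have:=H (rcons s i) x I; rewrite foldr_rcons.
Qed.

Lemma smg_cont f : smg f->continuous f.
elim=> {f} [f|a|j|f g _ Cf _ Cg|f g _ Cf _ Cg|b f Sb _ Cf|c d f _ Cf].
- exact: sm_cont.
- by move=> x; exact: cst_continuous.
- exact: coord_continuous.
- by move=> x; apply: continuousD; [exact: Cf|exact: Cg].
- by move=> x; apply: continuousM; [exact: Cf|exact: Cg].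
- by move=> x; apply: (@continuous_comp _ _ _ f b); [exact: Cf|exact: smooth1_cont].
- move=> x; apply: (@continuous_comp _ _ _ (fun y:rV=>c *: y+d) f); last exact: Cf.
 apply: (@continuousD _ _ _ (fun y:rV=>c *: y) (fun=> d)); last exact: cst_continuous.
 exact: (@scaler_continuous _ rV c x).
Qed.

Lemma smg_pderiv f i : smg f ->
 exists2 f', smg f' & forall x, is_derive x (ee i) f (f' x).
elim=> {f} [f Sf|a|j|f g Sf [f' Sf' Df] Sg [g' Sg' Dg]|f g Sf [f' Sf' Df] Sg [g' Sg' Dg]|b f Sb Sf [f' Sf' Df]|c d f Sf [f' Sf' Df]].
- exists (pderiv i f); first by apply: smg_base; exact: sm_pderiv.
 by move=> x; exact: is_derive_pderiv.
- by exists (fun=> 0); [exact: smg_cst|move=> x; exact: is_derive_cst].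
- by exists (fun=> (i == j)%:R); [exact: smg_cst|move=> x; exact: is_derive_coord].
- by exists (fun x=>f' x+g' x); [exact: smgD|move=> x; exact: is_deriveD].
- exists (fun x=>f x * g' x+g x * f' x); last by move=> x; exact: is_deriveM.
 by apply: smgD; exact: smgM.
- have [Sb' Db]:=smooth1_derive1 Sb.
 exists (fun x=>(derive1 b) (f x) * f' x); last by move=> x; exact: is_derive_comp1.
 by apply: smgM => //; exact: smg_comp.
- exists (fun x=>c * f' (c *: x+d)).
  by apply: smgM; [exact: smg_cst|exact: smg_affine].
 by move=> x; exact: is_derive_affine.
Qed.

Lemma smg_sm f : smg f->sm f.
move=> Sf; split=> s x _.
have [g [Sg ->]] : exists g, smg g /\ foldr pderiv f s = g.
 elim: s=>[|i s [g [Sg E]]] /=; first by exists f.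
 have [g' Sg' Dg]:=smg_pderiv i Sg.
 by exists g'; split => //; rewrite E (pderivE Dg).
split; first exact: smg_cont.
by move=> i; have [g' _ Dg]:=smg_pderiv i Sg; have:=Dg x => ?; exact: ex_derive.
Qed.

Lemma sm_cst (a:R) : sm (fun=> a).
exact/smg_sm/smg_cst. Qed.

Lemma sm_coord j : sm (fun y=>y ord0 j).
exact/smg_sm/smg_coord. Qed.

Lemma smD f g : sm f->sm g->sm (fun y=>f y+g y).
by move=> *; apply/smg_sm/smgD; exact: smg_base. Qed.

Lemma smM f g : sm f->sm g->sm (fun y=>f y * g y).
by move=> *; apply/smg_sm/smgM; exact: smg_base. Qed.

Lemma sm_comp b f : smooth1 b->sm f->sm (fun y=>b (f y)).
by move=> *; apply/smg_sm/smg_comp => //; exact: smg_base. Qed.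

Lemma sm_affine (c:R) d f : sm f->sm (fun y=>f (c *: y+d)).
by move=> *; apply/smg_sm/smg_affine/smg_base. Qed.

Lemma smZ (a:R) f : sm f->sm (fun y=>a * f y).
by move=> Sf; apply: smM => //; exact: sm_cst. Qed.

Lemma smN f : sm f->sm (fun y => - f y).
by move=> Sf; have:=smZ (-1) Sf; under eq_fun do rewrite mulN1r.
Qed.

Lemma smB f g : sm f->sm g->sm (fun y=>f y-g y).
by move=> Sf Sg; apply: smD => //; exact: smN. Qed.

Lemma sm_sum (I:Type) (r:seq I) (P:pred I) (F:I->rV->R) :
 (forall k, P k->sm (F k))->sm (fun y => \sum_(k <- r | P k) F k y).
move=> SF; elim: r=>[|k r IH].
 by under eq_fun do rewrite big_nil; exact: sm_cst.
under eq_fun do rewrite big_cons.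
by case: (boolP (P k))=>Pk //; apply: smD => //; exact: SF.
Qed.

Lemma pderiv_cst i (a:R) : pderiv i (fun=> a) = (fun=> 0).
by apply: pderivE=>x; exact: is_derive_cst. Qed.

Lemma pderiv_coord i j : pderiv i (fun y=>y ord0 j) = (fun=> (i == j)%:R).
by apply: pderivE=>x; exact: is_derive_coord. Qed.

Lemma pderivD i f g : sm f->sm g ->
 pderiv i (fun y=>f y+g y) = (fun y=>pderiv i f y+pderiv i g y).
by move=> Sf Sg; apply: pderivE=>x; apply: is_deriveD; exact: is_derive_pderiv. Qed.

Lemma pderivM i f g : sm f->sm g ->
 pderiv i (fun y=>f y * g y) = (fun y=>f y * pderiv i g y+g y * pderiv i f y).
by move=> Sf Sg; apply: pderivE=>x; apply: is_deriveM; exact: is_derive_pderiv. Qed.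

Lemma pderivZ i (a:R) f : sm f ->
 pderiv i (fun y=>a * f y) = (fun y=>a * pderiv i f y).
move=> Sf; rewrite (pderivM i (sm_cst a) Sf) pderiv_cst.
by apply/funext=>y; rewrite mulr0 addr0.
Qed.

Lemma pderivB i f g : sm f->sm g ->
 pderiv i (fun y=>f y-g y) = (fun y=>pderiv i f y-pderiv i g y).
by move=> Sf Sg; apply: pderivE=>x; apply: is_deriveB; exact: is_derive_pderiv. Qed.

Lemma pderiv_comp i b f : smooth1 b->sm f ->
 pderiv i (fun y=>b (f y)) = (fun y=>derive1 b (f y) * pderiv i f y).
move=> Sb Sf; apply: pderivE=>x; apply: is_derive_comp1; last exact: is_derive_pderiv.
exact: (smooth1_derive1 Sb).2.
Qed.

Lemma pderiv_affine i (c:R) d f : sm f ->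
 pderiv i (fun y=>f (c *: y+d)) = (fun y=>c * pderiv i f (c *: y+d)).
by move=> Sf; apply: pderivE=>x; apply: is_derive_affine; exact: is_derive_pderiv. Qed.

Lemma pderiv_sum (I:Type) (r:seq I) (P:pred I) (F:I->rV->R) i :
 (forall k, sm (F k)) ->
 pderiv i (fun y => \sum_(k <- r | P k) F k y) = (fun y => \sum_(k <- r | P k) pderiv i (F k) y).
move=> SF; elim: r=>[|k r IH].
 under eq_fun do rewrite big_nil.
 by rewrite pderiv_cst; apply/funext=>y; rewrite big_nil.
under eq_fun do rewrite big_cons.
under [RHS]eq_fun do rewrite big_cons.
case: (boolP (P k))=>Pk //; rewrite pderivD ?IH//; apply: sm_sum => //.
Qed.

(** The points [p k] lead from x to y by changing one coordinate at a time and stay in the box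
    spanned by x and y, so the one-variable mean value bound applies to each leg and only partial
    derivatives are involved. The vector [a] is a frozen gradient. *)
Lemma mvt_box f x y (a : 'I_N->R) (e:R) :
 (forall (z:rV) i, (forall j, `|z ord0 j-x ord0 j| <= `|y ord0 j-x ord0 j|) ->
  derivable f z (ee i) /\ `|pderiv i f z-a i| <= e) ->
 `|f y-f x - \sum_i a i*(y ord0 i-x ord0 i)| <=
  e * \sum_i `|y ord0 i-x ord0 i|.
move=> H.
pose p k : rV:=\row_j (if (j<k)%N then y ord0 j else x ord0 j).
suff K k : (k<=N)%N ->
 `|f (p k)-f x - \sum_(i : 'I_N | (i<k)%N) a i*(y ord0 i-x ord0 i)| <=
  e * \sum_(i : 'I_N | (i<k)%N) `|y ord0 i-x ord0 i|.
 have pN: p N = y by apply/rowP=>j; rewrite mxE ltn_ord.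
 have:=K N (leqnn N); rewrite pN.
 have T (F : 'I_N->R) : \sum_(i : 'I_N | (i<N)%N) F i = \sum_i F i.
  by apply: eq_bigl=>j; rewrite ltn_ord.
 by rewrite !T.
elim: k=>[_|k IH kN].
 have -> : p 0%N = x by apply/rowP=>j; rewrite mxE.
 by rewrite !big_pred0// !subrr normr0 mulr0.
have {}IH:=IH (ltnW kN); pose k':=Ordinal kN.
have S (F : 'I_N->R) : \sum_(i : 'I_N | (i<k.+1)%N) F i = F k' + \sum_(i : 'I_N | (i<k)%N) F i.
 rewrite (bigD1 k')//=; congr (_ + _); apply: eq_bigl=>j.
 by rewrite ltnS andbC -(inj_eq val_inj)/= -ltn_neqAle.
rewrite !S; set d:=y ord0 k'-x ord0 k'.
have pS: p k.+1 = d *: ee k'+p k.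
 apply/rowP=>j; rewrite !mxE eqxx/= ltnS leq_eqVlt -(inj_eq val_inj)/=.
 have [jk|jk] /= := eqVneq (j:nat) k; last by rewrite mulr0 add0r.
 have -> : j = k' by apply/val_inj.
 by rewrite /= ltnn mulr1 /d subrK.
have box (s:R) i : `|s| <= `|d| -> derivable f (s *: ee k'+p k) (ee i) /\
  `|pderiv i f (s *: ee k'+p k)-a i| <= e.
 move=> sd; apply: H=>j; rewrite !mxE eqxx/= -(inj_eq val_inj)/=.
 have [jk|jk] /= := eqVneq (j:nat) k.
  have -> : j = k' by apply/val_inj.
  by rewrite /= ltnn mulr1 addrK.
 by rewrite mulr0 add0r; case: ifP => // _; rewrite subrr normr0.
have : `|(f (d *: ee k'+p k)-a k' * d)-(f (0 *: ee k'+p k)-a k'*0)| <= e * `|d|.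
 apply: (@mvt_le_sym _ (fun s=>f (s *: ee k'+p k)-a k' * s)
  (fun s=>pderiv k' f (s *: ee k'+p k)-a k'))=>s sd; last exact: (box s k' sd).2.
 apply: is_deriveB.
  by apply/is_derive_lineP; apply: DeriveDef => //; exact: (box s k' sd).1.
 have:=is_deriveZ (a k') (is_derive_id s 1); rewrite /GRing.scale/= mulr1; exact.
rewrite scale0r add0r mulr0 subr0 -pS=>D.
rewrite (mulrDr e).
have DI:=lerD D IH.
apply: le_trans DI.
by apply: le_trans (ler_normD _ _); rewrite le_eqVlt; apply/orP; left; apply/eqP; congr `|_|; ring.
Qed.

End calc.

Section euclid.
Context {R : realType} {N : nat}.
Notation rV := 'rV[R]_N.
Notation dot := (@dotrv R N).
Implicit Types (x y z:rV) (a b:R).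

Definition nrm x : R:=Num.sqrt (dot x x).

Lemma dotC x y : dot x y = dot y x.
by apply: eq_bigr=>i _; rewrite mulrC. Qed.

Lemma dotDl x y z : dot (x+y) z = dot x z+dot y z.
by rewrite -big_split/=; apply: eq_bigr=>i _; rewrite mxE mulrDl. Qed.

Lemma dotZl a x y : dot (a *: x) y = a * dot x y.
by rewrite mulr_sumr; apply: eq_bigr=>i _; rewrite mxE mulrA. Qed.

Lemma dotNl x y : dot (- x) y = - dot x y.
by rewrite -scaleN1r dotZl mulN1r. Qed.

Lemma dotBl x y z : dot (x-y) z = dot x z-dot y z.
by rewrite dotDl dotNl. Qed.

Lemma dotDr x y z : dot z (x+y) = dot z x+dot z y.
by rewrite dotC dotDl !(dotC z). Qed.

Lemma dotZr a x y : dot y (a *: x) = a * dot y x.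
by rewrite dotC dotZl (dotC y). Qed.

Lemma dotNr x y : dot y (- x) = - dot y x.
by rewrite dotC dotNl (dotC y). Qed.

Lemma dotBr x y z : dot z (x-y) = dot z x-dot z y.
by rewrite dotDr dotNr. Qed.

Lemma dot0l x : dot 0 x = 0.
by rewrite -(scale0r 0) dotZl mul0r. Qed.

Lemma dot_ge0 x : 0<=dot x x.
by apply: sumr_ge0=>i _; rewrite -expr2 sqr_ge0. Qed.

Lemma dot_eq0 x : dot x x = 0->x = 0.
move=> /eqP; rewrite psumr_eq0=>[/allP H|i _]; last by rewrite -expr2 sqr_ge0.
apply/rowP=>i; have:=H i (mem_index_enum _); rewrite mulf_eq0 orbb => /eqP ->.
by rewrite mxE.
Qed.

Lemma dot_eel i x : dot (delta_mx ord0 i) x = x ord0 i.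
rewrite /dotrv (bigD1 i)//= big1=>[|j ji]; rewrite mxE !eqxx/=.
 by rewrite mul1r addr0.
by rewrite (negbTE ji) mul0r.
Qed.

Lemma dot_CS x y : dot x y^+2<=dot x x * dot y y.
have [y0|y0]:=eqVneq (dot y y) 0.
 by rewrite (dot_eq0 y0) dotC dot0l expr0n/= dot0l mulr0.
have yp: 0<dot y y by rewrite lt_def y0 dot_ge0.
have:=dot_ge0 (dot y y *: x-dot x y *: y).
rewrite !(dotBl, dotBr, dotZl, dotZr) (dotC y x)=>H.
rewrite -subr_ge0 -(pmulr_rge0 _ yp); apply: le_trans H _.
by rewrite le_eqVlt; apply/orP; left; apply/eqP; ring.
Qed.

Lemma nrm_ge0 x : 0<=nrm x. Proof. exact: sqrtr_ge0. Qed.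
Hint Resolve nrm_ge0 : core.

Lemma nrm_sq x : nrm x^+2 = dot x x.
by rewrite sqr_sqrtr// dot_ge0. Qed.

Lemma nrm_le x a : 0<=a->(nrm x<=a) = (dot x x<=a^+2).
by move=> a0; rewrite -nrm_sq ler_pXn2r// nnegrE. Qed.

Lemma nrm_CS x y : `|dot x y| <= nrm x * nrm y.
rewrite -(@ler_pXn2r _ 2)// ?nnegrE ?mulr_ge0//.
by rewrite real_normK ?num_real// exprMn !nrm_sq dot_CS.
Qed.

Lemma nrm0 : nrm 0 = 0. Proof. by rewrite /nrm dot0l sqrtr0. Qed.

Lemma nrmZ a x : nrm (a *: x) = `|a| * nrm x.
by rewrite /nrm dotZl dotZr mulrA -expr2 sqrtrM ?sqr_ge0// sqrtr_sqr. Qed.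

Lemma nrmN x : nrm (- x) = nrm x.
by rewrite -scaleN1r nrmZ normrN1 mul1r. Qed.

Lemma nrmD x y : nrm (x+y)<=nrm x+nrm y.
rewrite nrm_le ?addr_ge0// dotDl !dotDr (dotC y x) sqrrD !nrm_sq.
have /ler_normlP[_ H]:=nrm_CS x y; rewrite mulr2n; lra.
Qed.

Lemma nrm_distC x y : nrm (x-y) = nrm (y-x).
by rewrite -nrmN opprB. Qed.

Lemma nrm_tri x y z : nrm (x-z)<=nrm (x-y)+nrm (y-z).
by have:=nrmD (x-y) (y-z); rewrite addrA subrK. Qed.

Lemma nrmB_ge x y : nrm x-nrm y<=nrm (x-y).
by rewrite lerBlDr; have:=nrmD (x-y) y; rewrite subrK. Qed.

Lemma nrm_eq0 x : nrm x = 0->x = 0.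
by move=> x0; apply: dot_eq0; rewrite -nrm_sq x0 expr0n. Qed.

Lemma nrm_gt0 x : x != 0->0<nrm x.
by move=> x0; rewrite lt_def nrm_ge0 andbT; apply: contra_neq x0; exact: nrm_eq0. Qed.

Lemma coord_le_nrm x i : `|x ord0 i| <= nrm x.
rewrite -(@ler_pXn2r _ 2)// ?nnegrE// real_normK ?num_real// nrm_sq.
rewrite /dotrv (bigD1 i)//= -expr2 lerDl sumr_ge0// => j _.
by rewrite -expr2 sqr_ge0.
Qed.

Lemma nrm_ee i : nrm (delta_mx ord0 i) = 1.
by rewrite /nrm dot_eel mxE !eqxx sqrtr1. Qed.

Lemma nrm_le_sum x : nrm x <= \sum_i `|x ord0 i|.
have S0: 0 <= \sum_i `|x ord0 i| by apply: sumr_ge0.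
rewrite nrm_le// expr2 mulr_suml; apply: ler_sum=>i _.
apply: (le_trans (ler_norm _)); rewrite normrM ler_wpM2l//.
by rewrite (bigD1 i)//= lerDl sumr_ge0.
Qed.

Lemma norm_le_nrm x : `|x| <= nrm x.
rewrite [`|x|]mx_normrE; apply: bigmax_le => // -[i j] _ /=.
by rewrite (ord1 i) coord_le_nrm.
Qed.

Lemma coord_le_norm x i : `|x ord0 i| <= `|x|.
rewrite [`|x|]mx_normrE.
exact: (@le_bigmax _ _ _ 0 (fun ij : 'I_1 * 'I_N => `|x ij.1 ij.2|) (ord0, i)).
Qed.

Lemma sum_coord_le_nrm x : \sum_i `|x ord0 i| <= N%:R * nrm x.
apply: (@le_trans _ _ (\sum_(i<N) nrm x)); first by apply: ler_sum=>i _; exact: coord_le_nrm.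
by rewrite sumr_const card_ord mulr_natl.
Qed.

Lemma nrm_le_norm x : nrm x<=N%:R * `|x|.
apply: (le_trans (nrm_le_sum x)).
apply: (@le_trans _ _ (\sum_(i<N) `|x|)); first by apply: ler_sum=>i _; exact: coord_le_norm.
by rewrite sumr_const card_ord mulr_natl.
Qed.

Lemma nbhs_nrmP x (A:set rV) :
 nbhs x A <-> exists2 e : R, 0<e & forall y, nrm (y-x)<e->A y.
apply: (iff_trans (nbhs_normP x A)); split=> -[e /= e0 H].
 exists e => // y xy; apply: H => /=; apply: le_lt_trans xy.
 by rewrite distrC norm_le_nrm.
exists (e/(N%:R+1)); first by rewrite /= divr_gt0// ltr_wpDl.
move=> y /=; rewrite ltr_pdivlMr ?ltr_wpDl// => xy; apply: H.
rewrite nrm_distC; apply: le_lt_trans xy; apply: (le_trans (nrm_le_norm _)).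
by rewrite mulrC ler_wpM2l// lerDl.
Qed.

Lemma open_nrmP (A:set rV) : open A <-> forall x, A x ->
 exists2 e : R, 0<e & forall y, nrm (y-x)<e->A y.
rewrite openE; split=> H x Ax; first exact/nbhs_nrmP/H.
by apply/nbhs_nrmP/H.
Qed.

Lemma continuous_nrmP (f:rV->R) x : {for x, continuous f} <->
 forall e, 0<e->exists2 d : R, 0<d & forall y, nrm (y-x)<d -> `|f y-f x| < e.
split=> H.
 move=> e e0; have /cvgrPdist_lt/(_ e e0):=H; move/nbhs_nrmP=>[d d0 Hd].
 by exists d => // y /Hd; rewrite distrC.
move=> B /nbhs_normP[e /= e0 eB]; have [d d0 Hd]:=H e e0.
suff : nbhs x (f @^-1` B) by [].
by apply/nbhs_nrmP; exists d => // y yd; apply: eB; rewrite /= distrC; exact: Hd.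
Qed.

Lemma nrm_continuous x0 : continuous (fun x=>nrm (x-x0)).
move=> x; apply/continuous_nrmP=>e e0; exists e => // y; apply: le_lt_trans.
rewrite ler_norml; apply/andP; split.
 rewrite lerNl opprB; have:=nrm_tri x y x0; rewrite (nrm_distC x y); lra.
have:=nrm_tri y x x0; lra.
Qed.

Lemma dot_continuous n : continuous (fun x=>dot x n).
move=> x; apply/continuous_nrmP=>e e0.
exists (e/(nrm n+1)); first by rewrite divr_gt0// ltr_wpDl.
move=> y; rewrite ltr_pdivlMr ?ltr_wpDl// => yx; rewrite -dotBl.
apply: le_lt_trans yx; apply: (le_trans (nrm_CS _ _)).
by rewrite ler_wpM2l// lerDl.
Qed.

Lemma closed_nball x0 a : closed [set x | nrm (x-x0)<=a].
apply: (@closed_comp _ _ (fun x=>nrm (x-x0)) [set t | t<=a]); last exact: closed_le.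
by move=> x _; exact: nrm_continuous.
Qed.

Lemma bounded_nrmP (A:set rV) : bounded_set A <-> exists M : R, forall x, A x->nrm x<=M.
split=> [[M [_ HM]]|[M HM]].
 exists (N%:R*(M+1))=>x Ax; apply: (le_trans (nrm_le_norm x)).
 by rewrite ler_wpM2l//; apply: HM => //; rewrite ltrDl.
exists M; split; first exact: num_real.
move=> M' MM' x /HM; move: (norm_le_nrm x) => /=; lra.
Qed.

Lemma compact_nball x0 a : compact [set x | nrm (x-x0)<=a].
apply: bounded_closed_compact; last exact: closed_nball.
apply/bounded_nrmP; exists (a+nrm x0)=>x /= xa.
by have:=nrmD (x-x0) x0; rewrite subrK; lra.
Qed.

Lemma closed_nrmP (A:set rV) : closed A <->
 forall x, (forall e, 0<e->exists2 y, A y & nrm (y-x)<e)->A x.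
split=> [cA x H|H x clx].
 apply: cA=>B /nbhs_nrmP[e e0 eB]; have [y Ay yx]:=H e e0.
 by exists y; split => //; exact: eB.
apply: H=>e e0; have [|y [Ay yx]]:=clx [set y | nrm (y-x)<e]; last by exists y.
by apply/nbhs_nrmP; exists e.
Qed.

Lemma closure_nrmP (A:set rV) x : closure A x <->
 (forall e, 0<e->exists2 y, A y & nrm (y-x)<e).
split=> [clx e e0|H B /nbhs_nrmP[e e0 eB]].
 by have [|y [Ay yx]]:=clx [set y | nrm (y-x)<e]; [apply/nbhs_nrmP; exists e|exists y].
by have [y Ay yx]:=H e e0; exists y; split => //; exact: eB.
Qed.

Lemma sm_dot n : sm (fun y:rV=>dot y n).
by apply: sm_sum=>k _; apply: smM; [exact: sm_coord|exact: sm_cst]. Qed.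

Lemma pderiv_dot i n : pderiv i (fun y:rV=>dot y n) = (fun=> n ord0 i).
rewrite pderiv_sum=>[|k]; last by apply: smM; [exact: sm_coord|exact: sm_cst].
apply/funext=>y; rewrite (bigD1 i)//= big1 ?addr0=>[|j ji].
 by rewrite pderivM ?pderiv_coord ?pderiv_cst ?eqxx ?mulr0 ?add0r ?mulr1//; [exact: sm_coord|exact: sm_cst].
rewrite pderivM ?pderiv_coord ?pderiv_cst ?mulr0 ?add0r; [|exact: sm_coord|exact: sm_cst].
by rewrite eq_sym (negbTE ji) mulr0.
Qed.

Lemma sm_dot2 : sm (fun y:rV=>dot y y).
by apply: sm_sum=>k _; apply: smM; exact: sm_coord. Qed.

Lemma pderiv_dot2 i : pderiv i (fun y:rV=>dot y y) = (fun y=>2 * y ord0 i).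
rewrite pderiv_sum=>[|k]; last by apply: smM; exact: sm_coord.
apply/funext=>y; rewrite (bigD1 i)//= big1 ?addr0=>[|j ji].
 by rewrite pderivM ?pderiv_coord ?eqxx; [by rewrite mulr_natl mulr2n !mulr1|exact: sm_coord|exact: sm_coord].
rewrite pderivM ?pderiv_coord; [|exact: sm_coord|exact: sm_coord].
by rewrite eq_sym (negbTE ji) mulr0 addr0.
Qed.

End euclid.
#[global] Hint Resolve nrm_ge0 : core.

Ltac pos := repeat first [exact: ltr0n | exact: ler0n | exact: ltr01 | exact: ler01 | assumption | (apply: ltW; assumption) |
 exact: powR_ge0 | exact: expR_ge0 | exact: normr_ge0 | exact: nrm_ge0 | exact: sqr_ge0 |
 apply: exprn_ge0 | apply: addr_ge0 | rewrite invr_ge0 | apply: mulr_ge0].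

Definition nball {R : realType} {N : nat} (x : 'rV[R]_N) (t:R) : set 'rV[R]_N :=
 [set y | nrm (y-x)<=t].

(** * Borel sets, Lebesgue measure and integration by parts *)

Section borel.
Context {R : realType} {N : nat}.
Notation rV := 'rV[R]_N.
Notation leb := (lebesgue_rV R N).

Lemma measurable_box (a b : 'I_N->R) :
 measurable [set x : rV | forall i, a i<=x ord0 i<=b i].
rewrite [X in measurable X](_:_ = \bigcap_(i in [set: 'I_N])
  ((fun v:rV=>v ord0 i) @^-1` `[a i, b i])).
 apply: fin_bigcap_measurable => // i _.
 by rewrite -[X in measurable X]setTI; exact: measurable_coord.
by apply/seteqP; split=> [x H i _|x H i] /=; [rewrite in_itv/= H|have:=H i I; rewrite /= in_itv].
Qed.

(** The sigma-algebra is generated by the coordinates, hence an open set is exhibited as a countable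
    union of boxes with rational centres and half-sides 1/(k+1). *)
Lemma open_measurable_rV (A:set rV) : open A->measurable A.
move=> /open_nrmP oA.
pose B (qk : 'rV[rat]_N * nat) : set rV :=
 [set x | forall i, ratr (qk.1 ord0 i)-qk.2.+1%:R^-1<=x ord0 i<=ratr (qk.1 ord0 i)+qk.2.+1%:R^-1].
have -> : A = \bigcup_qk (if `[< B qk `<=` A >] then B qk else set0).
 apply/seteqP; split=> [x Ax|x [qk _]]; last by case: ifPn => // /asboolP BA /BA.
 have [e e0 eA]:=oA x Ax.
 (* Centre and point each deviate by at most 1/(k+1) in every coordinate, hence the factor 2; N + 1
    avoids a division by zero. *)
 have e20: 0<e/(2*(N%:R+1)) by rewrite divr_gt0// mulr_gt0// ltr_wpDl.
 have [k kE] : exists k : nat, (k.+1%:R)^-1<e/(2*(N%:R+1)).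
  by have [k] := @ltr_add_invr R 0 _ e20; rewrite add0r => ?; exists k.
 have k0: 0<(k.+1%:R : R)^-1 by rewrite invr_gt0.
 have H i: {q : rat | (x ord0 i-k.+1%:R^-1<ratr q<x ord0 i)%R}.
  apply: cid; have /rat_in_itvoo[q] : x ord0 i-k.+1%:R^-1<x ord0 i by rewrite ltrBlDr ltrDl.
  by rewrite in_itv/= => ?; exists q.
 exists (\row_i (sval (H i)), k) => //.
 case: ifPn=>[_|/asboolPn].
  rewrite /B /= => i; rewrite mxE; have /andP[h1 h2]:=svalP (H i).
  rewrite lerBlDr (le_trans (ltW h2)) ?lerDl ?(ltW k0)//=.
  by rewrite -lerBlDr ltW.
 case=> y By; apply: eA; apply: (le_lt_trans (nrm_le_sum _)).
 apply: (@le_lt_trans _ _ (\sum_(i<N) 2 * k.+1%:R^-1)).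
  apply: ler_sum=>i _; have:=By i; rewrite /= !mxE; case: (H i)=>q /=.
  by move: (k.+1%:R^-1)=>c ? ?; rewrite ler_norml; lra.
 rewrite sumr_const card_ord.
 move: kE; rewrite ltr_pdivlMr ?mulr_gt0// ?ltr_wpDl//; apply: le_lt_trans.
 by rewrite -[_ *+ N]mulr_natr; move: (k.+1%:R^-1) k0=>c c0; lra.
apply: countable_bigcupT_measurable; first exact: countableP.
by move=> qk; case: ifPn => // _; exact: measurable_box.
Qed.

Lemma continuous_measurable_rV (f:rV->R) : continuous f->measurable_fun setT f.
move=> cf; apply: (measurability _ (RGenOInfty.measurableE R))=>_ [_ [a ->]] <-.
apply: measurableI => //; apply: open_measurable_rV.
by apply: open_comp=>[x _|]; [exact: cf|exact: interval_open].
Qed.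

Lemma continuous_on_measurable (O:set rV) (f:rV->R) : open O ->
 (forall x, O x -> {for x, continuous f})->measurable_fun O f.
move=> oO cf; apply: (measurability _ (RGenOInfty.measurableE R))=>_ [_ [a ->]] <-.
apply: open_measurable_rV; apply/open_nrmP=>x [Ox /=]; rewrite in_itv/= andbT=>ax.
have [e e0 eO]:=(open_nrmP _).1 oO x Ox.
have fxa: 0<f x-a by rewrite subr_gt0.
have [d d0 Hd]:=(continuous_nrmP _ _).1 (cf x Ox) (f x-a) fxa.
exists (Num.min d e); first by rewrite lt_min d0.
move=> y; rewrite lt_min => /andP[/Hd yd /eO yO]; split => //=.
by rewrite in_itv/= andbT; move: yd; rewrite ltr_norml; lra.
Qed.

Lemma nball_box (x:rV) t : nball x t `<=`
 [set y | forall i, x ord0 i-t<=y ord0 i<=x ord0 i+t].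
by move=> y /= yt i; have:=le_trans (coord_le_nrm (y-x) i) yt; rewrite !mxE ler_norml; lra.
Qed.

Lemma measurable_nball (x:rV) t : measurable (nball x t).
rewrite -[X in measurable X]setCK; apply: measurableC; apply: open_measurable_rV.
exact/closed_openC/closed_nball.
Qed.

Lemma lebesgue_nball (x:rV) t : 0<=t ->
 (leb (nball x t)<=((2 * t)^+N)%:E)%E.
move=> t0; apply: (@le_trans _ _ (leb [set y | forall i, x ord0 i-t<=y ord0 i<=x ord0 i+t])).
 by apply: le_measure; rewrite ?inE; [exact: measurable_nball|exact: measurable_box|exact: nball_box].
rewrite lebesgue_rV_box=>[|i]; last by lra.
rewrite lee_fin (eq_bigr (fun=> 2 * t))=>[|i _]; last by lra.
by rewrite prodr_const card_ord.
Qed.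

Lemma lebesgue_bounded_lty (A:set rV) : measurable A->bounded_set A->(leb A < +oo)%E.
move=> mA /bounded_nrmP[M AM].
apply: (@le_lt_trans _ _ (leb (nball (0:rV) `|M|))).
 apply: le_measure; rewrite ?inE//; first exact: measurable_nball.
 by move=> x /AM xM; rewrite /nball /= subr0; apply: le_trans xM (ler_norm _).
by apply: le_lt_trans (lebesgue_nball _ _) _ => //; exact: ltry.
Qed.

Lemma bounded_supp_integrable (f:rV->R) (M K:R) : measurable_fun setT f ->
 (forall x, `|f x| <= K)->(forall x, M<nrm x->f x = 0)->leb.-integrable setT (EFin \o f).
move=> mf fK fM; pose B : set rV:=nball (0:rV) `|M|.
have mB: measurable B by exact: measurable_nball.
have -> : EFin \o f = (EFin \o f) \_ B.
 apply/funext=>x; rewrite patchE; case: ifPn => // /negP xB /=; rewrite fM//.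
 rewrite ltNge; apply/negP=>xM; apply: xB; rewrite inE /B /nball /= subr0.
 exact: le_trans xM (ler_norm _).
apply/(@integrable_mkcond _ _ _ leb B (EFin \o f) mB).
apply: (@measurable_bounded_integrable _ _ _ leb f B) => //.
- by apply: le_lt_trans (lebesgue_nball _ _) _ => //; exact: ltry.
- exact: measurable_funTS.
- exists K; split; first exact: num_real.
 by move=> K' KK' x _ /=; apply: le_trans (fK x) (ltW KK').
Qed.

Lemma continuous_supp_bounded (f:rV->R) (M:R) : continuous f ->
 (forall x, M<nrm x->f x = 0)->exists K, forall x, `|f x| <= K.
move=> cf fM.
have B0: nball (0:rV) `|M| !=set0 by exists 0; rewrite /nball /= subr0 nrm0.
have C: {within nball (0:rV) `|M|, continuous (fun x => `|f x|)}.
 by apply: continuous_subspaceT=>x; apply: (@continuous_comp _ _ _ f (fun t:R => `|t|)); [exact: cf|exact: norm_continuous].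
have [c _ cmax]:=compact_EVT_max B0 (@compact_nball R N 0 `|M|) C.
exists `|f c| => x; have [xM|xM]:=leP (nrm (x-0)) `|M|; first by apply: cmax; rewrite inE.
rewrite fM ?normr0//; move: xM; rewrite subr0; apply: le_lt_trans; exact: ler_norm.
Qed.

Lemma continuous_supp_integrable (f:rV->R) (M:R) : continuous f ->
 (forall x, M<nrm x->f x = 0)->leb.-integrable setT (EFin \o f).
move=> cf fM; have [K HK]:=continuous_supp_bounded cf fM.
by apply: (bounded_supp_integrable _ HK fM); exact: continuous_measurable_rV.
Qed.

End borel.

Section ibp.
Context {R : realType}.

Lemma integral_lebesgueS n (f : 'rV[R]_n.+1->R) :
 (lebesgue_rV R n.+1).-integrable setT (EFin \o f) ->
 (@lebesgue_measure R \x lebesgue_rV R n)%E.-integrable setT (fun z=>(f (rV_cons z))%:E) /\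
 (\int[lebesgue_rV R n.+1]_x (f x)%:E =
 \int[(@lebesgue_measure R \x lebesgue_rV R n)%E]_z (f (rV_cons z))%:E)%E.
move=> intf; have mf:=measurable_int _ intf.
have mf1: measurable_fun setT f by exact/measurable_EFinP.
have mfc: measurable_fun setT (f \o @rV_cons R n).
 exact: (measurableT_comp mf1 (@measurable_rV_cons R n)).
have I1: (@lebesgue_measure R \x lebesgue_rV R n)%E.-integrable setT (fun z=>(f (rV_cons z))%:E).
 apply/integrableP; split; first exact/measurable_EFinP.
 have /integrableP[_]:=intf; apply: le_lt_trans.
 rewrite [leRHS](@ge0_integral_pushforward _ _ _ _ R (@rV_cons R n))//.
 - exact: measurable_rV_cons.
 - exact: measurableT_comp.
split => //; rewrite [LHS](@integral_pushforward _ _ _ _ R (@rV_cons R n))//.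
exact: measurable_rV_cons.
Qed.

Lemma rV_cons_dist n (x y:R) (v w : 'rV[R]_n) :
 nrm (rV_cons (x, v)-rV_cons (y, w))<=`|x-y| + \sum_i `|v ord0 i-w ord0 i|.
apply: (le_trans (nrm_le_sum _)); rewrite big_ord_recl; apply: lerD.
 by rewrite !mxE unlift_none.
by apply: ler_sum=>i _; rewrite !mxE liftK.
Qed.

Lemma nrm_cons_ge n (x:R) (v : 'rV[R]_n) :
 `|x| <= nrm (rV_cons (x, v)) /\ nrm v<=nrm (rV_cons (x, v)).
split.
 by have:=coord_le_nrm (rV_cons (x, v)) ord0; rewrite mxE unlift_none.
rewrite nrm_le// nrm_sq /dotrv big_ord_recl ler_wpDl//; first by rewrite -expr2 sqr_ge0.
by apply: ler_sum=>i _; rewrite mxE liftK.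
Qed.

Lemma rV_cons_line n (x h:R) (v w : 'rV[R]_n) :
 rV_cons (x, h *: w+v) = h *: rV_cons (0, w)+rV_cons (x, v).
by apply/rowP=>i; rewrite !mxE; case: unliftP=>[j _|_]/=; rewrite ?mxE// mulr0 add0r. Qed.

Lemma rV_cons_line0 n (x h:R) (v : 'rV[R]_n) :
 rV_cons (h+x, v) = h *: delta_mx ord0 ord0+rV_cons (x, v).
apply/rowP=>i; rewrite !mxE !eqxx; case: unliftP=>[j ->|->]/=; rewrite ?mxE//= ?mulr1//.
by rewrite mulr0 add0r.
Qed.

Lemma delta_lift n (j : 'I_n) :
 delta_mx ord0 (lift ord0 j) = rV_cons (0, delta_mx ord0 j) :> 'rV[R]_n.+1.
apply/rowP=>i; rewrite !mxE eqxx; case: unliftP=>[k ->|->]/=; rewrite ?mxE//=.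
Qed.

(** Induction on the dimension, with the first coordinate split off by Fubini. If i is another
    coordinate, the inner integral vanishes by induction; if i is the first one, the order is
    exchanged and the inner integral is a difference of values of f outside its support. *)
Lemma integral_pderiv n (i : 'I_n) (f : 'rV[R]_n->R) (M:R) :
 continuous f->continuous (pderiv i f) ->
 (forall x, derivable f x (delta_mx ord0 i)) ->
 (forall x, M<nrm x->f x = 0) ->
 (\int[lebesgue_rV R n]_x (pderiv i f x)%:E = 0)%E.
elim: n i f=>[[]//|n IH] i f cf cdf df fM.
have dfM x: M<nrm x->pderiv i f x = 0.
 move=> Mx; rewrite /pderiv.
 have : is_derive x (delta_mx ord0 i) f 0.
  have E: {near x, (fun=> 0) =1 f}.
   apply/nbhs_nrmP; exists (nrm x-M)=>[|y yx]; first by rewrite subr_gt0.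
   rewrite fM//; have:=nrmB_ge x y; rewrite (nrm_distC x y); lra.
  by apply: (near_eq_is_derive E); exact: is_derive_cst.
 by move=> ?; rewrite derive_val.
have intdf:=continuous_supp_integrable cdf dfM.
have [I1 ->]:=integral_lebesgueS intdf.
rewrite -(integral12_prod_meas1 I1) /fubini_F.
case: (unliftP ord0 i)=>[j|] iE; subst i.
 apply: integral0_eq=>x _.
 pose g (v : 'rV[R]_n):=f (rV_cons (x, v)).
 have Cc: continuous (fun v : 'rV[R]_n=>rV_cons (x, v)).
  move=> v A /nbhs_nrmP[e e0 eA]; apply/nbhs_nrmP.
  exists (e/(n%:R+1)); first by rewrite divr_gt0// ltr_wpDl.
  move=> w; rewrite ltr_pdivlMr ?ltr_wpDl// => wv; apply: eA.
  apply: (le_lt_trans (rV_cons_dist _ _ _ _)); rewrite subrr normr0 add0r.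
  apply: le_lt_trans wv; apply: (@le_trans _ _ (n%:R * nrm (w-v))).
   by have:=sum_coord_le_nrm (w-v); under eq_bigr do rewrite !mxE.
  by have:=nrm_ge0 (w-v); lra.
 have E v: (fun h:R=>h^-1 *: ((g \o shift v) (h *: delta_mx ord0 j)-g v)) =
   (fun h:R=>h^-1 *: ((f \o shift (rV_cons (x, v))) (h *: delta_mx ord0 (lift ord0 j))-f (rV_cons (x, v)))).
  by apply/funext=>h /=; rewrite /g rV_cons_line -delta_lift.
 have dg v: pderiv j g v = pderiv (lift ord0 j) f (rV_cons (x, v)).
  by rewrite /pderiv /derive E.
 under eq_integral do rewrite -dg.
 apply: IH.
 - by move=> v; apply: (@continuous_comp _ _ _ (fun v : 'rV[R]_n=>rV_cons (x, v)) f); [exact: Cc|exact: cf].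
 - have -> : pderiv j g = (pderiv (lift ord0 j) f) \o (fun v=>rV_cons (x, v)).
   by apply/funext=>v; rewrite dg.
  by move=> v; apply: continuous_comp; [exact: Cc|exact: cdf].
 - move=> v; have:=df (rV_cons (x, v)); rewrite /derivable.
  by rewrite E.
 - move=> v Mv; apply: fM; apply: lt_le_trans Mv _; exact: (nrm_cons_ge x v).2.
transitivity (\int[lebesgue_rV R n]_v \int[lebesgue_measure]_x (pderiv ord0 f (rV_cons (x, v)))%:E)%E.
 exact: (Fubini I1).
apply: integral0_eq=>v _.
pose K : R := `|M| + 1; pose g (x:R):=f (rV_cons (x, v)).
have K0: 0<K by rewrite ltr_wpDl.
have dg (x:R) : is_derive x 1 g (pderiv ord0 f (rV_cons (x, v))).
 have : is_derive (0 *: delta_mx ord0 ord0+rV_cons (x, v)) (delta_mx ord0 ord0) f (pderiv ord0 f (rV_cons (x, v))).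
  by rewrite scale0r add0r; apply: DeriveDef => //; exact: df.
 move=> /is_derive_lineP D.
 have := @is_derive1_comp _ (fun s:R=>f (s *: delta_mx ord0 ord0+rV_cons (x, v))) (fun s=>s-x) x
  (pderiv ord0 f (rV_cons (x, v))) 1.
 rewrite subrr mulr1 => /(_ D); rewrite (_:_ \o _ = g); last first.
  by apply/funext=>s /=; rewrite -rV_cons_line0 subrK.
 apply; rewrite -[X in is_derive _ _ _ X]subr0; exact: is_deriveB.
have cg: continuous (fun x=>pderiv ord0 f (rV_cons (x, v))).
 move=> x; apply: (@continuous_comp _ _ _ (fun x:R=>rV_cons (x, v)) (pderiv ord0 f)); last exact: cdf.
 move=> A /nbhs_nrmP[e e0 eA].
 exists e => //= y; rewrite /= distrC=>yx; apply: eA.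
 apply: (le_lt_trans (rV_cons_dist _ _ _ _)); rewrite big1 ?addr0// => i _.
 by rewrite subrr normr0.
have gK (x:R) : M < `|x| -> g x = 0.
 by move=> Mx; apply: fM; apply: lt_le_trans Mx _; exact: (nrm_cons_ge x v).1.
pose I : set R := `[- K, K]%classic.
transitivity (\int[lebesgue_measure]_(x in I) (pderiv ord0 f (rV_cons (x, v)))%:E)%E.
 rewrite [RHS]integral_mkcond; apply: eq_integral=>x _.
 rewrite patchE; case: ifPn => // /negP xK; rewrite dfM//.
 apply: lt_le_trans (nrm_cons_ge x v).1; apply: (le_lt_trans (ler_norm M)).
 rewrite ltNge; apply/negP=>xM; apply: xK; rewrite inE/I/= in_itv/=.
 by move: xM; rewrite ler_norml /K; lra.
rewrite /I (@continuous_FTC2 R (fun x=>pderiv ord0 f (rV_cons (x, v))) g).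
- have -> : g K = 0 by apply: gK; rewrite gtr0_norm// /K; have:=ler_norm M; lra.
 have -> : g (- K) = 0 by apply: gK; rewrite normrN gtr0_norm// /K; have:=ler_norm M; lra.
 by rewrite sube0.
- by lra.
- exact: continuous_subspaceT.
- have gc: continuous g.
  by move=> x; apply: differentiable_continuous; apply/derivable1_diffP; have:=dg x => ?; apply: ex_derive.
 split.
 + by move=> x _; have:=dg x => ?; apply: ex_derive.
 + exact/cvg_at_right_filter/gc.
 + exact/cvg_at_left_filter/gc.
- by move=> x _; rewrite derive1E; have:=dg x => ?; rewrite derive_val.
Qed.

End ibp.

(** * The space L2 on a bounded open set *)

Section ae.
Context {R : realType} {N : nat} (O:set 'rV[R]_N).
Implicit Types (P Q S : 'rV[R]_N->Prop).

Lemma ae_in_impl P Q : (forall x, O x->P x->Q x)->ae_in O P->ae_in O Q.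
by move=> PQ; rewrite /ae_in; apply: filterS=>x H Ox; apply: PQ => //; exact: H. Qed.

Lemma ae_in_impl2 P Q S : (forall x, O x->P x->Q x->S x) ->
 ae_in O P->ae_in O Q->ae_in O S.
move=> PQ; rewrite /ae_in; apply: filterS2=>x HP HQ Ox.
by apply: PQ => //; [exact: HP|exact: HQ].
Qed.

Lemma ae_inW P : (forall x, O x->P x)->ae_in O P.
by move=> PW; rewrite /ae_in; apply: aeW. Qed.

End ae.

Section L2.
Context {R : realType} {N : nat} (O:set 'rV[R]_N).
Hypotheses (oO:open O) (bO:bounded_set O).
Notation rV := 'rV[R]_N.
Notation leb := (lebesgue_rV R N).
Implicit Types (f g h u v:rV->R).

Definition I1 f:=leb.-integrable O (EFin \o f).
Definition Int f:=\int[leb]_(x in O) f x.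
Definition L2 f:=measurable_fun O f /\ I1 (fun x=>f x^+2).
Definition n2 f:=Num.sqrt (Int (fun x=>f x^+2)).

Lemma mO : measurable O.
exact: open_measurable_rV. Qed.

Lemma muO : (leb O < +oo)%E.
exact: (lebesgue_bounded_lty mO). Qed.
Hint Resolve mO : core.
Definition vol : R:=fine (leb O).
Lemma vol_ge0 : 0<=vol. Proof. exact: fine_ge0. Qed.

Lemma I1_meas f : I1 f->measurable_fun O f.
by move=> /(measurable_int _)/measurable_EFinP. Qed.

Lemma I1_le f g : measurable_fun O f->I1 g->(forall x, O x -> `|f x| <= g x)->I1 f.
move=> mf Ig fg; apply: (le_integrable mO _ _ Ig); first exact/measurable_EFinP.
by move=> x Ox /=; rewrite lee_fin (le_trans (fg x Ox))// ler_norm.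
Qed.

Lemma I1_bounded f (M:R) : measurable_fun O f->(forall x, O x -> `|f x| <= M)->I1 f.
move=> mf fM; apply: measurable_bounded_integrable => //; first exact: muO.
exists M; split; first exact: num_real.
by move=> M' MM' x Ox /=; apply: le_trans (fM x Ox) (ltW MM').
Qed.

Lemma I1_cst (a:R) : I1 (fun=> a).
by apply: (@I1_bounded _ `|a|). Qed.

Lemma I1D f g : I1 f->I1 g->I1 (fun x=>f x+g x).
by move=> If Ig; have:=integrableD mO If Ig; apply: eq_integrable. Qed.

Lemma I1B f g : I1 f->I1 g->I1 (fun x=>f x-g x).
by move=> If Ig; have:=integrableB mO If Ig; apply: eq_integrable. Qed.

Lemma I1Z (a:R) f : I1 f->I1 (fun x=>a * f x).
by move=> If; have:=integrableZl mO a If; apply: eq_integrable. Qed.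

Lemma I1_norm f : I1 f->I1 (fun x => `|f x|).
by move=> If; have:=integrable_abse If; apply: eq_integrable. Qed.

Lemma I1_sum (I:Type) (r:seq I) (F:I->rV->R) :
 (forall k, I1 (F k))->I1 (fun x => \sum_(k <- r) F k x).
move=> IF; elim: r=>[|k r IH].
 by under eq_fun do rewrite big_nil; exact: I1_cst.
by under eq_fun do rewrite big_cons; exact: I1D.
Qed.

Lemma I1M f g (M:R) : measurable_fun O f->(forall x, O x -> `|f x| <= M)->I1 g ->
 I1 (fun x=>f x * g x).
move=> mf fM Ig; apply: (@I1_le _ (fun x=>M * `|g x|)).
- by apply: measurable_funM => //; exact: I1_meas.
- exact/I1Z/I1_norm.
- by move=> x Ox; rewrite normrM ler_wpM2r// fM.
Qed.

Lemma eq_Int f g : (forall x, O x->f x = g x)->Int f = Int g.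
by move=> fg; apply: eq_Rintegral=>x; rewrite inE => /fg. Qed.

Lemma eq_I1 f g : (forall x, O x->f x = g x)->I1 f->I1 g.
by move=> fg; apply: eq_integrable => // x; rewrite inE => /fg /= ->. Qed.

Lemma IntD f g : I1 f->I1 g->Int (fun x=>f x+g x) = Int f+Int g.
exact: RintegralD. Qed.

Lemma IntB f g : I1 f->I1 g->Int (fun x=>f x-g x) = Int f-Int g.
exact: RintegralB. Qed.

Lemma IntZ (a:R) f : I1 f->Int (fun x=>a * f x) = a*Int f.
by move=> If; exact: RintegralZl. Qed.

Lemma IntN f : I1 f->Int (fun x => - f x) = - Int f.
by move=> If; have:=IntZ (-1) If; rewrite mulN1r => <-; apply: eq_Int=>x _; rewrite mulN1r.
Qed.

Lemma Int0 : Int (fun=> 0) = 0.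
by rewrite /Int /Rintegral integral0_eq. Qed.

Lemma Int_sum (I:Type) (r:seq I) (F:I->rV->R) :
 (forall k, I1 (F k))->Int (fun x => \sum_(k <- r) F k x) = \sum_(k <- r) Int (F k).
move=> IF; elim: r=>[|k r IH].
 by rewrite big_nil -[RHS]Int0; apply: eq_Int=>x _; rewrite big_nil.
rewrite big_cons -IH -IntD//; last exact: I1_sum.
by apply: eq_Int=>x _; rewrite big_cons.
Qed.

Lemma Int_le f g : I1 f->I1 g->(forall x, O x->f x<=g x)->Int f<=Int g.
by move=> *; exact: le_Rintegral. Qed.

Lemma Int_ge0 f : (forall x, O x->0<=f x)->0<=Int f.
exact: Rintegral_ge0. Qed.

Lemma Int_abs f : I1 f -> `|Int f| <= Int (fun x => `|f x|).
by move=> ?; exact: le_normr_Rintegral. Qed.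

Lemma Int_cst (a:R) : Int (fun=> a) = a * vol.
by rewrite /Int Rintegral_cst. Qed.

Lemma Int_abs_le f g : measurable_fun O f->I1 g->(forall x, O x -> `|f x| <= g x) ->
 `|Int f| <= Int g.
move=> mf Ig fg; have If:=I1_le mf Ig fg; apply: (le_trans (Int_abs If)).
by apply: Int_le => //; exact: I1_norm.
Qed.

Lemma Int_ae0 f : I1 f->(forall x, O x->0<=f x)->Int f = 0->ae_in O (fun x=>f x = 0).
move=> If f0 /eqP If0.
have mf:=I1_meas If.
have E: (\int[leb]_(x in O) (f x)%:E = 0)%E.
 have /fineK <- : (\int[leb]_(x in O) (f x)%:E)%E \is a fin_num by exact: integrable_fin_num If.
 by rewrite (_:fine _ = Int f)// (eqP If0).
have A: (\int[leb]_(x in O) `|(f x)%:E| = 0)%E.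
 by rewrite -[RHS]E; apply: eq_integral=>x; rewrite inE => /f0 fx /=; rewrite ger0_norm.
have mEf: measurable_fun O (EFin \o f) by exact/measurable_EFinP.
have:=(ae_eq_integral_abs leb mO mEf).1 A.
by apply: ae_in_impl=>x _ [].
Qed.

Lemma Int_ae_eq f g : measurable_fun O f->measurable_fun O g->ae_in O (fun x=>f x = g x) ->
 Int f = Int g.
move=> mf mg fg; rewrite /Int /Rintegral; congr fine.
apply: ae_eq_integral => //; [exact/measurable_EFinP|exact/measurable_EFinP|].
by move: fg; apply: ae_in_impl=>x _ /= ->.
Qed.

Lemma Int_ae_le f g : I1 f->I1 g->ae_in O (fun x=>f x<=g x)->Int f<=Int g.
move=> If Ig fg; have mf:=I1_meas If; have mg:=I1_meas Ig.
have IM: I1 (fun x=>Num.max (f x) (g x)).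
 apply: (@I1_le _ (fun x => `|f x| + `|g x|)); first exact: measurable_maxr.
  by apply: I1D; exact: I1_norm.
 by move=> x _; case: (leP (f x) (g x))=>_; rewrite ?lerDl ?lerDr.
have -> : Int g = Int (fun x=>Num.max (f x) (g x)).
 apply: Int_ae_eq => //; first exact: measurable_maxr.
 by move: fg; apply: ae_in_impl=>x _ fg; rewrite max_r.
by apply: Int_le => // x _; rewrite le_max lexx.
Qed.

Lemma L2_meas f : L2 f->measurable_fun O f. Proof. by case. Qed.

Lemma L2_le f g : measurable_fun O f->L2 g->(forall x, O x -> `|f x| <= `|g x|)->L2 f.
move=> mf [mg Ig] fg; split => //; apply: (@I1_le _ (fun x=>g x^+2)) => //.
 exact: measurable_funX.
move=> x Ox; rewrite normrX -[g x^+2]real_normK ?num_real//.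
by rewrite lerXn2r ?nnegrE// fg.
Qed.

Lemma L2_mul f g : L2 f->L2 g->I1 (fun x=>f x * g x).
move=> [mf If] [mg Ig]; apply: (@I1_le _ (fun x=>f x^+2+g x^+2)).
- exact: measurable_funM.
- exact: I1D.
- move=> x _; rewrite normrM -[f x^+2]real_normK ?num_real// -[g x^+2]real_normK ?num_real//.
 have:=sqr_ge0 (`|f x| - `|g x|); have:=normr_ge0 (f x); have:=normr_ge0 (g x); nra.
Qed.

Lemma L2D f g : L2 f->L2 g->L2 (fun x=>f x+g x).
move=> Lf Lg; have Ifg:=L2_mul Lf Lg; case: Lf Lg=>mf If [mg Ig].
split; first exact: measurable_funD.
have:=I1D (I1D If Ig) (I1Z 2 Ifg); apply: eq_I1=>x _; ring.
Qed.

Lemma L2Z (a:R) f : L2 f->L2 (fun x=>a * f x).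
move=> [mf If]; split; first exact: measurable_funM.
by have:=I1Z (a^+2) If; apply: eq_I1=>x _; rewrite exprMn.
Qed.

Lemma L2N f : L2 f->L2 (fun x => - f x).
by move=> /(L2Z (-1)); under eq_fun do rewrite mulN1r. Qed.

Lemma L2B f g : L2 f->L2 g->L2 (fun x=>f x-g x).
by move=> Lf Lg; apply: L2D => //; exact: L2N. Qed.

Lemma L2_norm f : L2 f->L2 (fun x => `|f x|).
by move=> Lf; apply: (L2_le _ Lf)=>[|x _]; [apply: measurableT_comp => //; exact: L2_meas|rewrite normr_id]. Qed.

Lemma L2_bounded f (M:R) : measurable_fun O f->(forall x, O x -> `|f x| <= M)->L2 f.
move=> mf fM; split => //; apply: (@I1_bounded _ (M^+2)); first exact: measurable_funX.
by move=> x Ox; rewrite normrX lerXn2r ?nnegrE ?fM//; apply: le_trans (fM x Ox).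
Qed.

Lemma L2_cst (a:R) : L2 (fun=> a).
by apply: (@L2_bounded _ `|a|). Qed.

Lemma L2M f g (M:R) : measurable_fun O f->(forall x, O x -> `|f x| <= M)->L2 g ->
 L2 (fun x=>f x * g x).
move=> mf fM Lg; apply: (@L2_le _ (fun x=>M * g x)); last first.
- by move=> x Ox; rewrite !normrM ler_wpM2r// (le_trans (fM x Ox))// ler_norm.
- exact: L2Z.
- by apply: measurable_funM => //; exact: L2_meas.
Qed.

Lemma L2_I1 f : L2 f->I1 f.
by move=> Lf; have:=L2_mul Lf (L2_cst 1); apply: eq_I1=>x _; rewrite mulr1. Qed.

Lemma eq_L2 f g : (forall x, O x->f x = g x)->L2 f->L2 g.
move=> fg [mf If]; split; last by move: If; apply: eq_I1=>x Ox; rewrite fg.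
by apply: eq_measurable_fun mf=>x; rewrite inE => /fg.
Qed.

Lemma L2_sum (I:Type) (r:seq I) (F:I->rV->R) :
 (forall k, L2 (F k))->L2 (fun x => \sum_(k <- r) F k x).
move=> IF; elim: r=>[|k r IH].
 by under eq_fun do rewrite big_nil; exact: L2_cst.
by under eq_fun do rewrite big_cons; exact: L2D.
Qed.

Lemma n2_ge0 f : 0<=n2 f. Proof. exact: sqrtr_ge0. Qed.
Hint Resolve n2_ge0 : core.

Lemma n2_sq f : n2 f^+2 = Int (fun x=>f x^+2).
by rewrite sqr_sqrtr// Int_ge0// => x _; exact: sqr_ge0. Qed.

Lemma eq_n2 f g : (forall x, O x->f x = g x)->n2 f = n2 g.
by move=> fg; congr Num.sqrt; apply: eq_Int=>x Ox; rewrite fg. Qed.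

Lemma n2N f : n2 (fun x => - f x) = n2 f.
by congr Num.sqrt; apply: eq_Int=>x _; rewrite sqrrN. Qed.

Lemma n2_distC f g : n2 (fun x=>f x-g x) = n2 (fun x=>g x-f x).
by rewrite -n2N; apply: eq_n2=>x _; rewrite opprB. Qed.

Lemma n2_norm f : n2 (fun x => `|f x|) = n2 f.
by congr Num.sqrt; apply: eq_Int=>x _; rewrite real_normK ?num_real. Qed.

Lemma n2_le f g : measurable_fun O f->L2 g->(forall x, O x -> `|f x| <= `|g x|)->n2 f<=n2 g.
move=> mf Lg fg; have [_ If]:=L2_le mf Lg fg; rewrite ler_wsqrtr// Int_le//; first exact: Lg.2.
move=> x Ox; rewrite -[f x^+2]real_normK ?num_real// -[g x^+2]real_normK ?num_real//.
by rewrite lerXn2r ?nnegrE// fg.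
Qed.

Lemma n2Z (a:R) f : L2 f->n2 (fun x=>a * f x) = `|a| * n2 f.
move=> [_ If]; rewrite /n2; under eq_Int do rewrite exprMn.
by rewrite IntZ// sqrtrM ?sqr_ge0// sqrtr_sqr.
Qed.

Lemma n2_CS f g : L2 f->L2 g -> `|Int (fun x=>f x * g x)| <= n2 f * n2 g.
move=> Lf Lg; have Ifg:=L2_mul Lf Lg; have [mf If]:=Lf; have [mg Ig]:=Lg.
rewrite -(@ler_pXn2r _ 2)// ?nnegrE ?mulr_ge0// real_normK ?num_real// exprMn !n2_sq.
set a:=Int (fun x=>f x^+2); set b:=Int (fun x=>g x^+2); set c:=Int _.
have H (s t:R) : 0<=s^+2 * a-2 * s * t * c+t^+2 * b.
 have : 0<=Int (fun x=>(s * f x-t * g x)^+2) by apply: Int_ge0=>x _; exact: sqr_ge0.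
 have -> : Int (fun x=>(s * f x-t * g x)^+2) =
  Int (fun x=>(s^+2 * f x^+2-(2 * s * t)*(f x * g x))+t^+2 * g x^+2).
  by apply: eq_Int=>x _; ring.
 have A1:=I1Z (s^+2) If; have A2:=I1Z (2 * s * t) Ifg; have A3:=I1Z (t^+2) Ig.
 by rewrite IntD ?IntB ?IntZ//; exact: I1B.
have a0: 0<=a by apply: Int_ge0=>x _; exact: sqr_ge0.
have b0: 0<=b by apply: Int_ge0=>x _; exact: sqr_ge0.
have [bE|bN]:=eqVneq b 0.
 have [->|cN]:=eqVneq c 0; first by rewrite expr0n/= bE mulr0.
 (* With b = 0 the quadratic form is affine in t; this value of t makes it equal to -1. *)
 have:=H 1 ((a+1)/(2 * c)).
 have -> : 1^+2 * a-2*1*((a+1)/(2 * c)) * c+((a+1)/(2 * c))^+2 * b = - 1.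
  by rewrite bE; field.
 by rewrite lerNr oppr0 ler10.
have bp: 0<b by rewrite lt_def bN.
have:=H b c; rewrite -subr_ge0 -(pmulr_rge0 _ bp); nra.
Qed.

Lemma n2D f g : L2 f->L2 g->n2 (fun x=>f x+g x)<=n2 f+n2 g.
move=> Lf Lg; have Ifg:=L2_mul Lf Lg; have [mf If]:=Lf; have [mg Ig]:=Lg.
rewrite -(@ler_pXn2r _ 2)// ?nnegrE ?addr_ge0// n2_sq.
have -> : Int (fun x=>(f x+g x)^+2) = Int (fun x=>(f x^+2+2*(f x * g x))+g x^+2).
 by apply: eq_Int=>x _; ring.
have A2:=I1Z 2 Ifg; rewrite IntD ?IntD ?IntZ//; last exact: I1D.
rewrite -!n2_sq; have:=n2_CS Lf Lg; have:=ler_norm (Int (fun x=>f x * g x)); nra.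
Qed.

Lemma n2_tri f g h : L2 f->L2 g->L2 h ->
 n2 (fun x=>f x-h x)<=n2 (fun x=>f x-g x)+n2 (fun x=>g x-h x).
move=> Lf Lg Lh; have:=n2D (L2B Lf Lg) (L2B Lg Lh).
by rewrite (@eq_n2 _ (fun x=>f x-h x))// => x _; ring.
Qed.

Lemma n2_ae0 f : L2 f->n2 f = 0->ae_in O (fun x=>f x = 0).
move=> [_ If] f0; have : Int (fun x=>f x^+2) = 0 by rewrite -n2_sq f0 expr0n.
move/(Int_ae0 If (fun x _=>sqr_ge0 (f x))); apply: ae_in_impl=>x _ /eqP.
by rewrite sqrf_eq0 => /eqP.
Qed.

Lemma Int_n2 f : L2 f -> `|Int f| <= n2 f*Num.sqrt vol.
move=> Lf; have:=n2_CS Lf (L2_cst 1).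
rewrite (_:n2 (fun=> 1) = Num.sqrt vol); last by rewrite /n2 expr1n Int_cst mul1r.
by under eq_Int do rewrite mulr1.
Qed.

End L2.
#[global] Hint Resolve n2_ge0 : core.
Notation Int_on := Int.
Notation I1_on := I1.
Notation n2_on := n2.

Section complete.
Context {R : realType} {N : nat} (O:set 'rV[R]_N).
Hypotheses (oO:open O) (bO:bounded_set O).
Notation rV := 'rV[R]_N.
Notation leb := (lebesgue_rV R N).
Notation I1 := (I1 O).
Notation Int := (Int O).
Notation L2 := (L2 O).
Notation n2 := (n2 O).

Let mO : measurable O:=mO oO.
Hint Resolve mO : core.
Implicit Types (f g h u v:rV->R).

Lemma limn_einf_le_cst (a:nat -> \bar R) (M : \bar R) :
 (forall k, (a k<=M)%E)->(limn_einf a<=M)%E.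
move=> aM; rewrite limn_einf_lim; apply: lime_le; first exact: is_cvg_einfs.
by apply: nearW=>k; apply: ereal_inf_le => /=; exists (a k); rewrite ?aM//; exists k => /=.
Qed.

(** Riesz-Fischer. Along a subsequence with increments of norm at most 2^-(j+1), the sum of the
    absolute increments has finite integral because O has finite volume, so the subsequence
    converges almost everywhere; Fatou's lemma turns the Cauchy property into convergence in
    norm. *)
Lemma L2_complete (f:nat->rV->R) : (forall k, L2 (f k)) ->
 (forall e:R, 0<e->exists K, forall k l, (K<=k)%N->(K<=l)%N ->
  n2 (fun x=>f k x-f l x)<=e) ->
 exists2 u, L2 u & forall e : R, 0<e->exists K, forall k, (K<=k)%N ->
  n2 (fun x=>f k x-u x)<=e.
move=> Lf Cf.
have p2 j: 0<1/(2 ^ j.+1)%:R :> R by rewrite divr_gt0// ltr0n expn_gt0.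
have /choice[s0 Hs0] : forall j, exists K, forall k l, (K<=k)%N->(K<=l)%N ->
  n2 (fun x=>f k x-f l x)<=1/(2 ^ j.+1)%:R by move=> j; apply: Cf.
(* Summing the thresholds makes [s l] at least every [s0 j] with j <= l. *)
pose s j:=(\sum_(i<j.+1) s0 i)%N.
have s_ge j l: (j<=l)%N->(s0 j<=s l)%N.
 by move=> jl; rewrite /s (bigD1 (Ordinal (jl:(j<l.+1)%N)))//= leq_addr.
pose h j:=f (s j).
have h_le j l k: (j<=l)%N->(j<=k)%N->n2 (fun x=>h l x-h k x)<=1/(2 ^ j.+1)%:R.
 by move=> jl jk; apply: Hs0; exact: s_ge.
have Lh j: L2 (h j) by exact: Lf.
pose d j x := `|h j.+1 x-h j x|.
have Ld j: L2 (d j) by apply: L2_norm => //; exact: L2B.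
have Id j: I1 (d j) by exact: L2_I1.
have dE j: (\int[leb]_(x in O) (d j x)%:E = (Int (d j))%:E)%E.
 by rewrite [RHS]fineK//; exact: integrable_fin_num (Id j).
have md j: measurable_fun O (fun x=>(d j x)%:E).
 by apply/measurable_EFinP; exact: L2_meas (Ld j).
have d0 j x: O x->(0<=(d j x)%:E)%E by move=> _; rewrite lee_fin; exact: normr_ge0.
have S_fin: (\int[leb]_(x in O) (\sum_(0<=j <oo) (d j x)%:E) < +oo)%E.
 rewrite integral_nneseries//.
 apply: (@le_lt_trans _ _ (\sum_(0<=j <oo) (Num.sqrt (vol O)/(2 ^ j.+1)%:R)%:E)%E).
  apply: lee_nneseries=>[j _ _|j _]; first by apply: integral_ge0=>x /d0.
  rewrite dE lee_fin; apply: le_trans (ler_norm _) _.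
  apply: (le_trans (Int_n2 oO bO (Ld j))); rewrite n2_norm mulrC ler_wpM2l ?sqrtr_ge0//.
  by rewrite -[leRHS]mul1r; exact: h_le.
 by apply: le_lt_trans (epsilon_trick0 _ _) (ltry _); exact: sqrtr_ge0.
have mS: measurable_fun O (fun x=>(\sum_(0<=j <oo) (d j x)%:E)%E).
 by apply: ge0_emeasurable_sum => // j x Ox _; exact: d0.
have S_int: leb.-integrable O (fun x=>(\sum_(0<=j <oo) (d j x)%:E)%E).
 apply/integrableP; split => //; apply: le_lt_trans S_fin.
 apply: ge0_le_integral => //.
 - by apply: measurableT_comp.
 - by move=> x Ox; rewrite gee0_abs//; apply: nneseries_ge0=>j _ _; exact: d0.
pose u x:=fine (limn_esup (fun j=>(h j x)%:E)).
have mu: measurable_fun O u.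
 apply: (measurableT_comp (@fine_measurable R setT measurableT)).
 by apply: measurable_fun_limn_esup=>j; apply/measurable_EFinP; exact: L2_meas (Lh j).
have hu: ae_in O (fun x=>h j x @[j --> \oo] --> u x).
 have:=integrable_ae mO S_int; apply: ae_in_impl=>x Ox Sx.
 have : cvgn (series (fun j=>h j.+1 x-h j x)).
  apply: normed_cvg; apply: nnseries_is_cvg=>[j|]; first exact: normr_ge0.
  rewrite -ge0_fin_numE//; apply: nneseries_ge0=>j _ _; rewrite lee_fin; exact: normr_ge0.
 rewrite (_:series _ = (fun j=>h j x-h 0%N x)); last first.
  by apply/funext=>j; rewrite /series/= telescope_sumr.
 move=> /cvg_ex[l /= Hl].
 have hl: h j x @[j --> \oo] --> l+h 0%N x.
  have -> : (fun j=>h j x) = (fun j=>h j x-h 0%N x)+(fun=> h 0%N x).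
   by apply/funext=>j /=; rewrite addrfctE subrK.
  by apply: cvgD Hl _; exact: cvg_cst.
 have El: (h j x)%:E @[j --> \oo] --> (l+h 0%N x)%:E by apply: cvg_EFin => //; exact: nearW.
 by rewrite /u is_cvg_limn_esupE; [rewrite (cvg_lim _ El)|apply/cvg_ex; eexists; exact: El].
(* The norm of h j - u is bounded by the lower limit, in k, of the norms of h j - h (k+j), each at
   most 2^-(j+1). *)
have fat j: (\int[leb]_(x in O) ((h j x-u x)^+2)%:E<=((1/(2 ^ j.+1)%:R)^+2)%:E)%E.
 have mhu: measurable_fun O (fun x=>((h j x-u x)^+2)%:E).
  apply/measurable_EFinP; apply: measurable_funX; apply: measurable_funB => //.
  exact: L2_meas (Lh j).
 have mhh k: measurable_fun O (fun x=>((h j x-h (k+j)%N x)^+2)%:E).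
  apply/measurable_EFinP; apply: measurable_funX; apply: measurable_funB => //; exact: L2_meas (Lh _).
 have -> : (\int[leb]_(x in O) ((h j x-u x)^+2)%:E =
   \int[leb]_(x in O) limn_einf (fun k=>((h j x-h (k+j)%N x)^+2)%:E))%E.
  apply: ae_eq_integral => //.
   rewrite /limn_einf; apply: measurableT_comp => //.
   by apply: measurable_fun_limn_esup=>k; apply: measurableT_comp.
  move: hu; apply: ae_in_impl=>x Ox hx.
  have C: ((h j x-h (k+j)%N x)^+2)%:E @[k --> \oo] --> ((h j x-u x)^+2)%:E.
   apply: cvg_EFin; first exact: nearW.
   have hx': h (k+j)%N x @[k --> \oo] --> u x by rewrite (cvg_shiftn j (fun k=>h k x)).
   by apply: cvgM; apply: cvgB => //; exact: cvg_cst.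
  by rewrite limn_einf_lim; apply/esym/cvg_lim => //; exact: cvg_einfs.
 apply: (@le_trans _ _ (limn_einf (fun k => \int[leb]_(x in O) ((h j x-h (k+j)%N x)^+2)%:E))%E).
  by apply: fatou => // k x _; rewrite lee_fin sqr_ge0.
 apply: limn_einf_le_cst=>k.
 have Lhh: L2 (fun x=>h j x-h (k+j)%N x) by exact: L2B.
 have -> : (\int[leb]_(x in O) ((h j x-h (k+j)%N x)^+2)%:E =
  (Int (fun x=>(h j x-h (k+j)%N x)^+2))%:E)%E.
  by rewrite [RHS]fineK//; exact: integrable_fin_num Lhh.2.
 rewrite -n2_sq lee_fin lerXn2r ?nnegrE ?n2_ge0 ?(ltW (p2 j))//.
 by apply: h_le => //; exact: leq_addl.
have Lhu j: L2 (fun x=>h j x-u x).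
 split; first by apply: measurable_funB => //; exact: L2_meas (Lh j).
 apply/integrableP; split.
  apply/measurable_EFinP; apply: measurable_funX; apply: measurable_funB => //.
  exact: L2_meas (Lh j).
 apply: le_lt_trans (ltry ((1/(2 ^ j.+1)%:R)^+2)); apply: le_trans (fat j).
 rewrite le_eqVlt; apply/orP; left; apply/eqP; apply: eq_integral=>x _ /=.
 by rewrite ger0_norm ?sqr_ge0.
have Lu: L2 u.
 by have:=L2B oO (Lh 0%N) (Lhu 0%N); apply: eq_L2 => // x _; ring.
have n2hu j: n2 (fun x=>h j x-u x)<=1/(2 ^ j.+1)%:R.
 rewrite -(@ler_pXn2r _ 2)// ?nnegrE ?n2_ge0 ?(ltW (p2 j))//.
 rewrite n2_sq -lee_fin; apply: le_trans (fat j).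
 by rewrite fineK//; exact: integrable_fin_num (Lhu j).2.
exists u => // e e0.
have [j Hj] : exists j, 1/(2 ^ j.+1)%:R<=e/2.
 have e20: 0<e/2 by rewrite divr_gt0.
 have [j Hj] := @ltr_add_invr R 0 (e/2) e20.
 exists j; rewrite add0r in Hj; apply: le_trans (ltW Hj).
 rewrite div1r lef_pV2 ?posrE ?ltr0n ?expn_gt0// ler_nat.
 by rewrite ltnW// ltn_expl.
exists (s0 j)=>k jk.
apply: (le_trans (n2_tri oO (Lf k) (Lh j) Lu)).
have:=n2hu j; have:=Hs0 j k (s j) jk (s_ge j j (leqnn _)); rewrite -/(h j); lra.
Qed.

Lemma Lp_normE f : L2 f->Lp_norm O 2 f = (n2 f)%:E.
move=> Lf; have [mf If]:=Lf.
have E: (Lp_norm O 2 f `^ 2 = (n2 f^+2)%:E)%E.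
 rewrite /Lp_norm powR_Lnorm// n2_sq.
 rewrite [RHS]fineK; last exact: integrable_fin_num If.
 rewrite [RHS]integral_mkcond; apply: eq_integral=>x _ /=.
 rewrite !patchE; case: ifPn=>_; last by rewrite normr0 powR0// pnatr_eq0.
 by rewrite powR_mulrn// real_normK ?num_real.
have:=Lnorm_ge0 leb 2%:E (EFin \o (f \_ O)); rewrite -/(Lp_norm O 2 f).
case: (Lp_norm O 2 f) E=>[r| |] //=; last by rewrite pnatr_eq0.
rewrite lee_fin => -[E] r0; move: E; rewrite powR_mulrn// => /eqP.
by rewrite eqrXn2// ?n2_ge0// => /eqP ->.
Qed.

Lemma in_Lp2 f : in_Lp O 2 f <-> L2 f.
split=> [[mf fin]|Lf]; last by split; [exact: L2_meas|rewrite Lp_normE// ltry].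
split => //; apply/integrableP; split; first by apply/measurable_EFinP; exact: measurable_funX.
have E: (\int[leb]_(x in O) `|(f x^+2)%:E| = Lp_norm O 2 f `^ 2)%E.
 rewrite /Lp_norm powR_Lnorm// [LHS]integral_mkcond; apply: eq_integral=>x _ /=.
 rewrite !patchE; case: ifPn=>_; last by rewrite normr0 powR0// pnatr_eq0.
 by rewrite powR_mulrn// real_normK ?num_real// ger0_norm ?sqr_ge0.
rewrite /comp E; have:=Lnorm_ge0 leb 2%:E (EFin \o (f \_ O)); rewrite -/(Lp_norm O 2 f).
by case: (Lp_norm O 2 f) fin=>[r| |]//= _ _; rewrite ltry.
Qed.

Lemma Lp_cvg0 (f:nat->rV->R) : (forall k, L2 (f k)) ->
 ((fun k=>Lp_norm O 2 (f k)) @ \oo --> 0%E) <->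
 (forall e:R, 0<e->exists K, forall k, (K<=k)%N->n2 (f k)<e).
move=> Lf; have -> : (fun k=>Lp_norm O 2 (f k)) = (fun k=>(n2 (f k))%:E).
 by apply/funext=>k; exact: Lp_normE.
split=> [H e e0|H].
 have /fine_cvg /= H' : (n2 (f k))%:E @[k --> \oo] --> 0%:E by exact: H.
 have /cvgrPdist_lt/(_ e e0)[K _ HK]:=H'.
 by exists K=>k jk; have:=HK k jk; rewrite /= sub0r normrN (ger0_norm (n2_ge0 _ _)).
apply: cvg_EFin; first exact: nearW.
apply/cvgrPdist_lt=>e e0; have [K HK]:=H e e0.
by exists K => // k jk; have:=HK k jk; rewrite sub0r normrN (ger0_norm (n2_ge0 _ _)).
Qed.

End complete.

(** * Test functions, H^1_0 and the chain rule *)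

Section test_functions.
Context {R : realType} {N : nat} (O:set 'rV[R]_N).
Hypotheses (oO:open O) (bO:bounded_set O).
Notation rV := 'rV[R]_N.
Notation leb := (lebesgue_rV R N).
Notation Int := (Int O).
Notation L2 := (L2 O).
Notation n2 := (n2 O).
Notation tf := (test_function O).
Implicit Types (f h u v phi psi eta:rV->R) (g k : 'I_N->rV->R).

Lemma tf_sm phi : tf phi->sm phi. Proof. by case=> S _ _; exact: Sm. Qed.

Lemma tf_compact (K:set rV) psi : compact K->K `<=` O->sm psi ->
 (forall x, ~ K x->psi x = 0)->tf psi.
move=> cK KO Spsi psi0; have clK: closure [set x | psi x != 0] `<=` K.
 rewrite closureE; apply: smallest_sub; first exact: compact_closed (@norm_hausdorff _ _) cK.
 by move=> x /= /eqP px; apply: contrapT => /psi0.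
split; first by case: Spsi.
 by apply: subclosed_compact cK clK; exact: closed_closure.
exact: subset_trans clK KO.
Qed.

Lemma tf_out0 phi x : tf phi -> ~ closure [set x | phi x != 0] x->phi x = 0.
by move=> _ nx; apply: contrapT => /eqP px; apply: nx; exact: subset_closure. Qed.

Lemma tf_out phi x : tf phi -> ~ O x->phi x = 0.
by move=> T nO; apply: tf_out0 => //; case: T=>_ _ KO /KO. Qed.

Lemma tf_sub phi psi : tf phi->sm psi->(forall x, phi x = 0->psi x = 0)->tf psi.
move=> T Spsi pp; have [_ cK KO]:=T; apply: (tf_compact cK KO Spsi)=>x /(tf_out0 T).
exact: pp.
Qed.

Lemma tf_pderiv i phi : tf phi->tf (pderiv i phi).
move=> T; have [_ cK KO]:=T; apply: (tf_compact cK KO); first exact/sm_pderiv/tf_sm.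
move=> x nx; have : is_derive x (delta_mx ord0 i) phi 0; last by move=> ?; rewrite /pderiv derive_val.
have E: {near x, (fun=> 0) =1 phi}.
 have /open_nrmP/(_ x nx)[e e0 He] : open (~` closure [set x | phi x != 0]).
  exact/closed_openC/closed_closure.
 by apply/nbhs_nrmP; exists e => // y /He /(tf_out0 T).
by apply: (near_eq_is_derive E); exact: is_derive_cst.
Qed.

Lemma tfD phi psi : tf phi->tf psi->tf (fun x=>phi x+psi x).
move=> T1 T2; have [_ cK KO]:=T1; have [_ cL LO]:=T2.
apply: (@tf_compact (closure [set x | phi x != 0] `|` closure [set x | psi x != 0])).
- exact: compactU.
- by move=> x [/KO|/LO].
- by apply: smD; exact: tf_sm.
- by move=> x /not_orP[/(tf_out0 T1) -> /(tf_out0 T2) ->]; rewrite addr0.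
Qed.

Lemma tfMr phi eta : tf phi->sm eta->tf (fun x=>phi x * eta x).
by move=> T S; apply: (tf_sub T); [apply: smM => //; exact: tf_sm|move=> x ->; rewrite mul0r].
Qed.

Lemma tfMl phi eta : tf phi->sm eta->tf (fun x=>eta x * phi x).
by move=> T S; under eq_fun do rewrite mulrC; exact: tfMr. Qed.

Lemma tfZ (a:R) phi : tf phi->tf (fun x=>a * phi x).
by move=> T; apply: tfMl => //; exact: sm_cst. Qed.

Lemma tf0 : tf (fun=> 0).
by apply: (@tf_compact set0) => //; [exact: compact0|exact: sm_cst].
Qed.

Lemma sm_bounded eta : sm eta->exists2 M : R, 0<=M & forall x, O x -> `|eta x| <= M.
move=> S; have [M HM]:=(bounded_nrmP O).1 bO.
have B0: nball (0:rV) `|M| !=set0 by exists 0; rewrite /nball /= subr0 nrm0.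
have C: {within nball (0:rV) `|M|, continuous (fun x => `|eta x|)}.
 apply: continuous_subspaceT=>x; apply: (@continuous_comp _ _ _ eta (fun t:R => `|t|)).
  exact: sm_cont.
 exact: norm_continuous.
have [c _ cmax]:=compact_EVT_max B0 (@compact_nball R N 0 `|M|) C.
exists `|eta c| => // x Ox; apply: cmax; rewrite inE /nball/= subr0.
exact: le_trans (HM x Ox) (ler_norm _).
Qed.

Lemma sm_meas eta : sm eta->measurable_fun O eta.
by move=> S; apply: measurable_funTS; apply: continuous_measurable_rV; exact: sm_cont. Qed.

Lemma sm_L2 eta : sm eta->L2 eta.
by move=> S; have [M _ HM]:=sm_bounded S; apply: (L2_bounded oO bO _ HM); exact: sm_meas.
Qed.

Lemma L2_smM eta f : sm eta->L2 f->L2 (fun x=>eta x * f x).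
by move=> S Lf; have [M _ HM]:=sm_bounded S; apply: (L2M oO _ HM) => //; exact: sm_meas.
Qed.

Lemma tf_L2 phi : tf phi->L2 phi.
by move=> /tf_sm/sm_L2. Qed.

Lemma tf_Int phi : tf phi->Int phi = fine (\int[leb]_x (phi x)%:E)%E.
move=> T; rewrite /Int_on Rintegral_mkcond /Rintegral; congr fine.
apply: eq_integral=>x _; rewrite patchE; case: ifPn => // /negP nx; rewrite (tf_out T)//.
by move=> Ox; apply: nx; rewrite inE.
Qed.

Lemma Int_pderiv_tf i phi : tf phi->Int (pderiv i phi) = 0.
move=> T; rewrite tf_Int; last exact: tf_pderiv.
have [M HM]:=(bounded_nrmP O).1 bO; have S:=tf_sm T.
rewrite (@integral_pderiv R N i phi M)//.
- exact: sm_cont.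
- exact/sm_cont/sm_pderiv.
- by move=> x; exact: sm_derivable.
- by move=> x Mx; apply: (tf_out T) => /HM; rewrite leNgt Mx.
Qed.

Lemma tf_ibp i phi eta : tf phi->sm eta ->
 Int (fun x=>phi x * pderiv i eta x) = - Int (fun x=>pderiv i phi x * eta x).
move=> T S; have Sp:=tf_sm T; have:=Int_pderiv_tf i (tfMr T S).
rewrite pderivM//; under eq_Int do rewrite [X in _+X]mulrC.
rewrite IntD//; first by move=> /eqP; rewrite addr_eq0 => /eqP.
- by apply: L2_mul => //; [exact: sm_L2|exact/sm_L2/sm_pderiv].
- by apply: L2_mul => //; [exact/sm_L2/sm_pderiv|exact: sm_L2].
Qed.

(** H^1_0 with the gradient as a family of components and with approximation stated by epsilons
    rather than by a sequence; [in_H10P] identifies it with [in_H10]. *)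
Definition H u g := [/\ L2 u, forall i, L2 (g i) &
 forall e : R, 0<e->exists2 phi, tf phi &
  n2 (fun x=>phi x-u x)<e /\ forall i, n2 (fun x=>pderiv i phi x-g i x)<e].

Lemma H_tf phi : tf phi->H phi (fun i=>pderiv i phi).
move=> T; split=> [|i|e e0]; [exact: tf_L2|exact/tf_L2/tf_pderiv|].
have Z f: n2 (fun x=>f x-f x) = 0.
 by rewrite /n2_on; under eq_Int do rewrite subrr expr0n/=; rewrite Int0 sqrtr0.
by exists phi => //; rewrite Z; split => // i; rewrite Z.
Qed.

Lemma HD u v g k : H u g->H v k->H (fun x=>u x+v x) (fun i x=>g i x+k i x).
move=> [Lu Lg Hu] [Lv Lk Hv]; split=> [|i|e e0]; [exact: L2D|exact: L2D|].
have [|phi Tp [p1 p2]]:=Hu (e/2); first by rewrite divr_gt0.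
have [|psi Ts [s1 s2]]:=Hv (e/2); first by rewrite divr_gt0.
have Sp:=tf_sm Tp; have Ss:=tf_sm Ts.
exists (fun x=>phi x+psi x); first exact: tfD.
split=> [|i].
 have:=n2D oO (L2B oO (sm_L2 Sp) Lu) (L2B oO (sm_L2 Ss) Lv).
 rewrite (@eq_n2 _ _ O _ (fun x=>phi x+psi x-(u x+v x))); first by lra.
 by move=> x _; ring.
have:=n2D oO (L2B oO (sm_L2 (sm_pderiv i Sp)) (Lg i)) (L2B oO (sm_L2 (sm_pderiv i Ss)) (Lk i)).
rewrite (@eq_n2 _ _ O _ (fun x=>pderiv i (fun x=>phi x+psi x) x-(g i x+k i x))).
 by have:=p2 i; have:=s2 i; lra.
by move=> x _; rewrite pderivD//; ring.
Qed.

Lemma HZ (a:R) u g : H u g->H (fun x=>a * u x) (fun i x=>a * g i x).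
move=> [Lu Lg Hu]; split=> [|i|e e0]; [exact: L2Z|exact: L2Z|].
have a1: 0 < `|a| + 1 by rewrite ltr_wpDl.
have [|phi Tp [p1 p2]]:=Hu (e/(`|a| + 1)); first by rewrite divr_gt0.
rewrite ltr_pdivlMr// in p1; have Sp:=tf_sm Tp.
exists (fun x=>a * phi x); first exact: tfZ.
split=> [|i].
 rewrite (@eq_n2 _ _ O _ (fun x=>a*(phi x-u x)))=>[|x _]; last by rewrite mulrBr.
 rewrite n2Z//; last by apply: L2B => //; exact: sm_L2.
 by have:=n2_ge0 O (fun x=>phi x-u x); nra.
have:=p2 i; rewrite ltr_pdivlMr// => p2i.
rewrite (@eq_n2 _ _ O _ (fun x=>a*(pderiv i phi x-g i x)))=>[|x _]; last by rewrite pderivZ// mulrBr.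
rewrite n2Z//; last by apply: L2B => //; exact/sm_L2/sm_pderiv.
by have:=n2_ge0 O (fun x=>pderiv i phi x-g i x); nra.
Qed.

Lemma H_eq_ae u v g k : H u g->measurable_fun O v->(forall i, measurable_fun O (k i)) ->
 ae_in O (fun x=>u x = v x)->(forall i, ae_in O (fun x=>g i x = k i x))->H v k.
have L2_ae f h: L2 f->measurable_fun O h->ae_in O (fun x=>f x = h x)->L2 h.
 move=> [mf If] mh fh; split=> //; apply/integrableP; split.
  by apply/measurable_EFinP; exact: measurable_funX.
 have /integrableP[_]:=If.
 rewrite (_:integral _ _ _ = (\int[leb]_(x in O) `|(EFin \o (fun x=>(h x^+2)%R)) x|)%E)//.
 apply: ae_eq_integral => //; first exact: mO.
 - by apply: measurableT_comp => //; apply/measurable_EFinP; exact: measurable_funX.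
 - by apply: measurableT_comp => //; apply/measurable_EFinP; exact: measurable_funX.
 - by move: fh; apply: ae_in_impl=>x _ /= ->.
have n2_ae phi f h: L2 phi->measurable_fun O f->measurable_fun O h->ae_in O (fun x=>f x = h x) ->
  n2 (fun x=>phi x-f x) = n2 (fun x=>phi x-h x).
 move=> [mp _] mf mh fh; congr Num.sqrt; apply: (Int_ae_eq oO).
 - by apply: measurable_funX; exact: measurable_funB.
 - by apply: measurable_funX; exact: measurable_funB.
 - by move: fh; apply: ae_in_impl=>x _ ->.
move=> [Lu Lg Hu] mv mk uv gk; split=> [|i|e e0].
- exact: L2_ae uv.
- exact: L2_ae (gk i).
have [phi Tp [p1 p2]]:=Hu e e0; exists phi => //; split=> [|i].
 by rewrite -(n2_ae _ u)//; [exact: tf_L2|exact: L2_meas Lu].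
by rewrite -(n2_ae _ (g i))//; [exact/tf_L2/tf_pderiv|exact: L2_meas (Lg i)].
Qed.

Lemma H_eq u v g k : H u g->(forall x, O x->u x = v x) ->
 (forall i x, O x->g i x = k i x)->H v k.
move=> Hu uv gk; have [Lu Lg _]:=Hu; apply: (H_eq_ae Hu).
- exact: L2_meas (eq_L2 oO uv Lu).
- by move=> i; exact: L2_meas (eq_L2 oO (gk i) (Lg i)).
- exact: ae_inW.
- by move=> i; exact/ae_inW/gk.
Qed.

Lemma HB u v g k : H u g->H v k->H (fun x=>u x-v x) (fun i x=>g i x-k i x).
by move=> Hu /(HZ (-1)) Hv; apply: (H_eq (HD Hu Hv))=>[x _|i x _]; rewrite mulN1r.
Qed.

Lemma eq0_small (a C:R) : (forall e:R, 0<e -> `|a| <= C * e)->a = 0.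
move=> Ha; apply/eqP; rewrite -normr_le0; apply/ler_addgt0Pl=>e e0; rewrite addr0.
have C1: 0 < `|C| + 1 by rewrite ltr_wpDl.
apply: (le_trans (Ha (e/(`|C| + 1)) (divr_gt0 e0 C1))).
rewrite mulrA ler_pdivrMr// mulrC ler_wpM2l ?(ltW e0)//.
by apply: le_trans (ler_norm C) _; rewrite lerDl.
Qed.

Lemma le_small (a b C:R) : (forall e:R, 0<e->a<=b+C * e)->a<=b.
move=> Ha; apply/ler_addgt0Pr=>e e0.
have C1: 0 < `|C| + 1 by rewrite ltr_wpDl.
apply: (le_trans (Ha (e/(`|C| + 1)) (divr_gt0 e0 C1))); rewrite lerD2l.
rewrite mulrA ler_pdivrMr// mulrC ler_wpM2l ?(ltW e0)//.
by apply: le_trans (ler_norm C) _; rewrite lerDl.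
Qed.

(** Here [eta] may be non-zero on the boundary: the boundary term disappears because u is a limit of
    test functions, for which [tf_ibp] holds. *)
Lemma H_ibp u g i eta : H u g->sm eta ->
 Int (fun x=>u x * pderiv i eta x) = - Int (fun x=>g i x * eta x).
move=> [Lu Lg Hu] S; apply/eqP; rewrite -subr_eq0 opprK; apply/eqP.
have Ld: L2 (pderiv i eta) by exact/sm_L2/sm_pderiv.
have Le: L2 eta by exact: sm_L2.
apply: (@eq0_small _ (n2 (pderiv i eta)+n2 eta))=>e e0.
have [phi Tp [p1 p2]]:=Hu e e0; have Sp:=tf_sm Tp.
have Lp: L2 phi by exact: sm_L2.
have Ldp: L2 (pderiv i phi) by exact/sm_L2/sm_pderiv.
have -> : Int (fun x=>u x * pderiv i eta x)+Int (fun x=>g i x * eta x) =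
 - (Int (fun x=>(phi x-u x) * pderiv i eta x)+Int (fun x=>(pderiv i phi x-g i x) * eta x)).
 under [X in _ = - (X + _)]eq_Int do rewrite mulrBl.
 under [X in _ = - (_+X)]eq_Int do rewrite mulrBl.
 rewrite !IntB//; try exact: L2_mul.
 by rewrite (tf_ibp i Tp S); ring.
rewrite normrN; apply: (le_trans (ler_normD _ _)).
have:=n2_CS oO (L2B oO Lp Lu) Ld; have:=n2_CS oO (L2B oO Ldp (Lg i)) Le.
have:=p2 i; move: (n2_ge0 O eta) (n2_ge0 O (pderiv i eta)) p1.
move: (n2 eta) (n2 (pderiv i eta)) (n2 (fun x=>phi x-u x)) (n2 (fun x=>pderiv i phi x-g i x)) (`|_|) (`|_|).
by move=> a b c d p q; nra.
Qed.

(** From right to left, the weak gradient clause is supplied by [H_ibp], and the approximating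
    sequence by the tolerances 1/(k+1). *)
Lemma in_H10P u (G:rV->rV) : in_H10 O u G <-> H u (fun i x=>G x ord0 i).
split=> [[[/(in_Lp2 oO) Lu LG _] [phi [Tp cu cg]]]|Hu].
 have {}LG i : L2 (fun x=>G x ord0 i) by exact/(in_Lp2 oO)/LG.
 split=> // e e0.
 have /(Lp_cvg0 oO)/(_ e e0)[|K0 HK0]:=cu.
  by move=> j; apply: L2B => //; exact: tf_L2.
 have /choice[K HK] : forall i, exists K, forall j, (K<=j)%N ->
   n2 (fun x=>pderiv i (phi j) x-G x ord0 i)<e.
  move=> i; have /(Lp_cvg0 oO)/(_ e e0)// := cg i.
  by apply=>j; apply: L2B => //; exact/tf_L2/tf_pderiv.
 pose j:=(K0 + \sum_i K i)%N; exists (phi j) => //; split.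
  by apply: HK0; exact: leq_addr.
 by move=> i; apply: HK; rewrite /j (bigD1 i)//= addnCA leq_addr.
have [Lu LG Hc]:=Hu; split.
 split=> [|i|psi Ts i]; [exact/(in_Lp2 oO)|exact/(in_Lp2 oO)|].
 exact: (H_ibp i Hu (tf_sm Ts)).
have pos (k:nat) : 0<k.+1%:R^-1 :> R by rewrite invr_gt0.
have /choice[phi Hp] : forall k : nat, exists phi, [/\ tf phi, n2 (fun x=>phi x-u x)<k.+1%:R^-1 &
  forall i, n2 (fun x=>pderiv i phi x-G x ord0 i)<k.+1%:R^-1].
 by move=> j; have [phi T [p1 p2]]:=Hc _ (pos j); exists phi.
have small e: 0<e->exists K, forall k : nat, (K<=k)%N->k.+1%:R^-1<e :> R.
 move=> e0; have [K] := @ltr_add_invr R 0 e e0; rewrite add0r=>HK.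
 exists K=>j Kk; apply: le_lt_trans HK; rewrite lef_pV2 ?posrE// ler_nat; exact: Kk.
exists phi; split=> [j||i]; first by have []:=Hp j.
- apply/(Lp_cvg0 oO)=>[j|e e0]; first by apply: L2B => //; apply: tf_L2; have []:=Hp j.
 by have [K HK]:=small e e0; exists K=>j /HK; apply: lt_trans; have []:=Hp j.
- apply/(Lp_cvg0 oO)=>[j|e e0]; first by apply: L2B => //; apply/tf_L2/tf_pderiv; have []:=Hp j.
 by have [K HK]:=small e e0; exists K=>j /HK; apply: lt_trans; have [_ _]:=Hp j.
Qed.

End test_functions.

Section chain.
Context {R : realType} {N : nat} (O:set 'rV[R]_N).
Hypotheses (oO:open O) (bO:bounded_set O).
Notation rV := 'rV[R]_N.
Notation Int := (Int O).
Notation L2 := (L2 O).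
Notation n2 := (n2 O).
Notation tf := (test_function O).
Notation H := (H O).
Implicit Types (f h u v phi psi eta a:rV->R) (g k : 'I_N->rV->R).

Lemma n2_le3 f p q r (A B C:R) : measurable_fun O f->L2 p->L2 q->L2 r ->
 0<=A->0<=B->0<=C ->
 (forall x, O x -> `|f x| <= A * `|p x| + B * `|q x| + C * `|r x|) ->
 n2 f<=A * n2 p+B * n2 q+C * n2 r.
move=> mf Lp Lq Lr A0 B0 C0 fH.
have LA:=L2Z oO A (L2_norm oO Lp); have LB:=L2Z oO B (L2_norm oO Lq).
have LC:=L2Z oO C (L2_norm oO Lr).
apply: (@le_trans _ _ (n2 (fun x=>A * `|p x| + B * `|q x| + C * `|r x|))).
 apply: n2_le => // [|x Ox]; first by apply: L2D => //; exact: L2D.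
 by apply: le_trans (fH x Ox) (ler_norm _).
apply: (le_trans (n2D oO (L2D oO LA LB) LC)).
have:=n2D oO LA LB; rewrite !n2Z ?n2_norm ?ger0_norm//; try exact: L2_norm.
lra.
Qed.

Lemma lipschitz1 (b:R->R) (B:R) : smooth1 b->(forall s, `|(derive1 b) s| <= B) ->
 forall s t, `|b s-b t| <= B * `|s-t|.
move=> Sb bB s t; have [_ D]:=smooth1_derive1 Sb.
wlog ts : s t/t<=s=>[W|].
 have [/W//|/ltW/W]:=leP t s; by rewrite distrC (distrC s).
rewrite (ger0_norm (_:0<=s-t)) ?subr_ge0//.
by apply: (mvt_le ts (dg:=derive1 b))=>r _; exact: bB.
Qed.

Lemma sm_pderiv_bounded eta : sm eta ->
 exists2 M : R, 0<=M & forall i x, O x -> `|pderiv i eta x| <= M.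
move=> S; have /choice[M HM] : forall i, exists M : R, 0<=M /\ forall x, O x -> `|pderiv i eta x| <= M.
 by move=> i; have [M M0 HM]:=sm_bounded bO (sm_pderiv i S); exists M.
exists (\sum_i M i); first by apply: sumr_ge0=>i _; have []:=HM i.
move=> i x Ox; apply: le_trans ((HM i).2 x Ox) _.
by rewrite (bigD1 i)//= lerDl sumr_ge0// => j _; have []:=HM j.
Qed.

(** Subtracting [b (a x)] makes the composite vanish where u does, so that test functions are sent
    to test functions. With b', b'' bounded the map is continuous from H^1_0 to itself, which is
    checked on approximations of u. *)
Lemma H_chain u g a eta (b:R->R) (B1 B2:R) : H u g->sm a->sm eta->smooth1 b ->
 (forall s, `|(derive1 b) s| <= B1)->(forall s, `|(derive1 (derive1 b)) s| <= B2) ->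
 H (fun x=>eta x*(b (u x+a x)-b (a x)))
  (fun i x=>pderiv i eta x*(b (u x+a x)-b (a x)) +
   eta x*((derive1 b) (u x+a x)*(g i x+pderiv i a x)-(derive1 b) (a x) * pderiv i a x)).
move=> [Lu Lg Hu] Sa Se Sb bB1 bB2.
have [Sb' _]:=smooth1_derive1 Sb.
have Lip:=lipschitz1 Sb bB1; have Lip':=lipschitz1 Sb' bB2.
have B1_ge0: 0<=B1 by apply: le_trans (bB1 0).
have B2_ge0: 0<=B2 by apply: le_trans (bB2 0).
have [M1 M1_ge0 HM1]:=sm_bounded bO Se.
have [M2 M2_ge0 HM2]:=sm_pderiv_bounded Se.
have [M3 M3_ge0 HM3]:=sm_pderiv_bounded Sa.
have Lua: L2 (fun x=>u x+a x) by apply: L2D => //; exact: sm_L2.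
have mb (c:R->R) w : smooth1 c->measurable_fun O w->measurable_fun O (fun x=>c (w x)).
 move=> Sc mw; apply: (@measurableT_comp _ _ _ _ _ _ c _ w) => //.
 by apply: continuous_measurable_fun; exact: smooth1_cont.
have Lbu: L2 (fun x=>b (u x+a x)-b (a x)).
 apply: (@L2_le _ _ _ oO _ (fun x=>B1 * u x)); last 2 first.
 - exact: L2Z.
 - by move=> x _; apply: (le_trans (Lip _ _)); rewrite normrM (ger0_norm B1_ge0) addrK.
 by apply: measurable_funB; apply: mb => //; [exact: L2_meas Lua|exact: sm_meas].
have LG i: L2 (fun x=>(derive1 b) (u x+a x)*(g i x+pderiv i a x)-(derive1 b) (a x) * pderiv i a x).
 apply: L2B => //.
  apply: (L2M oO (M:=B1))=>[|x _|]; [|exact: bB1|].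
   by apply: mb => //; exact: L2_meas Lua.
  by apply: L2D => //; exact/sm_L2/sm_pderiv.
 by apply: sm_L2 => //; apply: smM; [exact: sm_comp|exact: sm_pderiv].
pose T phi x:=eta x*(b (phi x+a x)-b (a x)).
have ST phi: sm phi->sm (fun x=>b (phi x+a x)-b (a x)).
 by move=> S; apply: smB; apply: sm_comp => //; exact: smD.
have TT phi: tf phi->tf (T phi).
 move=> Tp; apply: (tf_sub Tp); first by apply: smM => //; exact/ST/(tf_sm Tp).
 by move=> x; rewrite /T => ->; rewrite add0r subrr mulr0.
have dT i phi: sm phi->pderiv i (T phi) = fun x=>pderiv i eta x*(b (phi x+a x)-b (a x)) +
  eta x*((derive1 b) (phi x+a x)*(pderiv i phi x+pderiv i a x)-(derive1 b) (a x) * pderiv i a x).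
 move=> S; rewrite pderivM//; last exact: ST.
 apply/funext=>x; rewrite pderivB; [|exact/sm_comp/smD|exact: sm_comp].
 rewrite !pderiv_comp//; last exact: smD.
 by rewrite pderivD//; ring.
split=> [|i|e e0]; first exact: L2_smM.
 by apply: L2D => //; apply: L2_smM => //; exact: sm_pderiv.
pose c3:=2*M1*B1.
have c3_ge0: 0<=c3 by rewrite !mulr_ge0.
have c31: 0<2*(c3+1) by rewrite mulr_gt0// ltr_wpDl.
(* In (b'(phi + a) - b'(u + a)) g neither factor is both bounded and small. So g is split as (g - D
   phi1) + D phi1 with phi1 fixed before phi: the first part is small in L2 and multiplied by at
   most 2 B1, the second is bounded by K and multiplied by at most B2 |phi - u|. *)
have [|phi1 T1 [_ p1]]:=Hu (e/(2*(c3+1))); first by rewrite divr_gt0.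
have S1:=tf_sm T1; have [K K_ge0 HK]:=sm_pderiv_bounded S1.
pose c1:=(M2*B1+M1*B1)+M1*B2*(K+M3); pose c2:=M1*B1.
have c1_ge0: 0<=c1 by rewrite !(addr_ge0, mulr_ge0).
have c2_ge0: 0<=c2 by rewrite mulr_ge0.
have c12: 0<2*(c1+c2+1) by rewrite mulr_gt0// ltr_wpDl// addr_ge0.
have [|phi T2 [q1 q2]]:=Hu (e/(2*(c1+c2+1))); first by rewrite divr_gt0.
have S2:=tf_sm T2.
have fin (x y z:R) : x<e/(2*(c1+c2+1))->y<e/(2*(c1+c2+1)) ->
  z<e/(2*(c3+1))->0<=x->0<=y->0<=z->c1 * x+c2 * y+c3 * z<e.
 by rewrite !ltr_pdivlMr// => ? ? ? ? ? ?; nra.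
have Lpu: L2 (fun x=>phi x-u x) by apply: L2B => //; exact: sm_L2.
have Lpg i: L2 (fun x=>pderiv i phi x-g i x) by apply: L2B => //; exact/sm_L2/sm_pderiv.
have L1g i: L2 (fun x=>pderiv i phi1 x-g i x) by apply: L2B => //; exact/sm_L2/sm_pderiv.
exists (T phi); first exact: TT.
have Lip2 x: `|b (phi x+a x)-b (u x+a x)| <= B1 * `|phi x-u x|.
 by apply: (le_trans (Lip _ _)); rewrite (_:_ - _ = phi x-u x)//; ring.
split=> [|i].
 apply: (@le_lt_trans _ _ (c1 * n2 (fun x=>phi x-u x)+c2 * n2 (fun x=>phi x-u x)+c3*0)).
  rewrite mulr0 addr0.
  have := @n2_le3 (fun x=>T phi x-eta x*(b (u x+a x)-b (a x))) (fun x=>phi x-u x) (fun x=>phi x-u x) (fun x=>phi x-u x) c1 c2 0.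
  rewrite mul0r addr0; apply => // [|x Ox].
   apply: measurable_funB; first by apply: sm_meas => //; exact/tf_sm/TT.
   by apply: measurable_funM; [exact: sm_meas|exact: L2_meas Lbu].
  rewrite mul0r addr0 /T -mulrBr opprB addrA subrK normrM.
  apply: (@le_trans _ _ (M1*(B1 * `|phi x-u x|))).
   by apply: ler_pM => //; exact: HM1.
  rewrite -mulrDl mulrA ler_wpM2r// /c1 /c2.
  have : 0<=M2*B1 by rewrite mulr_ge0.
  have : 0<=M1*B2*(K+M3) by rewrite !mulr_ge0// addr_ge0.
  have : 0<=M1*B1 by rewrite mulr_ge0.
  lra.
 by apply: fin => //; rewrite ?n2_ge0// divr_gt0.
apply: (@le_lt_trans _ _ (c1 * n2 (fun x=>phi x-u x)+c2 * n2 (fun x=>pderiv i phi x-g i x) +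
  c3 * n2 (fun x=>pderiv i phi1 x-g i x))); last by apply: fin; rewrite ?n2_ge0.
apply: n2_le3 => // [|x Ox].
 apply: measurable_funB; first by apply: sm_meas => //; exact/tf_sm/tf_pderiv/TT.
 apply: measurable_funD; apply: measurable_funM.
 - by apply: sm_meas => //; exact: sm_pderiv.
 - exact: L2_meas Lbu.
 - exact: sm_meas.
 - exact: L2_meas (LG i).
rewrite dT//.
set d:=b (phi x+a x)-b (u x+a x).
set b'p:=derive1 b (phi x+a x); set b'u:=derive1 b (u x+a x).
have -> : pderiv i eta x*(b (phi x+a x)-b (a x)) +
 eta x*(b'p*(pderiv i phi x+pderiv i a x)-derive1 b (a x) * pderiv i a x) -
 (pderiv i eta x*(b (u x+a x)-b (a x)) +
 eta x*(b'u*(g i x+pderiv i a x)-derive1 b (a x) * pderiv i a x)) =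
 (pderiv i eta x * d+eta x*(b'p*(pderiv i phi x-g i x))) +
 eta x*((b'p-b'u)*(g i x-pderiv i phi1 x)+(b'p-b'u)*(pderiv i phi1 x+pderiv i a x)).
 by rewrite /d; ring.
have b'pu: `|b'p-b'u| <= B2 * `|phi x-u x|.
 by apply: (le_trans (Lip' _ _)); rewrite (_:_ - _ = phi x-u x)//; ring.
have b'pu2: `|b'p-b'u| <= 2*B1.
 by apply: (le_trans (ler_normB _ _)); have:=bB1 (phi x+a x); have:=bB1 (u x+a x); rewrite -/b'p -/b'u; lra.
have E1: `|pderiv i eta x * d| <= M2*(B1 * `|phi x-u x|).
 by rewrite normrM ler_pM//; [exact: HM2|exact: Lip2].
have E2: `|eta x*(b'p*(pderiv i phi x-g i x))| <= M1*(B1 * `|pderiv i phi x-g i x|).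
 by rewrite !normrM ler_pM ?mulr_ge0//; [exact: HM1|rewrite ler_wpM2r//; exact: bB1].
have E3: `|(b'p-b'u)*(g i x-pderiv i phi1 x)| <= 2*B1 * `|pderiv i phi1 x-g i x|.
 by rewrite normrM (distrC (g i x)) ler_wpM2r.
have E4: `|(b'p-b'u)*(pderiv i phi1 x+pderiv i a x)| <= B2 * `|phi x-u x| * (K+M3).
 rewrite normrM ler_pM//; apply: (le_trans (ler_normD _ _)).
 by rewrite lerD//; [exact: HK|exact: HM3].
have E5: `|eta x*((b'p-b'u)*(g i x-pderiv i phi1 x)+(b'p-b'u)*(pderiv i phi1 x+pderiv i a x))| <=
 M1*(2*B1 * `|pderiv i phi1 x-g i x| + B2 * `|phi x-u x| * (K+M3)).
 by rewrite normrM ler_pM//; [exact: HM1|apply: (le_trans (ler_normD _ _)); exact: lerD].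
apply: (le_trans (ler_normD _ _)).
apply: (le_trans (lerD (ler_normD _ _) (lexx _))).
apply: (le_trans (lerD (lerD E1 E2) E5)).
rewrite /c1 /c2 /c3.
have : 0<=M1*B1 * `|phi x-u x| by rewrite !mulr_ge0.
lra.
Qed.

Definition Dg g k : R:=\sum_i Int (fun x=>g i x * k i x).

Lemma DgC g k : Dg g k = Dg k g.
by apply: eq_bigr=>i _; apply: eq_Int=>x _; rewrite mulrC. Qed.

Lemma DgDl g k l (t:R) : (forall i, L2 (g i))->(forall i, L2 (k i))->(forall i, L2 (l i)) ->
 Dg (fun i x=>g i x+t * k i x) l = Dg g l+t*Dg k l.
move=> Lg Lk Ll; rewrite /Dg mulr_sumr -big_split/=; apply: eq_bigr=>i _.
rewrite -IntZ ?L2_mul// -IntD//; [|exact: L2_mul|by apply: I1Z => //; exact: L2_mul].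
by apply: eq_Int=>x _; ring.
Qed.

Lemma Dg_n2 g : Dg g g = \sum_i n2 (g i)^+2.
by apply: eq_bigr=>i _; rewrite n2_sq. Qed.

Lemma Dg_ge0 g : 0<=Dg g g.
by rewrite Dg_n2; apply: sumr_ge0=>i _; exact: sqr_ge0. Qed.

Lemma n2_le_Dg g i : n2 (g i)^+2<=Dg g g.
by rewrite Dg_n2 (bigD1 i)//= lerDl; apply: sumr_ge0=>j _; exact: sqr_ge0. Qed.

Lemma eq_Dg g k g' k' : (forall i x, O x->g i x = g' i x)->(forall i x, O x->k i x = k' i x) ->
 Dg g k = Dg g' k'.
by move=> E1 E2; apply: eq_bigr=>i _; apply: eq_Int=>x Ox; rewrite E1// E2. Qed.

(** One direction suffices: integrating by parts against the coordinate x_i0, whose derivative is 1,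
    gives Int phi^2 = -2 Int x_i0 phi D_i0 phi, and |x_i0| <= M on O. *)
Lemma poincare : (0<N)%N->exists2 C : R, 0<C & forall u g, H u g->n2 u^+2<=C*Dg g g.
move=> N0; pose i0:=Ordinal N0.
have [M M0 HM]:=sm_bounded bO (sm_coord i0:sm (fun y:rV=>y ord0 i0)).
have P phi: tf phi->n2 phi<=2*M * n2 (pderiv i0 phi).
 move=> T; have S:=tf_sm T; have L:=sm_L2 oO bO S.
 have Ld:=sm_L2 oO bO (sm_pderiv i0 S).
 have:=tf_ibp oO bO i0 (tfMr T S) (sm_coord i0).
 rewrite pderiv_coord eqxx pderivM//.
 have -> : Int (fun x=>phi x * phi x * true%:R) = n2 phi^+2.
  by rewrite n2_sq; apply: eq_Int=>x _; rewrite mulr1 expr2.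
 have -> : Int (fun y=>(phi y * pderiv i0 phi y+phi y * pderiv i0 phi y) * y ord0 i0) =
  2*Int (fun y=>phi y*(y ord0 i0 * pderiv i0 phi y)).
  rewrite -IntZ; [|by []|].
   by apply: eq_Int=>x _; ring.
  by apply: L2_mul => //; apply: L2_smM => //; exact: sm_coord.
 move=> E; have:=n2_CS oO L (L2_smM oO bO (sm_coord i0) Ld).
 have : n2 (fun x=>x ord0 i0 * pderiv i0 phi x)<=M * n2 (pderiv i0 phi).
  rewrite -[M in M * _]ger0_norm// -n2Z//; apply: n2_le => //; last first.
  - by move=> x Ox; rewrite !normrM ler_wpM2r// (le_trans (HM x Ox))// ler_norm.
  - exact: L2Z.
  - exact: L2_meas (L2_smM oO bO (sm_coord i0) Ld).
 have [->|p0]:=eqVneq (n2 phi) 0; first by rewrite !mulr_ge0 ?n2_ge0.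
 have pp: 0<n2 phi by rewrite lt_def p0 n2_ge0.
 move=> E1 E2; rewrite -(ler_pM2l pp) -expr2 E; move: E2.
 set A:=Int _; have:=ler_norm (- A); rewrite normrN.
 have:=n2_ge0 O (pderiv i0 phi); nra.
exists ((2*M+1)^+2); first by rewrite exprn_gt0// ltr_wpDl// mulr_ge0.
move=> u g [Lu Lg Hu]; suff Q : n2 u<=2*M * n2 (g i0).
 apply: (@le_trans _ _ ((2*M+1)^+2 * n2 (g i0)^+2)); last first.
  by rewrite ler_wpM2l ?sqr_ge0// n2_le_Dg.
 rewrite -exprMn lerXn2r ?nnegrE ?mulr_ge0 ?n2_ge0 ?addr_ge0 ?mulr_ge0//.
 by apply: (le_trans Q); rewrite ler_wpM2r ?n2_ge0// lerDl.
apply: (@le_small _ _ _ (1+2*M))=>e e0; have [phi T [p1 p2]]:=Hu e e0.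
have L:=tf_L2 oO bO T; have Ld:=tf_L2 oO bO (tf_pderiv i0 T).
have E1: n2 u<=n2 (fun x=>phi x-u x)+n2 phi.
 have:=n2D oO (L2B oO Lu L) L; rewrite n2_distC.
 by rewrite (@eq_n2 _ _ O (fun x=>u x-phi x+phi x) u)// => x _; rewrite subrK.
have E2: n2 (pderiv i0 phi)<=n2 (fun x=>pderiv i0 phi x-g i0 x)+n2 (g i0).
 have:=n2D oO (L2B oO Ld (Lg i0)) (Lg i0).
 by rewrite (@eq_n2 _ _ O (fun x=>pderiv i0 phi x-g i0 x+g i0 x) (pderiv i0 phi))// => x _; rewrite subrK.
have:=P phi T; have:=p2 i0; nra.
Qed.

End chain.
Notation Dg_on := Dg.

(** * Weak solutions: smooth positive part, existence and comparison *)

Section smooth_positive_part.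
Context {R : realType}.
Implicit Types (s t e:R).

Lemma expinv_bound n t : expinv n t<=n`!%:R.
rewrite /expinv; case: ifPn=>t0 //; rewrite expRN ler_pdivrMr ?expR_gt0//.
by apply: expR_geXn; rewrite invr_ge0 ltW.
Qed.

Lemma expinv_nonpos n t : t<=0->expinv n t = 0.
by rewrite /expinv ltNge => ->. Qed.

Lemma expinv_mul n t : t * expinv n.+1 t = expinv n t.
rewrite /expinv; case: ifPn=>t0; last by rewrite mulr0.
by rewrite exprS !mulrA divff ?mul1r// gt_eqF.
Qed.

(** Equal to s exp(-e/s) for s > 0: smooth and convex, with slope in [0,1], at most the positive
    part of s and at least s - e. *)
Definition pospart e s : R:=s * expinv 0 (e^-1 * s).

Lemma smooth1_pospart e : smooth1 (pospart e).
apply: smooth1M; first exact: smooth1_id.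
apply: (@smooth1_comp _ (expinv 0) (fun s=>e^-1 * s)); first exact: smooth1_expinv.
by apply: smooth1M; [exact: smooth1_cst|exact: smooth1_id].
Qed.

Lemma is_derive_scale (c s:R) : is_derive s 1 (fun r:R=>c * r) c.
have:=is_deriveZ c (is_derive_id s 1); rewrite /GRing.scale/= mulr1; exact.
Qed.

Lemma derive1_pospart e : e != 0 ->
 derive1 (pospart e) = fun s=>expinv 0 (e^-1 * s)+expinv 1 (e^-1 * s).
move=> e0; apply/funext=>s; rewrite derive1E; suff D : is_derive s 1 (pospart e) (expinv 0 (e^-1 * s)+expinv 1 (e^-1 * s)) by rewrite derive_val.
have D1:=is_derive1_comp (is_derive_expinv 0 (e^-1 * s)) (is_derive_scale e^-1 s).
have D2:=is_deriveM (is_derive_id s 1) D1.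
apply: (is_derive_eq D2); rewrite /GRing.scale/= oppr0 mul0r add0r mulr1.
by rewrite -(expinv_mul 1) addrC; ring.
Qed.

Lemma derive2_pospart e : e != 0 ->
 derive1 (derive1 (pospart e)) = fun s=>e^-1 * expinv 3 (e^-1 * s).
move=> e0; rewrite derive1_pospart//; apply/funext=>s; rewrite derive1E.
suff D : is_derive s 1 (fun s=>expinv 0 (e^-1 * s)+expinv 1 (e^-1 * s)) (e^-1 * expinv 3 (e^-1 * s)).
 by rewrite derive_val.
have D1:=is_derive1_comp (is_derive_expinv 0 (e^-1 * s)) (is_derive_scale e^-1 s).
have D2:=is_derive1_comp (is_derive_expinv 1 (e^-1 * s)) (is_derive_scale e^-1 s).
by apply: (is_derive_eq (is_deriveD D1 D2)); ring.
Qed.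

Lemma pospart_nonpos e s : 0<e->s<=0->pospart e s = 0.
by move=> e0 s0; rewrite /pospart expinv_nonpos ?mulr0// pmulr_rle0 ?invr_gt0. Qed.

Lemma pospart_ge0 e s : 0<e->0<=pospart e s.
move=> e0; have [s0|s0]:=leP s 0; first by rewrite pospart_nonpos.
by rewrite mulr_ge0 ?expinv_ge0// ltW.
Qed.

Lemma pospart_le e s : 0<e->pospart e s<=`|s|.
move=> e0; have [s0|s0]:=leP s 0; first by rewrite pospart_nonpos.
rewrite gtr0_norm// /pospart -[leRHS]mulr1 ler_wpM2l ?(ltW s0)//.
by apply: le_trans (expinv_bound 0 _) _; rewrite fact0.
Qed.

Lemma pospart_approx e s : 0<e->s<=pospart e s+e.
move=> e0; have [s0|s0]:=leP s 0.
 by rewrite pospart_nonpos// add0r (le_trans s0)// ltW.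
have es0: 0<e^-1 * s by rewrite mulr_gt0 ?invr_gt0.
rewrite /pospart /expinv es0 mul1r.
have:=expR_ge1Dx (- (e^-1 * s)^-1).
have -> : (e^-1 * s)^-1 = e/s by rewrite invfM invrK.
move: (expR _)=>E HE.
have : s*(1 + - (e/s))<=s*E by rewrite ler_wpM2l// ltW.
have -> : s*(1 + - (e/s)) = s-e by field; rewrite gt_eqF.
lra.
Qed.

Lemma dpospart_ge0 e s : 0<e->0<=derive1 (pospart e) s.
by move=> e0; rewrite derive1_pospart ?gt_eqF// addr_ge0// expinv_ge0. Qed.

Lemma dpospart_nonpos e s : 0<e->s<=0->derive1 (pospart e) s = 0.
move=> e0 s0; rewrite derive1_pospart ?gt_eqF// !expinv_nonpos ?addr0//;
by rewrite pmulr_rle0 ?invr_gt0.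
Qed.

Lemma dpospart_le1 e s : 0<e->derive1 (pospart e) s<=1.
move=> e0; rewrite derive1_pospart ?gt_eqF//; move: (e^-1 * s)=>t; rewrite /expinv.
case: ifPn=>t0; last by rewrite addr0.
rewrite expr0 expr1 -mulrDl expRN ler_pdivrMr ?expR_gt0// mul1r.
exact: expR_ge1Dx.
Qed.

Lemma dpospart_norm e s : 0<e -> `|derive1 (pospart e) s| <= 1.
by move=> e0; rewrite ger0_norm ?dpospart_le1// dpospart_ge0. Qed.

Lemma dpospart_mul e s : 0<e->derive1 (pospart e) s * s<=pospart e s+e.
move=> e0; rewrite derive1_pospart ?gt_eqF// mulrDl /pospart mulrC lerD2l.
have -> : s = e*(e^-1 * s) by field; rewrite gt_eqF.
rewrite mulrCA mulVKf ?gt_eqF// [X in e*X]mulrC expinv_mul -[leRHS]mulr1 ler_wpM2l ?(ltW e0)//.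
by apply: le_trans (expinv_bound 0 _) _; rewrite fact0.
Qed.

Lemma d2pospart_ge0 e s : 0<e->0<=derive1 (derive1 (pospart e)) s.
by move=> e0; rewrite derive2_pospart ?gt_eqF// mulr_ge0 ?expinv_ge0// invr_ge0 ltW.
Qed.

Lemma d2pospart_norm e s : 0<e -> `|derive1 (derive1 (pospart e)) s| <= e^-1*6%:R.
move=> e0; rewrite ger0_norm ?d2pospart_ge0// derive2_pospart ?gt_eqF//.
by rewrite ler_wpM2l ?invr_ge0 ?(ltW e0)//; exact: (expinv_bound 3).
Qed.

(** A third derivative appears because [H_chain] is also applied with b equal to the first
    derivative of [pospart], in [H_dpos]. *)
Lemma d3pospart_norm e : 0<e->exists B : R, forall s,
 `|derive1 (derive1 (derive1 (pospart e))) s| <= B.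
move=> e0; exists (e^-1 * e^-1*(3%:R*4`!%:R+5`!%:R))=>s.
rewrite derive2_pospart ?gt_eqF// derive1E.
have D1:=is_derive1_comp (is_derive_expinv 3 (e^-1 * s)) (is_derive_scale e^-1 s).
have D: is_derive s 1 (fun s=>e^-1 * expinv 3 (e^-1 * s))
  (e^-1*((- 3%:R * expinv 4 (e^-1 * s)+expinv 5 (e^-1 * s)) * e^-1)).
 exact: is_deriveZ.
rewrite derive_val; move: (e^-1 * s)=>t.
have ei: 0<=e^-1 by rewrite invr_ge0 ltW.
rewrite normrM (ger0_norm ei) -mulrA ler_wpM2l// mulrC normrM (ger0_norm ei) ler_wpM2l//.
have:=expinv_bound 4 t; have:=expinv_bound 5 t; have:=expinv_ge0 4 t; have:=expinv_ge0 5 t.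
move: (expinv 4 t) (expinv 5 t) (4`!%:R : R) (5`!%:R : R)=>p q A B *.
rewrite ler_norml; apply/andP; split; nra.
Qed.

End smooth_positive_part.

Section weak.
Context {R : realType} {N : nat} (O:set 'rV[R]_N).
Hypotheses (oO:open O) (bO:bounded_set O).
Notation rV := 'rV[R]_N.
Notation Int := (Int O).
Notation L2 := (L2 O).
Notation n2 := (n2 O).
Notation tf := (test_function O).
Notation H := (H O).
Notation Dg := (Dg O).
Implicit Types (f h u v w phi psi eta a:rV->R) (g k : 'I_N->rV->R).

Definition gr phi : 'I_N->rV->R:=fun i=>pderiv i phi.
Definition wsol u g f:=H u g /\ forall v k, H v k->Dg g k = Int (fun x=>f x * v x).
(** A lower bound c for the Rayleigh quotient, tested on smooth functions; [rayleigh_H] extends it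
    to H^1_0 when c >= 0. *)
Definition rayleigh (c:R):=forall phi, tf phi->c * n2 phi^+2<=Dg (gr phi) (gr phi).

Lemma tf_gr_L2 phi : tf phi->forall i, L2 (gr phi i).
by move=> T i; exact/(tf_L2 oO bO)/tf_pderiv. Qed.

Lemma HL2 u g : H u g->L2 u. Proof. by case. Qed.
Lemma HL2g u g : H u g->forall i, L2 (g i). Proof. by case. Qed.

Lemma Int_linM (a b w:rV->R) (t:R) : L2 a->L2 b->L2 w ->
 Int (fun x=>(a x+t * b x) * w x) = Int (fun x=>a x * w x)+t*Int (fun x=>b x * w x).
move=> La Lb Lw; have I2:=L2_mul oO La Lw; have I3:=L2_mul oO Lb Lw.
rewrite -(IntZ oO t I3) -(IntD oO I2 (I1Z oO t I3)).
by apply: eq_Int=>x _; ring.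
Qed.

Lemma Dg_CS g k : (forall i, L2 (g i))->(forall i, L2 (k i)) ->
 `|Dg g k| <= (\sum_i n2 (g i))*(\sum_i n2 (k i)).
move=> Lg Lk; apply: (le_trans (ler_norm_sum _ _ _)).
rewrite mulr_suml; apply: ler_sum=>i _; apply: (le_trans (n2_CS oO (Lg i) (Lk i))).
rewrite ler_wpM2l ?n2_ge0// (bigD1 i)//= lerDl; apply: sumr_ge0=>j _; exact: n2_ge0.
Qed.

Lemma DgBr g k l : (forall i, L2 (g i))->(forall i, L2 (k i))->(forall i, L2 (l i)) ->
 Dg g (fun i x=>k i x-l i x) = Dg g k-Dg g l.
move=> Lg Lk Ll; rewrite (DgC O g l) (DgC O g k) (DgC O g) -mulN1r -DgDl//.
by apply: eq_Dg => // i x _; rewrite mulN1r.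
Qed.

Lemma DgBl g k l : (forall i, L2 (g i))->(forall i, L2 (k i))->(forall i, L2 (l i)) ->
 Dg (fun i x=>k i x-l i x) g = Dg k g-Dg l g.
by move=> *; rewrite (DgC O _ g) DgBr// !(DgC O g). Qed.

Lemma wsol_tf u g f : H u g->L2 f ->
 (forall psi, tf psi->Dg g (gr psi) = Int (fun x=>f x * psi x))->wsol u g f.
move=> Hu Lf E; split => // v k [Lv Lk Hv]; have [Lu Lg _]:=Hu.
apply/eqP; rewrite -subr_eq0; apply/eqP.
apply: (@eq0_small _ _ ((\sum_i n2 (g i))*N%:R+n2 f))=>e e0.
have [phi T [p1 p2]]:=Hv e e0; have Lp:=tf_L2 oO bO T; have Lgp:=tf_gr_L2 T.
have -> : Dg g k-Int (fun x=>f x * v x) =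
 Int (fun x=>f x*(phi x-v x))-Dg g (fun i x=>gr phi i x-k i x).
 rewrite DgBr// E//; under [X in _ = X - _]eq_Int do rewrite mulrBr.
 by rewrite IntB//; [ring|exact: L2_mul|exact: L2_mul].
apply: (le_trans (ler_normB _ _)); rewrite addrC mulrDl; apply: lerD.
 have Ld i: L2 (fun x=>gr phi i x-k i x) by apply: L2B => //; exact: Lgp.
 apply: (le_trans (Dg_CS Lg Ld)); rewrite -mulrA ler_wpM2l//.
  by apply: sumr_ge0=>i _; exact: n2_ge0.
 apply: (@le_trans _ _ (\sum_(i<N) e)); first by apply: ler_sum=>i _; exact/ltW/p2.
 by rewrite sumr_const card_ord mulr_natl.
apply: (le_trans (n2_CS oO Lf (L2B oO Lp Lv))); rewrite ler_wpM2l ?n2_ge0//; exact: ltW.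
Qed.

Lemma H_complete (v:nat->rV->R) (g:nat -> 'I_N->rV->R) : (forall k:nat, H (v k) (g k)) ->
 (forall e:R, 0<e->exists K, forall k l : nat, (K<=k)%N->(K<=l)%N ->
  n2 (fun x=>v k x-v l x)<=e /\ forall i, n2 (fun x=>g k i x-g l i x)<=e) ->
 exists u gu, H u gu /\ forall e : R, 0<e->exists K, forall k : nat, (K<=k)%N ->
  n2 (fun x=>v k x-u x)<=e /\ forall i, n2 (fun x=>g k i x-gu i x)<=e.
move=> Hv C.
have Lv (k:nat) : L2 (v k):=HL2 (Hv k); have Lgk (k:nat) i : L2 (g k i):=HL2g (Hv k) i.
have [u Lu Hu]:=L2_complete oO bO Lv (fun e e0=>let: ex_intro K HK:=C e e0 in
 ex_intro _ K (fun j j' Kk Kl=>(HK j j' Kk Kl).1)).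
have /choice[gu Hg] : forall i, exists gi, L2 gi /\ forall e : R, 0<e->exists M, forall j : nat, (M<=j)%N ->
  n2 (fun x=>g j i x-gi x)<=e.
 move=> i; have [gi Li Hi]:=L2_complete oO bO (fun j:nat=>Lgk j i) (fun e e0=>let: ex_intro K HK:=C e e0 in
 ex_intro _ K (fun j j' Kk Kl=>(HK j j' Kk Kl).2 i)).
 by exists gi.
have Lg i: L2 (gu i) by have []:=Hg i.
have close (e:R) : 0<e->exists M, forall j : nat, (M<=j)%N ->
  n2 (fun x=>v j x-u x)<=e /\ forall i, n2 (fun x=>g j i x-gu i x)<=e.
 move=> e0; have [M0 HM0]:=Hu e e0.
 have /choice[M HM] : forall i, exists M, forall j : nat, (M<=j)%N->n2 (fun x=>g j i x-gu i x)<=e.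
  by move=> i; exact: (Hg i).2.
 exists (M0 + \sum_i M i)%N=>j Mj; split; first by apply: HM0; apply: leq_trans Mj; exact: leq_addr.
 by move=> i; apply: HM; apply: leq_trans Mj; rewrite (bigD1 i)//= addnCA leq_addr.
exists u, gu; split=> //; split=> // e e0.
have e2: 0<e/2 by lra.
have [M HM]:=close (e/2) e2; have [q1 q2]:=HM M (leqnn M).
have [_ _ /(_ _ e2)[phi T [p1 p2]]]:=Hv M.
have Lp:=tf_L2 oO bO T; have Lgp:=tf_gr_L2 T.
exists phi => //; split=> [|i].
 by have:=n2_tri oO Lp (Lv M) Lu; lra.
by have:=n2_tri oO (Lgp i) (Lgk M i) (Lg i); have:=q2 i; have:=p2 i; rewrite /gr; lra.
Qed.

(** Direct method over test functions: the energy J is bounded below because c lies below the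
    Rayleigh constant c', a minimising sequence is Cauchy by the parallelogram identity, and its
    limit inherits the Euler equation. *)
Lemma exists_wsol (c c':R) f : (0<N)%N->0<c'->c<c'->rayleigh c'->L2 f ->
 exists u g, wsol u g (fun x=>c * u x+f x).
move=> N0 c'0 cc' Rc Lf.
have [C C0 HC]:=poincare oO bO N0.
pose E phi psi:=Dg (gr phi) (gr psi)-c*Int (fun x=>phi x * psi x).
have [th th0 coer] : exists2 th : R, 0<th & forall phi, tf phi->th*Dg (gr phi) (gr phi)<=E phi phi.
 (* Coercivity constant: a negative c only helps, and a positive one costs at most the fraction c/c'
    of the Dirichlet integral. *)
 exists (1-Num.max c 0/c').
  by rewrite subr_gt0 ltr_pdivrMr// mul1r gt_max cc'.
 move=> phi T; rewrite /E.
 have -> : Int (fun x=>phi x * phi x) = n2 phi^+2.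
  by rewrite n2_sq; apply: eq_Int=>x _; rewrite expr2.
 rewrite mulrBl mul1r lerD2l lerN2 mulrAC.
 have [c0|c0]:=leP c 0.
  by rewrite mul0r mul0r (le_trans _ (lexx 0))// mulr_le0_ge0// sqr_ge0.
 by rewrite ler_pdivlMr// -mulrA ler_wpM2l ?(ltW c0)// mulrC Rc.
pose l phi:=Int (fun x=>f x * phi x).
pose J phi:=E phi phi-2 * l phi.
pose lin phi psi (t:R) x:=phi x+t * psi x.
have Tlin phi psi t: tf phi->tf psi->tf (lin phi psi t) by move=> *; apply: tfD => //; exact: tfZ.
have grlin phi psi t i x: tf phi->tf psi->gr (lin phi psi t) i x = gr phi i x+t * gr psi i x.
 move=> /tf_sm S1 /tf_sm S2; rewrite /gr pderivD//; last exact: smZ.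
 by rewrite pderivZ.
have ELr phi psi chi t: tf phi->tf psi->tf chi->E (lin phi psi t) chi = E phi chi+t*E psi chi.
 move=> T1 T2 T3; rewrite /E.
 have -> : Dg (gr (lin phi psi t)) (gr chi) = Dg (gr phi) (gr chi)+t*Dg (gr psi) (gr chi).
  rewrite -DgDl//; try exact: tf_gr_L2.
  by apply: eq_Dg => // i x _; exact: grlin.
 have -> : Int (fun x=>lin phi psi t x * chi x) = Int (fun x=>phi x * chi x)+t*Int (fun x=>psi x * chi x).
  have L1:=tf_L2 oO bO T1; have L2':=tf_L2 oO bO T2; have L3:=tf_L2 oO bO T3.
  exact: Int_linM.
 move: (Dg (gr phi) _) (Dg (gr psi) _) (Int (fun x=>phi x * chi x)) (Int (fun x=>psi x * chi x))=>a1 a2 a3 a4; ring.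
have EC phi psi: E phi psi = E psi phi.
 by rewrite /E DgC; congr (_ - _ * _); apply: eq_Int=>x _; rewrite mulrC.
have llin phi psi t: tf phi->tf psi->l (lin phi psi t) = l phi+t * l psi.
 move=> /(tf_L2 oO bO) L1 /(tf_L2 oO bO) L2'.
 have E0 h: Int (fun x=>f x * h x) = Int (fun x=>h x * f x) by apply: eq_Int=>x _; rewrite mulrC.
 rewrite /l !E0; exact: Int_linM.
have Jlin phi psi t: tf phi->tf psi->J (lin phi psi t) = J phi+2 * t*(E phi psi-l psi)+t^+2*E psi psi.
 move=> T1 T2; rewrite /J llin// ELr//; last exact: Tlin.
 by rewrite !(EC _ (lin _ _ _)) !ELr// (EC psi phi); ring.
have l_le phi: tf phi -> `|l phi| ^+ 2<=n2 f^+2*C*Dg (gr phi) (gr phi).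
 move=> T; have:=n2_CS oO Lf (tf_L2 oO bO T); have:=HC _ _ (H_tf oO bO T).
 rewrite -/(gr phi) -/(l phi)=>P1 P2.
 apply: (@le_trans _ _ ((n2 f * n2 phi)^+2)); first by rewrite lerXn2r ?nnegrE ?mulr_ge0 ?n2_ge0.
 by rewrite exprMn -mulrA ler_wpM2l ?sqr_ge0.
pose K:=n2 f^+2*C.
have K0: 0<=K by pos.
have J_ge phi: tf phi -> - (K/th)<=J phi.
 move=> T; have:=coer phi T; have:=l_le phi T; rewrite -/K /J.
 have:=ler_norm (l phi); move: (normr_ge0 (l phi)); have:=Dg_ge0 O (gr phi).
 move: (E phi phi) (l phi) (`|l phi|) (Dg _ _)=>e a b d d0 b0 ab bd ed.
 rewrite -lerBlDr opprK; have Kt: K/th * th = K by field; rewrite gt_eqF.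
 have Kt0: 0<=K/th by pos.
 have : 0<=(th * d-b)^+2 by exact: sqr_ge0.
 have S: 2 * b<=th * d+K/th.
  move: (K/th) Kt Kt0=>z Kt Kt0.
  have td: 0<=th * d by pos.
  rewrite -(@ler_pXn2r _ 2) ?nnegrE//; [|by lra|by lra].
  have : 0<=(th * d-z)^+2 by exact: sqr_ge0.
  have -> : (th * d-z)^+2 = (th * d+z)^+2-4*(z * th) * d by ring.
  by rewrite Kt exprMn; move: (_+z) => ?; lra.
 lra.
pose SJ := [set J phi | phi in tf].
have hI: has_inf SJ.
 split; first by exists (J (fun=> 0)); exists (fun=> 0) => //; exact: tf0.
 by exists (- (K/th))=>_ [phi T <-]; exact: J_ge.
pose m:=inf SJ.
have m_le phi: tf phi->m<=J phi by move=> T; apply: ge_inf; [exact: hI.2|exists phi].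
have pos (j:nat) : 0<j.+1%:R^-1 :> R by rewrite invr_gt0.
have /choice[phi Hphi] : forall j : nat, exists phi, tf phi /\ J phi<m+j.+1%:R^-1.
 move=> j; have [_ [phi T <-] Jm]:=inf_adherent (pos j) hI.
 by exists phi.
have Tphi j: tf (phi j) by have []:=Hphi j.
have small (e:R) : 0<e->exists M, forall j : nat, (M<=j)%N->j.+1%:R^-1<e.
 move=> e0; have [M] := @ltr_add_invr R 0 e e0; rewrite add0r=>HM.
 exists M=>j Mj; apply: le_lt_trans HM; rewrite lef_pV2 ?posrE// ler_nat; exact: Mj.
have Cauchy j j': th*Dg (fun i x=>gr (phi j) i x-gr (phi j') i x) (fun i x=>gr (phi j) i x-gr (phi j') i x)
  <= 2*(j.+1%:R^-1+j'.+1%:R^-1).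
 have [T1 J1]:=Hphi j; have [T2 J2]:=Hphi j'.
 have:=coer _ (Tlin _ _ (-1) T1 T2).
 have -> : Dg (gr (lin (phi j) (phi j') (-1))) (gr (lin (phi j) (phi j') (-1))) =
   Dg (fun i x=>gr (phi j) i x-gr (phi j') i x) (fun i x=>gr (phi j) i x-gr (phi j') i x).
  by apply: eq_Dg=>i x _; rewrite grlin// mulN1r.
 move=> A1; apply: (le_trans A1).
 (* The function tested here is the midpoint of phi j and phi j'; comparing its energy with the
    infimum is the parallelogram argument. *)
 have h: m<=J (lin (phi j) (lin (phi j') (phi j) (-1)) 2^-1) by exact: (m_le _ (Tlin _ _ _ T1 (Tlin _ _ _ T2 T1))).
 move: h; rewrite Jlin//; last exact: Tlin.
 rewrite !(EC _ (lin _ _ _)) !ELr//; try exact: Tlin.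
 rewrite llin// !(EC _ (lin _ _ _)) !ELr//.
 rewrite (EC (phi j') (phi j)); move: J1 J2; rewrite /J.
 move: (E (phi j) (phi j)) (E (phi j) (phi j')) (E (phi j') (phi j')) (l (phi j)) (l (phi j')) (j.+1%:R^-1) (j'.+1%:R^-1)=>a1 a2 a3 a4 a5 a6 a7.
 rewrite divff// (_:2^-1^+2 = 4^-1 :> R); [lra|by field].
have grC (e:R) : 0<e->exists M, forall j j', (M<=j)%N->(M<=j')%N->forall i,
  n2 (fun x=>gr (phi j) i x-gr (phi j') i x)<=e.
 move=> e0; have [|M HM]:=small (th * e^+2/4); first by rewrite divr_gt0// mulr_gt0// exprn_gt0.
 exists M=>j j' /HM Hj /HM Hj' i; rewrite -(@ler_pXn2r _ 2) ?nnegrE ?n2_ge0 ?(ltW e0)//.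
 rewrite -(ler_pM2l th0); apply: le_trans (le_trans (Cauchy j j') _).
  rewrite ler_pM2l//; pose kk i x:=gr (phi j) i x-gr (phi j') i x.
  exact: (n2_le_Dg O kk i).
 move: Hj Hj'; move: (j.+1%:R^-1) (j'.+1%:R^-1)=>a6 a7; lra.
have phiC (e:R) : 0<e->exists M, forall j j', (M<=j)%N->(M<=j')%N ->
  n2 (fun x=>phi j x-phi j' x)<=e.
 move=> e0; have [|M HM]:=small (th * e^+2/(4*C)); first by rewrite divr_gt0 ?mulr_gt0// exprn_gt0.
 exists M=>j j' /HM Hj /HM Hj'; rewrite -(@ler_pXn2r _ 2) ?nnegrE ?n2_ge0 ?(ltW e0)//.
 have:=HC _ _ (HB oO bO (H_tf oO bO (Tphi j)) (H_tf oO bO (Tphi j'))); rewrite -/(gr _) -/(gr _)=>P.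
 apply: (le_trans P); have CP:=Cauchy j j'.
 move: Hj Hj'; rewrite !ltr_pdivlMr ?mulr_gt0// => Hj Hj'.
 rewrite -(ler_pM2l th0); apply: (@le_trans _ _ (C*(2*(j.+1%:R^-1+j'.+1%:R^-1)))).
  by rewrite mulrCA ler_wpM2l// ltW.
 move: Hj Hj'; move: (j.+1%:R^-1) (j'.+1%:R^-1)=>a6 a7; lra.
have [|u [g [HH close]]] := @H_complete phi (fun j=>gr (phi j)) (fun j=>H_tf oO bO (Tphi j)).
 move=> e e0; have [M h]:=phiC e e0; have [M' h']:=grC e e0.
 exists (M+M')%N=>j j' Mj Mj'; split; [apply: h|apply: h'].
 - exact: leq_trans (leq_addr _ _) Mj.
 - exact: leq_trans (leq_addr _ _) Mj'.
 - exact: leq_trans (leq_addl _ _) Mj.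
 - exact: leq_trans (leq_addl _ _) Mj'.
have [Lu Lg _]:=HH.
exists u, g; apply: wsol_tf => //.
 by apply: L2D => //; exact: L2Z.
move=> psi T; have Lpsi:=tf_L2 oO bO T; have Lgpsi:=tf_gr_L2 T.
have -> : Int (fun x=>(c * u x+f x) * psi x) = c*Int (fun x=>u x * psi x)+l psi.
 rewrite addrC /l -(Int_linM c Lf Lu Lpsi).
 by apply: eq_Int=>x _; ring.
apply/eqP; rewrite -subr_eq0 opprD addrA; apply/eqP.
(* The perturbation used is -A/Ep times psi, where A is half the derivative of J in direction psi;
   the added 1 keeps the quotient defined when E psi psi = 0. *)
pose Ep:=E psi psi+1.
have Ep1: 1<=Ep.
 by rewrite lerDr; apply: le_trans (coer psi T); rewrite mulr_ge0 ?(ltW th0)// Dg_ge0.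
have EL j: `|E (phi j) psi-l psi| ^+ 2<=Ep * j.+1%:R^-1.
 have [Tj Jj]:=Hphi j; set A:=E (phi j) psi-l psi.
 have:=m_le _ (Tlin _ _ (- (A/Ep)) Tj T); rewrite Jlin// -/A=>M1.
 have Epp: 0<Ep by apply: lt_le_trans Ep1.
 rewrite real_normK ?num_real//.
 have : 2*(A/Ep)*A-(A/Ep)^+2*E psi psi<=j.+1%:R^-1.
  move: M1 Jj; rewrite sqrrN; move: (J (phi j)) (A/Ep) (E psi psi) (j.+1%:R^-1)=>a1 a2 a3 a4; lra.
 rewrite (_:E psi psi = Ep-1); last by rewrite /Ep; ring.
 have -> : 2*(A/Ep)*A-(A/Ep)^+2*(Ep-1) = A^+2/Ep+(A/Ep)^+2.
  by field; rewrite gt_eqF.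
 have:=sqr_ge0 (A/Ep)=>S1 S2.
 have : A^+2/Ep<=j.+1%:R^-1 by apply: le_trans S2; rewrite lerDl.
 by rewrite ler_pdivrMr// mulrC.
apply: (@eq0_small _ _ (1+((\sum_i n2 (gr psi i))*N%:R + `|c| * n2 psi)))=>e e0.
have [M HM]:=close e e0.
have [M' HM']:=small (e^+2/Ep) (divr_gt0 (exprn_gt0 2 e0) (lt_le_trans ltr01 Ep1)).
pose j:=(M+M')%N; have [q1 q2]:=HM j (leq_addr _ _).
have Lj:=tf_L2 oO bO (Tphi j); have Lgj:=tf_gr_L2 (Tphi j).
have -> : Dg g (gr psi)-c*Int (fun x=>u x * psi x)-l psi =
 (E (phi j) psi-l psi)-(Dg (fun i x=>gr (phi j) i x-g i x) (gr psi)-c*Int (fun x=>(phi j x-u x) * psi x)).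
 rewrite /E DgBl//; under [X in _ = _-(_ - _*X)]eq_Int do rewrite mulrBl.
 by rewrite IntB ?L2_mul//; ring.
apply: (le_trans (ler_normB _ _)); rewrite mulrDl mul1r; apply: lerD.
 rewrite -(@ler_pXn2r _ 2) ?nnegrE ?(ltW e0)//; apply: (le_trans (EL j)).
 have:=HM' j (leq_addl _ _); rewrite ltr_pdivlMr ?(lt_le_trans ltr01 Ep1)// mulrC; exact: ltW.
apply: (le_trans (ler_normB _ _)); rewrite mulrDl; apply: lerD.
 rewrite DgC; have Ld i: L2 (fun x=>gr (phi j) i x-g i x) by apply: L2B => //; exact: Lgj.
 apply: (le_trans (Dg_CS Lgpsi Ld)); rewrite -mulrA ler_wpM2l//.
  by apply: sumr_ge0=>i _; exact: n2_ge0.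
 apply: (@le_trans _ _ (\sum_(i<N) e)); first by apply: ler_sum=>i _; exact: q2.
 by rewrite sumr_const card_ord mulr_natl.
rewrite normrM -mulrA ler_wpM2l//; apply: (le_trans (n2_CS oO (L2B oO Lj Lu) Lpsi)).
by rewrite mulrC ler_wpM2l ?n2_ge0.
Qed.

Lemma rayleigh_H (c:R) u g : 0<=c->rayleigh c->H u g->c * n2 u^+2<=Dg g g.
move=> c0 Rc [Lu Lg Hu].
pose S:=\sum_i n2 (g i).
have S0: 0<=S by apply: sumr_ge0=>i _; exact: n2_ge0.
apply: (@le_small _ _ _ (2 * c * n2 u+2 * c+(2*S*N%:R+N%:R*N%:R)*1))=>e e0.
pose d:=Num.min e 1; have d0: 0<d by rewrite lt_min e0 ltr01.
have de: d<=e by rewrite ge_min lexx. have d1: d<=1 by rewrite ge_min lexx orbT.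
have [phi T [p1 p2]]:=Hu d d0; have L:=tf_L2 oO bO T; have Ld:=tf_gr_L2 T.
have A1: n2 u<=n2 phi+d.
 have:=n2D oO (L2B oO Lu L) L; rewrite n2_distC (@eq_n2 _ _ O (fun x=>u x-phi x+phi x) u); first by lra.
 by move=> x _; rewrite subrK.
have A2: n2 phi<=n2 u+d.
 have:=n2D oO (L2B oO L Lu) Lu; rewrite (@eq_n2 _ _ O (fun x=>phi x-u x+u x) phi); first by lra.
 by move=> x _; rewrite subrK.
have A3: n2 u^+2<=n2 phi^+2+(2 * n2 u+2) * e.
 have u0:=n2_ge0 O u; have p0:=n2_ge0 O phi.
 have : n2 u^+2<=(n2 phi+d)^+2 by rewrite lerXn2r ?nnegrE ?addr_ge0 ?(ltW d0).
 by nra.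
pose k i x:=gr phi i x-g i x.
have Lk i: L2 (k i) by apply: L2B => //; exact: Ld.
have Sk: \sum_i n2 (k i)<=N%:R * d.
 apply: (@le_trans _ _ (\sum_(i<N) d)); first by apply: ler_sum=>i _; exact: ltW (p2 i).
 by rewrite sumr_const card_ord mulr_natl.
have Sk0: 0 <= \sum_i n2 (k i) by apply: sumr_ge0=>i _; exact: n2_ge0.
have B1: Dg (gr phi) (gr phi) = Dg g g+2*Dg k g+Dg k k.
 have -> : Dg (gr phi) (gr phi) = Dg (fun i x=>g i x+1 * k i x) (fun i x=>g i x+1 * k i x).
  by apply: eq_Dg=>i x _; rewrite /k; ring.
 have Lgk i: L2 (fun x=>g i x+1 * k i x) by apply: L2D => //; exact: L2Z.
 by rewrite DgDl// (DgC O g) (DgC O k) !DgDl// (DgC O g k); ring.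
have B2:=Dg_CS Lk Lg; have B3:=Dg_CS Lk Lk.
have B4:=ler_norm (Dg k g); have B5:=ler_norm (Dg k k).
have RT:=Rc phi T.
have B6: Dg (gr phi) (gr phi)<=Dg g g+(2*S*N%:R+N%:R*N%:R) * e.
 have N0: 0<=N%:R :> R by [].
 have X1: (\sum_i n2 (k i))*S<=N%:R * d*S by rewrite ler_wpM2r.
 have X2: (\sum_i n2 (k i))*(\sum_i n2 (k i))<=(N%:R * d)*(N%:R * d).
  by rewrite ler_pM.
 have X3: N%:R * d*(N%:R * d)<=N%:R*N%:R * d.
  rewrite mulrACA ler_wpM2l ?mulr_ge0//; exact: ler_piMr (ltW d0) d1.
 have X4: N%:R*N%:R * d<=N%:R*N%:R * e by rewrite ler_wpM2l.
 have X5: N%:R * d*S<=S*N%:R * e by rewrite mulrC mulrA ler_wpM2l ?mulr_ge0.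
 rewrite B1 -/S in B2 *; lra.
have cA: c * n2 u^+2<=c*(n2 phi^+2+(2 * n2 u+2) * e) by rewrite ler_wpM2l.
lra.
Qed.

(** [H_chain] only controls b(u + a) - b(a). This condition says that the positive part of the
    barrier a has zero boundary values by itself, as when a <= 0 on O or when it is supported in a
    compact subset of O. *)
Definition okbar a:=forall e : R, 0<e ->
 H (fun x=>pospart e (a x)) (fun i x=>derive1 (pospart e) (a x) * pderiv i a x).

Lemma okbar_le0 u g a : H u g->(forall x, O x->a x<=0)->okbar a.
move=> Hu a0 e e0; refine (H_eq oO bO (HZ oO bO 0 Hu) _ _)=>[x Ox|i x Ox].
 by rewrite mul0r pospart_nonpos// a0.
by rewrite mul0r dpospart_nonpos ?mul0r// a0.
Qed.

Lemma H_pospart (e:R) u g a : 0<e->H u g->sm a->okbar a ->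
 H (fun x=>pospart e (u x+a x)) (fun i x=>derive1 (pospart e) (u x+a x)*(g i x+pderiv i a x)).
move=> e0 Hu Sa Ha.
have:=H_chain oO bO Hu Sa (sm_cst 1) (smooth1_pospart e) (fun s=>dpospart_norm s e0) (fun s=>d2pospart_norm s e0).
move=> HH; refine (H_eq oO bO (HD oO bO HH (Ha e e0)) _ _)=>[x Ox|i x Ox].
 by rewrite mul1r subrK.
by rewrite pderiv_cst mul0r add0r mul1r subrK.
Qed.

(** Weak maximum principle. The smooth positive part T of w = u + a satisfies c' |T|^2 <= max(c,0)
    (|T|^2 + e Int T); since c < c', its norm is O(e), and e -> 0 shows that the true positive part
    is zero. *)
Lemma comparison (c c':R) u g a : 0<c'->c<c'->rayleigh c'->H u g->sm a ->
 okbar a ->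
 (forall e:R, 0<e->Dg (fun i x=>g i x+pderiv i a x)
   (fun i x=>derive1 (pospart e) (u x+a x)*(g i x+pderiv i a x)) <=
  c*Int (fun x=>(u x+a x) * pospart e (u x+a x))) ->
 ae_in O (fun x=>u x+a x<=0).
move=> c'0 cc' Rc Hu Sa a0 D.
have [Lu Lg _]:=Hu; pose w x:=u x+a x.
have Lw: L2 w by apply: L2D => //; exact: sm_L2.
pose cp:=Num.max c 0; have cp0: 0<=cp by rewrite le_max lexx orbT.
have cpc': cp<c' by rewrite gt_max cc'.
pose M:=Num.sqrt (vol O)*(cp/(c'-cp)+1).
have Lb (e:R) : 0<e->L2 (fun x=>pospart e (w x)) by move=> e0; case: (H_pospart e0 Hu Sa a0).
have B (e:R) : 0<e->n2 (fun x=>pospart e (w x))<=cp * e*Num.sqrt (vol O)/(c'-cp).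
 move=> e0; have HT:=H_pospart e0 Hu Sa a0; have [LT LgT _]:=HT.
 set T:=fun x=>pospart e (w x); set k:=fun i x=>derive1 (pospart e) (w x)*(g i x+pderiv i a x).
 have E1: Dg k k<=Dg (fun i x=>g i x+pderiv i a x) k.
  apply: ler_sum=>i _; apply: Int_le => //; first exact: L2_mul (LgT i) (LgT i).
   by apply: L2_mul => //; [apply: L2D => //; exact/sm_L2/sm_pderiv|exact: LgT].
  move=> x Ox; rewrite /k; have:=dpospart_ge0 (w x) e0; have:=dpospart_le1 (w x) e0.
  move: (derive1 _ _) (g i x + _)=>p q p1 p0.
  have -> : q*(p * q) = p * q*(p * q)+q^+2*(p*(1-p)) by ring.
  by rewrite lerDl mulr_ge0 ?sqr_ge0// mulr_ge0// subr_ge0.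
 have E2:=rayleigh_H (ltW c'0) Rc HT; have E3:=D e e0.
 have E4: c*Int (fun x=>w x*T x)<=cp*(n2 T^+2+e*Int T).
  apply: (@le_trans _ _ (cp*Int (fun x=>w x*T x))).
   rewrite ler_wpM2r ?le_max ?lexx//; apply: Int_ge0=>x Ox.
   rewrite /T; have [w0|w0]:=leP (w x) 0; first by rewrite pospart_nonpos ?mulr0.
   by rewrite mulr_ge0 ?pospart_ge0// ltW.
  rewrite ler_wpM2l// n2_sq -IntZ ?L2_I1// -IntD//; [|exact: LT.2|by apply: I1Z => //; exact: L2_I1].
  apply: Int_le => //; [exact: L2_mul|by apply: I1D => //; [exact: LT.2|apply: I1Z => //; exact: L2_I1]|].
  move=> x Ox; have:=pospart_approx (w x) e0; have:=pospart_ge0 (w x) e0.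
  by rewrite -/(T x); move: (T x) (w x)=>p q; nra.
 have E5:=Int_n2 oO bO LT; have E6:=ler_norm (Int T).
 rewrite -/T ler_pdivlMr ?subr_gt0//.
 have [n0|n0]:=eqVneq (n2 T) 0.
  by rewrite n0 mul0r !mulr_ge0 ?sqrtr_ge0// ltW.
 have np: 0<n2 T by rewrite lt_def n0 n2_ge0.
 rewrite -(ler_pM2l np); move: E1 E2 E3 E4 E5 E6; rewrite -/w -/k -/T.
 have S0:=sqrtr_ge0 (vol O); move: (Num.sqrt (vol O)) S0=>S S0.
 move: (Dg k k) (Dg _ k) (Int (fun x=>w x*T x)) (Int T) (`|Int T|) (n2 T) np=>d1 d2 i1 i2 i3 n np E1 E2 E3 E4 E5 E6.
 have : (c'-cp) * n^+2<=cp * e * i2 by lra.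
 have : cp * e * i2<=cp * e*(n*S) by rewrite ler_wpM2l ?mulr_ge0 ?(ltW e0)//; lra.
 lra.
have wp (e:R) : 0<e->n2 (fun x=>Num.max (w x) 0)<=M * e.
 move=> e0; have Le:=Lb e e0; have Lc:=L2_cst oO bO e.
 apply: (@le_trans _ _ (n2 (fun x=>pospart e (w x)+e))).
  apply: n2_le => //; first by apply: measurable_maxr => //; exact: L2_meas Lw.
   exact: L2D.
  move=> x Ox; have:=pospart_approx (w x) e0; have:=pospart_ge0 (w x) e0=>p1 p2.
  rewrite ger0_norm; last by rewrite le_max lexx orbT.
  by apply: le_trans (ler_norm _); rewrite ge_max p2 addr_ge0// ltW.
 apply: (le_trans (n2D oO Le Lc)).
 have -> : n2 (fun=> e) = e*Num.sqrt (vol O).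
  by rewrite /n2_on Int_cst// sqrtrM ?sqr_ge0// sqrtr_sqr gtr0_norm.
 have:=B e e0; rewrite /M.
 have -> : cp * e*Num.sqrt (vol O)/(c'-cp) = cp/(c'-cp)*(e*Num.sqrt (vol O)) by ring.
 move=> H1; apply: (le_trans (lerD H1 (lexx _))); rewrite le_eqVlt; apply/orP; left; apply/eqP; ring.
have Lwp: L2 (fun x=>Num.max (w x) 0).
 apply: (L2_le oO _ Lw); first by apply: measurable_maxr => //; exact: L2_meas Lw.
 by move=> x _; case: (leP (w x) 0) => // _; rewrite normr0.
have w0: n2 (fun x=>Num.max (w x) 0) = 0.
 by apply: (@eq0_small _ _ M)=>e e0; rewrite ger0_norm ?n2_ge0//; exact: wp.
have:=n2_ae0 oO Lwp w0; apply: ae_in_impl=>x _ mx; rewrite -/(w x) -mx le_max lexx//.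
Qed.

Lemma wsol_comparison (c c':R) u g v k f h : 0<c'->c<c'->rayleigh c' ->
 L2 f->L2 h ->
 wsol u g (fun x=>c * u x+f x)->wsol v k (fun x=>c * v x+h x) ->
 ae_in O (fun x=>f x<=h x)->ae_in O (fun x=>u x<=v x).
move=> c'0 cc' Rc Lf Lh [Hu Su] [Hv Sv] fh.
have Hw:=HB oO bO Hu Hv; have [Lu Lg _]:=Hu; have [Lv Lk _]:=Hv.
have:=comparison c'0 cc' Rc Hw (sm_cst 0).
have ok := @okbar_le0 _ _ (fun=> 0) Hw (fun _ _=>lexx 0).
move=> /(_ ok) Q; have:=Q _; move=> {}Q.
suff : ae_in O (fun x=>u x-v x+0<=0).
 by apply: ae_in_impl=>x _; rewrite addr0 subr_le0.
apply: Q=>e e0; have HT:=H_pospart e0 Hw (sm_cst 0) ok.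
have [LT LgT _]:=HT.
set T:=(fun x=>pospart e _) in HT LT *.
set kT:=(fun i x=>derive1 (pospart e) _ * _) in HT LgT *.
have -> : Dg (fun i x=>g i x-k i x+pderiv i (fun=> 0) x) kT = Dg g kT-Dg k kT.
 rewrite -DgBl//; apply: eq_Dg => // i x _; by rewrite pderiv_cst addr0.
rewrite (Su _ _ HT) (Sv _ _ HT) -IntB//; last 2 first.
- by apply: L2_mul => //; apply: L2D => //; exact: L2Z.
- by apply: L2_mul => //; apply: L2D => //; exact: L2Z.
rewrite -IntZ//; last by apply: L2_mul => //; apply: L2D => //; [exact: L2B|exact: L2_cst].
apply: Int_ae_le => //.
- by apply: I1B => //; apply: L2_mul => //; apply: L2D => //; exact: L2Z.
- by apply: I1Z => //; apply: L2_mul => //; apply: L2D => //; [exact: L2B|exact: L2_cst].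
move: fh; apply: ae_in_impl=>x _ fh; have:=pospart_ge0 (u x-v x+0) e0.
by rewrite -/(T x); move: (T x)=>t t0; nra.
Qed.

End weak.

(** * Radial kernels, convolution and mollification *)

Section profiles.
Context {R : realType}.
Implicit Types (Q:R->R) (s t:R).

(** The argument s stands for |z|^2/t^2: a profile gives a kernel supported in the ball of radius t
    and smooth at its centre, without square roots. *)
Definition prof Q:=smooth1 Q /\ forall s, 1<=s->Q s = 0.

Lemma prof_derive Q : prof Q->prof (derive1 Q).
move=> [S Q0]; have [S' D]:=smooth1_derive1 S; split=> // s s1.
have /is_derive1P/(_ _ _) D':=D s.
apply: (@eq0_small _ _ 1)=>e e0; have [r r0 Hr]:=D' e e0.
have:=Hr (r/2); rewrite !Q0 ?lerDl ?subrr ?sub0r ?normrN//; last first.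
 by apply: (le_trans s1); rewrite lerDl divr_ge0// ltW.
have r2: 0<r/2 by rewrite divr_gt0.
rewrite gtr0_norm// => /(_ _); rewrite ltr_pdivrMr// => H1.
have : `|derive1 Q s*(r/2)| <= e*(r/2) by apply: H1; lra.
by rewrite normrM (gtr0_norm r2) ler_pM2r// mul1r.
Qed.

Lemma profM (b:R->R) Q : smooth1 b->prof Q->prof (fun s=>b s*Q s).
by move=> Sb [S Q0]; split=> [|s /Q0 ->]; [exact: smooth1M|rewrite mulr0]. Qed.

Lemma profD Q P : prof Q->prof P->prof (fun s=>Q s+P s).
by move=> [S Q0] [S' P0]; split=> [|s s1]; [exact: smooth1D|rewrite Q0// P0// addr0]. Qed.

Lemma profZ (a:R) Q : prof Q->prof (fun s=>a*Q s).
exact/profM/smooth1_cst. Qed.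

Lemma prof_bounded Q : prof Q->exists2 C : R, 0<=C & forall s, 0<=s -> `|Q s| <= C.
move=> [S Q0]; have cQ:=smooth1_cont S.
have [|c _ Hc] := @EVT_max R (fun s => `|Q s|) 0 1 ler01.
 by apply: continuous_subspaceT=>s; apply: continuous_comp; [exact: cQ|exact: norm_continuous].
exists `|Q c| => // s s0; have [s1|s1]:=leP s 1; last by rewrite Q0 ?normr0// ltW.
by apply: Hc; rewrite in_itv/= s0.
Qed.

Lemma prof_expinv n : prof (fun s=>expinv n (1-s)).
split=> [|s s1]; last by rewrite expinv_nonpos// subr_le0.
apply: (@smooth1_comp _ (expinv n) (fun s=>1-s)); first exact: smooth1_expinv.
suff : smooth1 (fun s:R=>1+(-1) * id s).
 by congr smooth1; apply/funext=>s; rewrite /= mulN1r.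
by apply: smooth1D; [exact: smooth1_cst|apply: smooth1M; [exact: smooth1_cst|exact: smooth1_id]].
Qed.

Lemma derive1_expinv1B n : derive1 (fun s:R=>expinv n (1-s)) =
 fun s=>n%:R * expinv n.+1 (1-s)-expinv n.+2 (1-s).
apply/funext=>s; rewrite derive1E; apply: derive_val.
have D:=is_derive_expinv n (1-s).
have E: is_derive s 1 (fun r:R=>1-r) (- 1).
 apply/is_derive1P=>e e0; exists 1 => // h _.
 by rewrite (_:_ - _ = 0) ?normr0 ?mulr_ge0 ?(ltW e0)//; ring.
apply: (is_derive_eq (@is_derive1_comp R (expinv n) (fun r:R=>1-r) s _ _ D E)); ring.
Qed.

End profiles.

Section radial.
Context {R : realType} {N : nat}.
Notation rV := 'rV[R]_N.
Notation dot := (@dotrv R N).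
Implicit Types (Q:R->R) (x y z:rV) (p:nat) (t:R).

(** The exponent p is independent of the dimension because differentiation raises it: a partial
    derivative is z_i times a kernel of exponent p + 2 ([pderiv_rk]). *)
Definition rk p Q t z : R:=t^-p*Q (t ^- 2 * dot z z).
Definition lap (f:rV->R) : rV->R:=fun y => \sum_i pderiv i (pderiv i f) y.

Lemma sm_shift f x : sm f->sm (fun y=>f (y-x)).
by move=> /(sm_affine 1 (- x)); congr sm; apply/funext=>y; rewrite scale1r. Qed.

Lemma pderiv_shift i f x : sm f->pderiv i (fun y=>f (y-x)) = (fun y=>pderiv i f (y-x)).
move=> S; have:=pderiv_affine i 1 (- x) S.
rewrite (_:(fun y=>f (1 *: y + - x)) = (fun y=>f (y-x))); last by apply/funext=>y; rewrite scale1r.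
by move=> ->; apply/funext=>y; rewrite scale1r mul1r.
Qed.

Lemma lap_shift f x : sm f->lap (fun y=>f (y-x)) = (fun y=>lap f (y-x)).
move=> S; apply/funext=>y; apply: eq_bigr=>i _.
by rewrite (pderiv_shift i x S) (pderiv_shift i x (sm_pderiv i S)).
Qed.

Lemma rk_sm p Q t : smooth1 Q->sm (rk p Q t).
by move=> S; apply: smZ; apply: sm_comp => //; apply: smZ; exact: sm_dot2. Qed.

Lemma pderiv_rk i p Q t : smooth1 Q ->
 pderiv i (rk p Q t) = (fun z=>z ord0 i * rk p.+2 (fun s=>2 * derive1 Q s) t z).
move=> S; rewrite /rk pderivZ; last by apply: sm_comp => //; apply: smZ; exact: sm_dot2.
rewrite pderiv_comp//; last by apply: smZ; exact: sm_dot2.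
rewrite pderivZ; last exact: sm_dot2.
apply/funext=>z; rewrite pderiv_dot2 -(addn2 p) -!exprVn exprD; ring.
Qed.

Lemma rk_mulr p Q t z : t != 0 ->
 dot z z * rk p.+2 Q t z = rk p (fun s=>s*Q s) t z.
move=> t0; rewrite /rk -(addn2 p) -!exprVn exprD.
move: (t^-1^+p) (t^-1^+2) (dot z z)=>a b c; ring.
Qed.

Lemma pderiv_coord_rk i j p Q t : smooth1 Q ->
 pderiv i (fun z=>z ord0 j * rk p Q t z) =
 fun z=>z ord0 j*(z ord0 i * rk p.+2 (fun s=>2 * derive1 Q s) t z)+(i == j)%:R * rk p Q t z.
move=> S; rewrite pderivM ?pderiv_coord ?pderiv_rk//; [|exact: sm_coord|exact: rk_sm].
by apply/funext=>z; congr (_ + _); rewrite mulrC.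
Qed.

(** The radial Laplacian in dimension m, in the variable s = |z|^2/t^2. The dimension is a parameter
    since z_j times a radial function behaves as in dimension N + 2 ([lap_coord_rk]). *)
Definition lapP (m:nat) Q : R->R:=fun s=>(2 * m)%:R * derive1 Q s+4*(s * derive1 (derive1 Q) s).

Lemma lap_rk p Q t : smooth1 Q->t != 0->lap (rk p Q t) = rk p.+2 (lapP N Q) t.
move=> S t0; have [S1 _]:=smooth1_derive1 S; have [S2 _]:=smooth1_derive1 S1.
have S1': smooth1 (fun s=>2 * derive1 Q s) by apply: smooth1M => //; exact: smooth1_cst.
have D2: derive1 (fun s=>2 * derive1 Q s) = fun s=>2 * derive1 (derive1 Q) s.
 apply/funext=>s; rewrite derive1E; apply: derive_val.
 have [_ D]:=smooth1_derive1 S1.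
 by apply: (@is_deriveZ _ _ _ (derive1 Q) 2).
apply/funext=>z; rewrite /lap.
under eq_bigr=>i _ do rewrite pderiv_rk// pderiv_coord_rk// eqxx mul1r mulrA D2.
rewrite big_split/= -mulr_suml -/(dot z z) rk_mulr// sumr_const card_ord.
rewrite /rk /lapP; move: (t^-p.+2) (t ^- 2 * dot z z)=>a b.
rewrite -mulr_natr natrM; ring.
Qed.

Lemma lap_coord_rk j p Q t : smooth1 Q->t != 0 ->
 lap (fun z=>z ord0 j * rk p Q t z) = fun z=>z ord0 j * rk p.+2 (lapP N.+2 Q) t z.
move=> S t0; have [S1 _]:=smooth1_derive1 S; have [S2 _]:=smooth1_derive1 S1.
have S1': smooth1 (fun s=>2 * derive1 Q s) by apply: smooth1M => //; exact: smooth1_cst.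
have D2: derive1 (fun s=>2 * derive1 Q s) = fun s=>2 * derive1 (derive1 Q) s.
 apply/funext=>s; rewrite derive1E; apply: derive_val.
 have [_ D]:=smooth1_derive1 S1.
 by apply: (@is_deriveZ _ _ _ (derive1 Q) 2).
have L: lap (fun z=>z ord0 j * rk p Q t z) = fun z=>z ord0 j * lap (rk p Q t) z+2 * pderiv j (rk p Q t) z.
 have Sr:=rk_sm p t S.
 apply/funext=>z; rewrite /lap.
 have E i: pderiv i (pderiv i (fun z=>z ord0 j * rk p Q t z)) z =
  z ord0 j * pderiv i (pderiv i (rk p Q t)) z+2*(pderiv i (rk p Q t) z*(i == j)%:R).
  rewrite pderivM//; last exact: sm_coord.
  rewrite pderivD; [|by apply: smM; [exact: sm_coord|exact: sm_pderiv]|by apply: smM => //; exact/sm_pderiv/sm_coord].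
  rewrite (pderivM i (sm_coord j) (sm_pderiv i Sr)) (pderivM i Sr (sm_pderiv i (sm_coord j))).
  rewrite !pderiv_coord pderiv_cst; ring.
 transitivity (\sum_i (z ord0 j * pderiv i (pderiv i (rk p Q t)) z+2*(pderiv i (rk p Q t) z*(i == j)%:R))).
  by apply: eq_bigr=>i _; exact: E.
 clear E.
 rewrite big_split/= -mulr_sumr -mulr_sumr; congr (_+2 * _).
 rewrite (bigD1 j)//= eqxx mulr1 big1 ?addr0// => i /negPf ->; by rewrite mulr0.
rewrite L lap_rk// pderiv_rk//; apply/funext=>z.
rewrite /rk /lapP; move: (t^-p.+2) (t ^- 2 * dot z z) (z ord0 j)=>a b c.
rewrite !natrM -(addn2 N) natrD; ring.
Qed.

Lemma is_derive_rk p Q t z : smooth1 Q->t != 0 ->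
 is_derive t 1 (fun t=>rk p Q t z) (rk p.+1 (fun s => - (p%:R*Q s+2*(s * derive1 Q s))) t z).
move=> S t0; have [S1 D]:=smooth1_derive1 S.
have V: is_derive t 1 (fun r:R=>r^-1) (- t ^- 2).
 by apply: (is_derive_eq (@is_deriveV R id t 1 _ t0 (is_derive_id t 1))); rewrite /GRing.scale/= mulr1.
have P n: is_derive t 1 (fun r:R=>r^-n) (- n%:R * t^-n.+1).
 case: n=>[|n].
  rewrite oppr0 mul0r (_:(fun _=>_) = cst 1); first exact: is_derive_cst.
  by apply/funext=>r; rewrite expr0 invr1.
 have E := @is_derive1_comp R (fun r:R=>r^+n.+1) (fun r:R=>r^-1) t _ _ (is_derive_exprn n (t^-1)) V.
 rewrite (_:(fun r=>_) = (fun r:R=>r^+n.+1) \o (fun r:R=>r^-1)); last by apply/funext=>r /=; rewrite exprVn.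
 apply: (is_derive_eq E); rewrite -!exprVn !exprS; ring.
have Pd: is_derive t 1 (fun r:R=>r ^- 2 * dot z z) (- 2 * t ^- 3 * dot z z).
 have E := @is_deriveM R R (fun r:R=>r ^- 2) (cst (dot z z)) t 1 _ _ (P 2%N) (is_derive_cst _ _ _).
 by apply: (is_derive_eq E); rewrite scaler0 add0r /GRing.scale/= mulrC.
have Qd := @is_derive1_comp R Q (fun r:R=>r ^- 2 * dot z z) t _ _ (D _) Pd.
have E := @is_deriveM R R (fun r:R=>r^-p) (Q \o (fun r:R=>r ^- 2 * dot z z)) t 1 _ _ (P p) Qd.
apply: (is_derive_eq E); rewrite /GRing.scale/= /rk -!exprVn !exprS.
move: (t^-1^+p) (dot z z)=>a b; rewrite !(mulr1, expr0); ring.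
Qed.

Lemma rk_out p Q t z : prof Q->0<t->t<=nrm z->rk p Q t z = 0.
move=> [_ Q0] t0 tz; rewrite /rk Q0 ?mulr0//.
by rewrite ler_pdivlMl ?exprn_gt0// mulr1 -nrm_sq lerXn2r ?nnegrE ?nrm_ge0// ltW.
Qed.

Lemma rk_bound p Q t z (C:R) : 0<t->(forall s, 0<=s -> `|Q s| <= C) -> `|rk p Q t z| <= C * t^-p.
move=> t0 HC; rewrite /rk normrM mulrC [`|t^-p|]ger0_norm ?invr_ge0 ?exprn_ge0 ?(ltW t0)//.
rewrite ler_wpM2r ?invr_ge0 ?exprn_ge0 ?(ltW t0)//; apply: HC.
by rewrite mulr_ge0 ?dot_ge0// invr_ge0 exprn_ge0// ltW.
Qed.

Lemma coord_rk_bound i p Q t z (C:R) : 0<t->prof Q->(forall s, 0<=s -> `|Q s| <= C) ->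
 `|z ord0 i * rk p.+1 Q t z| <= C * t^-p.
move=> t0 PQ HC; have [tz|zt]:=leP t (nrm z).
 by rewrite rk_out// mulr0 normr0 mulr_ge0 ?invr_ge0 ?exprn_ge0 ?(ltW t0)// (le_trans (normr_ge0 _) (HC 0 (lexx 0))).
rewrite normrM; have:=rk_bound p.+1 z t0 HC=>B.
apply: (@le_trans _ _ (t*(C * t^-p.+1))).
 by apply: ler_pM => //; exact: le_trans (coord_le_nrm z i) (ltW zt).
rewrite le_eqVlt; apply/orP; left; apply/eqP; rewrite exprS; field.
by rewrite expf_neq0/= gt_eqF.
Qed.

End radial.

Section convolution.
Context {R : realType} {N : nat} (O:set 'rV[R]_N).
Hypotheses (oO:open O) (bO:bounded_set O).
Notation rV := 'rV[R]_N.
Notation leb := (lebesgue_rV R N).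
Notation I1 := (I1 O).
Notation Int := (Int O).
Notation L2 := (L2 O).
Implicit Types (f h u v w phi psi eta a k:rV->R).

Lemma is_derive_Int u (K K':R->rV->R) (a b t C:R) : L2 u->a<t<b ->
 (forall s, a<s<b->measurable_fun O (K s)) ->
 (forall s, a<s<b->exists M : R, forall y, O y -> `|K s y| <= M) ->
 (forall s y, a<s<b->O y->is_derive s (1:R) (K ^~ y) (K' s y)) ->
 (forall s y, a<s<b->O y -> `|K' s y| <= C) ->
 is_derive t (1:R) (fun s=>Int (fun y=>u y*K s y)) (Int (fun y=>u y*K' t y)).
move=> Lu tab mK bK dK bK'.
pose F (s:R) y:=u y*K s y.
have dF s y: a<s<b->O y->is_derive s (1:R) (F ^~ y) (u y*K' s y).
 by move=> sab Oy; have D:=dK s y sab Oy; exact: (@is_deriveZ _ _ _ (K ^~ y) (u y) s 1 _ D).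
have pF s y: a<s<b->O y->partial1of2 F s y = u y*K' s y.
 by move=> sab Oy; rewrite partial1of2E; apply: derive_val; exact: dF.
have C0: 0<=Num.max C 0 by rewrite le_max lexx orbT.
have h1: (`]a, b[%classic : set R) t by rewrite /= in_itv.
have h2 x: (`]a, b[%classic : set R) x->leb.-integrable O (EFin \o F x).
 rewrite /= in_itv/= => xab; have [M HM]:=bK x xab.
 have:=I1M oO (mK x xab) HM (L2_I1 oO bO Lu); apply: (eq_I1 oO)=>y _; exact: mulrC.
have h3 x y: (`]a, b[%classic : set R) x->O y->derivable (F ^~ y) x 1.
 by rewrite /= in_itv/= => xab Oy; case: (dF x y xab Oy).
have h4 y: 0<=Num.max C 0 * `|u y| by rewrite mulr_ge0.
have h5: leb.-integrable O (EFin \o (fun y=>Num.max C 0 * `|u y|)).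
 by apply: (I1Z oO); apply: (I1_norm oO); exact: L2_I1.
have h6 x y: (`]a, b[%classic : set R) x->O y -> `|partial1of2 F x y| <= Num.max C 0 * `|u y|.
 rewrite /= in_itv/= => xab Oy; rewrite pF// normrM mulrC ler_wpM2r//.
 by rewrite le_max bK'.
have E:=differentiation_under_integral (mO oO) h1 h2 h3 h4 h5 h6.
have D:=derivable_under_integral (mO oO) h1 h2 h3 h4 h5 h6.
apply: DeriveDef; first exact: D.
rewrite -derive1E E; apply: (@eq_Int _ _ O)=>y Oy; exact: pF.
Qed.

Definition conv u k : rV->R:=fun x=>Int (fun y=>u y * k (y-x)).
Definition bdd k:=exists2 C : R, 0<=C & forall z, `|k z| <= C.

Lemma lip_of_pderiv k (C:R) : sm k->(forall i z, `|pderiv i k z| <= C) ->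
 forall y z, `|k y-k z| <= C*(N%:R * nrm (y-z)).
move=> S HC y z; have := @mvt_box _ _ k z y (fun=> 0) C _.
rewrite big1 ?subr0; last by move=> i _; rewrite mul0r.
move=> h; apply: le_trans (h _) _.
 by move=> w i _; split; [exact: sm_derivable|rewrite subr0].
case: N k S HC y z h=>[|n] k S HC y z h; first by rewrite big_ord0 mul0r.
rewrite ler_wpM2l ?(le_trans (normr_ge0 _) (HC ord0 y))//.
by have:=sum_coord_le_nrm (y-z); under eq_bigr do rewrite !mxE.
Qed.

Lemma conv_I1 u k x : L2 u->sm k->bdd k->I1 (fun y=>u y * k (y-x)).
move=> Lu S [C C0 HC]; apply: (eq_I1 oO (f:=fun y=>k (y-x) * u y))=>[y _|]; first exact: mulrC.
by apply: (I1M oO (M:=C)) => //; [exact: (sm_meas (sm_shift x S))|exact: (L2_I1 oO bO)].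
Qed.

Lemma conv_lip u k (C:R) x z : L2 u->sm k->bdd k->(forall i z, `|pderiv i k z| <= C) ->
 `|conv u k x-conv u k z| <= C*(N%:R * nrm (x-z))*Int (fun y => `|u y|).
move=> Lu S B HC; have Iu:=L2_I1 oO bO Lu.
have Ix:=conv_I1 x Lu S B; have Iz:=conv_I1 z Lu S B.
rewrite /conv -(IntB oO Ix Iz) -(IntZ oO _ (I1_norm oO Iu)).
apply: (Int_abs_le oO); first exact: (I1_meas (I1B oO Ix Iz)).
 exact: (I1Z oO _ (I1_norm oO Iu)).
move=> y _; rewrite -mulrBr normrM mulrC ler_wpM2r//.
apply: (le_trans (lip_of_pderiv S HC _ _)).
by rewrite (_:y-x-(y-z) = z-x) ?(nrm_distC z)//; apply/rowP=>j; rewrite !mxE; ring.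
Qed.

Lemma is_derive_conv u k x i : L2 u->sm k->bdd k->bdd (pderiv i k) ->
 is_derive x (delta_mx ord0 i) (conv u k) (- conv u (pderiv i k) x).
move=> Lu S [B _ HB] [C C0 HC].
apply/is_derive_line.
pose e : rV:=delta_mx ord0 i.
pose K (s:R) y:=k (y-(s *: e+x)); pose K' (s:R) y := - pderiv i k (y-(s *: e+x)).
have D (s:R) y : is_derive s (1:R) (K ^~ y) (K' s y).
 have D0:=is_derive_pderiv (y-(s *: e+x)) i S.
 have D1: is_derive (- s) (1:R) (fun r:R=>k (r *: e+(y-x))) (pderiv i k (y-(s *: e+x))).
  apply/is_derive_lineP; rewrite (_ : - s *: e+(y-x) = y-(s *: e+x))//.
  by apply/rowP=>j; rewrite !mxE; ring.
 have D2: is_derive s (1:R) (fun r:R => - r) (- 1).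
  apply/is_derive1P=>r r0; exists 1 => // h _.
  by rewrite (_:_ - _ = 0) ?normr0 ?mulr_ge0 ?(ltW r0)//; ring.
 have D3 := @is_derive1_comp R _ (fun r:R => - r) s _ _ D1 D2.
 rewrite (_:K ^~ y = (fun r:R=>k (r *: e+(y-x))) \o (fun r:R => - r)).
  by apply: (is_derive_eq D3); rewrite mulrN1.
 apply/funext=>r; rewrite /K /=; congr k; apply/rowP=>j; rewrite !mxE; ring.
have := @is_derive_Int u K K' (-1) 1 0 C Lu _ _ _ _ _.
rewrite oppr_lt0 ltr01 => /(_ isT).
rewrite (_:Int (fun y=>u y*K' 0 y) = - conv u (pderiv i k) x); last first.
 rewrite /conv -(IntN oO); last by apply: conv_I1 => //; [exact: sm_pderiv|exists C].
 by apply: eq_Int=>y _; rewrite /K' scale0r add0r mulrN.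
move=> h; apply: h=>[s _|s _|s y _ _] //.
- exact: (sm_meas (sm_shift _ S)).
- by exists B=>y _; exact: HB.
- by rewrite normrN; exact: HC.
Qed.

End convolution.

Section kernel.
Context {R : realType} (N:nat).
Notation rV := 'rV[R]_N.
Notation leb := (lebesgue_rV R N).

Definition th0 : R->R:=fun s=>expinv 0 (1-s).
Definition ps0 : R->R:=fun s => - 2 * derive1 th0 s.
Definition kc : R:=fine (\int[leb]_z (rk N ps0 1 (z:rV))%:E)%E.
Definition Th : R->R:=fun s=>kc^-1 * th0 s.
(** With psi_t = t^-N Ps and theta_t = t^-N Th, the factor -2 gives d/dt psi_t = t Lap theta_t
    ([is_derive_psk]); the constant [kc] makes the mass of psi_t equal to 1. *)
Definition Ps : R->R:=fun s => - 2 * derive1 Th s.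
Lemma prof_th0 : prof th0. Proof. exact: prof_expinv. Qed.
Lemma prof_Th : prof Th. Proof. exact/profZ/prof_th0. Qed.
Lemma prof_ps0 : prof ps0. Proof. exact/profZ/prof_derive/prof_th0. Qed.
Lemma prof_Ps : prof Ps. Proof. exact/profZ/prof_derive/prof_Th. Qed.

Lemma derive1Z (a:R) (Q:R->R) : smooth1 Q->derive1 (fun s=>a*Q s) = fun s=>a * derive1 Q s.
move=> S; apply/funext=>s; rewrite derive1E; apply: derive_val.
have [_ D]:=smooth1_derive1 S.
by apply: (@is_deriveZ _ _ _ Q a).
Qed.

Lemma PsE s : Ps s = kc^-1 * ps0 s.
by rewrite /Ps /Th derive1Z; [rewrite /ps0; ring|exact: (prof_th0).1]. Qed.

Lemma ps0E s : ps0 s = 2 * expinv 2 (1-s).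
by rewrite /ps0 /th0 derive1_expinv1B mul0r sub0r mulrNN. Qed.

Lemma is_derive_psk (t:R) (z:rV) : t != 0 ->
 is_derive t (1:R) (fun t=>rk N Ps t z) (t * lap (rk N Th t) z).
move=> t0; have [ST _]:=prof_Th; have [SP _]:=prof_Ps; have [ST1 _]:=smooth1_derive1 ST.
apply: (is_derive_eq (is_derive_rk N z SP t0)).
rewrite lap_rk// /rk; move: (t ^- 2 * dotrv z z)=>s; rewrite /lapP.
have -> : derive1 Ps = fun s => - 2 * derive1 (derive1 Th) s by rewrite /Ps derive1Z.
rewrite /Ps natrM -!exprVn !exprS; move: (t^-1^+N) (derive1 Th s) (derive1 (derive1 Th) s)=>a b c.
by field.
Qed.

(** The scale identity differentiated in z; it uses the N + 2 dimensional radial Laplacian and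
    drives the gradient estimates. *)
Lemma is_derive_dpsk (t:R) i (z:rV) : t != 0 ->
 is_derive t (1:R) (fun t=>pderiv i (rk N Ps t) z) (t * lap (pderiv i (rk N Th t)) z).
move=> t0; have [ST _]:=prof_Th; have [SP _]:=prof_Ps.
have [ST1 _]:=smooth1_derive1 ST; have [ST2 _]:=smooth1_derive1 ST1; have [SP1 _]:=smooth1_derive1 SP.
have [ST3 _]:=smooth1_derive1 ST2.
have SP2: smooth1 (fun s=>2 * derive1 Ps s) by apply: smooth1M => //; exact: smooth1_cst.
have SQ2: smooth1 (fun s=>2 * derive1 Th s) by apply: smooth1M => //; exact: smooth1_cst.
rewrite (_:(fun t=>_) = fun t=>z ord0 i * rk N.+2 (fun s=>2 * derive1 Ps s) t z); last first.
 by apply/funext=>r; rewrite pderiv_rk.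
have D:=is_derive_rk N.+2 z SP2 t0.
apply: (is_derive_eq (@is_deriveZ _ _ _ (fun r=>rk N.+2 (fun s=>2 * derive1 Ps s) r z) (z ord0 i) t 1 _ D)).
rewrite (pderiv_rk i N t ST) lap_coord_rk// /rk /GRing.scale/=; move: (t ^- 2 * dotrv z z)=>s; rewrite /lapP.
have P1: derive1 Ps = fun s => - 2 * derive1 (derive1 Th) s by rewrite /Ps derive1Z.
rewrite (derive1Z 2 SP1) (derive1Z 2 ST1) (derive1Z 2 ST2) P1 (derive1Z (-2) ST2).
rewrite -(addn2 N) !natrM !natrD -!exprVn !exprS addn2.
move: (t^-1^+N) (derive1 (derive1 Th) s) (derive1 (derive1 (derive1 Th)) s)=>a b c.
by rewrite !exprS; field.
Qed.

End kernel.

Section compactly_supported.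
Context {R : realType} {N : nat}.
Notation rV := 'rV[R]_N.
Implicit Types (k:rV->R) (x y z:rV).

Definition csm (t:R) k:=sm k /\ forall z, t<=nrm z->k z = 0.

Lemma csm_bdd t k : csm t k->bdd k.
move=> [S k0]; have [K HK]:=continuous_supp_bounded (sm_cont S) (fun x (h:t<nrm x)=>k0 x (ltW h)).
by exists K => //; exact: le_trans (normr_ge0 _) (HK 0).
Qed.

Lemma tf_csm (O:set rV) t k x : csm t k->nball x t `<=` O->test_function O (fun y=>k (y-x)).
move=> [S k0] BO; apply: (@tf_compact _ _ _ (nball x t)) => //.
- exact: compact_nball.
- exact: sm_shift.
- by move=> y nb; apply: k0; rewrite leNgt; apply/negP=>h; apply: nb; rewrite /nball/= ltW.
Qed.

Lemma csm_pderiv t k i : csm t k->csm t (pderiv i k).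
move=> [S k0]; split=> [|z tz]; first exact: sm_pderiv.
have Z (w:rV) : t<nrm w->pderiv i k w = 0.
 move=> tw; apply: derive_val.
 have E: {near w, (fun=> 0) =1 k}.
  apply/nbhs_nrmP; exists (nrm w-t); first by rewrite subr_gt0.
  move=> y yw /=; rewrite k0//; have:=nrmB_ge w y; rewrite nrm_distC; lra.
 by apply: (near_eq_is_derive E); exact: is_derive_cst.
(* On the sphere |z| = t the derivative is a limit of the zero values further out, along the ray
   through z. For t <= 0 the kernel is identically zero. *)
have [t0|t0]:=leP t 0; last first.
 have z0: 0<nrm z by exact: lt_le_trans tz.
 apply: (@eq0_small _ _ 1)=>e e0.
 have cS:=sm_cont (sm_pderiv i S); have /continuous_nrmP/(_ e e0)[d d0 Hd]:=cS z.
 pose c:=d/(2 * nrm z); have c0: 0<c by rewrite divr_gt0// mulr_gt0.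
 have:=Hd (z+c *: z); rewrite addrAC subrr add0r nrmZ gtr0_norm//.
 have -> : c * nrm z = d/2 by rewrite /c; field; rewrite gt_eqF.
 rewrite Z ?sub0r ?normrN; first by move=> h; rewrite mul1r ltW// h//; lra.
 rewrite -[X in X + _]scale1r -scalerDl nrmZ gtr0_norm ?addr_gt0//.
 by apply: le_lt_trans tz _; rewrite ltr_pMl// ltrDl.
have [t1|t1]:=ltP t (nrm z); first exact: Z.
have K0 w: k w = 0.
 by apply: k0; apply: le_trans t0 (nrm_ge0 _).
by rewrite (_:k = fun=> 0) ?pderiv_cst//; exact/funext.
Qed.

Lemma csm_sum t (F : 'I_N->rV->R) : (forall i, csm t (F i))->csm t (fun z => \sum_i F i z).
move=> H; split; first by apply: sm_sum=>i _; case: (H i).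
by move=> z tz; apply: big1=>i _; case: (H i)=>_ ->.
Qed.

Lemma csm_lap t k : csm t k->csm t (lap k).
by move=> C; apply: csm_sum=>i; do 2 apply: csm_pderiv. Qed.

Lemma csm_rk p Q (t:R) : prof Q->0<t->csm t (rk p Q t:rV->R).
by move=> PQ t0; split=> [|z tz]; [exact: rk_sm PQ.1|exact: rk_out]. Qed.

Lemma prof_lapP m (Q:R->R) : prof Q->prof (lapP m Q).
move=> PQ; have P1:=prof_derive PQ; have P2:=prof_derive P1.
apply: profD; first exact: profZ.
refine (@profZ R 4 (fun s=>s * derive1 (derive1 Q) s) (profM (@smooth1_id R) P2)).
Qed.

Lemma pderiv_rk_bound p (Q:R->R) : prof Q->exists2 C : R, 0<=C &
 forall (t:R) i z, 0<t -> `|pderiv i (rk p Q t) z| <= C * t^-p.+1.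
move=> PQ; have P1: prof (fun s=>2 * derive1 Q s) by exact/profZ/prof_derive.
have [C C0 HC]:=prof_bounded P1; exists C => // t i z t0.
by rewrite (pderiv_rk i p t PQ.1); exact: coord_rk_bound.
Qed.

Lemma rk_bound' p (Q:R->R) : prof Q->exists2 C : R, 0<=C &
 forall (t:R) (z:rV), 0<t -> `|rk p Q t z| <= C * t^-p.
by move=> PQ; have [C C0 HC]:=prof_bounded PQ; exists C => // t z t0; exact: rk_bound. Qed.

Lemma lap_rk_bound p (Q:R->R) : prof Q->exists2 C : R, 0<=C &
 forall (t:R) (z:rV), 0<t -> `|lap (rk p Q t) z| <= C * t^-p.+2.
move=> PQ; have [C C0 HC]:=rk_bound' p.+2 (prof_lapP N PQ); exists C => // t z t0.
by rewrite (lap_rk p PQ.1) ?gt_eqF//; exact: HC.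
Qed.

Lemma lap_pderiv_rk_bound p (Q:R->R) : prof Q->exists2 C : R, 0<=C &
 forall (t:R) i z, 0<t -> `|lap (pderiv i (rk p Q t)) z| <= C * t^-p.+3.
move=> PQ; have P1: prof (fun s=>2 * derive1 Q s) by exact/profZ/prof_derive.
have P2:=prof_lapP N.+2 P1.
have [C C0 HC]:=prof_bounded P2; exists C => // t i z t0.
by rewrite (pderiv_rk i p t PQ.1) (lap_coord_rk i p.+2 P1.1) ?gt_eqF//; exact: coord_rk_bound.
Qed.

End compactly_supported.

Section scale_derivative.
Context {R : realType} {N : nat} (O:set 'rV[R]_N).
Hypotheses (oO:open O) (bO:bounded_set O).
Notation rV := 'rV[R]_N.
Notation Int := (Int O).
Notation I1 := (I1 O).
Notation L2 := (L2 O).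
Notation tf := (test_function O).
Notation conv := (conv O).
Notation theta t := (rk N (Th N) t : rV -> R).
Notation psi t := (rk N (Ps N) t : rV -> R).
Implicit Types (f h u v w phi eta a k:rV->R) (x y z:rV).

Lemma csm_theta (t:R) : 0<t->csm t (theta t).
exact/csm_rk/prof_Th. Qed.

Lemma csm_psi (t:R) : 0<t->csm t (psi t).
exact/csm_rk/prof_Ps. Qed.

Lemma conv_csm_I1 t u k x : L2 u->csm t k->I1 (fun y=>u y * k (y-x)).
by move=> Lu C; apply: conv_I1 => //; [exact: C.1|exact: csm_bdd C]. Qed.

Lemma mid_lt (t:R) : 0<t->t/2<t<2 * t. Proof. by lra. Qed.

Lemma is_derive_conv_psi u x (t:R) : L2 u->0<t ->
 is_derive t (1:R) (fun t=>conv u (psi t) x) (t * conv u (lap (theta t)) x).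
move=> Lu t0; have [C C0 HC] := @lap_rk_bound R N N (Th N) (prof_Th N).
have := @is_derive_Int _ _ O oO bO u (fun t y=>psi t (y-x)) (fun t y=>t * lap (theta t) (y-x))
 (t/2) (2 * t) t (C*(t/2)^-N.+1) Lu (mid_lt t0).
rewrite (_:Int (fun y=>u y*(t * lap (theta t) (y-x))) = t * conv u (lap (theta t)) x); last first.
 rewrite /conv -(IntZ oO _ (conv_csm_I1 x Lu (csm_lap (csm_theta t0)))).
 by apply: eq_Int=>y _; rewrite mulrCA.
have t2: 0<t/2 by lra.
move=> h; apply: h=>[s /andP[s1 _]|s /andP[s1 _]|s y /andP[s1 _] _|s y /andP[s1 _] _].
- have s0:=lt_trans t2 s1; exact: (sm_meas (sm_shift _ (csm_psi s0).1)).
- have s0:=lt_trans t2 s1; have [B _ HB]:=csm_bdd (csm_psi s0); exists B=>y _; exact: HB.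
- by apply: is_derive_psk; rewrite gt_eqF// (lt_trans t2 s1).
- have s0:=lt_trans t2 s1; rewrite normrM gtr0_norm//.
 apply: (@le_trans _ _ (s*(C * s^-N.+2))); first by rewrite ler_wpM2l ?(ltW s0)// HC.
 rewrite (_:s*(C * s^-N.+2) = C * s^-N.+1).
  by rewrite ler_wpM2l// lef_pV2 ?posrE ?exprn_gt0// lerXn2r ?nnegrE ?ltW.
 by rewrite exprS; field; rewrite expf_neq0/= gt_eqF.
Qed.

Lemma is_derive_conv_dpsi u x (t:R) i : L2 u->0<t ->
 is_derive t (1:R) (fun t=>conv u (pderiv i (psi t)) x) (t * conv u (lap (pderiv i (theta t))) x).
move=> Lu t0; have [C C0 HC] := @lap_pderiv_rk_bound R N N (Th N) (prof_Th N).
have := @is_derive_Int _ _ O oO bO u (fun t y=>pderiv i (psi t) (y-x))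
 (fun t y=>t * lap (pderiv i (theta t)) (y-x))
 (t/2) (2 * t) t (C*(t/2)^-N.+2) Lu (mid_lt t0).
rewrite (_:Int (fun y=>u y*(t * lap (pderiv i (theta t)) (y-x))) = t * conv u (lap (pderiv i (theta t))) x); last first.
 rewrite /conv -(IntZ oO _ (conv_csm_I1 x Lu (csm_lap (csm_pderiv i (csm_theta t0))))).
 by apply: eq_Int=>y _; rewrite mulrCA.
have t2: 0<t/2 by lra.
move=> h; apply: h=>[s /andP[s1 _]|s /andP[s1 _]|s y /andP[s1 _] _|s y /andP[s1 _] _].
- have s0:=lt_trans t2 s1; exact: (sm_meas (sm_shift _ (csm_pderiv i (csm_psi s0)).1)).
- have s0:=lt_trans t2 s1; have [B _ HB]:=csm_bdd (csm_pderiv i (csm_psi s0)); exists B=>y _; exact: HB.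
- by apply: is_derive_dpsk; rewrite gt_eqF// (lt_trans t2 s1).
- have s0:=lt_trans t2 s1; rewrite normrM gtr0_norm//.
 apply: (@le_trans _ _ (s*(C * s^-N.+3))); first by rewrite ler_wpM2l ?(ltW s0)// HC.
 rewrite (_:s*(C * s^-N.+3) = C * s^-N.+2).
  by rewrite ler_wpM2l// lef_pV2 ?posrE ?exprn_gt0// lerXn2r ?nnegrE ?ltW.
 by rewrite exprS; field; rewrite expf_neq0/= gt_eqF.
Qed.

(** -Lap u = f in the sense of distributions, with both derivatives on the test function. Applied to
    translates of theta_t it turns convolution of u with [lap (theta t)] into minus convolution of f
    with theta_t. *)
Definition vsol u f:=forall phi, tf phi->Int (fun y=>u y * lap phi y) = - Int (fun y=>f y * phi y).

Lemma vsol_theta u f x (t:R) : vsol u f->0<t->nball x t `<=` O ->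
 conv u (lap (theta t)) x = - conv f (theta t) x.
move=> V t0 B; have Ct:=csm_theta t0; rewrite -(V _ (tf_csm Ct B)).
by apply: eq_Int=>y _; rewrite (lap_shift x Ct.1).
Qed.

Lemma vsol_dtheta u f x (t:R) i : vsol u f->0<t->nball x t `<=` O ->
 conv u (lap (pderiv i (theta t))) x = - conv f (pderiv i (theta t)) x.
move=> V t0 B; have Ct:=csm_pderiv i (csm_theta t0); rewrite -(V _ (tf_csm Ct B)).
by apply: eq_Int=>y _; rewrite (lap_shift x Ct.1).
Qed.

Lemma wsol_vsol u g f : wsol O u g f->vsol u f.
move=> [Hu Su] phi T; have:=Su _ _ (H_tf oO bO T)=>E.
have S:=tf_sm T; have [Lu Lg _]:=Hu.
rewrite -E /Dg -sumrN.
under [LHS]eq_Int do rewrite mulr_sumr.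
rewrite Int_sum//; last by move=> i; apply: (L2_mul oO) => //; apply: (sm_L2 oO bO); do 2 apply: sm_pderiv.
by apply: eq_bigr=>i _; rewrite (H_ibp oO bO i Hu (sm_pderiv i S)).
Qed.

End scale_derivative.
Notation conv_on := conv.

Section normalization.
Context {R : realType} {N : nat}.
Notation rV := 'rV[R]_N.
Notation leb := (lebesgue_rV R N).
Notation theta t := (rk N (Th N) t : rV -> R).
Notation psi t := (rk N (Ps N) t : rV -> R).
Implicit Types (O:set rV) (x y z:rV).

(** Otherwise a small box around x, of positive volume, would lie in a null set. *)
Lemma ae_dense O (P:rV->Prop) x (e:R) : open O->ae_in O P->O x->0<e ->
 exists y, [/\ O y, nrm (y-x)<e & P y].
move=> /open_nrmP oO [B [mB B0 sub]] Ox e0; have [d d0 Hd]:=oO x Ox.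
pose r:=Num.min d e/N.+1%:R.
have r0: 0<r by rewrite divr_gt0// lt_min d0 e0.
apply: contrapT=>nex.
pose X := [set y : rV | forall i, x ord0 i-r<=y ord0 i<=x ord0 i+r].
have XB: X `<=` B.
 move=> y Xy; apply: sub => /= Py; apply: nex; exists y.
 have ny: nrm (y-x)<Num.min d e.
  apply: (le_lt_trans (nrm_le_sum _)); apply: (@le_lt_trans _ _ (\sum_(i<N) r)).
   apply: ler_sum=>i _; rewrite !mxE; have:=Xy i; rewrite ler_norml; lra.
  rewrite sumr_const card_ord -mulr_natr /r mulrAC ltr_pdivrMr// ltr_pM2l ?lt_min ?d0//.
  by rewrite ltr_nat.
 move: ny; rewrite lt_min => /andP[y1 y2]; split=> //; first exact: Hd.
 by apply: Py; exact: Hd.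
have X0: (leb X<=0)%E.
 by rewrite -B0; apply: le_measure => //; rewrite inE//; exact: measurable_box.
move: X0; rewrite /X lebesgue_rV_box; last by move=> i; lra.
rewrite lee_fin leNgt => /negP; apply; apply: prodr_gt0=>i _; lra.
Qed.

Definition bball (M:R) : set rV := [set y | nrm y<M].

Lemma open_bball M : open (bball M).
apply/open_nrmP=>x xM; exists (M-nrm x); first by rewrite subr_gt0.
by move=> y yx; rewrite /bball/=; have:=nrmD (y-x) x; rewrite subrK; lra.
Qed.

Lemma bounded_bball M : bounded_set (bball M).
by apply/bounded_nrmP; exists M=>x /ltW. Qed.

Lemma rk_even p (Q:R->R) t z : rk p Q t (- z) = rk p Q t z.
by rewrite /rk dotNl dotNr opprK. Qed.

Lemma ps0_ge0 (s:R) : 0<=ps0 s.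
by rewrite ps0E mulr_ge0// expinv_ge0. Qed.

Lemma kc_gt0 : 0<kc N :> R.
have C := @csm_rk R N N _ 1 prof_ps0 ltr01.
have oB := @open_bball 2; have bB := @bounded_bball 2.
have B1: nball (0:rV) 1 `<=` bball 2.
 by move=> y; rewrite /nball/= subr0=>h; rewrite /bball/=; lra.
have T:=tf_csm C B1.
have k0 z: 0<=rk N ps0 1 (z:rV) by rewrite mulr_ge0 ?ps0_ge0// invr_ge0 exprn_ge0.
have E: Int (bball 2) (rk N ps0 1) = kc N :> R.
 have F: (fun y=>rk N ps0 1 (y-0)) = rk N ps0 1 :> (rV->R) by apply/funext=>y; rewrite subr0.
 by rewrite F in T; exact: (tf_Int T).
rewrite lt_def -E Int_ge0// andbT; apply/eqP=>E0.
have I: I1 (bball 2) (rk N ps0 1).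
 by apply: (L2_I1 oB bB); apply: (sm_L2 oB bB); exact: C.1.
have A:=Int_ae0 oB I (fun x _=>k0 x) E0.
have [|y [_ y1 y0]] := @ae_dense (bball 2) _ 0 1 oB A _ ltr01.
 by rewrite /bball/= nrm0.
move: y1; rewrite subr0=>y1.
move: y0; rewrite /rk expr1n invr1 mul1r expr1n invr1 mul1r ps0E => /eqP.
have d1: 0<1-dotrv y y by rewrite subr_gt0 -nrm_sq expr_lt1// nrm_ge0.
by rewrite /expinv d1 mulf_eq0 pnatr_eq0/= mulf_eq0 expf_eq0/= invr_eq0 gt_eqF//= gt_eqF// expR_gt0.
Qed.

Lemma Ps_ge0 (s:R) : 0<=Ps N s.
by rewrite PsE mulr_ge0 ?ps0_ge0// invr_ge0 ltW// kc_gt0. Qed.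

Lemma Th_ge0 (s:R) : 0<=Th N s.
by rewrite mulr_ge0 ?expinv_ge0// invr_ge0 ltW// kc_gt0. Qed.

(** For s < 1 the profile [ps0] is 2 (1-s)^-2 times [th0]. This lets a zero order term averaged with
    theta_t be absorbed by the mean with psi_t. *)
Lemma Th_le_Ps (s:R) : 0<=s->2*Th N s<=Ps N s.
move=> s0; rewrite PsE /Th mulrCA ler_wpM2l ?invr_ge0 ?(ltW kc_gt0)// ps0E ler_wpM2l// /th0 /expinv.
case: ifP => // s1; rewrite expr0 ler_wpM2r ?expR_ge0// exprn_ege1// invf_ge1//; lra.
Qed.

Lemma psi_ge0 (t:R) z : 0<t->0<=psi t z.
by move=> t0; rewrite mulr_ge0 ?Ps_ge0// invr_ge0 exprn_ge0// ltW. Qed.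

Lemma theta_ge0 (t:R) z : 0<t->0<=theta t z.
by move=> t0; rewrite mulr_ge0 ?Th_ge0// invr_ge0 exprn_ge0// ltW. Qed.

Lemma theta_le_psi (t:R) z : 0<t->2 * theta t z<=psi t z.
move=> t0; rewrite mulrCA ler_wpM2l ?invr_ge0 ?exprn_ge0 ?(ltW t0)// Th_le_Ps//.
by rewrite mulr_ge0 ?dot_ge0// invr_ge0 exprn_ge0// ltW.
Qed.

Lemma Int_lap0 O k (t:R) x : open O->bounded_set O->csm t k->nball x t `<=` O ->
 conv O (fun=> 1) (lap k) x = 0.
move=> oO bO C B; rewrite /conv.
have T:=tf_csm C B.
rewrite (@eq_Int _ _ O _ (fun y => \sum_i pderiv i (pderiv i (fun y=>k (y-x))) y)); last first.
 by move=> y _; rewrite mul1r; have:=lap_shift x C.1 => /(congr1 (fun f=>f y)) <-.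
rewrite (Int_sum oO bO).
 by apply: big1=>i _; apply: (Int_pderiv_tf bO); exact: tf_pderiv.
by move=> i; apply: (L2_I1 oO bO); apply: (tf_L2 oO bO); do 2 apply: tf_pderiv.
Qed.

Lemma Int_dcsm0 O k (t:R) x i : open O->bounded_set O->csm t k->nball x t `<=` O ->
 conv O (fun=> 1) (pderiv i k) x = 0.
move=> oO bO C B; rewrite /conv; have T:=tf_csm C B.
rewrite (@eq_Int _ _ O _ (pderiv i (fun y=>k (y-x)))); last first.
 by move=> y _; rewrite mul1r (pderiv_shift i x C.1).
exact: (Int_pderiv_tf bO).
Qed.

Lemma nball_bball x (t M:R) : nrm x+t<M->nball x t `<=` bball M.
by move=> h y; rewrite /nball /bball/= => yx; have:=nrmD (y-x) x; rewrite subrK; lra. Qed.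

Lemma integral_csm O k (t:R) x : open O->bounded_set O->csm t k->nball x t `<=` O ->
 Int O (fun y=>k (y-x)) = fine (\int[leb]_y (k (y-x))%:E)%E.
by move=> oO bO C B; rewrite (tf_Int (tf_csm C B)). Qed.

Lemma nrm_mono z x : (forall j, `|z ord0 j| <= `|x ord0 j|)->nrm z<=nrm x.
move=> zx; rewrite nrm_le// nrm_sq; apply: ler_sum=>j _.
by rewrite -!expr2 -[leLHS]real_normK ?num_real// -[leRHS]real_normK ?num_real// lerXn2r ?nnegrE.
Qed.

(** No change of variables is made: the mass is constant in t, its derivative being t times the
    integral of a Laplacian, and constant in x, its derivative being the integral of a partial
    derivative. At t = 1, x = 0 it is 1 by the choice of [kc]. *)
Lemma integral_psi (t:R) x : 0<t->fine (\int[leb]_y (psi t (y-x))%:E)%E = 1.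
move=> t0; pose M:=nrm x+t+2.
have tM: nrm x+t<M by rewrite /M; lra.
have kE: (kc N:R)^-1 * kc N = 1 by rewrite mulVf// gt_eqF// kc_gt0.
have M1: nrm (0:rV)+1<M by rewrite nrm0 /M; have:=nrm_ge0 x; lra.
have Mx z: nrm z<=nrm x->nrm z+1<M by rewrite /M; lra.
have oB := @open_bball M; have bB := @bounded_bball M.
have L1: L2 (bball M) (fun=> 1) by exact: L2_cst.
have E0 s z k: csm s k->nrm z+s<M ->
  conv (bball M) (fun=> 1) k z = fine (\int[leb]_y (k (y-z))%:E)%E.
 move=> C h; rewrite -(integral_csm oB bB C (nball_bball h)).
 by apply: eq_Int=>y _; rewrite mul1r.
have t2: forall s : R, Num.min t 1<=s<=Num.max t 1->0<s /\ nrm x+s<M.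
 move=> s; rewrite ge_min le_max => /andP[s1 s2]; split.
  by case/orP: s1=>s1; [exact: lt_le_trans s1|exact: lt_le_trans s1].
 by case/orP: s2=>s2; rewrite /M; have:=t0; lra.
have Et: conv (bball M) (fun=> 1) (psi t) x = conv (bball M) (fun=> 1) (psi 1) x.
 have Z (a b:R) : Num.min t 1<=a->a<=b->b<=Num.max t 1 ->
   conv (bball M) (fun=> 1) (psi b) x = conv (bball M) (fun=> 1) (psi a) x.
  move=> a1 ab b1; apply/eqP; rewrite -subr_eq0 -normr_le0.
  have := @mvt_le _ (fun t=>conv (bball M) (fun=> 1) (psi t) x) (fun=> 0) a b 0 ab.
  rewrite mul0r; apply=>s /andP[s1 s2]; last by rewrite normr0.
  have [s0 sM] : 0<s /\ nrm x+s<M by apply: t2; rewrite (le_trans a1 s1) (le_trans s2 b1).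
  have D:=is_derive_conv_psi oB bB x L1 s0.
  by rewrite (Int_lap0 oB bB (csm_theta s0) (nball_bball sM)) mulr0 in D.
 have [t1|t1]:=leP t 1.
  by symmetry; apply: Z; rewrite ?ge_min ?le_max ?lexx ?orbT.
 by apply: Z; rewrite ?ge_min ?le_max ?lexx ?orbT// ltW.
apply: (eq_trans (esym (E0 t x _ (csm_psi t0) tM))).
rewrite Et; have C1 := @csm_psi R N 1 ltr01.
have Bx z: nrm z<=nrm x->nball z 1 `<=` bball M.
 by move=> zx; apply: nball_bball; exact: Mx.
have -> : conv (bball M) (fun=> 1) (psi 1) x = conv (bball M) (fun=> 1) (psi 1) 0.
 apply/eqP; rewrite -subr_eq0 -normr_le0.
 have := @mvt_box _ _ (conv (bball M) (fun=> 1) (psi 1)) 0 x (fun=> 0) 0 _.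
 rewrite mul0r big1; last by move=> i _; rewrite mul0r.
 rewrite subr0; apply=>z i zx.
 have zx': nrm z<=nrm x.
  by apply: nrm_mono=>j; have:=zx j; rewrite !mxE !subr0.
 have D:=is_derive_conv oB bB z L1 C1.1 (csm_bdd C1) (csm_bdd (csm_pderiv i C1)).
 rewrite (Int_dcsm0 i oB bB C1 (Bx z zx')) oppr0 in D.
 by split; [case: D|rewrite subr0 /pderiv derive_val normr0].
have Cp := @csm_rk R N N _ 1 prof_ps0 ltr01.
rewrite /conv (@eq_Int _ _ _ _ (fun y=>(kc N:R)^-1*(1 * rk N ps0 1 (y-0)))); last first.
 by move=> y _; rewrite /rk PsE; ring.
rewrite (IntZ oB); last exact: conv_csm_I1 L1 Cp.
rewrite -/(conv (bball M) (fun=> 1) (rk N ps0 1) 0) (E0 1 0 _ Cp M1).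
under eq_integral do rewrite subr0.
exact: kE.
Qed.

Lemma Int_psi O (t:R) x : open O->bounded_set O->0<t->nball x t `<=` O ->
 Int O (fun y=>psi t (y-x)) = 1.
by move=> oO bO t0 B; rewrite (integral_csm oO bO (csm_psi t0) B) integral_psi. Qed.

End normalization.

Section mollification.
Context {R : realType} {N : nat} (O:set 'rV[R]_N).
Hypotheses (oO:open O) (bO:bounded_set O).
Notation rV := 'rV[R]_N.
Notation leb := (lebesgue_rV R N).
Notation Int := (Int O).
Notation I1 := (I1 O).
Notation L2 := (L2 O).
Notation tf := (test_function O).
Notation conv := (conv O).
Notation psi t := (rk N (Ps N) t : rV -> R).
Implicit Types (f h u v w phi eta a k:rV->R) (x y z:rV).

Lemma EFin_Int f : I1 f->(Int f)%:E = (\int[leb]_(x in O) (f x)%:E)%E.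
by move=> If; rewrite -[RHS]fineK//; exact: (integrable_fin_num (mO oO) If). Qed.

Lemma measurable_diff_fun k : continuous k->measurable_fun setT (fun z:rV * rV=>k (z.2-z.1)).
move=> ck; apply: (measurableT_comp (continuous_measurable_rV ck)).
apply: measurable_fun_rVP=>i; under eq_fun do rewrite !mxE.
apply: measurable_funB.
 exact: (measurableT_comp (measurable_coord i) measurable_snd).
exact: (measurableT_comp (measurable_coord i) measurable_fst).
Qed.

Lemma conv_cont t u k : L2 u->csm t k->continuous (conv u k).
move=> Lu C x; apply/continuous_nrmP=>e e0.
have [B HB] : exists B : R, forall i z, `|pderiv i k z| <= B.
 have /choice[c Hc] : forall i, exists c : R, forall z, `|pderiv i k z| <= c.
  by move=> i; have [c _ Hc]:=csm_bdd (csm_pderiv i C); exists c.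
 exists (\sum_i `|c i|)=>i z; apply: (le_trans (Hc i z)); rewrite (bigD1 i)//=.
 by apply: (le_trans (ler_norm _)); rewrite lerDl sumr_ge0.
pose M := `|B| * N%:R*Int (fun y => `|u y|)+1.
have M0: 0<M by rewrite ltr_wpDl// !mulr_ge0// Int_ge0.
exists (e/M); first by rewrite divr_gt0.
move=> y yx; have HB' i z: `|pderiv i k z| <= `|B| by apply: le_trans (HB i z) (ler_norm _).
have:=conv_lip oO bO y x Lu C.1 (csm_bdd C) HB'=>h.
apply: (le_lt_trans h); rewrite ltr_pdivlMr// in yx.
apply: le_lt_trans yx; rewrite /M mulrDr mulr1.
rewrite (_:_*Int _ = nrm (y-x)*(`|B| * N%:R*Int (fun y => `|u y|))) ?lerDl ?nrm_ge0//.
by rewrite !mulrA; congr (_ * _); rewrite mulrC mulrA.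
Qed.

Lemma conv_L2 t u k : L2 u->csm t k->L2 (conv u k).
move=> Lu C; have [B B0 HB]:=csm_bdd C.
apply: (L2_bounded oO bO (M:=B*Int (fun y => `|u y|))).
 by apply: (continuous_on_measurable oO)=>x _; exact: conv_cont Lu C x.
move=> x _; have Iu:=L2_I1 oO bO Lu; rewrite -(IntZ oO _ (I1_norm oO Iu)).
apply: (Int_abs_le oO); first exact: I1_meas (conv_csm_I1 oO bO x Lu C).
 exact: (I1Z oO _ (I1_norm oO Iu)).
by move=> y _; rewrite normrM mulrC ler_wpM2r.
Qed.

(** Tonelli for the zero extension of w: by evenness the integral in x of psi_t(y - x) over the
    whole space is 1, and restricting x to O only decreases it. *)
Lemma conv_psi_L1 (t:R) w : L2 w->(forall x, O x->0<=w x)->0<t ->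
 Int (conv w (psi t))<=Int w.
move=> Lw w0 t0; have C := @csm_psi R N t t0; have Iw:=L2_I1 oO bO Lw.
have mO:=mO oO.
pose F (z:rV * rV) : \bar R:=(((cst 1:rV->R) \_ O) z.1*((w \_ O) z.2 * psi t (z.2-z.1)))%:E.
have wO y: 0<=(w \_ O) y by rewrite patchE; case: ifP => // /set_mem/w0.
have oneO y: 0<=((cst 1:rV->R) \_ O) y by rewrite patchE; case: ifP.
have F0 (z:rV * rV) : (0<=F z)%E by rewrite lee_fin; apply: mulr_ge0 => //; apply: mulr_ge0 => //; exact: psi_ge0.
have mF: measurable_fun setT F.
 apply/measurable_EFinP; apply: measurable_funM.
  apply: (measurableT_comp _ measurable_fst).
  by apply/(measurable_restrictT _ mO); exact: measurable_cst.
 apply: measurable_funM; last exact: measurable_diff_fun (sm_cont C.1).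
 apply: (measurableT_comp _ measurable_snd).
 by apply/(measurable_restrictT _ mO); exact: I1_meas Iw.
have in1 x: (\int[leb]_y F (x, y))%E = ((conv w (psi t) \_ O) x)%:E.
 rewrite /F patchE/=; case: ifP=>Ox; last first.
  under eq_integral do rewrite patchE Ox mul0r.
  by rewrite integral0.
 under eq_integral do rewrite patchE Ox mul1r.
 have Icx:=conv_csm_I1 oO bO x Lw C; rewrite /conv_on (EFin_Int Icx).
 rewrite [RHS]integral_mkcond; apply: eq_integral=>y _; rewrite !patchE; case: ifP => //.
 by rewrite mul0r.
have Ip y: leb.-integrable setT (EFin \o (fun x=>psi t (x-y))).
 have Cs: continuous (fun x=>psi t (x-y)) by exact/sm_cont/sm_shift/C.1.
 apply: (continuous_supp_integrable (M:=t+nrm y) Cs)=>x tx; apply: C.2.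
 have:=nrmB_ge x y; lra.
have in2 y: (\int[leb]_x F (x, y)<=((w \_ O) y)%:E)%E.
 have E1: (\int[leb]_x (psi t (x-y))%:E = 1)%E.
  rewrite -[LHS]fineK; first by rewrite integral_psi.
  exact: (integrable_fin_num measurableT (Ip y)).
 have -> : ((w \_ O) y)%:E = (\int[leb]_x ((w \_ O) y * psi t (x-y))%:E)%E.
  under [RHS]eq_integral do rewrite EFinM.
  rewrite integralZl//; last exact: Ip.
  by rewrite E1 mule1.
 have p1: forall x : rV, [set: rV] x->(0<=F (x, y))%E by move=> x _; exact: F0.
 have p2: measurable_fun [set: rV] (fun x=>F (x, y)):=measurable_fun_pair1 y mF.
 have p3: measurable_fun [set: rV] (fun x=>((w \_ O) y * psi t (x-y))%:E).
  apply/measurable_EFinP; apply: measurable_funM; first exact: measurable_cst.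
  by have /integrableP[/measurable_EFinP]:=Ip y.
 apply: (ge0_le_integral leb measurableT p1 p2 p3)=>x _.
 rewrite lee_fin -(rk_even N (Ps N) t (x-y)) opprB patchE.
 have h0: 0<=(w \_ O) y * psi t (y-x) by apply: mulr_ge0; [exact: wO|exact: psi_ge0].
 by case: ifP=>_; [rewrite mul1r|rewrite mul0r].
have Ic: I1 (conv w (psi t)) by exact: (L2_I1 oO bO (conv_L2 Lw C)).
rewrite -lee_fin EFin_Int// EFin_Int//.
rewrite integral_mkcond [leRHS]integral_mkcond.
have -> : (\int[leb]_x ((fun x=>(conv w (psi t) x)%:E) \_ O) x = \int[leb]_x \int[leb]_y F (x, y))%E.
 by apply: eq_integral=>x _; rewrite in1 !patchE; case: ifP.
rewrite (fubini_tonelli F mF F0).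
have p1: forall y : rV, [set: rV] y->(0 <= \int[leb]_x F (x, y))%E by move=> y _; apply: integral_ge0.
have p2: measurable_fun [set: rV] (fun y => \int[leb]_x F (x, y))%E by exact: measurable_fun_fubini_tonelli_G.
have p3: measurable_fun [set: rV] ((fun x=>(w x)%:E) \_ O).
 by apply/(measurable_restrictT _ mO); apply/measurable_EFinP; exact: I1_meas Iw.
apply: (ge0_le_integral leb measurableT p1 p2 p3)=>y _.
by apply: (le_trans (in2 y)); rewrite !patchE; case: ifP.
Qed.

Lemma tf_pderiv_bdd phi : tf phi->exists2 C : R, 0<=C & forall i x, `|pderiv i phi x| <= C.
move=> T; have [C C0 HC]:=sm_pderiv_bounded bO (tf_sm T); exists C => // i x.
have [Ox|nOx]:=pselect (O x); first exact: HC.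
by rewrite (tf_out (tf_pderiv i T) nOx) normr0.
Qed.

Lemma tf_lip phi : tf phi->exists2 C : R, 0<=C & forall x y, `|phi y-phi x| <= C * nrm (y-x).
move=> T; have [C C0 HC]:=tf_pderiv_bdd T; exists (C*N%:R); first by rewrite mulr_ge0.
by move=> x y; rewrite -mulrA; exact: lip_of_pderiv (tf_sm T) HC y x.
Qed.

Lemma conv_psi_lip phi : tf phi->exists2 C : R, 0<=C & forall x (t:R), 0<t ->
 `|conv phi (psi t) x-phi x| <= C * t.
move=> T; have [C C0 HC]:=tf_lip T; exists C => // x t t0.
have [K HK]:=(bounded_nrmP O).1 bO.
pose M := `|K| + nrm x+t+1.
have M1: nrm x+t<M by rewrite /M; have:=normr_ge0 K; lra.
have OM: O `<=` bball M.
 move=> y /HK h; rewrite /bball/= /M; have:=ler_norm K; have:=nrm_ge0 x; lra.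
have oB := @open_bball R N M; have bB := @bounded_bball R N M; have Cp := @csm_psi R N t t0.
have S:=tf_sm T.
have TO: tf (fun y=>phi y * psi t (y-x)) by apply: tfMr => //; exact: sm_shift Cp.1.
have TB: test_function (bball M) (fun y=>phi y * psi t (y-x)).
 by case: TO=>q1 q2 q3; split=> //; exact: subset_trans OM.
have Ip: I1_on (bball M) (fun y=>psi t (y-x)).
 by apply: (L2_I1 oB bB); apply: (sm_L2 oB bB); exact: sm_shift Cp.1.
have -> : conv phi (psi t) x-phi x = Int_on (bball M) (fun y=>phi y * psi t (y-x)-phi x * psi t (y-x)).
 rewrite (IntB oB); last 2 first.
 - exact: (L2_I1 oB bB (tf_L2 oB bB TB)).
 - exact: (I1Z oB).
 by rewrite (IntZ oB)// (Int_psi oB bB t0 (nball_bball M1)) mulr1 /conv_on (tf_Int TO) (tf_Int TB).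
have -> : C * t = Int_on (bball M) (fun y=>C * t * psi t (y-x)).
 by rewrite (IntZ oB)// (Int_psi oB bB t0 (nball_bball M1)) mulr1.
apply: (Int_abs_le oB).
- apply: (@sm_meas _ _ (bball M)); apply: smB; apply: smM => //; try exact: sm_shift Cp.1.
 exact: sm_cst.
- exact: (I1Z oB).
- move=> y _; rewrite -mulrBl normrM [`|psi t _|]ger0_norm ?psi_ge0//.
 have [ty|yt]:=leP t (nrm (y-x)); first by rewrite Cp.2// !mulr0.
 rewrite ler_wpM2r ?psi_ge0//; apply: (le_trans (HC x y)); rewrite ler_wpM2l// ltW//.
Qed.

(** A test function close to u is moved by O(t) under mollification ([conv_psi_lip]), and
    [conv_psi_L1] controls what happens to the remainder. *)
Lemma conv_psi_cvg u g (e:R) : H O u g->0<e->exists2 d : R, 0<d & forall t, 0<t->t<d ->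
 Int (fun x => `|conv u (psi t) x-u x|)<=e.
move=> [Lu _ Hu] e0; pose V:=Num.sqrt (vol O).
have V0: 0<=V:=sqrtr_ge0 _.
pose e1:=e/(4*(V+1)); have e10: 0<e1 by rewrite divr_gt0// mulr_gt0// ltr_wpDl.
have [phi T [p1 _]]:=Hu e1 e10.
have [C C0 HC]:=conv_psi_lip T; have Lp:=tf_L2 oO bO T.
have vO:=vol_ge0 O.
pose d:=e/(4*(C * vol O+1)).
have d0: 0<d by rewrite divr_gt0// mulr_gt0// ltr_wpDl// mulr_ge0.
exists d => // t t0 td; have Cp := @csm_psi R N t t0.
have Ld: L2 (fun x=>phi x-u x):=L2B oO Lp Lu.
pose w x := `|phi x-u x|.
have Lw: L2 w:=L2_norm oO Ld.
have Iw: Int w<=e1*V.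
 have:=Int_n2 oO bO Lw; have:=ler_norm (Int w); rewrite n2_norm=>q1 q2.
 apply: (le_trans q1); apply: (le_trans q2); rewrite ler_wpM2r// ltW//.
have Lcu:=conv_L2 Lu Cp; have Lcp:=conv_L2 Lp Cp; have Lcw:=conv_L2 Lw Cp.
have Icw:=L2_I1 oO bO Lcw; have Iww:=L2_I1 oO bO Lw.
have Ict: I1 (fun=> C * t) by exact: I1_cst.
have I2:=I1D oO Ict Iww; have I3: I1 (fun x=>conv w (psi t) x+(C * t+w x)):=I1D oO Icw I2.
apply: (@le_trans _ _ (Int (fun x=>conv w (psi t) x+(C * t+w x)))).
 apply: (Int_le oO) => //.
  by apply: (I1_norm oO); apply: (L2_I1 oO bO); exact: L2B.
 move=> x Ox.
 have A1: `|conv u (psi t) x-conv phi (psi t) x| <= conv w (psi t) x.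
  have Iwx:=conv_csm_I1 oO bO x Lw Cp; have Iu:=conv_csm_I1 oO bO x Lu Cp; have Iph:=conv_csm_I1 oO bO x Lp Cp.
  rewrite /conv_on -(IntB oO Iu Iph); apply: (Int_abs_le oO).
  - exact: I1_meas (I1B oO Iu Iph).
  - exact: Iwx.
  - by move=> y _; rewrite -mulrBl normrM distrC [`|psi t _|]ger0_norm ?psi_ge0.
 have A2:=HC x t t0.
 rewrite /w (_:conv u (psi t) x-u x = (conv u (psi t) x-conv phi (psi t) x)+(conv phi (psi t) x-phi x)+(phi x-u x)); last by ring.
 have B1:=ler_normD (conv u (psi t) x-conv phi (psi t) x+(conv phi (psi t) x-phi x)) (phi x-u x).
 have B2:=ler_normD (conv u (psi t) x-conv phi (psi t) x) (conv phi (psi t) x-phi x).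
 by apply: (le_trans B1); rewrite [leRHS]addrA; apply: lerD => //; apply: (le_trans B2); exact: lerD.
rewrite (IntD oO Icw I2) (IntD oO Ict Iww) (Int_cst oO).
have J1: Int (conv w (psi t))<=Int w by exact: (conv_psi_L1 Lw (fun x _=>normr_ge0 _) t0).
have J2: C * t * vol O<=e/4.
 rewrite mulrAC; apply: (@le_trans _ _ ((C * vol O+1) * d)).
  by apply: ler_pM; rewrite ?mulr_ge0 ?(ltW t0)// ?lerDl// ltW.
 by rewrite /d le_eqVlt; apply/orP; left; apply/eqP; field; rewrite gt_eqF// ltr_wpDl// mulr_ge0.
have J3: e1*V<=e/4.
 apply: (@le_trans _ _ (e1*(V+1))); first by rewrite ler_wpM2l ?(ltW e10)// lerDl.
 by rewrite /e1 le_eqVlt; apply/orP; left; apply/eqP; field; rewrite gt_eqF// ltr_wpDl.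
move: J1 J2 J3 Iw e0; clear; lra.
Qed.

Lemma Int_le_ae u (K:R) : L2 u ->
 (forall e:R, 0<e->Int (fun x=>Num.max (u x-K) 0)<=e)->ae_in O (fun x=>u x<=K).
move=> Lu He; pose f x:=Num.max (u x-K) 0.
have Luk: L2 (fun x=>u x-K) by apply: (L2B oO) => //; exact: L2_cst.
have f0 x: O x->0<=f x by rewrite le_max lexx orbT.
have Lf: L2 f.
 apply: (L2_le oO _ Luk); first by apply: measurable_maxr => //; exact: L2_meas Luk.
 by move=> x _; rewrite /f; case: (leP (u x-K) 0) => // _; rewrite normr0.
have If:=L2_I1 oO bO Lf.
have E0: Int f = 0.
 by apply: (@eq0_small _ _ 1)=>e e0; rewrite mul1r ger0_norm ?He// Int_ge0.
have:=Int_ae0 oO If f0 E0; apply: ae_in_impl=>x _ fx.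
by rewrite -subr_le0 -fx /f le_max lexx.
Qed.

Lemma ae_bound_of_conv u g (K:R) : H O u g ->
 (forall e:R, 0<e->exists2 t : R, 0<t<e & forall x, O x->conv u (psi t) x<=K) ->
 ae_in O (fun x=>u x<=K).
move=> Hu HK; have [Lu _ _]:=Hu; apply: Int_le_ae => // e e0.
have [d d0 Hd]:=conv_psi_cvg Hu e0; have [t /andP[t0 td] Ht]:=HK d d0.
apply: le_trans (Hd t t0 td).
have Ld: L2 (fun x=>conv u (psi t) x-u x) by apply: (L2B oO) => //; exact: conv_L2 Lu (csm_psi t0).
have Luk: L2 (fun x=>u x-K) by apply: (L2B oO) => //; exact: L2_cst.
apply: (Int_le oO); [|exact: (I1_norm oO (L2_I1 oO bO Ld))|].
 apply: (L2_I1 oO bO); apply: (L2_le oO _ Luk); first by apply: measurable_maxr => //; exact: L2_meas Luk.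
 by move=> x _; case: (leP (u x-K) 0) => // _; rewrite normr0.
move=> x Ox; rewrite ge_max normr_ge0 andbT distrC; apply: le_trans (ler_norm _).
by rewrite lerD2l lerN2 Ht.
Qed.

End mollification.

Lemma derive_ge0_le {R : realType} (g dg:R->R) (a b:R) : a<=b ->
 (forall s, a<=s<=b->is_derive s (1:R) g (dg s)) ->
 (forall s, a<=s<=b->0<=dg s)->g a<=g b.
rewrite le_eqVlt => /predU1P[<-//|ab dgE dg0].
have [s| |c] := @MVT R g dg a b ab.
- by rewrite in_itv/= => /andP[/ltW sa /ltW sb]; apply: dgE; rewrite sa.
- apply: derivable_within_continuous=>s; rewrite in_itv/= => sab.
 by have:=dgE _ sab => ?; apply: ex_derive.
- rewrite in_itv/= => /andP[/ltW ac /ltW cb] E.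
 by rewrite -subr_ge0 E mulr_ge0 ?subr_ge0 ?(ltW ab)// dg0 ?ac.
Qed.

(** * Morrey bounds and the supremum estimate *)

Section sup_bound.
Context {R : realType} {N : nat} (O:set 'rV[R]_N).
Hypotheses (oO:open O) (bO:bounded_set O).
Notation rV := 'rV[R]_N.
Notation Int := (Int O).
Notation I1 := (I1 O).
Notation L2 := (L2 O).
Notation H := (H O).
Notation Dg := (Dg O).
Notation conv := (conv O).
Notation wsol := (wsol O).
Notation theta t := (rk N (Th N) t : rV -> R).
Notation psi t := (rk N (Ps N) t : rV -> R).
Implicit Types (f h u v w phi eta a k:rV->R) (x y z:rV).

(** The mass of |f| on a ball of radius t is O(t^(N-1+al)). Convolution of f with a kernel of size
    t^-N is then O(t^(al-1)), and t times it, the rate of change of the means of u in the scale, is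
    O(t^al). *)
Definition morrey f (F al:R):=forall x (t:R), 0<t<=1 ->
 Int (fun y => \1_(nball x t) y * `|f y|)<=F * t^+N * t `^ (al-1).

Lemma indic_I1 x (t:R) f : L2 f->I1 (fun y => \1_(nball x t) y * `|f y|).
move=> Lf; apply: (I1M oO (M:=1)).
- exact: (measurable_indic (measurable_nball x t)).
- by move=> y _; rewrite indicE; case: (_ \in _); rewrite ?normr1 ?normr0.
- exact: (I1_norm oO (L2_I1 oO bO Lf)).
Qed.

Lemma morrey_ge0 f F al : morrey f F al->0<=F.
move=> /(_ 0 1); rewrite ltr01 lexx expr1n powR1 !mulr1 => /(_ isT); apply: le_trans.
by apply: Int_ge0=>y _; rewrite mulr_ge0.
Qed.

Lemma morrey_abs f F al : morrey f F al->morrey (fun x => `|f x|) F al.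
by move=> M x t t01; apply: le_trans (M x t t01); under eq_Int do rewrite normr_id. Qed.

Lemma Int_nball x (t:R) : 0<=t->Int (fun y => \1_(nball x t) y)<=(2 * t)^+N.
move=> t0; rewrite -lee_fin; apply: le_trans (lebesgue_nball x t0).
have I: I1 (fun y => \1_(nball x t) y).
 apply: (I1_bounded oO bO (M:=1)); first exact: (measurable_indic (measurable_nball x t)).
 by move=> y _; rewrite indicE; case: (_ \in _); rewrite ?normr1 ?normr0.
rewrite (EFin_Int oO I) integral_indic; [|exact: mO|exact: measurable_nball].
by apply: le_measure; rewrite ?inE; [apply: measurableI; [exact: measurable_nball|exact: mO]|exact: measurable_nball|].
Qed.

Lemma morrey_bounded f (K al:R) : L2 f->al<=1->(forall x, O x -> `|f x| <= K)->0<=K->morrey f (K*2^+N) al.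
move=> Lf al1 fK K0 x t /andP[t0 t1].
have P: 1<=t `^ (al-1).
 have := @ger_powR R t _ (al-1) 0; rewrite powRr0; apply; first by rewrite t0.
 by rewrite subr_le0.
apply: (@le_trans _ _ (K*(2 * t)^+N)); last first.
 by rewrite exprMn mulrA -[leLHS]mulr1 ler_wpM2l// !mulr_ge0// exprn_ge0// ltW.
have I: I1 (fun y => \1_(nball x t) y).
 apply: (I1_bounded oO bO (M:=1)); first exact: (measurable_indic (measurable_nball x t)).
 by move=> y _; rewrite indicE; case: (_ \in _); rewrite ?normr1 ?normr0.
apply: (@le_trans _ _ (Int (fun y=>K * \1_(nball x t) y))).
 by apply: (Int_le oO); [exact: indic_I1|exact: (I1Z oO)|move=> y Oy; rewrite mulrC ler_wpM2r// fK].
by rewrite (IntZ oO)// ler_wpM2l// Int_nball// ltW.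
Qed.

Lemma morreyD f h F1 F2 al : L2 f->L2 h->morrey f F1 al->morrey h F2 al ->
 morrey (fun x=>f x+h x) (F1+F2) al.
move=> Lf Lh M1 M2 x t t01; rewrite -mulrA mulrDl !mulrA.
apply: le_trans (lerD (M1 x t t01) (M2 x t t01)).
have I1':=indic_I1 x t Lf; have I2:=indic_I1 x t Lh.
rewrite -(IntD oO I1' I2); apply: (Int_le oO); [exact/indic_I1/(L2D oO)|exact: (I1D oO)|].
by move=> y _; rewrite -mulrDr ler_wpM2l// ler_normD.
Qed.

Lemma morrey_le f h F al : L2 f->L2 h->(forall x, O x -> `|f x| <= `|h x|)->morrey h F al->morrey f F al.
move=> Lf Lh fh M x t t01; apply: le_trans (M x t t01).
by apply: (Int_le oO); [exact: indic_I1|exact: indic_I1|move=> y Oy; rewrite ler_wpM2l// fh].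
Qed.

Lemma morreyZ f F al (c:R) : L2 f->morrey f F al->morrey (fun x=>c * f x) (`|c| * F) al.
move=> Lf M x t t01; have:=M x t t01=>h.
have -> : Int (fun y => \1_(nball x t) y * `|c * f y|) = `|c| * Int (fun y => \1_(nball x t) y * `|f y|).
 by rewrite -(IntZ oO)//; [apply: eq_Int=>y _; rewrite normrM mulrCA|exact: indic_I1].
by rewrite -!mulrA ler_wpM2l// mulrA.
Qed.

Lemma conv_morrey f F al (t B:R) k x : L2 f->morrey f F al->0<t<=1->csm t k ->
 (forall z, `|k z| <= B) -> `|conv f k x| <= B*(F * t^+N * t `^ (al-1)).
move=> Lf M t01 C HB; have B0: 0<=B:=le_trans (normr_ge0 _) (HB 0).
apply: (@le_trans _ _ (B*Int (fun y => \1_(nball x t) y * `|f y|))); last by rewrite ler_wpM2l// M.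
have Ii:=indic_I1 x t Lf; have Ic:=conv_csm_I1 oO bO x Lf C.
rewrite -(IntZ oO _ Ii); apply: (Int_abs_le oO); [exact: I1_meas Ic|exact: (I1Z oO)|].
move=> y _; rewrite normrM indicE; have [yB|yB]:=pselect (nball x t y).
 by rewrite mem_set// mul1r mulrC ler_wpM2r.
rewrite memNset// mul0r mulr0 C.2 ?normr0 ?mulr0// leNgt; apply/negP=>h; apply: yB; exact: ltW.
Qed.

Lemma powR_t (t al:R) : 0<t<=1->0<al->t * t `^ (al-1) = t `^ al /\ t `^ al<=1.
move=> /andP[t0 t1] a0; split; first by rewrite mulr_powRB1// ltW.
by have := @ger_powR R t _ 0 al; rewrite powRr0; apply; rewrite ?t0// ltW.
Qed.

Lemma H_pos u g (e:R) : 0<e->H u g ->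
 H (fun x=>pospart e (u x)) (fun i x=>derive1 (pospart e) (u x) * g i x).
move=> e0 Hu; have HT:=H_pospart oO bO e0 Hu (sm_cst 0) (okbar_le0 oO bO Hu (fun _ _=>lexx 0)).
refine (H_eq oO bO HT _ _)=>[x _|i x _]; first by rewrite addr0.
by rewrite pderiv_cst !addr0.
Qed.

Lemma H_dpos u g eta (e:R) : 0<e->H u g->sm eta ->
 H (fun x=>eta x * derive1 (pospart e) (u x))
  (fun i x=>pderiv i eta x * derive1 (pospart e) (u x)+eta x*(derive1 (derive1 (pospart e)) (u x) * g i x)).
move=> e0 Hu S; have [S1 _]:=smooth1_derive1 (smooth1_pospart e).
have [B HB]:=d3pospart_norm e0.
have HT:=H_chain oO bO Hu (sm_cst 0) S S1 (fun s=>d2pospart_norm s e0) HB.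
have Z:=dpospart_nonpos e0 (lexx 0).
refine (H_eq oO bO HT _ _)=>[x _|i x _]; first by rewrite addr0 Z subr0.
have P0: pderiv i (fun=> 0 : R) x = 0 by rewrite pderiv_cst.
move: (pderiv i (fun=> 0) x) (derive1 (derive1 (pospart e))) (derive1 (pospart e)) P0 Z=>p b2 b1->Z.
by rewrite !addr0 Z subr0 mulr0 subr0.
Qed.

(** Kato's inequality in smoothed form: the positive part w of u satisfies -Lap w <= kap w + kap e +
    f, tested with theta_t centred at x. The test function is theta_t times the derivative of
    [pospart] at u. *)
Lemma sub_mean_value (kap e:R) u g h f x (t:R) : 0<e->0<=kap->wsol u g h->L2 h->L2 f ->
 (forall x, O x->0<=f x) ->
 (forall x, O x -> `|h x| <= kap * `|u x| + f x)->0<t ->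
 - (kap * conv (fun x=>pospart e (u x)) (theta t) x+conv (fun x=>kap * e+f x) (theta t) x) <=
 conv (fun x=>pospart e (u x)) (lap (theta t)) x.
move=> e0 k0 [Hu Su] Lh Lf f0 hf t0; have Hw:=H_pos e0 Hu.
have [Lw Lwg _]:=Hw; have [Lu Lg _]:=Hu.
have Ct := @csm_theta R N t t0; pose eta y:=theta t (y-x).
have S: sm eta:=sm_shift x Ct.1.
have Hv:=H_dpos e0 Hu S; have Lv:=HL2 Hv; have Lvg:=HL2g Hv.
set w:=(fun x=>pospart e (u x)) in Hw Lw *.
set v:=(fun x=>eta x * _) in Hv Lv; set vg:=(fun i x=>_ + _) in Hv Lvg.
have Lkf: L2 (fun x=>kap * e+f x) by apply: (L2D oO) => //; exact: L2_cst.
have -> : conv w (lap (theta t)) x = - \sum_i Int (fun y=>derive1 (pospart e) (u y) * g i y * pderiv i eta y).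
 rewrite -sumrN /conv_on (@eq_Int _ _ O _ (fun y => \sum_i w y * pderiv i (pderiv i eta) y)); last first.
  by move=> y _; rewrite -mulr_sumr -[X in _ = w y*X]/(lap eta y) /eta (lap_shift x Ct.1).
 rewrite (Int_sum oO bO); last by move=> i; apply: (L2_mul oO Lw); apply: (sm_L2 oO bO); do 2 apply: sm_pderiv.
 by apply: eq_bigr=>i _; rewrite (H_ibp oO bO i Hw (sm_pderiv i S)).
rewrite lerN2.
have Ivg i: I1 (fun y=>g i y * vg i y):=L2_mul oO (Lg i) (Lvg i).
apply: (@le_trans _ _ (Dg g vg)).
 apply: ler_sum=>i _; apply: (Int_le oO) => //.
  by apply: (L2_mul oO (Lwg i)); apply: (sm_L2 oO bO); exact: sm_pderiv.
 move=> y _; rewrite /vg.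
 have p0: 0<=eta y by exact: theta_ge0.
 have:=d2pospart_ge0 (u y) e0.
 move: (derive1 (derive1 (pospart e)) (u y)) (derive1 (pospart e) (u y)) (pderiv i eta y) (g i y)=>a b c d a0.
 (* The extra term carries the second derivative of [pospart] and has the favourable sign, by
    convexity. *)
 have -> : d*(c * b+eta y*(a * d)) = b * d * c+eta y * a * d^+2 by ring.
 by rewrite lerDl mulr_ge0 ?sqr_ge0// mulr_ge0.
rewrite (Su _ _ Hv).
have Iw:=conv_csm_I1 oO bO x Lw Ct; have Ik:=conv_csm_I1 oO bO x Lkf Ct.
rewrite /conv_on -(IntZ oO kap Iw) -(IntD oO (I1Z oO kap Iw) Ik).
apply: (Int_le oO); [exact: L2_mul|exact: (I1D oO (I1Z oO kap Iw) Ik)|move=> y Oy].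
have p0: 0<=eta y by exact: theta_ge0.
rewrite mulrA -mulrDl -/(eta y) /v mulrCA mulrC ler_wpM2r// /w.
have hy:=hf y Oy; have d0:=dpospart_ge0 (u y) e0; have d1:=dpospart_le1 (u y) e0.
have dm:=dpospart_mul (u y) e0; have dn := @dpospart_nonpos R e (u y) e0.
have w0:=pospart_ge0 (u y) e0.
have F0: `|h y| * derive1 (pospart e) (u y)<=(kap * `|u y| + f y) * derive1 (pospart e) (u y) by rewrite ler_wpM2r.
apply: (@le_trans _ _ (`|h y| * derive1 (pospart e) (u y))); first by rewrite ler_wpM2r// ler_norm.
have [u0|u0]:=leP (u y) 0.
 by rewrite (dn u0) mulr0 (pospart_nonpos e0 u0) mulr0 add0r addr_ge0 ?mulr_ge0 ?f0// ltW.
apply: (le_trans F0); rewrite gtr0_norm//; have fy:=f0 y Oy.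
rewrite mulrDl; move: (derive1 (pospart e) (u y)) (pospart e (u y)) d0 d1 dm w0=>d w' d0 d1 dm w0.
have A1: kap * u y * d<=kap*(w'+e) by rewrite -mulrA ler_wpM2l// mulrC.
have A2: f y * d<=f y by rewrite ler_piMr.
lra.
Qed.

(** A corrected mean of the positive part is nondecreasing in the scale, so the means at small
    scales are controlled by the one at scale 1, which is bounded by the L1 norm of u. Small scales
    give the almost everywhere bound. *)
Lemma sup_bound1 (kap al:R) : 0<=kap->0<al<=1->exists2 C : R, 0<=C &
 forall u g h f F, wsol u g h->L2 h->L2 f->(forall x, O x->0<=f x)->morrey f F al ->
 (forall x, O x -> `|h x| <= kap * `|u x| + f x) ->
 forall e, 0<e->ae_in O (fun x=>u x<=C*(Int (fun x => `|u x|)+F+e)).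
move=> k0 /andP[a0 a1].
have [Kp Kp0 HKp] := @rk_bound' R N N (Ps N) (prof_Ps N).
have [Kt Kt0 HKt] := @rk_bound' R N N (Th N) (prof_Th N).
pose E:=expR kap; have E0: 0<=E by exact: expR_ge0.
have E1: 1<=E by rewrite -expR0 ler_expR.
pose C:=E*(Kp+Kt*(1+kap*2^+N))+1.
have N2: 0<=2^+N :> R by exact: exprn_ge0.
have C0: 0<=C by rewrite addr_ge0// mulr_ge0// addr_ge0// mulr_ge0// addr_ge0// mulr_ge0.
exists C => // u g h f F W Lh Lf f0 Mf hf e e0.
have [Hu Su]:=W; have [Lu Lg _]:=Hu.
have Hw:=H_pos e0 Hu; have [Lw Lwg _]:=Hw.
set w:=(fun x=>pospart e (u x)) in Hw Lw *.
have w0 x: O x->0<=w x by move=> _; exact: pospart_ge0.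
pose f' x:=kap * e+f x.
have Lc: L2 (fun=> kap * e):=L2_cst oO bO _.
have Lf': L2 f':=L2D oO Lc Lf.
have ke0: 0<=kap * e by rewrite mulr_ge0// ltW.
have Mf': morrey f' (kap * e*2^+N+F) al.
 apply: morreyD => //; apply: morrey_bounded => // x _; by rewrite ger0_norm.
set F':=kap * e*2^+N+F in Mf'.
have F0: 0<=F:=morrey_ge0 Mf.
have F'0: 0<=F' by rewrite addr_ge0// mulr_ge0.
set In:=Int (fun x => `|u x|).
have In0: 0<=In by apply: Int_ge0.
have K x (t:R) : 0<t->t<=1->conv w (psi t) x<=E*(Kp*In+Kt*F').
 move=> t0 t1; pose b:=Kt*F'.
 have b0: 0<=b by rewrite mulr_ge0.
 pose Phi (s:R):=expR (kap * s) * conv w (psi s) x+b*E * s.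
 pose dPhi (s:R):=kap * expR (kap * s) * conv w (psi s) x+expR (kap * s)*(s * conv w (lap (theta s)) x)+b*E.
 have D s: t<=s<=1->is_derive s (1:R) Phi (dPhi s).
  move=> /andP[ts s1]; have s0:=lt_le_trans t0 ts.
  have D1:=is_derive_conv_psi oO bO x Lw s0.
  have D2 := @is_derive1_comp R expR (fun r:R=>kap * r) s _ _ (is_derive_expR _) (is_derive_scale kap s).
  have D3:=is_deriveM D2 D1.
  have D4:=is_deriveD D3 (is_derive_scale (b*E) s).
  by apply: (is_derive_eq D4); rewrite /dPhi /GRing.scale/=; ring.
 have dP s: t<=s<=1->0<=dPhi s.
  move=> /andP[ts s1]; have s0:=lt_le_trans t0 ts.
  have Q:=sub_mean_value x e0 k0 W Lh Lf f0 hf s0.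
  have s01: 0<s<=1 by rewrite s0.
  have Q1: s * conv w (theta s) x<=conv w (psi s) x.
   rewrite /conv_on -(IntZ oO s (conv_csm_I1 oO bO x Lw (csm_theta s0))).
   apply: (Int_le oO); [exact: (I1Z oO s (conv_csm_I1 oO bO x Lw (csm_theta s0)))|exact: (conv_csm_I1 oO bO x Lw (csm_psi s0))|].
   move=> y Oy; rewrite mulrCA ler_wpM2l ?w0//.
   have:=theta_le_psi (y-x) s0; have:=theta_ge0 (y-x) s0.
   move: (theta s (y-x)) (psi s (y-x))=>p q p0 pq.
   by apply: le_trans pq; rewrite ler_wpM2r//; lra.
  have Q2: s * conv f' (theta s) x<=b.
   have:=conv_morrey x Lf' Mf' s01 (csm_theta s0) (fun z=>HKt s z s0)=>h1.
   have:=le_trans (ler_norm _) h1=>h2.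
   apply: (@le_trans _ _ (s*(Kt * s^-N*(F' * s^+N * s `^ (al-1))))); first by rewrite ler_wpM2l// ltW.
   have [p1 p2]:=powR_t s01 a0.
   have -> : s*(Kt * s^-N*(F' * s^+N * s `^ (al-1))) = b*(s * s `^ (al-1)).
    by rewrite /b; field; rewrite expf_neq0// gt_eqF.
   by rewrite p1 ler_piMr.
  have X0:=expR_ge0 (kap * s).
  have X1: expR (kap * s)<=E by rewrite ler_expR ler_piMr.
  have Q3: - (kap * conv w (psi s) x+b)<=s * conv w (lap (theta s)) x.
   have : s*(- (kap * conv w (theta s) x+conv f' (theta s) x))<=s * conv w (lap (theta s)) x.
    by rewrite ler_wpM2l// ltW.
   apply: le_trans; rewrite mulrN lerN2 mulrDr lerD// mulrCA ler_wpM2l//.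
  have Q4: expR (kap * s) * - (kap * conv w (psi s) x+b)<=expR (kap * s)*(s * conv w (lap (theta s)) x).
   by rewrite ler_wpM2l.
  have Q5: b * expR (kap * s)<=b*E by rewrite ler_wpM2l.
  rewrite /dPhi; move: Q4 Q5; clear; lra.
 have Mon:=derive_ge0_le t1 D dP.
 have P1: Phi 1<=E*(Kp*In+b).
  rewrite /Phi mulr1 mulr1 -/E mulrDr [b*E]mulrC lerD2r ler_wpM2l//.
  rewrite /In -(IntZ oO Kp (I1_norm oO (L2_I1 oO bO Lu))).
  apply: (Int_le oO); [exact: (conv_csm_I1 oO bO x Lw (csm_psi ltr01))|exact: (I1Z oO Kp (I1_norm oO (L2_I1 oO bO Lu)))|].
  move=> y Oy; rewrite mulrC; apply: ler_pM; rewrite ?psi_ge0 ?w0//.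
   by have:=HKp 1 (y-x) ltr01; rewrite expr1n invr1 mulr1; exact: le_trans (ler_norm _).
  exact: pospart_le.
 apply: (le_trans _ (le_trans Mon P1)); rewrite /Phi.
 have c0: 0<=conv w (psi t) x by apply: Int_ge0=>y Oy; apply: mulr_ge0; [exact: w0|exact: psi_ge0].
 have e1: 1<=expR (kap * t) by rewrite -expR0 ler_expR mulr_ge0// ltW.
 have : conv w (psi t) x<=expR (kap * t) * conv w (psi t) x by rewrite ler_peMl.
 have : 0<=b*E * t by rewrite !mulr_ge0// ltW.
 by move: (conv _ _ _)=>c; lra.
have A: ae_in O (fun x=>w x<=E*(Kp*In+Kt*F')).
 apply: (ae_bound_of_conv oO bO Hw)=>d d0; pose t:=Num.min (d/2) 1.
 have t0: 0<t by rewrite lt_min divr_gt0//= ltr01.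
 exists t; first by rewrite t0/= gt_min; apply/orP; left; lra.
 by move=> x _; apply: K => //; rewrite ge_min lexx orbT.
apply: ae_in_impl A=>x _ wx; have:=pospart_approx (u x) e0; rewrite -/(w x)=>ux.
apply: (le_trans ux); rewrite /C /F' in wx *.
have G1: 0<=E*Kp*(F+e) by rewrite !mulr_ge0 ?addr_ge0// ltW.
have G2: 0<=E*(Kt*(In+e)) by rewrite !mulr_ge0 ?addr_ge0// ltW.
have G3: 0<=E*(Kt*(kap*2^+N)*(In+F)) by rewrite !mulr_ge0 ?addr_ge0.
move: G1 G2 G3 wx In0 F0; clear; move: (2^+N) In (w x)=>p q r; clear; lra.
Qed.

Lemma wsol_lin u (g : 'I_N->rV->R) h v (k : 'I_N->rV->R) f (c:R) : wsol u g h->wsol v k f->L2 h->L2 f ->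
 wsol (fun x=>u x+c * v x) (fun i x=>g i x+c * k i x) (fun x=>h x+c * f x).
move=> [Hu Su] [Hv Sv] Lh Lf; split; first exact: (HD oO bO Hu (HZ oO bO c Hv)).
move=> z kz Hz; have [Lz Lkz _]:=Hz.
rewrite (DgDl oO c (HL2g Hu) (HL2g Hv) Lkz) (Su _ _ Hz) (Sv _ _ Hz).
by rewrite (Int_linM oO c Lh Lf Lz).
Qed.

Lemma wsol0 : wsol (fun=> 0) (fun _ _=>0) (fun=> 0).
split; first by have:=H_tf oO bO (@tf0 R N O); under [X in H _ X]eq_fun do rewrite pderiv_cst.
by move=> v k _; rewrite /Dg_on big1=>[|i _]; [|rewrite -[RHS](Int0 O)]; rewrite -?[LHS](Int0 O); apply: eq_Int=>x _; rewrite mul0r.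
Qed.

Lemma eq_wsol u g h h' : wsol u g h->(forall x, O x->h x = h' x)->wsol u g h'.
move=> [Hu Su] hh; split=> // v k Hv; rewrite (Su _ _ Hv).
by apply: eq_Int=>x Ox; rewrite hh.
Qed.

Lemma wsolZ u g h (c:R) : wsol u g h->L2 h->wsol (fun x=>c * u x) (fun i x=>c * g i x) (fun x=>c * h x).
move=> W Lh; have:=wsol_lin c wsol0 W (L2_cst oO bO 0) Lh.
rewrite (_:(fun x=>0+c * u x) = (fun x=>c * u x)); last by apply/funext=>x; rewrite add0r.
rewrite (_:(fun x=>0+c * h x) = (fun x=>c * h x)); last by apply/funext=>x; rewrite add0r.
rewrite (_:(fun i x=>0+c * g i x) = (fun i x=>c * g i x))//.
by apply/funext=>i; apply/funext=>x; rewrite add0r.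
Qed.

Lemma sup_bound (kap al:R) : 0<=kap->0<al<=1->exists2 C : R, 0<=C &
 forall u g h f F, wsol u g h->L2 h->L2 f->morrey f F al ->
 (forall x, O x -> `|h x| <= kap * `|u x| + `|f x|) ->
 forall e, 0<e->ae_in O (fun x => `|u x| <= C*(Int (fun x => `|u x|)+F+e)).
move=> k0 al01; have [C C0 HC]:=sup_bound1 k0 al01; exists C => // u g h f F W Lh Lf Mf hf e e0.
have Lf':=L2_norm oO Lf; have Mf':=morrey_abs Mf.
have A1:=HC u g h _ F W Lh Lf' (fun x _=>normr_ge0 _) Mf' hf e e0.
have hf' x: O x -> `|-1 * h x| <= kap * `|-1 * u x| + `|f x| by move=> Ox; rewrite !mulN1r !normrN hf.
have A2:=HC _ _ _ _ F (wsolZ (-1) W Lh) (L2Z oO _ Lh) Lf' (fun x _=>normr_ge0 _) Mf' hf' e e0.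
have E1: Int (fun x => `|-1 * u x|) = Int (fun x => `|u x|) by apply: eq_Int=>x _; rewrite mulN1r normrN.
rewrite E1 in A2; apply: ae_in_impl2 A1 A2=>x Ox.
by rewrite mulN1r=>h1 h2; rewrite ler_norml h1 andbT lerNl.
Qed.

End sup_bound.

(** The denominator s + e + pospart(-s) equals s + e for s >= 0 and stays above e/2 everywhere, so
    its inverse is smooth on the whole line with the bounded derivatives that [H_chain] demands. *)
Lemma smooth_recip {R : realType} (e:R) : 0<e->exists c : R->R, [/\ smooth1 c,
 forall s, 0<=s->c s = (s+e)^-1 /\ derive1 c s = - (s+e) ^- 2,
 exists B : R, forall s, `|derive1 c s| <= B & exists B : R, forall s, `|derive1 (derive1 c) s| <= B].
move=> e0; have e2: 0<e/2 by lra.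
pose D (s:R):=s+e+pospart (e/2) (- s).
pose D1 (s:R):=1-derive1 (pospart (e/2)) (- s).
pose D2 (s:R):=derive1 (derive1 (pospart (e/2))) (- s).
have DN (b:R->R) (db s:R) : is_derive (- s) (1:R) b db->is_derive s (1:R) (fun r=>b (- r)) (- db).
 move=> Db; have N1: is_derive s (1:R) (fun r:R => - r) (- 1).
  apply/is_derive1P=>r r0; exists 1 => // h _.
  by rewrite (_:_ - _ = 0) ?normr0 ?mulr_ge0 ?(ltW r0)//; ring.
 by apply: (is_derive_eq (@is_derive1_comp R b (fun r:R => - r) s _ _ Db N1)); rewrite mulrN1.
have SN: smooth1 (fun s:R => - s).
 have:=smooth1M (smooth1_cst (-1)) (@smooth1_id R); congr smooth1; apply/funext=>s; exact: mulN1r.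
have [S1 P1]:=smooth1_derive1 (smooth1_pospart (e/2)).
have [S2 P2]:=smooth1_derive1 S1.
have SD: smooth1 D.
 apply: smooth1D; first by apply: smooth1D; [exact: smooth1_id|exact: smooth1_cst].
 exact: (smooth1_comp (smooth1_pospart _) SN).
have Dge s: e/2<=D s.
 rewrite /D; have:=pospart_approx (- s) e2; lra.
have D0 s: D s != 0 by rewrite gt_eqF// (lt_le_trans e2).
have dD (s:R) : is_derive s (1:R) D (D1 s).
 have A1: is_derive s (1:R) (fun r:R=>r+e) 1.
  apply/is_derive1P=>r r0; exists 1 => // h _.
  by rewrite (_:_ - _ = 0) ?normr0 ?mulr_ge0 ?(ltW r0)//; ring.
 exact: is_deriveD A1 (DN _ _ _ (P1 (- s))).
have dD1 (s:R) : is_derive s (1:R) D1 (D2 s).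
 have A1:=is_deriveB (is_derive_cst (1:R) s (1:R)) (DN _ _ _ (P2 (- s))).
 by apply: (is_derive_eq A1); rewrite sub0r opprK.
pose c (s:R):=(D s)^-1.
have Sc: smooth1 c by exact: smooth1V.
have dc (s:R) : is_derive s (1:R) c (- (D1 s * c s^+2)).
 apply: (is_derive_eq (is_deriveV (D0 s) (dD s))).
 by rewrite /GRing.scale/= /c exprVn mulNr mulrC.
have c1E: derive1 c = fun s => - (D1 s * c s^+2).
 by apply/funext=>s; rewrite derive1E; apply: derive_val.
have dc1 (s:R) : is_derive s (1:R) (fun s => - (D1 s * c s^+2)) (- (D2 s * c s^+2)+2*D1 s^+2 * c s^+3).
 have A2:=is_deriveM (dc s) (dc s).
 have A3:=is_deriveN (is_deriveM (dD1 s) A2).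
 rewrite (_:(fun s => - (D1 s * c s^+2)) = - (D1*(c * c))); last first.
  by apply/funext=>r; rewrite /GRing.opp/= /GRing.mul/= -expr2.
 by apply: (is_derive_eq A3); rewrite (_:(c * c) s = c s * c s)// /GRing.scale/=; ring.
have c2E: derive1 (derive1 c) = fun s => - (D2 s * c s^+2)+2*D1 s^+2 * c s^+3.
 by rewrite c1E; apply/funext=>s; rewrite derive1E; apply: derive_val.
have cb s: 0<=c s<=2/e.
 rewrite invr_ge0 (le_trans (ltW e2) (Dge s))/= -[leRHS]invf_div lef_pV2 ?posrE//.
 exact: lt_le_trans (Dge s).
have D1b s: 0<=D1 s<=1.
 rewrite /D1; have:=dpospart_ge0 (- s) e2; have:=dpospart_le1 (- s) e2; lra.
have c2b s: 0<=c s^+2<=(2/e)^+2.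
 have /andP[q1 q2]:=cb s; rewrite sqr_ge0 lerXn2r ?nnegrE ?divr_ge0//; exact: ltW.
have c3b s: 0<=c s^+3<=(2/e)^+3.
 have /andP[q1 q2]:=cb s; rewrite exprn_ge0// lerXn2r ?nnegrE ?divr_ge0//; exact: ltW.
exists c; split=> //.
- move=> s s0; have Ds: D s = s+e by rewrite /D pospart_nonpos ?addr0// oppr_le0.
 split; first by rewrite /c Ds.
 by rewrite c1E /D1 dpospart_nonpos ?oppr_le0// subr0 mul1r /c Ds exprVn.
- exists ((2/e)^+2)=>s; rewrite c1E normrN.
 have:=D1b s; have:=c2b s; move: (D1 s) (c s^+2)=>p q /andP[q0 q1] /andP[p0 p1].
 by rewrite normrM !ger0_norm//; apply: le_trans q1; rewrite ler_piMl.
- exists ((e/2)^-1*6%:R*(2/e)^+2+2*(2/e)^+3)=>s; rewrite c2E.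
 have:=D1b s; have:=c2b s; have:=c3b s; have:=d2pospart_norm (- s) e2; rewrite -/(D2 s).
 move: (D1 s) (c s^+2) (c s^+3) (D2 s)=>p q r d dB /andP[r0 r1] /andP[q0 q1] /andP[p0 p1].
 apply: (le_trans (ler_normD _ _)); rewrite normrN !normrM; apply: lerD.
  by apply: ler_pM => //; rewrite ger0_norm.
 rewrite !ger0_norm//; apply: ler_pM => //; first by rewrite mulr_ge0// sqr_ge0.
 by nra.
Qed.

(** * The first eigenvalue and a non-negative eigenfunction *)

Section spectral.
Context {R : realType} {N : nat} (O:set 'rV[R]_N).
Hypotheses (oO:open O) (bO:bounded_set O).
Notation rV := 'rV[R]_N.
Notation Int := (Int O).
Notation I1 := (I1 O).
Notation L2 := (L2 O).
Notation n2 := (n2 O).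
Notation H := (H O).
Notation Dg := (Dg O).
Notation tf := (test_function O).
Notation wsol := (wsol O).
Notation rayleigh := (rayleigh O).
Implicit Types (f h u v w phi eta a:rV->R) (g k : 'I_N->rV->R) (x y z:rV).

(* Picone's identity. *)

Lemma picone (c e:R) u g h : 0<e->wsol u g h->L2 h->ae_in O (fun x=>0<=u x) ->
 ae_in O (fun x=>c*(u x+e)<=h x)->rayleigh c.
move=> e0 [Hu Su] Lh u0 hc phi T; have S:=tf_sm T; have [Lu Lg _]:=Hu.
have [b [Sb bE [B1 HB1] [B2 HB2]]]:=smooth_recip e0.
have Sp2: sm (fun x=>phi x * phi x) by exact: smM.
have T2: tf (fun x=>phi x * phi x) by exact: tfMr.
have [Sb1 _]:=smooth1_derive1 Sb.
have P2 i x: pderiv i (fun x=>phi x * phi x) x = 2 * phi x * pderiv i phi x by rewrite pderivM//; ring.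
have HT:=H_chain oO bO Hu (sm_cst 0) Sp2 Sb HB1 HB2.
have HT2:=HZ oO bO (b 0) (H_tf oO bO T2).
pose v x:=phi x^+2 * b (u x).
pose k i x:=2 * phi x * pderiv i phi x * b (u x)+phi x^+2*(derive1 b (u x) * g i x).
have Hv: H v k.
 refine (H_eq oO bO (HD oO bO HT HT2) _ _)=>[x _|i x _].
  by rewrite addr0 /v; ring.
 have P0: pderiv i (fun=> 0 : R) x = 0 by rewrite pderiv_cst.
 rewrite !P2 /k; move: (pderiv i (fun=> 0) x) P0=>p ->; rewrite !addr0; ring.
have [Lv Lk _]:=Hv; have Lgr:=tf_gr_L2 oO bO T.
have A1: Dg g k<=Dg (gr phi) (gr phi).
 apply: ler_sum=>i _; apply: (Int_ae_le oO); [exact: L2_mul|exact: L2_mul|].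
 apply: ae_in_impl u0=>x _ ux; have [b0 b1]:=bE _ ux.
 rewrite /k b1 b0 -[X in-X]exprVn /gr; move: (phi x) (pderiv i phi x) ((u x+e)^-1) (g i x)=>p d q r.
 rewrite -subr_ge0 (_:_ - _ = (d-p * q * r)^+2); [exact: sqr_ge0|ring].
apply: le_trans A1; rewrite (Su _ _ Hv) n2_sq.
have Lp:=tf_L2 oO bO T; have Ip2: I1 (fun x=>phi x^+2):=Lp.2.
rewrite -(IntZ oO c Ip2); apply: (Int_ae_le oO); [exact: (I1Z oO)|exact: L2_mul|].
apply: ae_in_impl2 u0 hc=>x _ ux hx; have [b0 _]:=bE _ ux; rewrite /v b0.
have ue: 0<u x+e by rewrite ltr_wpDl.
by rewrite [leRHS]mulrCA [leLHS]mulrC ler_wpM2l ?sqr_ge0// ler_pdivlMr.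
Qed.

Lemma exists_test : O !=set0->exists2 phi, tf phi & 0<n2 phi.
move=> [x Ox]; have /open_nrmP/(_ x Ox)[d d0 Hd]:=oO.
have d2: 0<d/2 by lra.
have C := @csm_psi R N (d/2) d2.
have B: nball x (d/2) `<=` O by move=> y; rewrite /nball/= => h; apply: Hd; lra.
have T:=tf_csm C B; exists (fun y=>rk N (Ps N) (d/2) (y-x)) => //.
rewrite lt_def n2_ge0 andbT; apply/eqP=>E.
have L:=tf_L2 oO bO T; have:=Int_n2 oO bO L.
by rewrite E mul0r (Int_psi oO bO d2 B) normr1 ler10.
Qed.

(** The set of Rayleigh constants contains a positive one by Poincare's inequality and is bounded
    above by the quotient of any one non-zero test function; the bound passes to the supremum. *)
Lemma rayleigh_sup : (0<N)%N->O !=set0->exists l : R, [/\ 0<l, rayleigh l &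
 forall c, rayleigh c->c<=l].
move=> N0 On; have [phi T n0]:=exists_test On.
have [C C0 HC]:=poincare oO bO N0.
have RC: rayleigh C^-1.
 by move=> psi Ts; rewrite mulrC ler_pdivrMr// mulrC; exact: HC (H_tf oO bO Ts).
have ub c: rayleigh c->c<=Dg (gr phi) (gr phi)/n2 phi^+2.
 by move=> Rc; rewrite ler_pdivlMr ?exprn_gt0// Rc.
have S: has_sup [set c | rayleigh c].
 by split; [exists C^-1|exists (Dg (gr phi) (gr phi)/n2 phi^+2)=>c; exact: ub].
have le_l c: rayleigh c->c<=sup [set c | rayleigh c] by move=> Rc; apply: ub_le_sup => //; exact: S.2.
exists (sup [set c | rayleigh c]); split=> //.
 by apply: lt_le_trans (le_l _ RC); rewrite invr_gt0.
move=> psi Ts; have [n1|n1]:=eqVneq (n2 psi) 0; first by rewrite n1 expr0n/= mulr0 Dg_ge0.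
have n1': 0<n2 psi^+2 by rewrite exprn_gt0// lt_def n1 n2_ge0.
rewrite -ler_pdivlMr//; apply: ge_sup=>[|c Rc]; first by exists C^-1.
by rewrite ler_pdivlMr// Rc.
Qed.

Section first_eigenvalue.
Hypotheses (N_gt0:(0<N)%N).
Variable l : R.
Hypotheses (l_gt0:0<l) (ray_l:rayleigh l) (sup_l:forall c, rayleigh c->c<=l).

(** If v <= 1/2 held almost everywhere, the right-hand side would dominate (l + s/2)(v + e), and
    Picone's identity would make l + s/2 a Rayleigh constant, against the maximality of l. *)
Lemma resolvent_one (s:R) : 0<s->s<=l->exists v g,
 [/\ wsol v g (fun x=>(l-s) * v x+s), ae_in O (fun x=>0<=v x) &
   ~ ae_in O (fun x=>v x<=2^-1)].
move=> s0 sl; have ks: l-s<l by lra.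
have Ls:=L2_cst oO bO s; have L0:=L2_cst oO bO (0:R).
have [v [g W]]:=exists_wsol oO bO N_gt0 l_gt0 ks ray_l Ls.
have [Hv _]:=W; have [Lv _ _]:=Hv.
have v0: ae_in O (fun x=>0<=v x).
 apply: (wsol_comparison oO bO l_gt0 ks ray_l L0 Ls _ W).
  by apply: (eq_wsol (wsol0 oO bO))=>x _; rewrite mulr0 addr0.
 by apply: ae_inW=>x _; exact: ltW.
exists v, g; split=> // v1.
(* The numbers below are fitted to the threshold 1/2: with c = l + s/2 and c e = s/4, the inequality
   c (v + e) <= (l - s) v + s is equivalent to s v <= s/2. *)
have Lh: L2 (fun x=>(l-s) * v x+s) by apply: (L2D oO) => //; exact: L2Z.
pose c:=l+s/2; have c0: 0<c by rewrite /c; lra.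
pose e:=(4 * c)^-1 * s; have e0: 0<e by rewrite mulr_gt0// invr_gt0 mulr_gt0.
have ce: c * e = s/4 by rewrite /e; field; rewrite gt_eqF.
have : rayleigh c.
 apply: (picone e0 W Lh v0); apply: ae_in_impl v1=>x _ vx.
 rewrite mulrDr ce /c.
 have : s * v x<=s*2^-1 by rewrite ler_wpM2l// ltW.
 lra.
by move=> /sup_l; rewrite /c; lra.
Qed.

(** Formally v = s (-Lap - l + s)^-1 1 has spectral coefficients increasing in s, so <v - v', v'> >=
    0, which is the claim. In place of a spectral decomposition, z = (-Lap - l + s)^-1 v' is tested
    against v, v' and itself: <v, v'> - |v'|^2 becomes (s - s') times Int z - <z, v'>, and that
    factor is non-negative because s |z| <= |v'|. *)
Lemma resolvent_mono (s s':R) v g v' g' : 0<s'->s'<s->s<=l ->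
 wsol v g (fun x=>(l-s) * v x+s)->wsol v' g' (fun x=>(l-s') * v' x+s') ->
 n2 (fun x=>v x-v' x)^+2<=n2 v^+2-n2 v'^+2.
move=> s'0 ss sl [Hv Sv] [Hv' Sv'].
have s0: 0<s by lra. have ks: l-s<l by lra.
have [Lv Lg _]:=Hv; have [Lv' Lg' _]:=Hv'.
have [z [gz [Hz Sz]]]:=exists_wsol oO bO N_gt0 l_gt0 ks ray_l Lv'.
have [Lz Lgz _]:=Hz; have L1:=L2_cst oO bO (1:R).
have lin (p q r:rV->R) (a:R) : L2 p->L2 q->L2 r ->
 Int (fun x=>(a * p x+q x) * r x) = a*Int (fun x=>p x * r x)+Int (fun x=>q x * r x).
 move=> Lp Lq Lr; rewrite addrC -(Int_linM oO a Lq Lp Lr); apply: eq_Int=>x _; ring.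
have cstI (a:R) r : L2 r->Int (fun x=>a * r x) = a*Int r by move=> Lr; rewrite (IntZ oO)//; exact: L2_I1.
have Lc (a:R):=L2_cst oO bO a.
have E1:=Sv _ _ Hz; rewrite (lin v (fun=> s) z _ Lv (Lc s) Lz) (cstI s z Lz) in E1.
have E2:=Sv' _ _ Hz; rewrite (lin v' (fun=> s') z _ Lv' (Lc s') Lz) (cstI s' z Lz) in E2.
have E3:=Sz _ _ Hv; rewrite (lin z v' v _ Lz Lv' Lv) in E3.
have E4:=Sz _ _ Hv'; rewrite (lin z v' v' _ Lz Lv' Lv') in E4.
have E5:=Sz _ _ Hz; rewrite (lin z v' z _ Lz Lv' Lz) in E5.
have sym (p q:rV->R) : Int (fun x=>p x * q x) = Int (fun x=>q x * p x) by apply: eq_Int=>x _; rewrite mulrC.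
have P:=rayleigh_H oO bO (ltW l_gt0) ray_l Hz.
have CS:=n2_CS oO Lv' Lz.
have sq (p:rV->R) : Int (fun x=>p x * p x) = n2 p^+2 by rewrite n2_sq; apply: eq_Int=>x _; rewrite expr2.
have Q: n2 (fun x=>v x-v' x)^+2 = n2 v^+2+n2 v'^+2-2*Int (fun x=>v' x * v x).
 rewrite !n2_sq -(IntZ oO)//; last exact: L2_mul.
 rewrite -(IntD oO Lv.2 Lv'.2) -(IntB oO).
 - by apply: eq_Int=>x _; ring.
 - exact: (I1D oO Lv.2 Lv'.2).
 - by apply: (I1Z oO); exact: L2_mul.
rewrite (DgC O g gz) in E1; rewrite (DgC O g' gz) in E2.
rewrite !sq in E4; rewrite !sq in E5; rewrite (sym v' z) in E2; rewrite (sym v' z) in E5; rewrite (sym v z) in E1.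
rewrite (sym v' z) in CS.
have N1:=n2_ge0 O z; have N2:=n2_ge0 O v'; have CS':=le_trans (ler_norm _) CS.
rewrite Q; move: E1 E2 E3 E4 E5 P CS' N1 N2 {CS Q}.
move: (Dg gz g) (Dg gz g') (Dg gz gz) (Int (fun x=>z x * v x)) (Int (fun x=>z x * v' x)) (Int z) (Int (fun x=>v' x * v x)) (n2 z) (n2 v')=>d1 d2 d3 i1 i2 i3 i4 m p E1 E2 E3 E4 E5 P CS' m0 p0.
have A2: s * m<=p.
 have [->|mn]:=eqVneq m 0; first by rewrite mulr0.
 have mp: 0<m by rewrite lt_def mn.
 rewrite -(ler_pM2r mp); lra.
have A3: s * i2<=p^+2.
 apply: (@le_trans _ _ (s*(p * m))); first by rewrite ler_wpM2l// ltW.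
 by rewrite mulrCA expr2 ler_wpM2l.
have A4: s'*(i3-i2) = p^+2-s * i2 by lra.
have A5: 0<=i3-i2 by rewrite -(pmulr_rge0 _ s'0); lra.
have : 0<=(s-s')*(i3-i2) by rewrite mulr_ge0//; lra.
lra.
Qed.

(** Both equations are tested with v - v'; the positivity assumption, itself a consequence of
    [resolvent_mono], disposes of the term in (s - s') v'. *)
Lemma resolvent_grad (s s':R) v g v' g' i : 0<s'->s'<s->s<=l ->
 wsol v g (fun x=>(l-s) * v x+s)->wsol v' g' (fun x=>(l-s') * v' x+s') ->
 0<=Int (fun x=>v' x*(v x-v' x)) ->
 n2 (fun x=>g i x-g' i x)^+2<=l * n2 (fun x=>v x-v' x)^+2+s*(n2 (fun x=>v x-v' x)*Num.sqrt (vol O)).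
move=> s'0 ss sl [Hv Sv] [Hv' Sv'] pos.
have [Lv Lg _]:=Hv; have [Lv' Lg' _]:=Hv'.
have Hw:=HB oO bO Hv Hv'; have [Lw Lgw _]:=Hw.
pose w x:=v x-v' x.
apply: (le_trans (n2_le_Dg O (fun i x=>g i x-g' i x) i)).
have Lc (a:R):=L2_cst oO bO a.
have lin (p q r:rV->R) (a:R) : L2 p->L2 q->L2 r ->
 Int (fun x=>(a * p x+q x) * r x) = a*Int (fun x=>p x * r x)+Int (fun x=>q x * r x).
 move=> Lp Lq Lr; rewrite addrC -(Int_linM oO a Lq Lp Lr); apply: eq_Int=>x _; ring.
have cstI (a:R) r : L2 r->Int (fun x=>a * r x) = a*Int r by move=> Lr; rewrite (IntZ oO)//; exact: L2_I1.
have E1:=Sv _ _ Hw; rewrite (lin v (fun=> s) w _ Lv (Lc s) Lw) (cstI s w Lw) in E1.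
have E2:=Sv' _ _ Hw; rewrite (lin v' (fun=> s') w _ Lv' (Lc s') Lw) (cstI s' w Lw) in E2.
rewrite (DgBl oO Lgw Lg Lg') E1 E2.
have Q: n2 w^+2 = Int (fun x=>v x * w x)-Int (fun x=>v' x * w x).
 rewrite n2_sq -(IntB oO); [|exact: L2_mul|exact: L2_mul].
 by apply: eq_Int=>x _; rewrite /w; ring.
have B:=Int_n2 oO bO Lw; have B':=le_trans (ler_norm _) B.
have m0:=n2_ge0 O w; have V0:=sqrtr_ge0 (vol O).
rewrite -/w in pos *; move: pos B' Q m0 V0 {E1 E2 B}.
move: (Int (fun x=>v x * w x)) (Int (fun x=>v' x * w x)) (Int w) (n2 w) (Num.sqrt _)=>i1 i2 i3 m V pos B Q m0 V0.
have C2: 0<=s'*(m*V) by pos.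
nra.
Qed.

(** The squared norms of the solutions for s_j = l/(j+1) decrease and so converge; [resolvent_mono]
    turns this into the Cauchy property and [resolvent_grad] extends it to gradients. The equation,
    the sign and a lower bound for the norm pass to the limit. *)
Lemma first_eigenfunction : exists e g, [/\ wsol e g (fun x=>l * e x), ae_in O (fun x=>0<=e x) & 0<n2 e].
pose s (j:nat):=l/j.+1%:R.
have s0 j: 0<s j by rewrite divr_gt0.
have sl j: s j<=l by rewrite ler_pdivrMr// ler_peMr ?ler1n// ltW.
have smono j j': (j<j')%N->s j'<s j.
 by move=> jj; rewrite /s ltr_pM2l// ltf_pV2 ?posrE// ltr_nat.
have small (e:R) : 0<e->exists M, forall j : nat, (M<=j)%N->s j<=e.
 move=> e0; have [M] := @ltr_add_invr R 0 (e/l) (divr_gt0 e0 l_gt0); rewrite add0r ltr_pdivlMr// mulrC=>HM.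
 exists M=>j Mj; apply: le_trans (ltW HM); rewrite ler_pM2l// lef_pV2 ?posrE// ler_nat; exact: Mj.
have /choice[v Hv'] : forall j, exists v, exists g, [/\ wsol v g (fun x=>(l-s j) * v x+s j), ae_in O (fun x=>0<=v x) &
   ~ ae_in O (fun x=>v x<=2^-1)].
 by move=> j; exact: resolvent_one (s0 j) (sl j).
have /choice[g Hv]:=Hv'.
have W j: wsol (v j) (g j) (fun x=>(l-s j) * v j x+s j) by case: (Hv j).
have HH j: H (v j) (g j):=(W j).1.
have Lv j: L2 (v j):=HL2 (HH j); have Lg j i: L2 (g j i):=HL2g (HH j) i.
pose V:=Num.sqrt (vol O); have V0: 0<=V:=sqrtr_ge0 _.
have mono j j': (j<=j')%N->n2 (fun x=>v j x-v j' x)^+2<=n2 (v j)^+2-n2 (v j')^+2.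
 rewrite leq_eqVlt => /predU1P[<-|jj]; last exact: (resolvent_mono (s0 j') (smono _ _ jj) (sl j) (W j) (W j')).
 rewrite subrr (_:n2 _ = 0) ?expr0n//; apply/eqP; rewrite -sqrf_eq0 n2_sq; apply/eqP.
 by rewrite -[RHS](Int0 O); apply: eq_Int=>x _; rewrite subrr expr0n.
have a_le j j': (j<=j')%N->n2 (v j')^+2<=n2 (v j)^+2.
 by move=> /mono; have:=sqr_ge0 (n2 (fun x=>v j x-v j' x)); lra.
have aC (e:R) : 0<e->exists K, forall j, (K<=j)%N->n2 (v K)^+2-n2 (v j)^+2<=e.
 move=> e0; pose A := [set n2 (v j)^+2 | j in [set: nat]].
 have hA: has_inf A by split; [exists (n2 (v 0%N)^+2), 0%N|exists 0=>_ [j _ <-]; exact: sqr_ge0].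
 have [_ [K _ <-] HK]:=inf_adherent e0 hA; exists K=>j Kj.
 have : inf A<=n2 (v j)^+2 by apply: ge_inf; [exact: hA.2|exists j].
 lra.
have vC (e:R) : 0<e->exists K, forall j j', (K<=j)%N->(K<=j')%N ->
 n2 (fun x=>v j x-v j' x)<=e.
 move=> e0; have [K HK]:=aC (e^+2) (exprn_gt0 2 e0); exists K=>j j'.
 wlog jj : j j'/(j<=j')%N.
  by move=> h Kj Kj'; have [q|/ltnW q]:=leqP j j'; [exact: h|rewrite n2_distC; exact: h].
 move=> Kj Kj'; rewrite -(@ler_pXn2r _ 2) ?nnegrE ?(ltW e0)//.
 have:=mono _ _ jj; have:=a_le _ _ Kj; have:=HK _ Kj'; lra.
have grC j j' i: (j<=j')%N ->
 n2 (fun x=>g j i x-g j' i x)^+2<=l * n2 (fun x=>v j x-v j' x)^+2+l*(n2 (fun x=>v j x-v j' x)*V).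
 rewrite leq_eqVlt => /predU1P[<-|jj].
  rewrite (_:n2 (fun x=>g j i x-g j i x) = 0).
   by rewrite expr0n/= addr_ge0 ?mulr_ge0 ?sqr_ge0 ?n2_ge0// ltW.
  apply/eqP; rewrite -sqrf_eq0 n2_sq; apply/eqP.
  by rewrite -[RHS](Int0 O); apply: eq_Int=>x _; rewrite subrr expr0n.
 have pos: 0<=Int (fun x=>v j' x*(v j x-v j' x)).
  have Lw: L2 (fun x=>v j x-v j' x):=L2B oO (Lv j) (Lv j').
  have E: n2 (v j)^+2 = n2 (fun x=>v j x-v j' x)^+2+n2 (v j')^+2+2*Int (fun x=>v j' x*(v j x-v j' x)).
   have I3:=L2_mul oO (Lv j') Lw.
   rewrite !n2_sq -(IntZ oO 2 I3) -(IntD oO Lw.2 (Lv j').2) -(IntD oO (I1D oO Lw.2 (Lv j').2) (I1Z oO 2 I3)).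
   by apply: eq_Int=>x _; ring.
  have:=mono _ _ (ltnW jj); lra.
 have:=resolvent_grad i (s0 j') (smono _ _ jj) (sl j) (W j) (W j') pos=>h.
 by apply: (le_trans h); rewrite lerD2l ler_wpM2r// mulr_ge0// n2_ge0.
have gC (e:R) : 0<e->exists K, forall j j', (K<=j)%N->(K<=j')%N ->
 n2 (fun x=>v j x-v j' x)<=e /\ forall i, n2 (fun x=>g j i x-g j' i x)<=e.
 move=> e0; pose d:=Num.min e (Num.min 1 (e^+2/(l+l*V))).
 have lV: 0<l+l*V by rewrite ltr_wpDr// mulr_ge0// ltW.
 have d0: 0<d by rewrite !lt_min e0 ltr01 divr_gt0// exprn_gt0.
 have [K HK]:=vC d d0; exists K=>j j' Kj Kj'.
 have dj:=HK _ _ Kj Kj'.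
 split; first by apply: le_trans dj _; rewrite ge_min lexx.
 move=> i; wlog jj : j j' Kj Kj' dj/(j<=j')%N.
  by move=> h; have [q|/ltnW q]:=leqP j j'; [exact: h|rewrite n2_distC; apply: h => //; rewrite n2_distC].
 rewrite -(@ler_pXn2r _ 2) ?nnegrE ?(ltW e0)//.
 apply: (le_trans (grC _ _ i jj)).
 have m0:=n2_ge0 O (fun x=>v j x-v j' x).
 have d1: d<=1 by rewrite !ge_min lexx orbT.
 have de: d*(l+l*V)<=e^+2 by rewrite -ler_pdivlMr// !ge_min lexx !orbT.
 move: (n2 _) m0 dj=>m m0 dj; apply: le_trans de.
 have : l * m^+2<=l * d by rewrite ler_wpM2l ?(ltW l_gt0)//; nra.
 have : l*(m*V)<=l*(d*V) by rewrite ler_wpM2l ?(ltW l_gt0)// ler_wpM2r.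
 lra.
have [e [ge [He close]]]:=H_complete oO bO HH gC.
have [Le Lge _]:=He.
(* Non-degeneracy. If v_j were small in L2, then, its constant source s_j being small as well, the
   supremum bound would give v_j <= 1/4 + 1/8 + 1/8 = 1/2, which [resolvent_one] excludes. *)
have [c c0 [K0 HK0]] : exists2 c : R, 0<c & exists K, forall j, (K<=j)%N->c<=n2 (v j).
 have al1: 0<(1:R)<=1 by rewrite ltr01 lexx.
 have [C C0 HC]:=sup_bound oO bO (ltW l_gt0) al1.
 have C1: 0<C+1 by rewrite ltr_wpDl.
 have CV: 0<C*V+1 by rewrite ltr_wpDl// mulr_ge0.
 exists (4*(C*V+1))^-1; first by rewrite invr_gt0 mulr_gt0.
 pose e1:=(8*(C+1))^-1; have e10: 0<e1 by rewrite invr_gt0 mulr_gt0.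
 have p2: 0<2^+N :> R by exact: exprn_gt0.
 have [K HK]:=small (e1/2^+N) (divr_gt0 e10 p2).
 exists K=>j Kj; rewrite leNgt; apply/negP=>nv.
 have [_ _ nle]:=Hv j; apply: nle.
 have Ls:=L2_cst oO bO (s j).
 have Lh: L2 (fun x=>(l-s j) * v j x+s j) by apply: (L2D oO) => //; exact: L2Z.
 have Mf: morrey O (fun=> s j) (s j*2^+N) 1.
  have sb x: O x -> `|s j| <= s j by rewrite gtr0_norm.
  exact: (morrey_bounded oO bO Ls (lexx 1) sb (ltW (s0 j))).
 have hf x: O x -> `|(l-s j) * v j x+s j| <= l * `|v j x| + `|s j|.
  move=> _; apply: (le_trans (ler_normD _ _)); rewrite lerD2r normrM ler_wpM2r//.
  by rewrite ger0_norm ?subr_ge0// gerBl ltW.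
 have:=HC _ _ _ _ _ (W j) Lh Ls Mf hf e1 e10; apply: ae_in_impl=>x _ hx.
 apply: (le_trans (ler_norm _)); apply: (le_trans hx).
 have B1: Int (fun x => `|v j x|)<=n2 (v j)*V.
  by have:=Int_n2 oO bO (L2_norm oO (Lv j)); rewrite n2_norm; exact: le_trans (ler_norm _).
 have B2: s j*2^+N<=e1 by rewrite -ler_pdivlMr// HK.
 have B3: C * e1<=8^-1.
  by rewrite /e1 invfM mulrCA ler_piMr ?invr_ge0// ler_pdivrMr// mul1r lerDl.
 have B4: C*(n2 (v j)*V)<=4^-1.
  have:=n2_ge0 O (v j); move: (n2 (v j)) nv=>m mv m0.
  apply: (@le_trans _ _ (m*(C*V+1))); first by rewrite mulrDr mulr1 mulrCA lerDl.
  by rewrite -ler_pdivlMr//; apply: ltW; move: mv; rewrite invfM.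
 have : C*(Int (fun x => `|v j x|)+s j*2^+N+e1)<=C*(n2 (v j)*V+e1+e1).
  by rewrite ler_wpM2l// lerD2r lerD.
 move: B3 B4; move: (C*(Int _ + _ + _))=>q; lra.
exists e, ge; split.
- apply: wsol_tf => //; first exact: L2Z.
 move=> psi T; have Lq:=tf_L2 oO bO T; have Lgq:=tf_gr_L2 oO bO T; have Hq:=H_tf oO bO T.
 apply/eqP; rewrite -subr_eq0; apply/eqP.
 pose M:=N%:R*(\sum_i n2 (gr psi i))+l * n2 psi+n2 (v 0%N) * n2 psi + `|Int psi|.
 apply: (@eq0_small _ _ M)=>ep ep0.
 have [K1 HK1]:=close ep ep0; have [K2 HK2]:=small ep ep0.
 pose j:=(K1+K2)%N; have [q1 q2]:=HK1 j (leq_addr _ _); have q3:=HK2 j (leq_addl _ _).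
 have E1:=(W j).2 _ _ Hq.
 have Ld: L2 (fun x=>v j x-e x):=L2B oO (Lv j) Le.
 have Ldg i: L2 (fun x=>g j i x-ge i x):=L2B oO (Lg j i) (Lge i).
 have L1:=L2_cst oO bO (1:R).
 have E2: Int (fun x=>((l-s j) * v j x+s j) * psi x)-Int (fun x=>l * e x * psi x) =
  l*Int (fun x=>(v j x-e x) * psi x)-s j*Int (fun x=>v j x * psi x)+s j*Int psi.
  have I1':=L2_mul oO Ld Lq; have I2:=L2_mul oO (Lv j) Lq; have I3:=L2_I1 oO bO Lq.
  rewrite -(IntZ oO l I1') -(IntZ oO (s j) I2) -(IntZ oO (s j) I3).
  rewrite -(IntB oO (I1Z oO l I1') (I1Z oO (s j) I2)) -(IntD oO (I1B oO (I1Z oO l I1') (I1Z oO (s j) I2)) (I1Z oO (s j) I3)).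
  rewrite -(IntB oO); first by apply: eq_Int=>x _; ring.
   by apply: (L2_mul oO) => //; apply: (L2D oO); [exact: L2Z|exact: L2_cst].
  by apply: (L2_mul oO) => //; exact: L2Z.
 have E3: Dg ge (gr psi)-Int (fun x=>l * e x * psi x) =
  l*Int (fun x=>(v j x-e x) * psi x)-s j*Int (fun x=>v j x * psi x)+s j*Int psi
   - Dg (fun i x=>g j i x-ge i x) (gr psi).
  by rewrite -E2 -E1 (DgBl oO Lgq (Lg j) Lge); ring.
 rewrite E3.
 have B1:=n2_CS oO Ld Lq; have B2:=n2_CS oO (Lv j) Lq; have B3:=Dg_CS oO Ldg Lgq.
 have B4: n2 (v j)<=n2 (v 0%N).
  by rewrite -(@ler_pXn2r _ 2) ?nnegrE ?n2_ge0// a_le.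
 have S0: 0 <= \sum_i n2 (gr psi i) by apply: sumr_ge0=>i _; exact: n2_ge0.
 have B5: \sum_i n2 (fun x=>g j i x-ge i x)<=N%:R * ep.
  apply: (@le_trans _ _ (\sum_(i<N) ep)); first by apply: ler_sum=>i _; exact: q2.
  by rewrite sumr_const card_ord mulr_natl.
 have nq:=n2_ge0 O psi; have nv:=n2_ge0 O (v j).
 have t1: `|l*Int (fun x=>(v j x-e x) * psi x)| <= l * n2 psi * ep.
  rewrite normrM gtr0_norm// -mulrA ler_wpM2l ?(ltW l_gt0)//; apply: (le_trans B1).
  by rewrite mulrC ler_wpM2l.
 have t2: `|s j*Int (fun x=>v j x * psi x)| <= n2 (v 0%N) * n2 psi * ep.
  rewrite normrM gtr0_norm// mulrC; apply: ler_pM; rewrite ?normr_ge0 ?(ltW (s0 j))//.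
  by apply: (le_trans B2); rewrite ler_wpM2r.
 have t3: `|s j*Int psi| <= `|Int psi| * ep.
  by rewrite normrM gtr0_norm// mulrC ler_wpM2l.
 have t4: `|Dg (fun i x=>g j i x-ge i x) (gr psi)| <= N%:R*(\sum_i n2 (gr psi i)) * ep.
  by apply: (le_trans B3); rewrite mulrAC ler_wpM2r.
 have u1:=ler_normB (l*Int (fun x=>(v j x-e x) * psi x)-s j*Int (fun x=>v j x * psi x)+s j*Int psi) (Dg (fun i x=>g j i x-ge i x) (gr psi)).
 have u2:=ler_normD (l*Int (fun x=>(v j x-e x) * psi x)-s j*Int (fun x=>v j x * psi x)) (s j*Int psi).
 have u3:=ler_normB (l*Int (fun x=>(v j x-e x) * psi x)) (s j*Int (fun x=>v j x * psi x)).
 apply: (le_trans u1); rewrite /M; move: u2 u3 t1 t2 t3 t4; clear.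
 move: (l*Int (fun x=>(v j x-e x) * psi x)) (s j*Int (fun x=>v j x * psi x)) (s j*Int psi) (Dg _ _)=>a b d f.
 rewrite !mulrDl; move: (`|a-b+d|) (`|a-b|) (`|a|) (`|b|) (`|d|) (`|f|) => *; lra.
- have A: ae_in O (fun x => - e x<=0).
  apply: (Int_le_ae oO bO); first exact: L2N.
  move=> ep ep0; pose e1:=ep/(V+1).
  have V1: 0<V+1 by rewrite ltr_wpDl.
  have e10: 0<e1 by rewrite divr_gt0.
  have [K1 HK1]:=close e1 e10; have [q1 _]:=HK1 K1 (leqnn _).
  have Ld: L2 (fun x=>v K1 x-e x):=L2B oO (Lv K1) Le.
  apply: (@le_trans _ _ (Int (fun x => `|v K1 x-e x|))).
   apply: (Int_ae_le oO).
   + have Lm: L2 (fun x => - e x-0) by apply: (L2B oO); [exact: L2N|exact: L2_cst].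
    apply: (L2_I1 oO bO); apply: (L2_le oO _ Lm); first by apply: measurable_maxr => //; exact: L2_meas Lm.
    by move=> x _; case: (leP (- e x-0) 0) => // _; rewrite normr0.
   + exact: (I1_norm oO (L2_I1 oO bO Ld)).
   + have [_ v0 _]:=Hv K1; apply: ae_in_impl v0=>x _ vx.
    by rewrite ge_max normr_ge0 andbT subr0; apply: le_trans (ler_norm _); rewrite lerBrDr addrC subrr.
  have:=Int_n2 oO bO (L2_norm oO Ld); rewrite n2_norm=>h; have h2:=le_trans (ler_norm _) h.
  apply: (le_trans h2); apply: (@le_trans _ _ (e1*(V+1))).
   by apply: ler_pM; rewrite ?n2_ge0// lerDl.
  by rewrite /e1 divfK// gt_eqF.
 by apply: ae_in_impl A=>x _; rewrite oppr_le0.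
- have c2: 0<c/2 by lra.
 have [K1 HK1]:=close _ c2; have [q1 _]:=HK1 (K0+K1)%N (leq_addl _ _).
 have q2:=HK0 (K0+K1)%N (leq_addr _ _).
 have:=n2D oO (L2B oO (Lv (K0+K1)%N) Le) Le.
 rewrite (@eq_n2 _ _ O (fun x=>v (K0+K1)%N x-e x+e x) (v (K0+K1)%N)); first by lra.
 by move=> x _; rewrite subrK.
Qed.

End first_eigenvalue.

End spectral.

(** * Differentiability criterion and interior C^1 regularity *)

Section differentiability.
Context {R : realType} {N : nat}.
Notation rV := 'rV[R]_N.
Implicit Types (x y:rV).

Definition lin_form (a : 'I_N->R) (h:rV) : R:=\sum_i a i * h ord0 i.

Fact lin_form_linear a : linear (lin_form a).
move=> c h k; rewrite /lin_form /GRing.scale/= mulr_sumr -big_split/=; apply: eq_bigr=>i _.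
by rewrite !mxE; ring.
Qed.
HB.instance Definition _ a:=GRing.isLinear.Build R rV R *:%R (lin_form a) (@lin_form_linear a).

Lemma lin_form_continuous a : continuous (lin_form a).
have E: lin_form a = fun y=>dotrv y (\row_i a i).
 by apply/funext=>y; apply: eq_bigr=>i _; rewrite mxE mulrC.
by rewrite E; exact: dot_continuous.
Qed.

Lemma differentiable_eps (f:rV->R) x (a : 'I_N->R) :
 (forall e:R, 0<e->exists2 d : R, 0<d & forall y, nrm (y-x)<d ->
  `|f y-f x - \sum_i a i*(y ord0 i-x ord0 i)| <= e * nrm (y-x)) ->
 differentiable f x /\ forall i, is_derive x (delta_mx ord0 i) f (a i).
move=> Hf.
have E: 'd f x = lin_form a :> (rV->R).
 apply: diff_unique; first exact: lin_form_continuous.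
 apply/eqaddoP=>e e0.
 have N0: 0<N%:R+1 :> R by rewrite ltr_wpDl.
 have [d d0 Hd]:=Hf (e/(N%:R+1)) (divr_gt0 e0 N0).
 apply/nbhs_nrmP; exists d => // h; rewrite subr0=>hd /=.
 have:=Hd (h+x); rewrite addrK => /(_ hd).
 rewrite (_ : \sum_i a i*((h+x) ord0 i-x ord0 i) = lin_form a h); last first.
  by apply: eq_bigr=>i _; rewrite mxE addrK.
 rewrite (_:(f \o _ - _) h = f (h+x)-(f x+lin_form a h))// opprD addrA=>B.
 apply: (le_trans B); rewrite -mulrA ler_wpM2l ?(ltW e0)// mulrC ler_pdivrMr//.
 apply: (le_trans (nrm_le_norm h)); rewrite mulrC ler_wpM2l// lerDl//.
have D: differentiable f x.
 apply/diff_locallyP; split; rewrite E; first exact: lin_form_continuous.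
 apply/eqaddoP=>e e0.
 have N0: 0<N%:R+1 :> R by rewrite ltr_wpDl.
 have [d d0 Hd]:=Hf (e/(N%:R+1)) (divr_gt0 e0 N0).
 apply/nbhs_nrmP; exists d => // h; rewrite subr0=>hd /=.
 have:=Hd (h+x); rewrite addrK => /(_ hd).
 rewrite (_ : \sum_i a i*((h+x) ord0 i-x ord0 i) = lin_form a h); last first.
  by apply: eq_bigr=>i _; rewrite mxE addrK.
 rewrite (_:(f \o _ - _) h = f (h+x)-(f x+lin_form a h))// opprD addrA=>B.
 apply: (le_trans B); rewrite -mulrA ler_wpM2l ?(ltW e0)// mulrC ler_pdivrMr//.
 apply: (le_trans (nrm_le_norm h)); rewrite mulrC ler_wpM2l// lerDl//.
split=> // i; apply: DeriveDef; first exact: diff_derivable.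
rewrite deriveE// E /lin_form (bigD1 i)//= eeE eqxx mulr1 big1 ?addr0// => j ji.
by rewrite eeE (negPf ji) mulr0.
Qed.

End differentiability.

Lemma is_derive_cmul {R : realType} (f:R->R) (c d r:R) : is_derive r (1:R) f d ->
 is_derive r (1:R) (fun s=>c * f s) (c * d).
by move=> D; exact: (@is_deriveZ _ _ _ f c r 1 _ D). Qed.

Section limits.
Context {R : realType}.
Implicit Types (P:R->Prop) (g m:R->R).

(** The intervals of centre g t and radius m t meet pairwise, so the supremum of their left end
    points lies in all of them. This is a limit as t -> 0 with its rate included. *)
Lemma limit_exists P g m : (exists t, P t) ->
 (forall s t, P s->P t->s<=t -> `|g t-g s| <= m t)->exists l : R, forall t, P t -> `|g t-l| <= m t.
move=> [t0 Pt0] Hg; pose A := [set g t-m t | t in P].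
have cmp s t: P s->P t->g t-m t<=g s+m s.
 move=> Ps Pt; have [st|/ltW ts]:=leP s t.
  have:=Hg s t Ps Pt st; have:=Hg s s Ps Ps (lexx s); rewrite subrr normr0 ler_norml; lra.
 have:=Hg t s Pt Ps ts; have:=Hg t t Pt Pt (lexx t); rewrite subrr normr0 ler_norml; lra.
have hA: has_sup A.
 by split; [exists (g t0-m t0), t0|exists (g t0+m t0)=>_ [t Pt <-]; exact: cmp].
exists (sup A)=>t Pt; rewrite ler_norml; apply/andP; split.
 have : sup A<=g t+m t by apply: ge_sup; [exact: hA.1|move=> _ [s Ps <-]; exact: cmp].
 lra.
have : g t-m t<=sup A by apply: ub_le_sup; [exact: hA.2|exists t].
lra.
Qed.

Lemma powR_small (al e:R) : 0<al->0<e->exists2 t : R, 0<t<=1 & forall s, 0<s<=t->s `^ al<=e.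
move=> a0 e0; pose t:=Num.min 1 (e `^ al^-1).
have t0: 0<t by rewrite lt_min ltr01 powR_gt0.
exists t; first by rewrite t0 ge_min lexx.
move=> s /andP[s0 st]; apply: (@le_trans _ _ ((e `^ al^-1) `^ al)).
 apply: ge0_ler_powR; rewrite ?nnegrE ?powR_ge0 ?(ltW a0) ?(ltW s0)//.
 by apply: (le_trans st); rewrite ge_min lexx orbT.
by rewrite -powRrM mulVf ?gt_eqF// powRr1// ltW.
Qed.

Lemma powR_mono (al s t:R) : 0<=al->0<=s->s<=t->s `^ al<=t `^ al.
by move=> a0 s0 st; apply: ge0_ler_powR; rewrite ?nnegrE// (le_trans s0). Qed.

End limits.

Section interior.
Context {R : realType} {N : nat} (O:set 'rV[R]_N).
Hypotheses (oO:open O) (bO:bounded_set O).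
Notation rV := 'rV[R]_N.
Notation leb := (lebesgue_rV R N).
Notation Int := (Int O).
Notation I1 := (I1 O).
Notation L2 := (L2 O).
Notation H := (H O).
Notation conv := (conv O).
Notation vsol := (vsol O).
Notation morrey := (morrey O).
Notation theta t := (rk N (Th N) t : rV -> R).
Notation psi t := (rk N (Ps N) t : rV -> R).
Implicit Types (f h u v w phi eta a k:rV->R) (x y z:rV).

Definition good x (t:R):=0<t<=1 /\ nball x t `<=` O.

Lemma good_le x s t : good x t->0<s->s<=t->good x s.
move=> [/andP[t0 t1] B] s0 st; split; first by rewrite s0 (le_trans st).
by move=> y yx; apply: B; exact: le_trans st.
Qed.

Lemma good_exists x : O x->exists t, good x t.
move=> Ox; have /open_nrmP/(_ x Ox)[d d0 Hd]:=oO.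
exists (Num.min 1 (d/2)); split; first by rewrite lt_min ltr01 divr_gt0//= ge_min lexx.
move=> y; rewrite /nball/= le_min => /andP[_ h]; apply: Hd; lra.
Qed.

(** U and G are the limits, as t -> 0, of the means of u and of their gradients, with explicit
    rates. The minus sign is that of [is_derive_conv], the kernel being evaluated at y - x. *)
Definition ireg (C al F:R) u (U:rV->R) (G : 'I_N->rV->R) :=
 forall x t, good x t -> `|conv u (psi t) x-U x| <= C*F*(t `^ al * t) /\
  forall i, `|- conv u (pderiv i (psi t)) x-G i x| <= C*F * t `^ al.

Lemma scale_estimate (al:R) : 0<al<=1->exists2 C : R, 0<=C &
 forall u f F, L2 u->L2 f->vsol u f->morrey f F al ->
 forall x s t, good x s->good x t->s<=t ->
 `|conv u (psi t) x-conv u (psi s) x| <= C*F*(t `^ al * t) /\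
 forall i, `|- conv u (pderiv i (psi t)) x - - conv u (pderiv i (psi s)) x| <= C*F * t `^ al.
move=> /andP[a0 a1].
have [K1 K10 HK1] := @rk_bound' R N N (Th N) (prof_Th N).
have [K2 K20 HK2] := @pderiv_rk_bound R N N (Th N) (prof_Th N).
exists (K1+K2/al); first by rewrite addr_ge0// divr_ge0// ltW.
move=> u f F Lu Lf V M x s t [/andP[s0 s1] Bs] [/andP[t0 t1] Bt] st.
have F0:=morrey_ge0 M.
have Br r: s<=r<=t -> [/\ 0<r, r<=1, nball x r `<=` O & 0<r<=1].
 move=> /andP[sr rt]; have r0:=lt_le_trans s0 sr; have r1:=le_trans rt t1; split=> //.
  by move=> y yx; apply: Bt; exact: le_trans rt.
 by rewrite r0.
have P0:=powR_ge0 t al.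
split.
 have D r: s<=r<=t->is_derive r (1:R) (fun t=>conv u (psi t) x) (- (r * conv f (theta r) x)).
  move=> /Br[r0 r1 B r01]; have:=is_derive_conv_psi oO bO x Lu r0.
  by rewrite (vsol_theta V r0 B) mulrN.
 have B r: s<=r<=t -> `|- (r * conv f (theta r) x)| <= K1*F * t `^ al.
  move=> srt; have [r0 r1 B r01]:=Br r srt; rewrite normrN normrM gtr0_norm//.
  have:=conv_morrey oO bO x Lf M r01 (csm_theta r0) (fun z=>HK1 r z r0)=>h.
  apply: (@le_trans _ _ (r*(K1 * r^-N*(F * r^+N * r `^ (al-1))))); first by rewrite ler_wpM2l// ltW.
  have [p1 p2]:=powR_t r01 a0.
  have -> : r*(K1 * r^-N*(F * r^+N * r `^ (al-1))) = K1*F*(r * r `^ (al-1)).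
   by field; rewrite expf_neq0// gt_eqF.
  rewrite p1 ler_wpM2l ?mulr_ge0// powR_mono ?(ltW a0) ?(ltW r0)//.
  by case/andP: srt.
 apply: (le_trans (mvt_le st D B)).
 rewrite -!mulrA; apply: ler_pM => //; rewrite ?mulr_ge0 ?subr_ge0//.
  by rewrite lerDl divr_ge0// ltW.
 by rewrite ler_wpM2l// ler_wpM2l//; lra.
move=> i; pose g r := - conv u (pderiv i (psi r)) x.
pose dg r:=r * conv f (pderiv i (theta r)) x.
have D r: s<=r<=t->is_derive r (1:R) g (dg r).
 move=> /Br[r0 r1 B r01]; have:=is_derive_conv_dpsi oO bO x i Lu r0.
 rewrite (vsol_dtheta i V r0 B) mulrN=>D.
 by apply: (is_derive_eq (is_deriveN D)); rewrite opprK.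
have B r: s<=r<=t -> `|dg r| <= K2*F * r `^ (al-1).
 move=> srt; have [r0 r1 B r01]:=Br r srt; rewrite /dg normrM gtr0_norm//.
 have:=conv_morrey oO bO x Lf M r01 (csm_pderiv i (csm_theta r0)) (fun z=>HK2 r i z r0)=>h.
 apply: (@le_trans _ _ (r*(K2 * r^-N.+1*(F * r^+N * r `^ (al-1))))); first by rewrite ler_wpM2l// ltW.
 rewrite le_eqVlt; apply/orP; left; apply/eqP; rewrite exprS.
 by field; rewrite expf_neq0 gt_eqF.
pose h r:=K2*F/al * r `^ al; pose dh r:=K2*F * r `^ (al-1).
have Dh r: s<=r<=t->is_derive r (1:R) h (dh r).
 move=> /Br[r0 _ _ _].
 have E: is_derive r (1:R) h (K2*F/al*(al * r `^ (al-1))).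
  exact: (is_derive_cmul (K2*F/al) (is_derive1_powR al r0)).
 by apply: (is_derive_eq E); rewrite /dh; field; rewrite gt_eqF.
have M1: h s-g s<=h t-g t.
 have P r: s<=r<=t->is_derive r (1:R) (fun r=>h r-g r) (dh r-dg r).
  by move=> srt; exact: is_deriveB (Dh r srt) (D r srt).
 apply: (derive_ge0_le st P)=>r srt.
 by have:=B r srt; rewrite ler_norml subr_ge0 => /andP[].
have M2: h s+g s<=h t+g t.
 have P r: s<=r<=t->is_derive r (1:R) (fun r=>h r+g r) (dh r+dg r).
  by move=> srt; exact: is_deriveD (Dh r srt) (D r srt).
 apply: (derive_ge0_le st P)=>r srt.
 by have:=B r srt; rewrite ler_norml => /andP[q1 _]; rewrite -(opprK (dg r)) subr_ge0 lerNl.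
have hs: 0<=h s by pos.
have ht: h t<=(K1+K2/al)*F * t `^ al.
 by rewrite /h ler_wpM2r// mulrDl mulrAC lerDr mulr_ge0.
have Q (p q r w E':R) : r-p<=w-q->r+p<=w+q->0<=r->w<=E' -> `|q-p| <= E'.
 by clear; move=> q1 q2 q3 q4; rewrite ler_norml; lra.
exact: Q M1 M2 hs ht.
Qed.

Lemma exists_ireg (al:R) : 0<al<=1->exists2 C : R, 0<=C &
 forall u f F, L2 u->L2 f->vsol u f->morrey f F al->exists U G, ireg C al F u U G.
move=> al01; have [C C0 HC]:=scale_estimate al01; exists C => // u f F Lu Lf V M.
have H0:=HC u f F Lu Lf V M.
have /choice[U HU] : forall x, exists l : R, forall t, good x t -> `|conv u (psi t) x-l| <= C*F*(t `^ al * t).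
 move=> x; have [gx|ngx]:=pselect (exists t, good x t); last by exists 0=>t gt; case: ngx; exists t.
 apply: (@limit_exists R (good x) (fun t=>conv u (psi t) x) (fun t=>C*F*(t `^ al * t))) => // s t gs gt st.
 exact: (H0 x s t gs gt st).1.
have /choice[G HG] : forall i, exists Gi : rV->R, forall x t, good x t -> `|- conv u (pderiv i (psi t)) x-Gi x| <= C*F * t `^ al.
 move=> i; suff /choice[Gi HGi] : forall x, exists l : R, forall t, good x t -> `|- conv u (pderiv i (psi t)) x-l| <= C*F * t `^ al by exists Gi.
 move=> x; have [gx|ngx]:=pselect (exists t, good x t); last by exists 0=>t gt; case: ngx; exists t.
 apply: (@limit_exists R (good x) (fun t => - conv u (pderiv i (psi t)) x) (fun t=>C*F*(t `^ al))) => // s t gs gt st.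
 exact: (H0 x s t gs gt st).2.
by exists U, G=>x t gt; split=> [|i]; [exact: HU|exact: HG].
Qed.

Section regular.
Variables (C al F:R) (u U:rV->R) (G : 'I_N->rV->R).
Hypotheses (C0:0<=C) (F0:0<=F) (al0:0<al) (Lu:L2 u) (reg:ireg C al F u U G).

Lemma good_near x t y : good x (2 * t)->nrm (y-x)<=t->good y t.
move=> [/andP[t0 t1] B] yx; split; first by lra.
by move=> z; rewrite /nball/= => zy; apply: B; rewrite /nball/=; have:=nrm_tri z y x; lra.
Qed.

Lemma small_scale x (e:R) : O x->0<e->exists2 t : R, 0<t & good x (2 * t) /\ C*F * t `^ al<=e.
move=> Ox e0; have [T gT]:=good_exists Ox; have [/andP[T0 T1] _]:=gT.
have CF0: 0<=C*F by rewrite mulr_ge0.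
have e1: 0<e/(C*F+1) by rewrite divr_gt0// ltr_wpDl.
have [t1 /andP[t10 _] Ht1]:=powR_small al0 e1.
pose t:=Num.min (T/2) t1; have t0: 0<t by rewrite lt_min t10 divr_gt0.
have tT: t<=T/2 by rewrite ge_min lexx.
have tt: t<=t1 by rewrite ge_min lexx orbT.
exists t => //; split; first by apply: (good_le gT); move: tT t0; lra.
have h: t `^ al<=e/(C*F+1) by apply: Ht1; rewrite t0.
apply: (@le_trans _ _ ((C*F+1)*(e/(C*F+1)))).
 by apply: ler_pM => //; rewrite ?powR_ge0// lerDl.
by rewrite mulrC divfK// gt_eqF// ltr_wpDl.
Qed.

Lemma ireg_G_cont x e i : O x->0<e->exists2 d : R, 0<d & forall z, nrm (z-x)<d -> `|G i z-G i x| <= e.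
move=> Ox e0; have e3: 0<e/3 by lra.
have [t t0 [g2 sm1]]:=small_scale Ox e3.
have Ck:=csm_pderiv i (@csm_psi R N t t0).
have cc:=conv_cont oO bO Lu Ck.
have /continuous_nrmP/(_ _ e3)[d d0 Hd]:=cc x.
have gx: good x t by apply: (good_le g2) => //; lra.
exists (Num.min d t); first by rewrite lt_min d0.
move=> z; rewrite lt_min => /andP[/Hd h1 h2].
have gz:=good_near g2 (ltW h2).
have [_ /(_ i) q1]:=reg gz; have [_ /(_ i) q2]:=reg gx.
move: h1 q1 q2 sm1; move: (conv _ _ z) (conv _ _ x) (C*F * _)=>a b c; rewrite ltr_norml !ler_norml; lra.
Qed.

(** [mvt_box] is applied to the mollified functions, whose partial derivatives near x are close to G
    x uniformly in small t; then t -> 0 with y fixed. *)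
Lemma ireg_diff x : O x->differentiable U x /\ forall i, is_derive x (delta_mx ord0 i) U (G i x).
move=> Ox; apply: differentiable_eps=>e e0.
have e1: 0<e/(N%:R+1) by rewrite divr_gt0// ltr_wpDl.
have /choice[d Hd] : forall i, exists d : R, 0<d /\ forall z, nrm (z-x)<d -> `|G i z-G i x| <= e/(N%:R+1).
 by move=> i; have [d d0 Hd]:=ireg_G_cont i Ox e1; exists d.
have [T gT]:=good_exists Ox; have [/andP[T0 T1] BT]:=gT.
have [D [D0 DT Dd]] : exists D : R, [/\ 0<D, D<=T/2 & forall i, D<=d i].
 have H (r:seq 'I_N) : exists D : R, [/\ 0<D, D<=T/2 & forall i, i \in r->D<=d i].
  elim: r=>[|j r [D [D0 DT Dr]]]; first by exists (T/2); split=> //; lra.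
  exists (Num.min D (d j)); split; first by rewrite lt_min D0 (Hd j).1.
   by rewrite ge_min DT.
  by move=> i; rewrite inE => /predU1P[->|/Dr h]; rewrite ge_min ?lexx ?h ?orbT.
 by have [D [D0 DT Dr]]:=H (enum 'I_N); exists D; split=> // i; apply: Dr; rewrite mem_enum.
exists D => // y yx.
have K0: 0<=C*F by pos.
pose Sy:=\sum_i `|y ord0 i-x ord0 i|.
have bnd: `|U y-U x - \sum_i G i x*(y ord0 i-x ord0 i)| <= e/(N%:R+1)*Sy.
 apply: (@le_small _ _ _ (Sy+2))=>ep ep0.
 have [tx tx0 [gx _]]:=small_scale Ox ep0.
 have p1: 0<Num.min ep (T/2) by rewrite lt_min ep0 divr_gt0.
 have CF1: 0<C*F+1 by rewrite ltr_wpDl.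
 have [t1 /andP[t10 t11] Ht1]:=powR_small al0 (divr_gt0 p1 CF1).
 pose t:=Num.min (T/2) t1; have t0: 0<t by rewrite lt_min t10 divr_gt0.
 have tT: t<=T/2 by rewrite ge_min lexx.
 have tt: t<=t1 by rewrite ge_min lexx orbT.
 have sm1: C*F * t `^ al<=ep.
  have h: t `^ al<=Num.min ep (T/2)/(C*F+1) by apply: Ht1; rewrite t0.
  apply: (@le_trans _ _ ((C*F+1)*(ep/(C*F+1)))).
   apply: ler_pM => //; rewrite ?powR_ge0 ?lerDl//; apply: (le_trans h).
   by rewrite ler_wpM2r ?invr_ge0 ?(ltW CF1)// ge_min lexx.
  by rewrite mulrC divfK// gt_eqF.
 have gd z: nrm (z-x)<=nrm (y-x)->good z t.
  move=> zx; split; first by rewrite t0 (le_trans tt).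
  move=> w; rewrite /nball/= => wz; apply: BT; rewrite /nball/=.
  have:=nrm_tri w z x; move: zx wz tT yx DT; lra.
 have Ck := @csm_psi R N t t0.
 have box z: (forall j, `|z ord0 j-x ord0 j| <= `|y ord0 j-x ord0 j|)->nrm (z-x)<=nrm (y-x).
  by move=> h; apply: nrm_mono=>j; rewrite !mxE.
 have M := @mvt_box R N (conv u (psi t)) x y (fun i=>G i x) (ep+e/(N%:R+1)).
 have {}M : `|conv u (psi t) y-conv u (psi t) x - \sum_i G i x*(y ord0 i-x ord0 i)| <= (ep+e/(N%:R+1))*Sy.
  apply: M=>z i /box zx.
  have Dc:=is_derive_conv oO bO z Lu Ck.1 (csm_bdd Ck) (csm_bdd (csm_pderiv i Ck)).
  split; first by case: Dc.
  rewrite /pderiv (derive_val (is_derive:=Dc)).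
  have [_ /(_ i) q1]:=reg (gd z zx).
  have q2:=(Hd i).2 z (le_lt_trans zx (lt_le_trans yx (Dd i))).
  move: q1 q2 sm1; move: (- conv _ _ z) (C*F * _)=>a c; rewrite !ler_norml; lra.
 have [q1 _]:=reg (gd y (lexx _)).
 have xx: nrm (x-x)<=nrm (y-x) by rewrite subrr nrm0 nrm_ge0.
 have [q2 _]:=reg (gd x xx).
 have sm2: C*F*(t `^ al * t)<=ep.
  rewrite mulrA; apply: le_trans sm1; rewrite ler_piMr ?mulr_ge0 ?powR_ge0//.
  exact: le_trans tt t11.
 move: M q1 q2 sm2; move: (conv _ _ y) (conv _ _ x) (C*F * _) (\sum_i _) (e/_ )=>a b c s1 e'.
 by rewrite mulrDl ler_norml => /andP[M1 M2] /[!ler_norml] /andP[A1 A2] /andP[B1 B2] c1; move: M1 M2 A1 A2 B1 B2 c1; lra.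
apply: (le_trans bnd).
have:=sum_coord_le_nrm (y-x); under eq_bigr do rewrite !mxE; rewrite -/Sy=>h.
apply: (@le_trans _ _ (e/(N%:R+1)*(N%:R * nrm (y-x)))); first by rewrite ler_wpM2l// ltW.
rewrite mulrA ler_wpM2r ?nrm_ge0// mulrAC ler_pdivrMr ?ltr_wpDl//.
by rewrite ler_wpM2l ?(ltW e0)// lerDl.
Qed.

Lemma ireg_cont x : O x -> {for x, continuous U}.
by move=> /ireg_diff[D _]; exact: differentiable_continuous. Qed.

Lemma ireg_eq x : O x -> {for x, continuous u} -> U x = u x.
move=> Ox /continuous_nrmP cu; apply/eqP; rewrite -subr_eq0; apply/eqP.
apply: (@eq0_small _ _ 2)=>e e0; have [d d0 Hd]:=cu e e0.
have [t t0 [g2 sm1]]:=small_scale Ox e0.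
pose s:=Num.min t (d/2); have s0: 0<s by rewrite lt_min t0 divr_gt0.
have st: s<=t by rewrite ge_min lexx.
have sd: s<=d/2 by rewrite ge_min lexx orbT.
have gs: good x s by apply: (good_le g2) => //; lra.
have [/andP[_ s1] Bs]:=gs.
have [q1 _]:=reg gs.
have sm2: C*F*(s `^ al * s)<=e.
 have CF0: 0<=C*F by rewrite mulr_ge0.
 rewrite mulrA; apply: (le_trans _ sm1).
 apply: (@le_trans _ _ (C*F * s `^ al)); first by rewrite ler_piMr ?mulr_ge0 ?powR_ge0.
 by rewrite ler_wpM2l// powR_mono ?(ltW al0) ?(ltW s0).
have Cs := @csm_psi R N s s0.
have Ip: I1 (fun y=>psi s (y-x)).
 by apply: (L2_I1 oO bO); apply: (sm_L2 oO bO); exact: sm_shift Cs.1.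
have E: conv u (psi s) x-u x = Int (fun y=>(u y-u x) * psi s (y-x)).
 rewrite -[u x in LHS]mulr1 -(Int_psi oO bO s0 Bs) -(IntZ oO (u x) Ip).
 rewrite -(IntB oO (conv_csm_I1 oO bO x Lu Cs) (I1Z oO (u x) Ip)).
 by apply: eq_Int=>y _; rewrite mulrBl.
have q2: `|conv u (psi s) x-u x| <= e.
 rewrite E -[leRHS]mulr1 -(Int_psi oO bO s0 Bs) -(IntZ oO e Ip); apply: (Int_abs_le oO).
 - have:=I1_meas (I1B oO (conv_csm_I1 oO bO x Lu Cs) (I1Z oO (u x) Ip)).
  by congr measurable_fun; apply/funext=>y; rewrite mulrBl.
 - exact: (I1Z oO e Ip).
 - move=> y _; rewrite normrM [`|psi s _|]ger0_norm ?psi_ge0//.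
  have [sy|ys]:=leP s (nrm (y-x)); first by rewrite Cs.2// !mulr0.
  by rewrite ler_wpM2r ?psi_ge0// ltW// Hd//; lra.
move: q1 q2 sm2; move: (conv _ _ x) (C*F * _)=>a c; rewrite !ler_norml; lra.
Qed.

(** The means converge pointwise to U and in L1 to u; Fatou's lemma identifies the two limits. *)
Lemma ireg_ae g : H u g->ae_in O (fun x=>U x = u x).
move=> Hu.
have mU: measurable_fun O U by apply: (continuous_on_measurable oO)=>x Ox; exact: ireg_cont.
have mE: measurable_fun O (fun x=>(`|U x-u x|)%:E).
 by apply/measurable_EFinP; apply: measurableT_comp => //; apply: measurable_funB => //; exact: L2_meas Lu.
have small (e:R) : 0<e->(\int[leb]_(x in O) (`|U x-u x|)%:E<=e%:E)%E.
 move=> e0; have [d d0 Hd]:=conv_psi_cvg oO bO Hu e0.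
 pose d':=Num.min (d/2) 1; have d'0: 0<d' by rewrite lt_min divr_gt0//= ltr01.
 have d'd: d'<d by rewrite gt_min; apply/orP; left; lra.
 have d'1: d'<=1 by rewrite ge_min lexx orbT.
 pose r (j:nat) : R:=d'/j.+1%:R.
 have r0 j: 0<r j by rewrite divr_gt0.
 have rd j: r j<=d' by rewrite ler_pdivrMr// ler_peMr ?ler1n// ltW.
 pose f (j:nat) x : \bar R:=(`|conv u (psi (r j)) x-u x|)%:E.
 have mf j: measurable_fun O (f j).
  apply/measurable_EFinP; apply: measurableT_comp => //.
  exact: L2_meas (L2B oO (conv_L2 oO bO Lu (csm_psi (r0 j))) Lu).
 have Ef j: (\int[leb]_(x in O) f j x<=e%:E)%E.
  have Ij: I1 (fun x => `|conv u (psi (r j)) x-u x|).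
   exact: (I1_norm oO (L2_I1 oO bO (L2B oO (conv_L2 oO bO Lu (csm_psi (r0 j))) Lu))).
  by rewrite -(EFin_Int oO Ij) lee_fin; apply: Hd => //; exact: le_lt_trans (rd j) d'd.
 have lim x: O x->limn_einf (f ^~ x) = (`|U x-u x|)%:E.
  move=> Ox; have c: f ^~ x @ \oo --> (`|U x-u x|)%:E.
   apply: cvg_EFin; first exact: nearW.
   apply/cvgrPdist_le=>ep ep0; have [t t0 [g2 sm1]]:=small_scale Ox ep0.
   have gt: good x t by apply: (good_le g2) => //; lra.
   have [M] := @ltr_add_invr R 0 (t/d') (divr_gt0 t0 d'0); rewrite add0r ltr_pdivlMr// mulrC=>HM.
   exists M => // j /= Mj.
   have rt: r j<=t.
    by apply: le_trans (ltW HM); rewrite ler_pM2l// lef_pV2 ?posrE// ler_nat; exact: Mj.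
   have [q1 _]:=reg (good_le gt (r0 j) rt).
   have CF0: 0<=C*F by rewrite mulr_ge0.
   have sm2: C*F*(r j `^ al * r j)<=ep.
    rewrite mulrA; apply: (le_trans _ sm1).
    apply: (@le_trans _ _ (C*F * r j `^ al)).
     by rewrite ler_piMr ?mulr_ge0 ?powR_ge0//; exact: le_trans (rd j) d'1.
    by rewrite ler_wpM2l// powR_mono ?(ltW al0) ?(ltW (r0 j)).
   rewrite /f /=; apply: (le_trans (ler_dist_dist _ _)).
   rewrite (_:U x-u x - _ = - (conv u (psi (r j)) x-U x)); last by ring.
   by rewrite normrN; exact: le_trans q1 sm2.
  by have [-> _]:=cvg_limn_einf_sup c.
 have f0 j x: O x->(0<=f j x)%E by rewrite lee_fin.
 have F1:=fatou leb (mO oO) mf f0.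
 have F2: (limn_einf (fun j => \int[leb]_(x in O) f j x)<=e%:E)%E by apply: limn_einf_le_cst.
 apply: le_trans F2; apply: le_trans F1; rewrite le_eqVlt; apply/orP; left; apply/eqP.
 by apply: eq_integral=>x /set_mem Ox; rewrite lim.
have Z: (\int[leb]_(x in O) (`|U x-u x|)%:E = 0)%E.
 apply/eqP; rewrite eq_le integral_ge0 ?andbT=>[|x _]; last by rewrite lee_fin.
 by apply/lee_addgt0Pr=>e e0; rewrite add0e; exact: small.
have A: (\int[leb]_(x in O) `|(`|U x-u x|)%:E| = 0)%E.
 by rewrite -[RHS]Z; apply: eq_integral=>x _; rewrite /= normr_id.
have:=(ae_eq_integral_abs leb (mO oO) mE).1 A.
by apply: ae_in_impl=>x Ox /= [] /eqP; rewrite normr_eq0 subr_eq0 => /eqP.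
Qed.

End regular.

Lemma conv_le_ball t (B S:R) u k x : L2 u->0<t->csm t k->(forall z, `|k z| <= B)->0<=S ->
 ae_in O (fun y=>nball x t y -> `|u y| <= S) -> `|conv u k x| <= B*S*(2 * t)^+N.
move=> Lu t0 Ck HB S0 uS; have B0: 0<=B:=le_trans (normr_ge0 _) (HB 0).
have Ic:=conv_csm_I1 oO bO x Lu Ck.
have mI: measurable_fun O (\1_(nball x t) : rV->R) by exact: (measurable_indic (measurable_nball x t)).
have Ii: I1 (fun y => \1_(nball x t) y).
 by apply: (I1_bounded oO bO (M:=1)) => // y _; rewrite indicE; case: (_ \in _); rewrite ?normr1 ?normr0.
apply: (le_trans (Int_abs oO Ic)).
apply: (@le_trans _ _ (Int (fun y=>B*S * \1_(nball x t) y))); last first.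
 by rewrite (IntZ oO)// ler_wpM2l ?mulr_ge0//; apply: Int_nball => //; exact: ltW.
apply: (Int_ae_le oO); [exact: (I1_norm oO Ic)|exact: (I1Z oO)|].
apply: ae_in_impl uS=>y _ h; rewrite normrM indicE.
have [yB|yB]:=pselect (nball x t y).
 by rewrite mem_set// mulr1 mulrC; apply: ler_pM => //; exact: h.
rewrite memNset// mulr0 Ck.2 ?normr0 ?mulr0// leNgt; apply/negP=>h'; apply: yB; exact: ltW.
Qed.

End interior.

(** * Geometry of the boundary *)

Section trap.
Context {R : realType} {N : nat} (O:set 'rV[R]_N).
Hypotheses (oO:open O) (bO:bounded_set O).
Notation rV := 'rV[R]_N.
Notation dot := (@dotrv R N).
Implicit Types (x y z n:rV).

Lemma bounded_on_compact (K:set rV) (f:rV->R) : compact K->(forall x, K x -> {for x, continuous f}) ->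
 exists2 M : R, 0<=M & forall x, K x -> `|f x| <= M.
move=> cK cf; have [[x Kx]|K0]:=pselect (K !=set0); last first.
 by exists 0 => // x Kx; case: K0; exists x.
have cn: {within K, continuous (fun x => `|f x|)}.
 apply: continuous_in_subspaceT=>y /set_mem Ky.
 by apply: continuous_comp; [exact: cf|exact: norm_continuous].
have [c cK' Hc]:=compact_EVT_max (ex_intro _ x Kx) cK cn.
by exists `|f c| => // y Ky; apply: Hc; rewrite inE.
Qed.

(* At scale c the set O is squeezed between two paraboloids around the inner normal n. *)

Definition trap (c:R) x0 n:=dot n n = 1 /\ forall y, nrm (y-x0)<=c ->
 (nrm (y-x0)^+2<c * dot (y-x0) n->O y) /\ (c * dot (y-x0) n < - nrm (y-x0)^+2 -> ~ O y).

Lemma trap_le c c' x0 n : 0<c'->c'<=c->trap c x0 n->trap c' x0 n.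
move=> c'0 cc [n1 T]; split=> // y yx; have [T1 T2]:=T y (le_trans yx cc).
have s0:=sqr_ge0 (nrm (y-x0)).
split=> h; [apply: T1|apply: T2].
 have d0: 0<dot (y-x0) n by rewrite -(pmulr_rgt0 _ c'0); exact: le_lt_trans h.
 by apply: (lt_le_trans h); rewrite ler_wpM2r// ltW.
have d0: dot (y-x0) n<0 by rewrite -(pmulr_rlt0 _ c'0); apply: (lt_le_trans h); rewrite oppr_le0.
by apply: le_lt_trans h; rewrite ler_wnM2r// ltW.
Qed.

Lemma boundaryP x : boundary O x -> ~ O x /\ closure O x.
case=> cx nx; split=> // Ox; apply: nx; rewrite /interior.
exact: open_nbhs_nbhs.
Qed.

(** Second order Taylor expansion of rho at boundary points near x1: the remainder M N^2 |y - x0|^2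
    is dominated by the linear term, since |grad rho| >= m there and c (M N^2 + 1) <= m. *)
Lemma local_trap x1 rho : boundary O x1->local_defining_function O x1 rho ->
 exists2 c : R, 0<c & forall x0, boundary O x0->nrm (x0-x1)<=c ->
  trap c x0 (- (nrm (grad rho x0))^-1 *: grad rho x0).
have nb (p q w:R) : `|p-q| <= w->p<=q+w /\ q<=p+w by rewrite ler_norml => /andP[? ?]; split; lra.
have fn (a b p e:R) : e < - a->b<=e->p<=a+b->p<0 by lra.
have fn2 (a b p e:R) : e<a->b<=e->p<0->a<=p+b->False by lra.
have fh (a b w:R) : a-b<=w->w<=a/2->a/2<=b by lra.
have fk (a b w k r:R) : k<=r/4->a<=b+w->b<=k->w<=k->a<=r/2 by lra.
move=> b1 [V [oV Vx1 Sr g1 Vr]].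
have gr0: 0<nrm (grad rho x1) by exact: nrm_gt0.
have /open_nrmP/(_ _ Vx1)[r r0 Hr]:=oV.
have gE x i: grad rho x ord0 i = pderiv i rho x by rewrite mxE.
have contg i: {for x1, continuous (pderiv i rho)} by exact: (Sr [:: i] x1 Vx1).1.
have [d d0 Hd] : exists2 d : R, 0<d & forall x, nrm (x-x1)<d->nrm (grad rho x1)/2<=nrm (grad rho x).
 pose e:=nrm (grad rho x1)/(2*(N%:R+1)).
 have e0: 0<e by rewrite divr_gt0// mulr_gt0// ltr_wpDl.
 have /choice[di Hdi] : forall i, exists di : R, 0<di /\ forall x, nrm (x-x1)<di -> `|pderiv i rho x-pderiv i rho x1| < e.
  by move=> i; have /continuous_nrmP/(_ e e0)[di di0 Hdi]:=contg i; exists di.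
 have [D D0 Dd] : exists2 D : R, 0<D & forall i, D<=di i.
  have H (s:seq 'I_N) : exists2 D : R, 0<D & forall i, i \in s->D<=di i.
   elim: s=>[|j s [D D0 Dr]]; first by exists 1.
   exists (Num.min D (di j)); first by rewrite lt_min D0 (Hdi j).1.
   by move=> i; rewrite inE => /predU1P[->|/Dr h]; rewrite ge_min ?lexx ?h ?orbT.
  by have [D D0 Dr]:=H (enum 'I_N); exists D => // i; apply: Dr; rewrite mem_enum.
 exists D => // x xD.
 have : nrm (grad rho x-grad rho x1)<=nrm (grad rho x1)/2.
  apply: (le_trans (nrm_le_sum _)); apply: (@le_trans _ _ (\sum_(i<N) e)).
   by apply: ler_sum=>i _; rewrite !mxE; apply/ltW/(Hdi i).2; exact: lt_le_trans (Dd i).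
  rewrite sumr_const card_ord -[_ *+ N]mulr_natl /e.
  have Q (a b:R) : 0<a->0<=b->b*(a/(2*(b+1)))<=a/2.
   move=> a0 bb; have -> : b*(a/(2*(b+1))) = (a/2)*(b/(b+1)) by field; rewrite gt_eqF// ltr_wpDl.
   by rewrite ger_pMr ?divr_gt0// ler_pdivrMr ?ltr_wpDl// mul1r lerDl.
  exact: (Q _ _ gr0 (ler0n R N)).
 have:=nrmB_ge (grad rho x1) (grad rho x); rewrite nrm_distC; exact: fh.
pose K := [set y : rV | nrm (y-x1)<=r/2].
have cK: compact K by exact: compact_nball.
have KV y: K y->V y by move=> Ky; apply: Hr; apply: le_lt_trans Ky _; lra.
have /choice[B2 HB2] : forall ij : 'I_N * 'I_N, exists B : R, 0<=B /\ forall y, K y -> `|pderiv ij.1 (pderiv ij.2 rho) y| <= B.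
 move=> [i j]; have [B B0 HB] := @bounded_on_compact K (pderiv i (pderiv j rho)) cK (fun x Kx=>(Sr [:: i; j] x (KV x Kx)).1).
 by exists B.
pose M:=\sum_ij B2 ij.
have M0: 0<=M by apply: sumr_ge0=>ij _; case: (HB2 ij).
have HM i j y: K y -> `|pderiv i (pderiv j rho) y| <= M.
 move=> Ky; apply: (le_trans ((HB2 (i, j)).2 y Ky)); rewrite /M (bigD1 (i, j))//= lerDl.
 by apply: sumr_ge0=>ij _; case: (HB2 ij).
pose m:=nrm (grad rho x1)/2; have m0: 0<m by rewrite divr_gt0.
pose A:=M*N%:R*N%:R+1; have A0: 0<A by rewrite ltr_wpDl// !mulr_ge0.
pose c:=Num.min (Num.min (r/4) (d/2)) (m/A).
have c0: 0<c by rewrite !lt_min !divr_gt0.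
have cr: c<=r/4 by rewrite !ge_min lexx.
have cd: c<=d/2 by rewrite !ge_min lexx orbT.
have cA: c*A<=m by rewrite -ler_pdivlMr// !ge_min lexx !orbT.
exists c => // x0 b0 x01.
have [nO0 clO0]:=boundaryP b0.
have K0: K x0 by apply: (le_trans x01); lra.
have V0:=KV _ K0.
(* At a boundary point rho >= 0 because x0 lies outside O, and rho <= 0 because x0 is a limit of
   points of O. *)
have rho0: rho x0 = 0.
 apply/eqP; rewrite eq_le; apply/andP; split; last first.
  by rewrite leNgt; apply/negP => /(Vr x0 V0).
 rewrite leNgt; apply/negP=>rp.
 have /continuous_nrmP/(_ _ rp)[d1 d10 Hd1]:=(Sr [::] x0 V0).1.
 have /open_nrmP/(_ _ V0)[d2 d20 Hd2]:=oV.
 have d3: 0<Num.min d1 d2 by rewrite lt_min d10.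
 have /closure_nrmP/(_ _ d3)[y Oy]:=clO0; rewrite lt_min => /andP[/Hd1 h1 /Hd2 Vy].
 have:=(Vr y Vy).1 Oy; move: h1; rewrite /= ltr_norml; lra.
set g:=grad rho x0; have gm: m<=nrm g by apply: Hd; apply: (le_lt_trans x01); lra.
have g0: 0<nrm g by exact: lt_le_trans gm.
have taylor y: nrm (y-x0)<=c -> `|rho y-dot (y-x0) g| <= M*N%:R*N%:R * nrm (y-x0)^+2.
 move=> yx.
 have box z: (forall j, `|z ord0 j-x0 ord0 j| <= `|y ord0 j-x0 ord0 j|)->nrm (z-x0)<=nrm (y-x0).
  by move=> h; apply: nrm_mono=>j; rewrite !mxE.
 have Kz z: nrm (z-x0)<=nrm (y-x0)->K z.
  by move=> h; exact: (fk _ _ _ _ _ cr (nrm_tri z x0 x1) (le_trans h yx) x01).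
 have E i z: nrm (z-x0)<=nrm (y-x0) -> `|pderiv i rho z-pderiv i rho x0| <= M*(N%:R * nrm (y-x0)).
  move=> zx; have := @mvt_box _ _ (pderiv i rho) x0 z (fun=> 0) M _.
  rewrite big1 ?subr0=>[h|j _]; last by rewrite mul0r.
  apply: (le_trans (h _)).
   move=> w j wz; have Kw: K w.
    apply: Kz; apply: le_trans zx; apply: nrm_mono=>k; rewrite !mxE; exact: wz.
   by split; [exact: (Sr [:: i] w (KV _ Kw)).2|rewrite subr0 HM].
  rewrite ler_wpM2l//; have:=sum_coord_le_nrm (z-x0); under eq_bigr do rewrite !mxE.
  by move=> h2; apply: (le_trans h2); rewrite ler_wpM2l.
 have := @mvt_box _ _ rho x0 y (fun i=>pderiv i rho x0) (M*(N%:R * nrm (y-x0))) _.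
 rewrite rho0 subr0 (_ : \sum_i pderiv i rho x0*(y ord0 i-x0 ord0 i) = dot (y-x0) g); last first.
  by apply: eq_bigr=>i _; rewrite !mxE mulrC.
 move=> h; apply: (le_trans (h _)).
  move=> z i /box zx; split; first exact: (Sr [::] z (KV _ (Kz _ zx))).2.
  exact: E.
 have s1: \sum_i `|y ord0 i-x0 ord0 i| <= N%:R * nrm (y-x0).
  by have:=sum_coord_le_nrm (y-x0); under eq_bigr do rewrite !mxE.
 apply: (le_trans (ler_wpM2l _ s1)); first by rewrite !mulr_ge0 ?nrm_ge0.
 by rewrite le_eqVlt; apply/orP; left; apply/eqP; ring.
split.
 rewrite dotZl dotZr -nrm_sq; field; by rewrite gt_eqF.
move=> y yx; have T:=taylor y yx.
have Ky: K y by exact: (fk _ _ _ _ _ cr (nrm_tri y x0 x1) yx x01).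
have Vy:=KV _ Ky.
rewrite dotZr mulNr !mulrN.
set q:=dot (y-x0) g in T *; set s:=nrm (y-x0) in T *.
have s0: 0<=s^+2 by exact: sqr_ge0.
have key: s^+2 * nrm g >= c*(M*N%:R*N%:R * s^+2).
 have : c*(M*N%:R*N%:R)<=nrm g.
  by apply: le_trans gm; apply: le_trans cA; rewrite ler_wpM2l ?(ltW c0)// lerDl.
 by move=> h; rewrite mulrA mulrC ler_wpM2l.
split=> h.
 apply/(Vr y Vy).
 have : s^+2 * nrm g < - (c * q).
  by move: h; rewrite mulrCA -mulrN ltr_pdivlMl// mulrC.
 move=> h2; have : c*(rho y)<0; last by rewrite pmulr_rlt0.
 have : c * rho y<=c*(q+M*N%:R*N%:R * s^+2).
  by rewrite ler_wpM2l ?(ltW c0)//; exact: (nb _ _ _ T).1.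
 by rewrite mulrDr=>h3; exact: fn h2 key h3.
move=> /(Vr y Vy).1 ry.
have : s^+2 * nrm g<c * q.
 by move: h; rewrite ltrN2 mulrCA ltr_pdivlMl// mulrC.
move=> h2.
have : c * q<=c*(rho y+M*N%:R*N%:R * s^+2).
 by rewrite ler_wpM2l ?(ltW c0)//; exact: (nb _ _ _ T).2.
have : c * rho y<0 by rewrite pmulr_rlt0.
by rewrite mulrDr=>h3 h4; exact: fn2 h2 key h3 h4.
Qed.

(** If n and n' differed, a short step from x0 along n - n' would enter both the inner region for n
    and the outer region for n'. *)
Lemma trap_unique (c c':R) x0 n n' : 0<c->0<c'->dot n n = 1->dot n' n' = 1 ->
 (forall y, nrm (y-x0)<=c->nrm (y-x0)^+2<c * dot (y-x0) n->O y) ->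
 (forall y, nrm (y-x0)<=c'->c' * dot (y-x0) n' < - nrm (y-x0)^+2 -> ~ O y)->n = n'.
move=> c0 c'0 n1 n1' T T'.
pose w:=n-n'; pose p:=dot n n'.
have ww: dot w w = 2*(1-p) by rewrite /w dotBl !dotBr n1 n1' (dotC n' n) -/p; ring.
have [w0|w0]:=eqVneq (dot w w) 0; first by apply/eqP; rewrite -subr_eq0; apply/eqP/dot_eq0.
have wp: 0<dot w w by rewrite lt_def w0 dot_ge0.
have p1: p<1 by move: wp; rewrite ww; lra.
have wn: dot w n = 1-p by rewrite /w dotBl n1 (dotC n' n).
have wn': dot w n' = - (1-p) by rewrite /w dotBl n1' -/p; ring.
have nw: 0<nrm w by rewrite lt_def nrm_ge0 andbT; apply: contraNneq w0=>h; rewrite -nrm_sq h expr0n.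
pose t:=Num.min (Num.min c c'/nrm w) (Num.min c c'/4).
have m0: 0<Num.min c c' by rewrite lt_min c0.
have t0: 0<t by rewrite lt_min !divr_gt0.
have tw: t * nrm w<=Num.min c c' by rewrite -ler_pdivlMr// ge_min lexx.
have t4: t<=Num.min c c'/4 by rewrite ge_min lexx orbT.
have mc: Num.min c c'<=c by rewrite ge_min lexx.
have mc': Num.min c c'<=c' by rewrite ge_min lexx orbT.
have yE: x0+t *: w-x0 = t *: w by rewrite addrAC subrr add0r.
have nt: nrm (t *: w) = t * nrm w by rewrite nrmZ gtr0_norm.
have y1: nrm (x0+t *: w-x0)<=c by rewrite yE nt; exact: le_trans tw mc.
have y2: nrm (x0+t *: w-x0)<=c' by rewrite yE nt; exact: le_trans tw mc'.
have T1:=T _ y1; have T2:=T' _ y2.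
have sq: (t * nrm w)^+2 = t*(t*(2*(1-p))) by rewrite exprMn nrm_sq ww; ring.
case: T2; rewrite ?yE ?nt ?sq ?dotZl ?wn ?wn'.
 rewrite mulrCA ltrNr -mulrN -mulrN opprK ltr_pM2l//.
 rewrite mulrA ltr_pM2r ?subr_gt0//; lra.
apply: T1; rewrite yE nt sq dotZl wn [ltRHS]mulrCA ltr_pM2l// mulrA ltr_pM2r ?subr_gt0//; lra.
Qed.

Lemma compact_boundary : compact (boundary O).
have E: boundary O = closure O `&` ~` O.
 apply/seteqP; split=> x [cx nx]; split=> //; first by case: (boundaryP (conj cx nx)).
 by move=> /interior_subset.
rewrite E; apply: compact_closedI; last exact: open_closedC.
have [M HM]:=(bounded_nrmP O).1 bO.
have cB := @compact_nball R N 0 M.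
apply: (subclosed_compact _ cB); first exact: closed_closure.
move=> x /closure_nrmP cx; rewrite /=; apply/ler_addgt0Pr=>e e0.
have [y Oy yx]:=cx e e0; have:=HM y Oy; rewrite subr0; have:=nrm_tri x y 0.
by rewrite !subr0 nrm_distC; lra.
Qed.

(** The constant of [local_trap] is uniform near each boundary point; compactness of the boundary,
    in its near-covering form, makes it global. *)
Lemma uniform_trap : (forall x, boundary O x->exists rho, local_defining_function O x rho) ->
 exists2 c : R, 0<c & exists n : rV->rV, forall x0, boundary O x0->trap c x0 (n x0).
move=> sO.
have /(_ R (0^'+) (fun c x0=>boundary O x0->exists n, trap c x0 n)):=(compact_near_coveringP _).1 compact_boundary.
move=> /(_ _ _)[].
 move=> x1 b1; have [rho Hrho]:=sO x1 b1; have [c c0 Hc]:=local_trap b1 Hrho.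
 exists ([set x | nrm (x-x1)<c], [set e : R | 0<e<c]) => /=.
  split; first by apply/nbhs_nrmP; exists c.
  by near=> e; apply/andP; split; near: e; [exact: nbhs_right_gt|exact: nbhs_right_lt].
 move=> [x e]/= [xc /andP[e0 ec]] bx.
 by exists (- (nrm (grad rho x))^-1 *: grad rho x); apply: (trap_le e0 (ltW ec)); apply: Hc => //; exact: ltW.
move=> e e0 He.
have e2: 0<e/2 by rewrite divr_gt0.
have:=He (e/2); rewrite /ball_/= sub0r normrN gtr0_norm// => /(_ _ e2) h.
exists (e/2) => //.
have /choice[n Hn] : forall x0, exists n, boundary O x0->trap (e/2) x0 n.
 move=> x0; have [b0|nb]:=pselect (boundary O x0); last by exists 0.
 have he: e/2<e by lra.
 by have [n Hn]:=h he x0 b0 b0; exists n.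
by exists n.
Unshelve. all: by end_near. Qed.

End trap.

Section geometry.
Context {R : realType} {N : nat} (O:set 'rV[R]_N) (N_gt0:(0<N)%N).
Hypotheses (oO:open O) (bO:bounded_set O).
Notation rV := 'rV[R]_N.
Notation dot := (@dotrv R N).
Variables (c:R) (n:rV->rV).
Hypotheses (c_gt0:0<c) (trapn:forall x0, boundary O x0->trap O c x0 (n x0)).
Implicit Types (x y z:rV).

Lemma n_unit x0 : boundary O x0->dot (n x0) (n x0) = 1.
by move=> /trapn[]. Qed.

Lemma nrm_n x0 : boundary O x0->nrm (n x0) = 1.
by move=> /n_unit h; rewrite /nrm h sqrtr1. Qed.

Lemma nrmB_sq (v w:rV) : nrm (v-w)^+2 = nrm v^+2-2 * dot v w+nrm w^+2.
by rewrite !nrm_sq dotBl !dotBr (dotC w v); ring. Qed.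

Lemma nrm_shift x0 y (a:R) : boundary O x0 ->
 nrm (y-(x0+a *: n x0))^+2 = nrm (y-x0)^+2-2 * a * dot (y-x0) (n x0)+a^+2.
move=> b0; have -> : y-(x0+a *: n x0) = (y-x0)-a *: n x0 by rewrite opprD addrA.
by move: (y-x0)=>w; rewrite nrmB_sq nrmZ nrm_n// mulr1 real_normK ?num_real// dotZr mulrA.
Qed.

(** Expanding the square, |y - x0 - a n| < a means |y - x0|^2 < 2 a <y - x0, n>, and 2 a <= c puts y
    inside the inner paraboloid. *)
Lemma interior_ball x0 (a:R) y : boundary O x0->0<a<=c/2->nrm (y-(x0+a *: n x0))<a->O y.
move=> b0 /andP[a0 ac] ya.
have h: nrm (y-x0)^+2<2 * a * dot (y-x0) (n x0).
 have:=nrm_shift y a b0; have : nrm (y-(x0+a *: n x0))^+2<a^+2 by rewrite ltrXn2r// nrm_ge0.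
 lra.
have p0: 0<dot (y-x0) (n x0).
 have a2: 0<2 * a by rewrite mulr_gt0.
 by rewrite -(pmulr_rgt0 _ a2); apply: le_lt_trans h; exact: sqr_ge0.
apply: ((trapn b0).2 y _).1.
 have:=nrm_tri y (x0+a *: n x0) x0; rewrite addrAC subrr add0r nrmZ nrm_n// gtr0_norm//; lra.
apply: (lt_le_trans h); rewrite ler_wpM2r ?(ltW p0)//; lra.
Qed.

Lemma exterior_ball x0 y : boundary O x0->O y->c/2<=nrm (y-(x0-(c/2) *: n x0)).
move=> b0 Oy; rewrite leNgt; apply/negP; rewrite -scaleNr=>ya.
have c2: 0<c/2 by rewrite divr_gt0.
have h: c * dot (y-x0) (n x0) < - nrm (y-x0)^+2.
 have:=nrm_shift y (- (c/2)) b0; have : nrm (y-(x0+(- (c/2)) *: n x0))^+2<(c/2)^+2 by rewrite ltrXn2r ?nrm_ge0// ltW.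
 rewrite sqrrN; lra.
apply: ((trapn b0).2 y _).2 Oy => //.
have:=nrm_tri y (x0+(- (c/2)) *: n x0) x0; rewrite addrAC subrr add0r nrmZ nrm_n// normrN gtr0_norm//; lra.
Qed.

(** At a nearest point x0 of the complement, the ball around x acts as an inner region with
    direction (x - x0)/d, so [trap_unique] forces that direction to be the inner normal. *)
Lemma nearest x : O x->exists x0 (d:R), [/\ boundary O x0, 0<d, nrm (x-x0) = d,
 (forall y, nrm (y-x)<d->O y) & x = x0+d *: n x0].
move=> Ox; have [M HM]:=(bounded_nrmP O).1 bO.
have M0: 0<=M by apply: le_trans (HM x Ox); exact: nrm_ge0.
pose e : rV:=delta_mx ord0 (Ordinal N_gt0).
have ne: nrm e = 1 by exact: nrm_ee.
(* A point outside O; its existence uses the unit vector e, hence N > 0. *)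
have nOb: ~ O ((M+1) *: e) by move=> /HM; rewrite nrmZ ne mulr1 ger0_norm; lra.
pose K := ~` O `&` [set y | nrm (y-x)<=nrm ((M+1) *: e-x)].
have cK: compact K by rewrite /K setIC; apply: compact_closedI; [exact: compact_nball|exact: open_closedC].
have K0: K !=set0 by exists ((M+1) *: e); split=> //=.
have cn: {within K, continuous (fun y=>nrm (y-x))} by apply: continuous_subspaceT; exact: nrm_continuous.
have [x0 /set_mem[nO0 /= x0b] Hx0]:=compact_EVT_min K0 cK cn.
have ball y: nrm (y-x)<nrm (x0-x)->O y.
 move=> yx; apply: contrapT=>nOy.
 have /Hx0 : y \in K by apply/mem_set; split=> //=; apply: le_trans x0b; exact: ltW.
 by rewrite leNgt yx.
have d0: 0<nrm (x0-x).
 by apply: nrm_gt0; rewrite subr_eq0; apply: contra_notN nO0 => /eqP->.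
set d:=nrm (x0-x) in d0 ball.
have b0: boundary O x0.
 split; last by move=> /interior_subset.
 apply/closure_nrmP=>e1 e10.
 pose t:=Num.min (1/2) (e1/(2 * d)).
 have t0: 0<t by rewrite lt_min !divr_gt0// mulr_gt0.
 have t1: t<=1/2 by rewrite ge_min lexx.
 have t2: t*(2 * d)<=e1 by rewrite -ler_pdivlMr ?mulr_gt0// ge_min lexx orbT.
 exists (x0+t *: (x-x0)).
  apply: ball; have -> : x0+t *: (x-x0)-x = (1-t) *: (x0-x).
   by apply/rowP=>i; rewrite !mxE; ring.
  by rewrite nrmZ gtr0_norm ?subr_gt0 ?gtr_pMl//; lra.
 by rewrite addrAC subrr add0r nrmZ gtr0_norm// nrm_distC -/d; nra.
exists x0, d; split => //; first by rewrite nrm_distC.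
have nE: d^-1 *: (x-x0) = n x0.
 apply: (@trap_unique _ _ O d c x0) => //.
 - by rewrite dotZl dotZr -nrm_sq nrm_distC -/d; field; rewrite gt_eqF.
 - exact: n_unit.
 - move=> y _ h; apply: ball; rewrite -(ltr_pXn2r (isT:0<2)%N) ?nnegrE ?nrm_ge0 ?(ltW d0)//.
  have -> : y-x = (y-x0)-(x-x0) by rewrite opprB addrA subrK.
  rewrite nrmB_sq (nrm_distC x) -/d.
  move: h; rewrite dotZr mulrA divff ?gt_eqF// mul1r.
  have:=sqr_ge0 (nrm (y-x0)); lra.
 - by move=> y yc; exact: ((trapn b0).2 y yc).2.
by rewrite -nE scalerA divff ?gt_eqF// scale1r addrC subrK.
Qed.

(** The point 3d/4 below x is still in O, so its height over the tangent plane is at least -(4d)^2/c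
    >= -d/4, by 64 d <= c; adding 3d/4 gives d/2. *)
Lemma cone_height x0 x (d:R) : boundary O x0->0<d->64 * d<=c->(forall y, nrm (y-x)<d->O y) ->
 nrm (x-x0)<=3 * d->d/2<=dot (x-x0) (n x0).
move=> b0 d0 dc Bx xd; pose y:=x-(3/4 * d) *: n x0.
have Oy: O y.
 apply: Bx; rewrite /y addrAC subrr add0r nrmN nrmZ nrm_n// mulr1 gtr0_norm ?mulr_gt0//; lra.
have yE: y-x0 = (x-x0)-(3/4 * d) *: n x0 by rewrite /y addrAC.
have y4: nrm (y-x0)<=4 * d.
 rewrite yE; apply: (le_trans (nrmD _ _)); rewrite nrmN nrmZ nrm_n// mulr1 gtr0_norm ?mulr_gt0//; lra.
have [|_ T2]:=(trapn b0).2 y; first by apply: (le_trans y4); lra.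
have : - nrm (y-x0)^+2<=c * dot (y-x0) (n x0) by rewrite leNgt; apply/negP => /T2.
have -> : dot (y-x0) (n x0) = dot (x-x0) (n x0)-3/4 * d by rewrite yE; move: (x-x0)=>w; rewrite dotBl dotZl n_unit// mulr1.
have : nrm (y-x0)^+2<=4 * d*(4 * d) by rewrite expr2; apply: ler_pM => //; exact: nrm_ge0.
move: (dot _ _)=>p h1 h2; rewrite leNgt; apply/negP=>h.
have : c*(p-3/4 * d)<=c*(- (1/4 * d)) by rewrite ler_wpM2l ?ltW//; lra.
nra.
Qed.

Lemma unit_normalE x0 nu : boundary O x0->outward_unit_normal O x0 nu->nu = - n x0.
move=> b0 [rho Hrho ->]; have [e e0 He]:=local_trap oO b0 Hrho.
have [|m1 T]:=He x0 b0; first by rewrite subrr nrm0 ltW.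
have [n1 T']:=trapn b0.
rewrite -(@trap_unique _ _ O e c x0 _ _ e0 c_gt0 m1 n1) ?scaleNr ?opprK//.
- by move=> y; rewrite -scaleNr => /T[].
- by move=> y /T'[].
Qed.

End geometry.

(** * Barriers, strong maximum principle and Hopf's lemma *)

Section barriers.
Context {R : realType} {N : nat} (O:set 'rV[R]_N).
Hypotheses (oO:open O) (bO:bounded_set O).
Notation rV := 'rV[R]_N.
Notation dot := (@dotrv R N).
Notation Int := (Int O).
Notation L2 := (L2 O).
Notation H := (H O).
Notation Dg := (Dg O).
Notation wsol := (wsol O).
Notation tf := (test_function O).
Notation conv := (conv O).
Notation vsol := (vsol O).
Notation theta t := (rk N (Th N) t : rV -> R).
Notation psi t := (rk N (Ps N) t : rV -> R).
Implicit Types (u h a:rV->R) (x y z:rV) (g : 'I_N->rV->R).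

(** Comparison of u with the smooth function -a, taking c = 0 in [comparison]. The inequality h <=
    Lap a is required only where u + a > 0, which is where the test function lives. *)
Lemma barrier_comparison (c':R) u g h a : 0<c'->rayleigh O c'->wsol u g h->L2 h->sm a->okbar O a ->
 ae_in O (fun x=>0<u x+a x->h x<=lap a x)->ae_in O (fun x=>u x+a x<=0).
move=> c'0 Rc [Hu Su] Lh Sa ok hl; have [Lu Lg _]:=Hu.
apply: (comparison oO bO c'0 c'0 Rc Hu Sa ok)=>e e0; rewrite mul0r.
have HT:=H_pospart oO bO e0 Hu Sa ok; have [LT LgT _]:=HT.
set T:=(fun x=>pospart e _) in HT LT *.
set kT:=(fun i x=>derive1 (pospart e) _ * _) in HT LgT *.
have Sai i:=sm_pderiv i Sa; have Laii i: L2 (pderiv i (pderiv i a)) by exact/(sm_L2 oO bO)/sm_pderiv.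
have Llap: L2 (lap a) by apply: (sm_L2 oO bO); apply: sm_sum=>i _; exact: sm_pderiv.
have -> : Dg (fun i x=>g i x+pderiv i a x) kT = Dg g kT+Dg (fun i=>pderiv i a) kT.
 rewrite /Dg_on -big_split/=; apply: eq_bigr=>i _; rewrite -IntD//; last 2 first.
 - by apply: L2_mul => //; exact: LgT.
 - by apply: L2_mul => //; [exact: (sm_L2 oO bO (Sai i))|exact: LgT].
 by congr Int; apply/funext=>x; rewrite mulrDl.
have -> : Dg (fun i=>pderiv i a) kT = - Int (fun x=>lap a x*T x).
 have -> : (fun x=>lap a x*T x) = (fun x => \sum_i T x * pderiv i (pderiv i a) x).
  by apply/funext=>x; rewrite mulrC mulr_sumr.
 rewrite (Int_sum oO bO)=>[|i]; last exact: L2_mul.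
 rewrite -sumrN; apply: eq_bigr=>i _; rewrite (H_ibp oO bO i HT (Sai i)) opprK.
 by congr Int; apply/funext=>x; rewrite mulrC.
rewrite (Su _ _ HT) -IntB//; [|exact: L2_mul|exact: L2_mul].
rewrite -(_:Int (fun=> 0) = 0); last by rewrite Int_cst ?mul0r.
apply: Int_ae_le => //.
- by apply: I1B => //; exact: L2_mul.
- exact/L2_I1/L2_cst.
move: hl; apply: ae_in_impl=>x _ hl; rewrite -mulrBl /T.
have [w0|/hl h1]:=leP (u x+a x) 0; first by rewrite pospart_nonpos ?mulr0.
by rewrite mulr_le0_ge0 ?subr_le0// pospart_ge0.
Qed.

(** Hopf's barrier: by [lap_gauss] it is subharmonic where 2 b |y - z|^2 >= N. *)
Definition gauss (b:R) z y : R:=expR (- b * dot (y-z) (y-z)).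

Let smooth1_gauss (b:R) : smooth1 (fun s:R=>expR (- b * s)).
exact: (smooth1_comp smooth1_exp (smooth1M (smooth1_cst _) smooth1_id)). Qed.

Lemma sm_gauss (b:R) z : sm (gauss b z).
exact: (sm_shift z (sm_comp (smooth1_gauss b) (@sm_dot2 R N))). Qed.

Lemma derive1_gauss (b:R) : derive1 (fun s:R=>expR (- b * s)) = fun s => - b * expR (- b * s).
apply/funext=>s; rewrite derive1E; apply: derive_val.
have D: is_derive s (1:R) (fun s:R => - b * s) (- b).
 by apply: is_derive_eq (is_deriveZ (- b) (is_derive_id s (1:R))) _; rewrite /GRing.scale/= mulr1.
by apply: is_derive_eq (is_derive1_comp (is_derive_expR _) D) _; rewrite mulrC.
Qed.

Lemma lap_gauss (b:R) z y : lap (gauss b z) y = (4 * b^+2 * nrm (y-z)^+2-2 * b*N%:R) * gauss b z y.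
pose Q (s:R):=expR (- b * s).
have -> : gauss b z = (fun y=>rk 0 Q 1 (y-z)).
 by apply/funext=>w; rewrite /rk /gauss /Q expr0 expr1n invr1 !mul1r.
rewrite lap_shift; last exact: (rk_sm _ _ (smooth1_gauss b)).
have -> : lap (rk 0 Q 1) = rk 2 (lapP N Q) 1:=lap_rk 0 (smooth1_gauss b) (oner_neq0 R).
rewrite /rk !expr1n !invr1 !mul1r /lapP -nrm_sq.
rewrite derive1_gauss derive1Z//= derive1_gauss /Q natrM; ring.
Qed.

Lemma lap_affine (k e:R) f y : sm f->lap (fun y=>k*(f y-e)) y = k * lap f y.
move=> S; rewrite /lap mulr_sumr; apply: eq_bigr=>i _.
have -> : pderiv i (fun y=>k*(f y-e)) = fun y=>k * pderiv i f y.
 rewrite pderivZ; last exact: smB S (sm_cst e).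
 by rewrite (pderivB i S (sm_cst e)) pderiv_cst; apply/funext=>x; rewrite subr0.
by rewrite pderivZ//; exact: sm_pderiv.
Qed.

Lemma ae_le_cont (f V:rV->R) : (forall x, O x -> {for x, continuous f}) ->
 (forall x, O x -> {for x, continuous V})->ae_in O (fun x=>f x<=V x)->forall x, O x->f x<=V x.
move=> cf cV fV x Ox; apply/ler_addgt0Pr=>e e0.
have e2: 0<e/2 by rewrite divr_gt0.
have /continuous_nrmP/(_ _ e2)[d d0 Hd]:=cf x Ox.
have /continuous_nrmP/(_ _ e2)[d' d'0 Hd']:=cV x Ox.
have [|y [Oy yx]]:=ae_dense oO fV Ox (_:0<Num.min d d'); first by rewrite lt_min d0.
move: yx; rewrite lt_min => /andP[/Hd h1 /Hd' h2]; move: h1 h2; rewrite !ltr_norml; lra.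
Qed.
Variables (c:R) (n:rV->rV).
Hypotheses (N_gt0:(0<N)%N) (c_gt0:0<c) (trapn:forall x0, boundary O x0->trap O c x0 (n x0)).

Lemma closure_bound M x : (forall y, O y->nrm y<=M)->closure O x->nrm x<=M.
move=> HM /closure_nrmP cx; apply/ler_addgt0Pr=>e e0.
by have [y Oy yx]:=cx e e0; have:=HM y Oy; have:=nrm_tri x y 0; rewrite !subr0 nrm_distC; lra.
Qed.

Let one_sub_exp (a:R) : 1-expR (- a)<=a.
have:=expR_ge1Dx (- a); lra. Qed.

(** A multiple of the Gaussian centred in the exterior tangent ball, shifted to vanish at x0, is
    non-positive on O and has Laplacian at least K; it is compared with u and with -u. The resulting
    slope depends on the supremum of h, and serves as the starting point of an iteration. *)
Lemma exterior_bound (c':R) : 0<c'->rayleigh O c'->exists2 L : R, 0<=L &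
 forall u g h (K:R), wsol u g h->L2 h->0<=K->(forall x, O x -> `|h x| <= K) ->
 forall x0, boundary O x0->ae_in O (fun y => `|u y| <= L*K * nrm (y-x0)).
move=> c'0 Rc; have [M HM]:=(bounded_nrmP O).1 bO.
pose r:=c/2; have r0: 0<r by rewrite divr_gt0.
have N0: 0<N%:R :> R by rewrite ltr0n.
(* With b r^2 = N, the bracket of [lap_gauss] is at least 4 b N - 2 b N = 2 b N for |y - z| >= r;
   [be] below is this bound times the least value of the Gaussian at distance at most D. *)
pose b:=N%:R/r^+2; have b0: 0<b by rewrite divr_gt0// exprn_gt0.
pose D:=2 * `|M| + r; have D0: 0<D by rewrite ltr_wpDl ?mulr_ge0.
pose be:=2 * b*N%:R * expR (- b*D^+2); have be0: 0<be by exact: (mulr_gt0 (mulr_gt0 (mulr_gt0 (ltr0n R 2) b0) N0) (expR_gt0 _)).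
exists (b*(D+r)/be); first exact: divr_ge0 (mulr_ge0 (ltW b0) (addr_ge0 (ltW D0) (ltW r0))) (ltW be0).
move=> u g h K W Lh K0 hK x0 bx; have [nOx clx]:=boundaryP oO bx.
pose z:=x0-r *: n x0.
have zr: nrm (x0-z) = r by rewrite /z opprB addrCA subrr addr0 nrmZ (nrm_n trapn)// mulr1 gtr0_norm.
have geo y: O y->r<=nrm (y-z)<=D.
 move=> Oy; rewrite (exterior_ball c_gt0 trapn bx Oy)/=.
 have:=nrm_tri y x0 z; have:=nrmD y (- x0); rewrite nrmN zr /D.
 have:=HM y Oy; have:=closure_bound HM clx; have:=ler_norm M; lra.
pose a y:=K/be*(gauss b z y-expR (- b * r^+2)).
have Sa: sm a by apply: smZ; apply: smB; [exact: sm_gauss|exact: sm_cst].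
have Kb: 0<=K/be by rewrite divr_ge0// ltW.
have a0 y: O y->a y<=0.
 move=> /geo/andP[ry _]; rewrite mulr_ge0_le0// subr_le0 ler_expR -nrm_sq !mulNr lerN2 ler_wpM2l ?(ltW b0)//.
 by rewrite lerXn2r ?nnegrE ?nrm_ge0// ltW.
have la y: O y->K<=lap a y.
 move=> /geo/andP[ry yD]; rewrite /a (lap_affine _ _ _ (sm_gauss b z)) lap_gauss.
 rewrite mulrAC ler_pdivlMr// ler_wpM2l// /be; apply: ler_pM; [exact: (mulr_ge0 (mulr_ge0 (ler0n R 2) (ltW b0)) (ltW N0))|exact: expR_ge0| |].
  have : b * r^+2<=b * nrm (y-z)^+2 by rewrite ler_wpM2l ?(ltW b0)// lerXn2r ?nnegrE ?nrm_ge0// ltW.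
  have -> : b * r^+2 = N%:R by rewrite /b divfK// gt_eqF// exprn_gt0.
  move: (nrm _) b0 N0=>p b0 N0 hp.
  have : 4 * b*N%:R<=4 * b*(b * p^+2):=ler_wpM2l (mulr_ge0 (ler0n R 4) (ltW b0)) hp.
  lra.
 rewrite ler_expR -nrm_sq !mulNr lerN2 ler_wpM2l ?(ltW b0)// lerXn2r ?nnegrE ?nrm_ge0// ltW//.
have up y: O y -> - a y<=b*(D+r)/be*K * nrm (y-x0).
 move=> Oy; have /andP[ry yD]:=geo y Oy.
 rewrite /a -mulrN opprB (_:b*(D+r)/be*K * nrm (y-x0) = K/be*(b*((D+r) * nrm (y-x0)))); last by ring.
 rewrite ler_wpM2l// /gauss -nrm_sq; set p:=nrm (y-z) in ry yD *.
 have -> : - b * p^+2 = - b * r^+2 + - (b*(p^+2-r^+2)) by ring.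
 rewrite expRD -{1}[expR (- b * r^+2)]mulr1 -mulrBr.
 apply: (@le_trans _ _ (b*(p^+2-r^+2))).
  have E1: expR (- b * r^+2)<=1 by rewrite expR_le1// mulNr oppr_le0 mulr_ge0 ?sqr_ge0 ?(ltW b0).
  have q0: 0<=b*(p^+2-r^+2) by rewrite mulr_ge0 ?(ltW b0)// subr_ge0 lerXn2r// nnegrE ?nrm_ge0// ltW.
  apply: (@le_trans _ _ (1-expR (- (b*(p^+2-r^+2))))); last exact: one_sub_exp.
  by rewrite -[leRHS]mul1r ler_wpM2r// subr_ge0 expR_le1// oppr_le0.
 rewrite ler_wpM2l ?(ltW b0)// subr_sqr mulrC; apply: ler_pM; rewrite ?subr_ge0// ?lerD2r//.
  by rewrite addr_ge0 ?nrm_ge0// ltW.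
 by have:=nrm_tri y x0 z; rewrite zr -/p; lra.
have ok W' g': H W' g'->okbar O a by move=> HW; exact: (okbar_le0 oO bO HW a0).
have U1: ae_in O (fun x=>u x+a x<=0).
 apply: (barrier_comparison c'0 Rc W Lh Sa (ok _ _ W.1)); apply: ae_inW=>x Ox _.
 by apply: le_trans (la x Ox); apply: le_trans (hK x Ox); exact: ler_norm.
have W2:=wsolZ oO bO (-1) W Lh.
have U2: ae_in O (fun x => -1 * u x+a x<=0).
 apply: (barrier_comparison c'0 Rc W2 _ Sa (ok _ _ W2.1)); first exact: L2Z.
 apply: ae_inW=>x Ox _; rewrite mulN1r.
 by apply: le_trans (la x Ox); apply: le_trans (hK x Ox); rewrite -normrN; exact: ler_norm.
apply: ae_in_impl2 U1 U2=>x Ox u1 u2; apply: le_trans (up x Ox); rewrite ler_norml; lra.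
Qed.

(** For f >= 0 the means of u increase as the scale decreases, so they stay below U. At a zero of U
    the mean of u >= 0 over a ball vanishes, so the zero set is open; it is also relatively closed,
    and connectedness concludes. *)
Lemma strong_maximum (C al F:R) u f U (G : 'I_N->rV->R) : connected O->L2 u->L2 f->vsol u f ->
 0<=C->0<=F->0<al->ireg O C al F u U G->ae_in O (fun x=>U x = u x) ->
 ae_in O (fun x=>0<=f x)->ae_in O (fun x=>0<=u x) -> ~ ae_in O (fun x=>u x = 0) ->
 forall x, O x->0<U x.
move=> connO Lu Lf Vu C0 F0 al0 RU Uu f0 u0 nu0.
have cU x (Ox:O x):=ireg_cont oO bO C0 F0 al0 Lu RU Ox.
have U0 x: O x->0<=U x.
 apply: (ae_le_cont (f:=fun=> 0))=>[y _||]; [exact: cst_continuous|exact: cU|].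
 by apply: ae_in_impl2 Uu u0=>y _ ->.
have mono x t: good O x t->conv u (psi t) x<=U x.
 move=> gt; have [/andP[t0 t1] Bt]:=gt; apply/ler_addgt0Pr=>e e0.
 have Ox: O x by apply: Bt; rewrite /nball/= subrr nrm0 ltW.
 have [r r0 [gr He]]:=small_scale oO C0 F0 al0 Ox e0.
 pose s:=Num.min r t; have s0: 0<s by rewrite lt_min r0.
 have sr: s<=r by rewrite ge_min lexx.
 have st: s<=t by rewrite ge_min lexx orbT.
 have [R1 _]:=RU x s (good_le gt s0 st).
 have {R1} : `|conv u (psi s) x-U x| <= e.
  apply: (le_trans R1); apply: le_trans He; rewrite ler_wpM2l ?mulr_ge0//.
  apply: (@le_trans _ _ (s `^ al)); first by rewrite ger_pMr ?powR_gt0//; exact: le_trans st t1.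
  by apply: powR_mono => //; exact: ltW.
 rewrite ler_norml => /andP[_ R1]; apply: (@le_trans _ _ (conv u (psi s) x)); last by rewrite -lerBlDl.
 rewrite -lerN2; apply: (derive_ge0_le (g:=fun s => - conv u (psi s) x) (dg:=fun s => - (s * conv u (lap (theta s)) x)) st)=>q /andP[sq qt].
  by apply: is_deriveN; apply: is_derive_conv_psi => //; exact: lt_le_trans sq.
 have q0:=lt_le_trans s0 sq.
 rewrite (vsol_theta Vu q0) ?mulrN ?opprK; last first.
  by move=> y yq; apply: Bt; exact: le_trans yq qt.
 apply: mulr_ge0; first exact: ltW.
 rewrite -(_:Int (fun=> 0) = 0); last by rewrite Int_cst ?mul0r.
 apply: Int_ae_le => //; [exact/L2_I1/L2_cst|exact: (conv_csm_I1 oO bO x Lf (csm_theta q0))|].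
 by apply: ae_in_impl f0=>y _ fy; rewrite mulr_ge0// theta_ge0.
pose B:=O `&` [set x | U x = 0].
have oB: open B.
 apply/open_nrmP=>x [Ox Ux]; have [t gt]:=good_exists oO Ox; have [/andP[t0 t1] Bt]:=gt.
 exists t => // y yt; have Oy: O y by apply: Bt; exact: ltW.
 split=> //=; apply/eqP; rewrite eq_le U0// andbT.
 have L2u: L2 (fun y => `|u y|).
  by apply: (L2_le oO _ Lu)=>[|w _]; [exact: measurableT_comp (@normr_measurable _ _) (L2_meas Lu)|rewrite normr_id].
 have Iu:=conv_csm_I1 oO bO x L2u (csm_psi t0).
 have c0: conv (fun y => `|u y|) (psi t) x = 0.
  apply/eqP; rewrite eq_le; apply/andP; split; last first.
   by apply: Int_ge0=>w _; rewrite mulr_ge0// psi_ge0.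
  rewrite -Ux; apply: le_trans (mono x t gt); apply: Int_ae_le => //.
   exact: (conv_csm_I1 oO bO x Lu (csm_psi t0)).
  by apply: ae_in_impl u0=>w _ uw; rewrite ger0_norm.
 have z0:=Int_ae0 oO Iu (fun w _=>mulr_ge0 (normr_ge0 (u w)) (psi_ge0 (w-x) t0)) c0.
 have {}z0 : ae_in (O `&` [set w | nrm (w-x)<t]) (fun w=>U w = 0).
  suff : ae_in O (fun w=>nrm (w-x)<t->U w = 0) by rewrite /ae_in; apply: filterS=>w h [/= Ow wx]; exact: h.
  apply: ae_in_impl2 z0 Uu=>w Ow /eqP h1->wx.
  move: h1; rewrite mulf_eq0 normr_eq0 => /orP[/eqP//|]; rewrite gt_eqF//.
  rewrite /rk PsE ps0E; apply: mulr_gt0; first by rewrite invr_gt0 exprn_gt0.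
  apply: mulr_gt0; first by rewrite invr_gt0 kc_gt0.
  have p0: 0<1-t ^- 2 * dot (w-x) (w-x).
   by rewrite subr_gt0 -nrm_sq mulrC ltr_pdivrMr ?exprn_gt0// mul1r ltr_pXn2r// nnegrE ?nrm_ge0// ltW.
  by rewrite /expinv p0; apply: mulr_gt0 => //; apply: mulr_gt0; [rewrite exprn_gt0// invr_gt0|exact: expR_gt0].
 apply/ler_addgt0Pr=>e e0; have /continuous_nrmP/(_ e e0)[d d0 Hd]:=cU y Oy.
 have oOt: open (O `&` [set w | nrm (w-x)<t]).
  apply: openI => //; rewrite (_ : [set _ | _] = (fun w=>nrm (w-x)) @^-1` [set s | s<t])//.
  by apply: open_comp; [move=> *; exact: nrm_continuous|exact: open_lt].
 have [w [_ wy Uw]]:=ae_dense oOt z0 (conj Oy yt) d0.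
 by have:=Hd w wy; rewrite Uw ltr_norml; lra.
have [B0|nB0 x Ox]:=pselect (B !=set0); last first.
 by rewrite lt_def U0// andbT; apply/eqP=>Ux; apply: nB0; exists x.
have BO: B = O.
 apply: connO B0 _ _; first by exists B; rewrite // /B setIA setIid.
 exists (closure B); first exact: closed_closure.
 apply/seteqP; split=> x [Ox Hx]; split=> //; first exact: subset_closure.
 apply/eqP; rewrite eq_le U0// andbT; apply/ler_addgt0Pr=>e e0.
 have /continuous_nrmP/(_ e e0)[d d0 Hd]:=cU x Ox.
 have /closure_nrmP/(_ d d0)[w [_ /= Uw] wx]:=Hx.
 by have:=Hd w wx; rewrite Uw ltr_norml; lra.
case: nu0; apply: ae_in_impl Uu=>x Ox <-; have : B x by rewrite BO.
by case.
Qed.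

(** A Gaussian barrier around the centre z of an interior tangent ball: in the core |x - z| < r/2 it
    lies below m, a lower bound of V on a compact set containing the core, and outside the core it
    is subharmonic. *)
Lemma hopf_bound (c':R) v g h V : 0<c'->rayleigh O c'->wsol v g h->L2 h->ae_in O (fun x=>0<=h x) ->
 (forall x, O x -> {for x, continuous V})->ae_in O (fun x=>V x = v x)->(forall x, O x->0<V x) ->
 exists2 k : R, 0<k & forall x d, O x->(forall y, nrm (y-x)<d->O y)->k * d<=V x.
move=> c'0 Rc W Lh h0 cV Vv V0; have [M HM]:=(bounded_nrmP O).1 bO.
have N0: 0<N%:R :> R by rewrite ltr0n.
pose r:=c/2; have r0: 0<r by rewrite divr_gt0.
pose K := [set x | forall y, nrm (y-x)<r/2->O y].
have KO x: K x->O x by apply; rewrite subrr nrm0 !divr_gt0.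
have cK: compact K.
 apply: (subclosed_compact _ (@compact_nball R N 0 M)).
  apply/closed_nrmP=>x Hx y yx.
  have [w Kw wx]:=Hx (r/2-nrm (y-x)) (ltac:(by rewrite subr_gt0)); apply: Kw.
  by have:=nrm_tri y x w; rewrite (nrm_distC x); lra.
 by move=> x /KO /HM; rewrite /= subr0.
have [m m0 Hm] : exists2 m : R, 0<m & forall x, K x->m<=V x.
 have [[x Kx]|K0]:=pselect (K !=set0); last by exists 1 => // x Kx; case: K0; exists x.
 have cV': {within K, continuous V} by apply: continuous_in_subspaceT=>y /set_mem/KO; exact: cV.
 have [w /set_mem Kw Hw]:=compact_EVT_min (ex_intro _ x Kx) cK cV'.
 by exists (V w); [exact/V0/KO|move=> y /mem_set; exact: Hw].
(* Fitted to the inner radius r/2: there 4 b^2 |x - z|^2 >= b (b r^2) = 2 b N. *)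
pose b:=2*N%:R/r^+2; have b0: 0<b by rewrite divr_gt0 ?mulr_gt0// exprn_gt0.
pose E:=expR (- b * r^+2).
(* The barrier is shifted to vanish at a radius r' < r, so that its positive part has compact
   support in O. For a point at distance d1 <= r/2 from the boundary the choice will be r' = r -
   d1/2, half way between the point and the sphere. *)
have barrier x0 r': boundary O x0->r/2<=r'<r->let z:=x0+r *: n x0 in
  forall x, O x->m*(gauss b z x-expR (- b * r'^+2))<=V x.
 move=> bx /andP[r'l r'r] z.
 pose k y:=m*(gauss b 0 y-expR (- b * r'^+2)).
 pose a y:=k (y-z).
 have Sk: sm k by apply: smZ; apply: smB; [exact: sm_gauss|exact: sm_cst].
 have Sa: sm a by exact: sm_shift.
 have aE y: a y = m*(gauss b z y-expR (- b * r'^+2)) by rewrite /a /k /gauss subr0.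
 have ok: okbar O a.
  move=> e e0; have S:=smooth1_pospart e.
  have T: tf (fun y=>pospart e (a y)).
   apply: (@tf_csm _ _ _ r' (fun y=>pospart e (k y))).
    split=> [|y yr]; first exact: sm_comp.
    rewrite pospart_nonpos// mulr_ge0_le0 ?(ltW m0)// subr_le0 /gauss subr0 ler_expR -nrm_sq !mulNr lerN2.
    by rewrite ler_wpM2l ?(ltW b0)// lerXn2r ?nnegrE ?nrm_ge0//; lra.
   move=> y yr; apply: (interior_ball trapn bx (a:=r)); first by rewrite r0 lexx.
   exact: le_lt_trans r'r.
  by apply: (H_eq oO bO (H_tf oO bO T)) => // i x _; rewrite (pderiv_comp i S Sa).
 have W':=wsolZ oO bO (-1) W Lh.
 have Q: ae_in O (fun x => -1 * v x+a x<=0).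
  apply: (barrier_comparison c'0 Rc W' _ Sa ok); first exact: L2Z.
  apply: ae_in_impl2 Vv h0=>x Ox Vx hx; rewrite !mulN1r -Vx=>va.
  have [xz|xz]:=leP (r/2) (nrm (x-z)).
   apply: (@le_trans _ _ 0); first by rewrite oppr_le0.
   rewrite (_:a = fun y=>m*(gauss b z y-expR (- b * r'^+2))); last exact/funext.
   rewrite (lap_affine _ _ _ (sm_gauss b z)) lap_gauss; apply: mulr_ge0; first exact: ltW.
   apply: mulr_ge0; last exact: expR_ge0.
   have : b*(r/2)^+2<=b * nrm (x-z)^+2 by rewrite ler_wpM2l ?(ltW b0)// lerXn2r ?nnegrE ?nrm_ge0//; lra.
   have br: b * r^+2 = 2*N%:R by rewrite /b divfK// gt_eqF// exprn_gt0.
   move: (nrm _) b0 N0=>p b0 N0 hp.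
   have : b*(b*(r/2)^+2)<=b*(b * p^+2) by rewrite ler_wpM2l// ltW.
   have -> : b*(b*(r/2)^+2) = b*(b * r^+2)/4 by field.
   rewrite br; lra.
  have : m<=V x.
   apply: Hm=>y yx; apply: (interior_ball trapn bx (a:=r)); first by rewrite r0 lexx.
   by have:=nrm_tri y x z; rewrite -/z; lra.
  have : a x<=m.
   rewrite aE ger_pMr// lerBlDr; apply: (@le_trans _ _ 1).
    by rewrite expR_le1 -nrm_sq mulNr oppr_le0 mulr_ge0 ?sqr_ge0 ?(ltW b0).
   by rewrite lerDl expR_ge0.
  lra.
 apply: ae_le_cont => //.
  move=> x _; apply: (@sm_cont _ _ (fun x=>m*(gauss b z x-expR (- b * r'^+2)))).
  by apply: smZ; apply: smB; [exact: sm_gauss|exact: sm_cst].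
 by apply: ae_in_impl2 Q Vv=>x _; rewrite aE=>q ->; lra.
have E0: 0<E by exact: expR_gt0.
pose k:=Num.min (m*E * b * r/4) (m/(2 * `|M| + 1)).
have k0: 0<k.
 rewrite lt_min; apply/andP; split.
  exact: divr_gt0 (mulr_gt0 (mulr_gt0 (mulr_gt0 m0 E0) b0) r0) (ltr0n R 4).
 by rewrite divr_gt0// ltr_wpDl ?mulr_ge0.
exists k => // x d Ox Bd; have [x0 [d1 [bx d10 xd1 Bd1 xE]]]:=nearest N_gt0 oO bO c_gt0 trapn Ox.
have dd1: d<=d1.
 rewrite leNgt; apply/negP=>dd; move: (dd); rewrite -xd1 nrm_distC => /Bd; exact: (boundaryP oO bx).1.
apply: (@le_trans _ _ (k * d1)); first by rewrite ler_wpM2l// ltW.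
have [dr|dr]:=leP d1 (r/2); last first.
 have Kx: K x by move=> y yx; apply: Bd1; exact: lt_trans dr.
 apply: le_trans (Hm x Kx).
 have dM: d1<=2 * `|M| + 1.
  have:=nrmD x (- x0); rewrite xd1 nrmN; have:=HM x Ox; have:=closure_bound HM (boundaryP oO bx).2.
  by have:=ler_norm M; lra.
 have kM: k*(2 * `|M| + 1)<=m by rewrite -ler_pdivlMr ?ltr_wpDl ?mulr_ge0// ge_min lexx orbT.
 by apply: le_trans kM; rewrite ler_wpM2l// ltW.
have r'P: r/2<=r-d1/2<r by apply/andP; split; lra.
apply: le_trans (barrier x0 _ bx r'P x Ox).
have -> : gauss b (x0+r *: n x0) x = expR (- b*(r-d1)^+2).
 rewrite /gauss -nrm_sq; congr (expR (_ * _^+2)).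
 have -> : x-(x0+r *: n x0) = (d1-r) *: n x0 by rewrite {1}xE opprD addrACA subrr add0r scalerBl.
 by rewrite nrmZ (nrm_n trapn bx) mulr1 ler0_norm ?opprB//; lra.
apply: (@le_trans _ _ (m*(E*(b*(r * d1/4))))).
 rewrite (_:m*(E*(b*(r * d1/4))) = m*E * b * r/4 * d1); last by field.
 by rewrite ler_wpM2r ?(ltW d10)// ge_min lexx.
rewrite ler_wpM2l ?(ltW m0)//.
have -> : - b*(r-d1)^+2 = - b*(r-d1/2)^+2+b*(d1 * r-3/4 * d1^+2) by field.
rewrite expRD -[X in _-X]mulr1 -mulrBr; apply: ler_pM; rewrite ?(ltW E0)//.
- exact: mulr_ge0 (ltW b0) (divr_ge0 (mulr_ge0 (ltW r0) (ltW d10)) (ler0n R 4)).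
- rewrite ler_expR !mulNr lerN2 ler_wpM2l ?(ltW b0)// lerXn2r ?nnegrE//; lra.
apply: (@le_trans _ _ (b*(d1 * r-3/4 * d1^+2))).
 rewrite ler_wpM2l ?(ltW b0)//; nra.
have:=expR_ge1Dx (b*(d1 * r-3/4 * d1^+2)); lra.
Qed.

End barriers.

(** * Slabs, reflected kernels and the expansion at a boundary point *)

Section product_laplacian.
Context {R : realType} {N : nat}.
Notation rV := 'rV[R]_N.
Notation dot := (@dotrv R N).
Implicit Types (f g k:rV->R) (x y z e:rV).

Lemma lapD f g y : sm f->sm g->lap (fun y=>f y+g y) y = lap f y+lap g y.
move=> Sf Sg; rewrite /lap -big_split/=; apply: eq_bigr=>i _.
by rewrite (pderivD i Sf Sg) (pderivD i (sm_pderiv i Sf) (sm_pderiv i Sg)).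
Qed.

Lemma lapM f g y : sm f->sm g ->
 lap (fun y=>f y * g y) y = f y * lap g y+g y * lap f y+2 * \sum_i pderiv i f y * pderiv i g y.
move=> Sf Sg; rewrite /lap !mulr_sumr -!big_split/=; apply: eq_bigr=>i _.
have Sfi:=sm_pderiv i Sf; have Sgi:=sm_pderiv i Sg.
rewrite (pderivM i Sf Sg) (pderivD i (smM Sf Sgi) (smM Sg Sfi)) (pderivM i Sf Sgi) (pderivM i Sg Sfi).
move: (f y) (g y) (pderiv i f y) (pderiv i g y) (pderiv i (pderiv i f) y) (pderiv i (pderiv i g) y) => *; ring.
Qed.

Lemma sm_height (Q:R->R) (a b:R) e : smooth1 Q->sm (fun z=>Q (a * dot z e+b)).
by move=> S; apply: sm_comp => //; apply: smD; [exact/smZ/sm_dot|exact: sm_cst]. Qed.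

Lemma pderiv_height (Q:R->R) (a b:R) e i : smooth1 Q ->
 pderiv i (fun z=>Q (a * dot z e+b)) = fun z=>a * e ord0 i * derive1 Q (a * dot z e+b).
move=> S; rewrite (pderiv_comp i S (smD (smZ a (sm_dot e)) (sm_cst b))).
rewrite (pderivD i (smZ a (sm_dot e)) (sm_cst b)) (pderivZ i a (sm_dot e)) pderiv_dot pderiv_cst.
by apply/funext=>z; rewrite addr0 mulrC.
Qed.

Lemma lap_height (Q:R->R) (a b:R) e z : smooth1 Q->dot e e = 1 ->
 lap (fun z=>Q (a * dot z e+b)) z = a^+2 * derive1 (derive1 Q) (a * dot z e+b).
move=> S e1; have [S1 _]:=smooth1_derive1 S.
transitivity (\sum_i (e ord0 i * e ord0 i)*(a^+2 * derive1 (derive1 Q) (a * dot z e+b))); last by rewrite -mulr_suml [X in X * _]e1 mul1r.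
apply: eq_bigr=>i _; rewrite (pderiv_height a b e i S) (pderivZ i _ (sm_height a b e S1)) (pderiv_height a b e i S1); ring.
Qed.

(** The flat function is nested: q vanishes up to 2/3 and is at least 1 from 1 on, and normalising
    by the factor exp(1) makes the outer function equal to 1 where q is 0. *)
Lemma exists_cutoff : exists2 Q : R->R, prof Q & (forall s, s<=2/3->Q s = 1) /\ forall s, 0<=Q s<=1.
pose q (s:R):=expR 1 * expinv 0 (3 * s+(-2)).
have Sq: smooth1 q.
 apply: smooth1M; first exact: smooth1_cst.
 apply: (@smooth1_comp _ (expinv 0) (fun s=>3 * s+(-2))); first exact: smooth1_expinv.
 by apply: smooth1D; [apply: smooth1M; [exact: smooth1_cst|exact: smooth1_id]|exact: smooth1_cst].
pose Q (s:R):=expR 1 * expinv 0 (1+(-1) * q s).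
have E1: expR 1 * expinv 0 1 = 1 :> R by rewrite /expinv ltr01 expr0 mul1r invr1 -expRD subrr expR0.
have E2 t: t<=1->expR 1 * expinv 0 t<=1 :> R.
 move=> t1; rewrite /expinv; case: ifP=>t0; last by rewrite mulr0.
 by rewrite expr0 mul1r -expRD expR_le1 subr_le0 invf_ge1.
exists Q; first split.
- apply: smooth1M; first exact: smooth1_cst.
 apply: (@smooth1_comp _ (expinv 0) (fun s=>1+(-1) * q s)); first exact: smooth1_expinv.
 by apply: smooth1D; [exact: smooth1_cst|apply: smooth1M => //; exact: smooth1_cst].
- move=> s s1; rewrite /Q /expinv ifF ?mulr0//; apply/negbTE; rewrite -leNgt mulN1r subr_le0 /q /expinv ifT; last by lra.
 rewrite expr0 mul1r -expRD; apply: (@le_trans _ _ (expR 0)); first by rewrite expR0.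
 rewrite ler_expR subr_ge0 invf_le1; lra.
split=> s; last first.
 apply/andP; split; first by rewrite mulr_ge0 ?expR_ge0// expinv_ge0.
 by apply: E2; rewrite mulN1r gerBl mulr_ge0 ?expR_ge0// expinv_ge0.
move=> s1; have q0: q s = 0 by rewrite /q /expinv ifF ?mulr0//; apply/negbTE; rewrite -leNgt; lra.
by rewrite /Q q0 mulr0 addr0.
Qed.

Lemma coord_unit e i : dot e e = 1 -> `|e ord0 i| <= 1.
by move=> e1; apply: (le_trans (coord_le_nrm e i)); rewrite /nrm e1 sqrtr1. Qed.

End product_laplacian.

Section slab.
Context {R : realType} {N : nat}.
Notation rV := 'rV[R]_N.
Notation dot := (@dotrv R N).
Implicit Types (O:set rV) (f g k:rV->R) (x y z e:rV).

Lemma Int_subset O O' f : open O->open O'->O `<=` O'->(forall x, 0<=f x)->I1 O' f->Int O f<=Int O' f.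
move=> oO oO' OO f0 If; have mO:=open_measurable_rV oO; have mO':=open_measurable_rV oO'.
have If': I1 O f by exact: (integrableS mO' mO OO If).
rewrite -lee_fin (EFin_Int oO If') (EFin_Int oO' If); apply: ge0_subset_integral => //.
- by apply/measurable_EFinP; exact: I1_meas If.
- by move=> x _; rewrite lee_fin.
Qed.

(** A slab of half-width 2s in a ball of radius r has volume O(s r^(N-1)), in any direction e.
    Instead of rotating coordinates, the slab is dominated by the derivative along e of a logistic
    function of height/s, and the derivative is moved onto a cutoff of gradient O(1/r). *)
Lemma slab_majorant : exists2 C : R, 0<=C & forall O x0 e (s r:R), open O->bounded_set O ->
 dot e e = 1->0<s->0<r ->
 exists G : rV->R, [/\ I1 O G, forall y, 0<=G y,
  forall y, nrm (y-x0)<=r -> `|dot (y-x0) e| <= 2 * s->1<=G y & Int O G<=C * s*(r^+N/r)].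
have [K K0 HK] := @pderiv_rk_bound R N 0 _ prof_th0.
pose Y (t:R):=(1+expR t)^-1.
have P t: 1+expR t != 0 :> R by rewrite gt_eqF// ltr_wpDr ?expR_ge0.
have Sy: smooth1 Y by apply: smooth1V => //; apply: smooth1D; [exact: smooth1_cst|exact: smooth1_exp].
have dY: derive1 Y = fun t => - (expR t*Y t^+2).
 apply/funext=>t; rewrite derive1E; apply: derive_val.
 have D: is_derive t (1:R) (fun t=>1+expR t) (expR t).
  by apply: (is_derive_eq (is_deriveD (is_derive_cst (1:R) t (1:R)) (is_derive_expR t))); rewrite add0r.
 have V := @is_deriveV _ (fun t:R=>1+expR t) t _ _ (P t) D; apply: (is_derive_eq V); rewrite /GRing.scale/= /Y exprVn; ring.
have Y01 t: 0<=Y t<=1.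
 by rewrite /Y invr_ge0 addr_ge0 ?expR_ge0//= invf_le1 ?lerDl ?expR_ge0// ltr_wpDr ?expR_ge0.
(* A lower bound for the integrand D on the slab: there height/s lies in [-2, 2] and |z|^2/(2r)^2 <=
   1/4. *)
pose y0:=expR (-2)*(1+expR 2)^-1^+2 * expinv 0 (3/4) : R.
have e34: 0<expinv 0 (3/4) :> R by rewrite /expinv ifT ?mulr_gt0 ?expR_gt0 ?expr0//; lra.
have i0: 0<(1+expR 2)^-1 :> R by rewrite invr_gt0 ltr_wpDr ?expR_ge0.
have y00: 0<y0 by apply: mulr_gt0 => //; apply: mulr_gt0; rewrite ?expR_gt0// exprn_gt0.
exists (y0^-1*(N%:R*K*4^+N)); first by rewrite mulr_ge0 ?invr_ge0 ?(ltW y00)// mulr_ge0 ?exprn_ge0// mulr_ge0.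
move=> O x0 e s r oO bO e1 s0 r0.
pose eta : rV->R:=rk 0 th0 (2 * r).
have r2: 0<2 * r by rewrite mulr_gt0.
have Ceta: csm (2 * r) eta by exact: csm_rk prof_th0 r2.
pose h z:=Y (s^-1 * dot z e+0).
have Sh: sm h by exact: sm_height.
pose k z:=h z * eta z.
have Ck: csm (2 * r) k by split=> [|z zr]; [exact: smM Sh Ceta.1|rewrite /k Ceta.2// mulr0].
pose D z:=expR (s^-1 * dot z e)*Y (s^-1 * dot z e)^+2 * eta z.
have th0_ge0 (t:R) : 0<=th0 t by exact: expinv_ge0.
have eta0 z: 0<=eta z by rewrite /eta /rk expr0 invr1 mul1r.
have D0 z: 0<=D z by rewrite mulr_ge0// mulr_ge0 ?expR_ge0// sqr_ge0.
(* Product rule along e for h times eta: the total derivative of k integrates to 0, which leaves s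
   times a term in the gradient of eta. *)
have DE z: D z = s*(\sum_i e ord0 i*(h z * pderiv i eta z) - \sum_i e ord0 i * pderiv i k z).
 rewrite -sumrB (eq_bigr (fun i=>(e ord0 i * e ord0 i)*(s^-1*D z)))=>[|i _].
  by rewrite -mulr_suml [X in _*(X * _)]e1 mul1r mulrA divff ?mul1r// gt_eqF.
 rewrite /k (pderivM i Sh Ceta.1) /h (pderiv_height s^-1 0 e i Sy) dY addr0 /D; ring.
have [M HM]:=(bounded_nrmP O).1 bO.
pose M' := `|M| + nrm x0+2 * r+1; pose O':=bball M' : set rV.
have oO': open O' by exact: open_bball.
have bO': bounded_set O' by exact: bounded_bball.
have OO: O `<=` O'.
 move=> y /HM yM; rewrite /O' /bball/= /M'; have:=ler_norm M; have:=nrm_ge0 x0; lra.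
have BO: nball x0 (2 * r) `<=` O' by apply: nball_bball; rewrite /M'; have:=normr_ge0 M; lra.
have SD: sm D.
 rewrite (_:D = fun z=>(- derive1 Y (s^-1 * dot z e+0)) * eta z); last first.
  by apply/funext=>z; rewrite dY addr0 opprK.
 by apply: smM Ceta.1; apply/smN/sm_height; exact: (smooth1_derive1 Sy).1.
have smI f: sm f->I1 O' (fun y=>f (y-x0)).
 by move=> Sf; apply: (L2_I1 oO' bO'); apply: (sm_L2 oO' bO'); exact: sm_shift.
have y0D z: nrm z<=r -> `|dot z e| <= 2 * s->y0<=D z.
 move=> zr; rewrite ler_norml => /andP[q1 q2].
 have t1: -2<=s^-1 * dot z e by rewrite ler_pdivlMl//; lra.
 have t2: s^-1 * dot z e<=2 by rewrite ler_pdivrMl//; lra.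
 rewrite /y0 /D; apply: ler_pM; rewrite ?mulr_ge0 ?expR_ge0 ?sqr_ge0 ?(ltW e34)//.
  apply: ler_pM; rewrite ?expR_ge0 ?sqr_ge0 ?ler_expR//.
  rewrite lerXn2r ?nnegrE ?(ltW i0)//; first by case/andP: (Y01 (s^-1 * dot z e)).
  by rewrite lef_pV2 ?posrE ?ltr_wpDr ?expR_ge0// lerD2l ler_expR.
 rewrite /eta /rk expr0 invr1 mul1r /th0.
 rewrite /expinv ifT ?expr0 ?mul1r; last by lra.
 have q: (2 * r) ^- 2 * dot z z<=1/4.
  rewrite -nrm_sq mulrC ler_pdivrMr ?exprn_gt0// exprMn.
  have : nrm z^+2<=r^+2 by rewrite lerXn2r ?nnegrE ?nrm_ge0// ltW.
  lra.
 rewrite ifT; last by lra.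
 by rewrite ler_expR lerN2 lef_pV2 ?posrE; lra.
exists (fun y=>y0^-1*D (y-x0)); split.
- by apply: (I1Z oO); apply: (L2_I1 oO bO); apply: (sm_L2 oO bO); exact: sm_shift.
- by move=> y; rewrite mulr_ge0 ?invr_ge0 ?(ltW y00).
- by move=> y h1 h2; rewrite ler_pdivlMl// mulr1 y0D.
apply: (@le_trans _ _ (Int O' (fun y=>y0^-1*D (y-x0)))).
 apply: Int_subset => // [y|]; first by rewrite mulr_ge0 ?invr_ge0 ?(ltW y00).
 exact/(I1Z oO')/smI.
rewrite (IntZ oO' _ (smI _ SD)) -!mulrA ler_wpM2l ?invr_ge0 ?(ltW y00)//.
pose X z:=\sum_i e ord0 i*(h z * pderiv i eta z).
have SX: sm X by apply: sm_sum=>i _; apply/smZ/smM => //; exact: sm_pderiv Ceta.1.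
have E: Int O' (fun y=>D (y-x0)) = s*Int O' (fun y=>X (y-x0)).
 have SK i: I1 O' (fun y=>e ord0 i * pderiv i k (y-x0)) by apply: (I1Z oO'); apply: smI; exact: sm_pderiv Ck.1.
 have Z i: Int O' (fun y=>e ord0 i * pderiv i k (y-x0)) = 0.
  rewrite (IntZ oO' _ (smI _ (sm_pderiv i Ck.1))) -[X in _*X](_:conv O' (fun=> 1) (pderiv i k) x0 = _); last first.
   by apply: eq_Int=>y _; rewrite mul1r.
  by rewrite (Int_dcsm0 _ oO' bO' Ck BO) mulr0.
 rewrite (_:(fun y=>D (y-x0)) = fun y=>s*(X (y-x0) - \sum_i e ord0 i * pderiv i k (y-x0))); last first.
  by apply/funext=>y; rewrite DE.
 have SS: I1 O' (fun y => \sum_i e ord0 i * pderiv i k (y-x0)) by exact: (I1_sum oO').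
 rewrite (IntZ oO'); last by apply: (I1B oO') => //; exact: smI.
 rewrite (IntB oO' (smI _ SX) SS) (Int_sum oO' bO' _ SK) big1 ?subr0// => i _; exact: Z.
rewrite E (_:N%:R*(K*(4^+N*(s*(r^+N/r)))) = s*(N%:R*K/r*(2*(2 * r))^+N)); last first.
 have -> : 2*(2 * r) = 4 * r by ring.
 by rewrite exprMn; field; rewrite gt_eqF.
rewrite ler_wpM2l ?(ltW s0)//.
have B0: 0<=N%:R*K/r by rewrite divr_ge0 ?mulr_ge0// ltW.
have II: I1 O' (fun y => \1_(nball x0 (2 * r)) y).
 by apply: (I1_bounded oO' bO' (M:=1))=>[|y _]; [apply: measurable_indic; exact: measurable_nball|rewrite indicE ger0_norm; case: (_ \in _)].
apply: (@le_trans _ _ (N%:R*K/r*Int O' (fun y => \1_(nball x0 (2 * r)) y))); last first.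
 by rewrite ler_wpM2l//; exact: (Int_nball oO' bO' x0 (ltW r2)).
rewrite -(IntZ oO' _ II); apply: (Int_le oO' (smI _ SX) (I1Z oO' _ II))=>y _.
rewrite indicE; have [yB|yB]:=pselect (nball x0 (2 * r) y); last first.
 rewrite memNset// mulr0 le_eqVlt; apply/orP; left; apply/eqP; apply: big1=>i _.
 rewrite (csm_pderiv i Ceta).2 ?mulr0// leNgt; apply/negP=>yr; apply: yB; exact: ltW.
rewrite mem_set// mulr1; apply: (le_trans (ler_norm _)); apply: (le_trans (ler_norm_sum _ _ _)).
apply: (@le_trans _ _ (\sum_(i<N) K/r)); last by rewrite sumr_const card_ord -[_ *+ N]mulr_natl mulrA.
apply: ler_sum=>i _; rewrite !normrM -[leRHS]mul1r; apply: ler_pM => //; rewrite ?mulr_ge0//; first exact: coord_unit.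
rewrite -[leRHS]mul1r; apply: ler_pM => //.
 by rewrite /h; have /andP[q1 q2]:=Y01 (s^-1 * dot (y-x0) e+0); rewrite ger0_norm.
apply: (le_trans (HK (2 * r) i (y-x0) r2)); rewrite expr1 ler_wpM2l// lef_pV2 ?posrE//; lra.
Qed.

End slab.

Section boundary_expansion.
Context {R : realType} {N : nat} (O:set 'rV[R]_N).
Hypotheses (oO:open O) (bO:bounded_set O).
Notation rV := 'rV[R]_N.
Notation dot := (@dotrv R N).
Notation L2 := (L2 O).
Notation tf := (test_function O).
Notation conv := (conv O).
Notation vsol := (vsol O).
Notation morrey := (morrey O).
Implicit Types (u f h a:rV->R) (x y z:rV) (g : 'I_N->rV->R).
Variables (c:R) (n:rV->rV).
Hypotheses (N_gt0:(0<N)%N) (c_gt0:0<c) (trapn:forall x0, boundary O x0->trap O c x0 (n x0)).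

(** |u| <= L times the distance to the complement of O, without naming that distance. *)
Definition dist_bound L u:=forall y y', O y -> ~ O y' -> `|u y| <= L * nrm (y-y').

(** The kernel k vanishes on the tangent hyperplane and is cut at a height s of order t^2. The part
    above s lies in O and can be tested against the equation, giving the Morrey term. In the
    remaining slab u is O(L s), Lap of the cut kernel is O(m0 t^-(N+2) (1 + t/s)) because k = O(s m0
    t^-(N+1)) there, and the volume is O(s t^(N-1)): in total O(m0 L). *)
Lemma slab_estimate (al ka:R) : 0<al<=1->1<=ka ->
 exists C t1 : R, [/\ 0<=C, 0<t1<=1, ka * t1<=1, 20*(ka * t1)<=c &
 forall u f F L x0 k (m0 t:R), L2 u->L2 f->vsol u f->morrey f F al->0<=L->dist_bound L u ->
 boundary O x0->0<t<=t1->0<=m0->csm (ka * t) k->(forall z, dot z (n x0) = 0->k z = 0) ->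
 (forall z, `|k z| <= m0 * t^-N)->(forall i z, `|pderiv i k z| <= m0 * t^-N.+1) ->
 (forall z, `|lap k z| <= m0 * t^-N.+2) -> `|conv u (lap k) x0| <= C * m0*(F * t `^ (al-1)+L)].
have fin (p q w a b m l:R) : q<=a * m * w->p<=b * m * l->0<=a->0<=b->0<=m->0<=w->0<=l ->
  p+q<=(a+b) * m*(w+l).
 move=> h1 h2 a0 b0 m0 w0 l0; have : 0<=a * m * l by pos.
 have : 0<=b * m * w by pos.
 lra.
have aux1 (r s:R) : 10 * s<=r->r+3 * s<=13/10 * r by lra.
have aux2 (q s:R) : q<2 * s->q+s<=3 * s by lra.
have aux3 (p b:R) : 0<b->p<=169/100 * b->p<2 * b by lra.
have aux4 (p r q s:R) : p<r->q<2 * s->p+(q+s)<=r+3 * s by lra.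
have aux5 (r s k:R) : 10 * s<=r->20 * r<=k->0<r->r+3 * s<=k by lra.
have aux7 (q s:R) : - s/2<=q->q<=2 * s->0<s -> `|q| <= 2 * s by rewrite ler_norml; lra.
have aux8 (p r q:R) : p<=r -> - p<=q -> - (2 * r)/2<=q by lra.
have aux9 (w:R) : - (1/3)/2<=w->0<=w+1/3 by lra.
have aux10 (r k:R) : 0<r->20 * r<=k->r<=k by lra.
have aux11 (w:R) : 2*(1/3)<=w->1<=w+1/3 by lra.
have aux6 (w:R) : w<=1/3->w+3^-1<=2/3 by lra.
have aux12 (q s:R) : - s/2<=q->0<s->0<=q+s by lra.
have le29: 2/9<=1 :> R by lra.
have le23: 2/3<=1 :> R by lra.
move=> al01 ka1; have ka0: 0<ka by exact: lt_le_trans ka1.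
have [Q PQ [Q1 Q01]] := @exists_cutoff R; have SQ:=PQ.1; have PQ1:=prof_derive PQ; have PQ2:=prof_derive PQ1.
have [Z1 Z10 HZ1]:=prof_bounded PQ1; have [Z2 Z20 HZ2]:=prof_bounded PQ2.
have [CG CG0 HG] := @slab_majorant R N.
pose S:=2 * ka^+2/c; have S0: 0<S by rewrite divr_gt0 ?mulr_gt0 ?exprn_gt0.
pose C1:=ka^+N * ka `^ (al-1).
pose NZ:=N%:R*(Z1+Z2); have NZ0: 0<=NZ by rewrite mulr_ge0 ?addr_ge0.
pose C2:=3*CG*(ka^+N/ka)*(S^+2+NZ*S).
pose t1:=Num.min 1 (Num.min 1 (c/20)/ka).
have t10: 0<t1 by rewrite lt_min ltr01 divr_gt0// lt_min ltr01 divr_gt0.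
have kt1: ka * t1<=Num.min 1 (c/20) by rewrite mulrC -ler_pdivlMr// ge_min lexx orbT.
have C10: 0<=C1 by rewrite /C1; pos.
have C20: 0<=C2 by rewrite /C2; pos.
exists (C1+C2), t1; split.
- exact: addr_ge0.
- by rewrite t10 ge_min lexx.
- by apply: le_trans kt1 _; rewrite ge_min lexx.
- have : ka * t1<=c/20 by apply: le_trans kt1 _; rewrite ge_min lexx orbT.
 lra.
move=> u f F L x0 k m0 t Lu Lf V M L0 HL bx /andP[t0 tt1] m00 Ck ke Bk B1 B2.
have F0:=morrey_ge0 M.
set e:=n x0 in ke; have e1: dot e e = 1 by exact: n_unit trapn _ bx.
have ne: nrm e = 1 by exact: nrm_n trapn _ bx.
pose r:=ka * t; have r0: 0<r by exact: mulr_gt0.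
have rt1: r<=ka * t1 by rewrite ler_wpM2l// ltW.
have r1: r<=1 by apply: le_trans rt1 (le_trans kt1 _); rewrite ge_min lexx.
have rc: 20 * r<=c.
 have : r<=c/20 by apply: le_trans rt1 (le_trans kt1 _); rewrite ge_min lexx orbT.
 lra.
(* In the ball of radius r, points of height above r^2/c = s/2 lie in O and points of height below
   -s/2 do not. *)
pose s:=2 * r^+2/c; have s0: 0<s by rewrite divr_gt0 ?mulr_gt0 ?exprn_gt0.
have csE: c * s = 2 * r^+2 by rewrite /s mulrC divfK// gt_eqF.
have sE: s = S * t^+2 by rewrite /s /S /r; field; rewrite gt_eqF.
have s3r: 10 * s<=r.
 have : c*(10 * s)<=c * r; last by rewrite ler_pM2l.
 by rewrite (_:c*(10 * s) = 20 * r * r) ?ler_wpM2r ?(ltW r0)//; rewrite mulrCA csE; ring.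
(* The argument a height + 1/3 of the cutoff is 2/3 at height s and 1 at height 2s, so g equals 1
   below s and 0 above 2s. *)
pose a:=(3 * s)^-1; have a0: 0<a by rewrite invr_gt0 mulr_gt0.
have as1: a * s = 1/3 by rewrite /a; field; rewrite gt_eqF.
pose g z:=Q (a * dot z e+1/3).
have Sg: sm g by exact: sm_height.
pose k1 z:=g z * k z; pose k2 z:=k z-k1 z.
have Sk:=Ck.1; have Sk1: sm k1 by exact: smM.
have Ck1: csm r k1 by split=> // z zr; rewrite /k1 Ck.2 ?mulr0.
have Ck2: csm r k2 by split=> [|z zr]; [exact: smB|rewrite /k2 Ck1.2// Ck.2// subrr].
have kb z: `|dot z e| <= 2 * s -> `|k z| <= m0 * t^-N.+1*(N%:R*(2 * s)).
 move=> zs; have z0: k (z-dot z e *: e) = 0 by apply: ke; rewrite dotBl dotZl e1 mulr1 subrr.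
 have:=lip_of_pderiv Sk B1 z (z-dot z e *: e); rewrite z0 subr0 opprB addrCA subrr addr0 nrmZ ne mulr1.
 by move=> h; apply: (le_trans h); do 2 (apply: ler_wpM2l; first by pos).
pose B:=m0 * t^-N.+2*(1+NZ*(t/s)).
have B0: 0<=B by rewrite /B; pos.
have lapk1 z: nrm z<=r -> - s/2<=dot z e<=2 * s -> `|lap k1 z| <= B.
 move=> zr /andP[q1 q2]; rewrite (lapM z Sg Sk).
 have sig0: 0<=a * dot z e+1/3.
  have : a*(- s/2)<=a * dot z e by rewrite ler_wpM2l// ltW.
  by rewrite mulrA mulrN as1; exact: aux9.
 have g1: `|g z| <= 1 by have /andP[? ?]:=Q01 (a * dot z e+1/3); rewrite ger0_norm.
 have K1: `|g z * lap k z| <= m0 * t^-N.+2 by rewrite normrM -[leRHS]mul1r ler_pM.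
 have K2: `|k z * lap g z| <= m0 * t^-N.+1*(N%:R*(2 * s))*(a^+2*Z2).
  rewrite normrM; apply: ler_pM => //; first by apply/kb/aux7.
  by rewrite /g (lap_height _ _ _ SQ e1) normrM (ger0_norm (sqr_ge0 a)) ler_wpM2l ?sqr_ge0// HZ2.
 have K3: `|2 * \sum_i pderiv i g z * pderiv i k z| <= 2*(N%:R*(a*Z1*(m0 * t^-N.+1))).
  rewrite normrM (ger0_norm (ler0n R 2)) ler_wpM2l//; apply: (le_trans (ler_norm_sum _ _ _)).
  apply: (@le_trans _ _ (\sum_(i<N) a*Z1*(m0 * t^-N.+1))); last by rewrite sumr_const card_ord -[_ *+ N]mulr_natl.
  apply: ler_sum=>i _; rewrite normrM; apply: ler_pM => //.
  rewrite /g (pderiv_height _ _ _ _ SQ) !normrM (gtr0_norm a0) -mulrA ler_wpM2l ?(ltW a0)//.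
  by rewrite -[leRHS]mul1r; apply: ler_pM => //; [exact: coord_unit|exact: HZ1].
 have tn0: 0<=t^-N.+2 by rewrite invr_ge0 exprn_ge0// ltW.
 have E1: t^-N.+1 = t * t^-N.+2 by rewrite [t^+N.+2]exprS; field; rewrite expf_neq0 ?gt_eqF.
 have K2': m0 * t^-N.+1*(N%:R*(2 * s))*(a^+2*Z2)<=m0 * t^-N.+2*(N%:R*Z2*(t/s)).
  have -> : m0 * t^-N.+1*(N%:R*(2 * s))*(a^+2*Z2) = m0 * t^-N.+2*(N%:R*Z2*(t/s))*(2/9).
   by rewrite E1 /a; field; rewrite expf_neq0 ?gt_eqF.
  rewrite ler_piMr//.
  by pos.
 have K3': 2*(N%:R*(a*Z1*(m0 * t^-N.+1)))<=m0 * t^-N.+2*(N%:R*Z1*(t/s)).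
  have -> : 2*(N%:R*(a*Z1*(m0 * t^-N.+1))) = m0 * t^-N.+2*(N%:R*Z1*(t/s))*(2/3).
   by rewrite E1 /a; field; rewrite expf_neq0 ?gt_eqF.
  rewrite ler_piMr//.
  by pos.
 have -> : B = m0 * t^-N.+2+m0 * t^-N.+2*(N%:R*Z2*(t/s))+m0 * t^-N.+2*(N%:R*Z1*(t/s)).
  by rewrite /B /NZ; ring.
 apply: (le_trans (ler_normD _ _)); apply: lerD; last exact: le_trans K3'.
 by apply: (le_trans (ler_normD _ _)); apply: lerD => //; exact: le_trans K2'.
(* The support of k2 lies at height at least s inside the ball of radius r, a compact set which the
   trap places in O. *)
have P2: tf (fun y=>k2 (y-x0)).
 pose K := [set y : rV | s<=dot (y-x0) e] `&` nball x0 r.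
 have cK: closed K.
  apply: closedI; last exact: closed_nball.
  rewrite (_ : [set _ | _] = (fun y=>dot y e) @^-1` [set v | s+dot x0 e<=v]).
   by apply: preimage_closed; [move=> ? _; exact: dot_continuous|exact: closed_ge].
  by apply/funext=>y; rewrite /= dotBl lerBrDr.
 have KO: K `<=` O.
  move=> y [/= sy yr]; apply: ((trapn bx).2 y _).1; first exact: le_trans yr (aux10 _ _ r0 rc).
  apply: (@le_lt_trans _ _ (r^+2)); first by rewrite lerXn2r ?nnegrE ?nrm_ge0// ltW.
  apply: (@lt_le_trans _ _ (c * s)); last by rewrite ler_wpM2l// ltW.
  by rewrite csE ltr_pMl ?exprn_gt0// ltr1n.
 apply: (@tf_compact _ _ _ K) => //.
 - by apply: (subclosed_compact cK (@compact_nball R N x0 r))=>y [].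
 - exact: (sm_shift x0 Ck2.1).
 move=> y nK; have [yr|yr]:=leP r (nrm (y-x0)); first exact: Ck2.2.
 have ys: dot (y-x0) e<s by rewrite ltNge; apply/negP=>h; apply: nK; split=> //; exact: ltW.
 rewrite /k2 /k1 /g Q1 ?mul1r ?subrr//.
 have : a * dot (y-x0) e<=a * s by rewrite ler_wpM2l ?(ltW a0)// ltW.
 by rewrite as1; exact: aux6.
(* Points of O in the ball have height at least -s/2. If the height is also below 2s, going down by
   height + s reaches the complement within 3s, whence |u| <= 3 s L; above 2s the cutoff is zero. *)
have pt (G:rV->R) : (forall y, 0<=G y)->(forall y, nrm (y-x0)<=r -> `|dot (y-x0) e| <= 2 * s->1<=G y) ->
  forall y, O y -> `|u y * lap k1 (y-x0)| <= 3 * s*L*B*G y.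
 move=> G0 G1 y Oy; rewrite normrM.
 have Z0: 0<=3 * s*L*B*G y by have:=G0 y; pos.
 have [yr|yr]:=leP r (nrm (y-x0)); first by rewrite (csm_lap Ck1).2// normr0 mulr0.
 have [yq|yq]:=leP (2 * s) (dot (y-x0) e).
  have sig1: 1<=a * dot (y-x0) e+1/3.
   have : a*(2 * s)<=a * dot (y-x0) e by rewrite ler_wpM2l// ltW.
   by rewrite mulrCA as1; exact: aux11.
  rewrite (lapM _ Sg Sk) /g PQ.2// mul0r (lap_height _ _ _ SQ e1) PQ2.2// !mulr0 add0r big1 ?mulr0 ?addr0 ?normr0 ?mulr0// => i _.
  by rewrite (pderiv_height _ _ _ _ SQ) PQ1.2// mulr0 mul0r.
 have ql: - s/2<=dot (y-x0) e.
  have [|_ T2]:=(trapn bx).2 y; first exact: le_trans (ltW yr) (aux10 _ _ r0 rc).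
  have : - nrm (y-x0)^+2<=c * dot (y-x0) e by rewrite leNgt; apply/negP => /T2.
  have : nrm (y-x0)^+2<=r^+2 by rewrite lerXn2r ?nnegrE ?nrm_ge0 ?(ltW r0)// ltW.
  move=> h1 h2; have : c*(- s/2)<=c * dot (y-x0) e; last by rewrite ler_pM2l.
  have -> : c*(- s/2) = - (c * s)/2 by field.
  rewrite csE; exact: aux8 h1 h2.
 have uy: `|u y| <= 3 * s*L.
  pose y':=y-(dot (y-x0) e+s) *: e.
  have d0: 0<=dot (y-x0) e+s by exact: aux12.
  have y'E: y'-x0 = (y-x0)-(dot (y-x0) e+s) *: e by rewrite /y' addrAC.
  have ny': ~ O y'.
   have n': nrm (y'-x0)<=r+3 * s.
    rewrite y'E; apply: (le_trans (nrmD _ _)); rewrite nrmN nrmZ ne mulr1 ger0_norm//; exact: aux4.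
   apply: ((trapn bx).2 y' _).2; first exact: le_trans n' (aux5 _ _ _ s3r rc r0).
   have -> : dot (y'-x0) (n x0) = - s.
    rewrite y'E -/e; move: (y-x0)=>w; rewrite dotBl dotZl e1; ring.
   rewrite mulrN ltrN2 csE.
   apply: (@le_lt_trans _ _ ((r+3 * s)^+2)).
    by apply: lerXn2r => //; rewrite nnegrE; pos.
   have : (r+3 * s)^+2<=(13/10 * r)^+2.
    by apply: lerXn2r; rewrite ?nnegrE; [pos|pos|exact: aux1].
   have : 0<r^+2 by rewrite exprn_gt0.
   rewrite (_:(13/10 * r)^+2 = 169/100 * r^+2); [exact: aux3|by field].
  apply: (le_trans (HL y y' Oy ny')); rewrite mulrC ler_wpM2r//.
  rewrite /y' opprB addrCA subrr addr0 nrmZ ne mulr1 ger0_norm//; exact: aux2.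
 apply: (@le_trans _ _ (3 * s*L*B)).
  apply: ler_pM => //; apply: lapk1; first exact: ltW.
  by rewrite ql ltW.
 rewrite ler_peMr; [by []|by pos|].
 apply: G1; first exact: ltW.
 by apply: aux7 => //; exact: ltW.
have Elap z: lap k z = lap k1 z+lap k2 z.
 rewrite -(lapD z Sk1 Ck2.1); congr (lap _ z); apply/funext=>w; rewrite /k2 addrC subrK//.
have Ec: conv u (lap k) x0 = conv u (lap k1) x0-conv f k2 x0.
 have -> : - conv f k2 x0 = conv u (lap k2) x0.
  by rewrite -(V _ P2); apply: eq_Int=>y _; rewrite (lap_shift x0 Ck2.1).
 rewrite -IntD//; [|exact: (conv_csm_I1 oO bO x0 Lu (csm_lap Ck1))|exact: (conv_csm_I1 oO bO x0 Lu (csm_lap Ck2))].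
 by apply: eq_Int=>y _; rewrite Elap mulrDr.
have T1: `|conv f k2 x0| <= C1 * m0*(F * t `^ (al-1)).
 have Bk2 z: `|k2 z| <= m0 * t^-N.
  apply: le_trans (Bk z); have -> : k2 z = (1-g z) * k z by rewrite /k2 /k1; ring.
  have /andP[g0 g1]:=Q01 (a * dot z e+1/3).
  have g2: 0<=1-g z by rewrite subr_ge0.
  by rewrite normrM (ger0_norm g2) -[leRHS]mul1r ler_wpM2r// gerBl.
 have r01: 0<r<=1 by rewrite r0.
 apply: (le_trans (conv_morrey oO bO x0 Lf M r01 Ck2 Bk2)).
 rewrite /r powRM ?(ltW t0) ?(ltW ka0)// exprMn /C1 le_eqVlt; apply/orP; left; apply/eqP.
 by field; rewrite expf_neq0// gt_eqF.
have [G [IG G0 G1 GI]]:=HG O x0 e s r oO bO e1 s0 r0.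
have T2: `|conv u (lap k1) x0| <= C2 * m0*L.
 have IK:=conv_csm_I1 oO bO x0 Lu (csm_lap Ck1).
 apply: (le_trans (Int_abs_le oO (I1_meas IK) (I1Z oO (3 * s*L*B) IG) (pt G G0 G1))).
 rewrite (IntZ oO _ IG).
 apply: (@le_trans _ _ (3 * s*L*B*(CG * s*(r^+N/r)))).
  by apply: ler_wpM2l => //; pos.
 have -> : 3 * s*L*B*(CG * s*(r^+N/r)) =
   3*CG*(ka^+N/ka)*(m0*L)*(S^+2 * t+NZ*S).
  rewrite /B sE /r exprMn [t^+N.+2]exprS [t^+N.+1]exprS; field.
  by rewrite expf_neq0 !gt_eqF.
 rewrite /C2 (_:_*(S^+2+NZ*S) * m0*L = 3*CG*(ka^+N/ka)*(m0*L)*(S^+2+NZ*S)); last by ring.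
 apply: ler_wpM2l; first by pos.
 by rewrite lerD2r ler_piMr ?sqr_ge0//; apply: (le_trans tt1); rewrite ge_min lexx.
rewrite Ec; apply: (le_trans (ler_normB _ _)).
have P: 0<=F * t `^ (al-1) by pos.
exact: fin.
Qed.

End boundary_expansion.

Lemma powR_mvt {R : realType} (g dg:R->R) (al a b s t:R) : 0<al->0<s->s<=t->0<=a->0<=b ->
 (forall r, s<=r<=t->is_derive r (1:R) g (dg r)) ->
 (forall r, s<=r<=t -> `|dg r| <= a * r `^ (al-1)+b) -> `|g t-g s| <= a/al * t `^ al+b * t.
move=> al0 s0 st a0 b0 D B; have an: al != 0 by rewrite gt_eqF.
pose h r:=a/al * r `^ al+b * r; pose dh r:=a * r `^ (al-1)+b.
have pr r: s<=r<=t->0<r by move=> /andP[sr _]; exact: lt_le_trans sr.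
have Dh r: s<=r<=t->is_derive r (1:R) h (dh r).
 move=> /pr r0.
 have E1:=is_derive_cmul (a/al) (is_derive1_powR al r0); have E2:=is_derive_cmul b (is_derive_id r (1:R)).
 by apply: (is_derive_eq (is_deriveD E1 E2)); rewrite /dh; field.
have M1: h s-g s<=h t-g t.
 have P r: s<=r<=t->is_derive r (1:R) (fun r=>h r-g r) (dh r-dg r).
  by move=> srt; exact: is_deriveB (Dh r srt) (D r srt).
 apply: (derive_ge0_le st P)=>r srt.
 by have:=B r srt; rewrite ler_norml subr_ge0 => /andP[].
have M2: h s+g s<=h t+g t.
 have P r: s<=r<=t->is_derive r (1:R) (fun r=>h r+g r) (dh r+dg r).
  by move=> srt; exact: is_deriveD (Dh r srt) (D r srt).
 apply: (derive_ge0_le st P)=>r srt.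
 by have:=B r srt; rewrite ler_norml => /andP[q1 _]; rewrite -(opprK (dg r)) subr_ge0 lerNl.
have hs: 0<=h s by rewrite /h; pos.
rewrite -/(h t) ler_norml; move: (g s) (g t) (h s) (h t) M1 M2 hs; clear => *; lra.
Qed.

(** By scaling to t = 1, where the kernel is fixed and its second derivatives are bounded by compact
    support. *)
Lemma pderiv2_rk_bound {R : realType} {N : nat} p (Q:R->R) : prof Q->exists2 C : R, 0<=C &
 forall (t:R) i j (z : 'rV[R]_N), 0<t -> `|pderiv j (pderiv i (rk p Q t)) z| <= C * t^-p.+2.
move=> PQ; pose k : 'rV[R]_N->R:=rk p Q 1.
have Ck: csm 1 k by exact: csm_rk.
have /choice[B HB] : forall ij : 'I_N * 'I_N, exists B : R, 0<=B /\ forall z, `|pderiv ij.2 (pderiv ij.1 k) z| <= B.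
 by move=> [i j]; have [B B0 HB]:=csm_bdd (csm_pderiv j (csm_pderiv i Ck)); exists B.
exists (\sum_ij B ij); first by apply: sumr_ge0=>ij _; exact: (HB ij).1.
move=> t i j z t0; have Sk:=Ck.1; have Ski:=sm_pderiv i Sk.
have -> : rk p Q t = fun z : 'rV[R]_N=>t^-p * k (t^-1 *: z+0).
 by apply/funext=>w; rewrite /k /rk !expr1n !invr1 !mul1r addr0 dotZl dotZr mulrA -invfM -expr2.
have E f m: sm f->pderiv m (fun z : 'rV[R]_N=>f (t^-1 *: z+0)) = fun z=>t^-1 * pderiv m f (t^-1 *: z+0).
 by move=> Sf; rewrite pderiv_affine.
rewrite pderivZ; last exact: sm_affine.
rewrite E// pderivZ; last by apply/smZ/sm_affine.
rewrite pderivZ; last exact: sm_affine.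
rewrite E//.
have Bz:=(HB (i, j)).2 (t^-1 *: z+0).
have le: B (i, j) <= \sum_ij B ij.
 by rewrite (bigD1 (i, j))//= lerDl; apply: sumr_ge0=>ij _; exact: (HB ij).1.
have tp: 0<=t^-p by pos.
have ti: 0<=t^-1 by pos.
have E2: t^-p.+2 = t^-p*(t^-1 * t^-1) by rewrite !exprS !invfM; ring.
rewrite 3!normrM (ger0_norm tp) (ger0_norm ti) E2 [leRHS]mulrC -!mulrA.
by do 3 (apply: ler_wpM2l => //); exact: le_trans le.
Qed.

Lemma pderiv_lin {R : realType} {N : nat} (a : 'I_N->R) (f : 'I_N -> 'rV[R]_N->R) j : (forall i, sm (f i)) ->
 pderiv j (fun z => \sum_i a i * f i z) = fun z => \sum_i a i * pderiv j (f i) z.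
move=> Sf; rewrite (@pderiv_sum _ _ _ _ _ (fun i z=>a i * f i z))=>[|i]; last exact/smZ.
by apply/funext=>z; apply: eq_bigr=>i _; rewrite pderivZ.
Qed.

Lemma lap_lin {R : realType} {N : nat} (a : 'I_N->R) (f : 'I_N -> 'rV[R]_N->R) z : (forall i, sm (f i)) ->
 lap (fun z => \sum_i a i * f i z) z = \sum_i a i * lap (f i) z.
move=> Sf; rewrite /lap; under [RHS]eq_bigr do rewrite mulr_sumr; rewrite exchange_big/=; apply: eq_bigr=>j _.
by rewrite (pderiv_lin a j Sf) pderiv_lin// => i; exact: sm_pderiv.
Qed.

Section normal_slope.
Context {R : realType} {N : nat} (O:set 'rV[R]_N).
Hypotheses (oO:open O) (bO:bounded_set O).
Notation rV := 'rV[R]_N.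
Notation dot := (@dotrv R N).
Notation I1 := (I1 O).
Notation L2 := (L2 O).
Notation conv := (conv O).
Notation vsol := (vsol O).
Notation morrey := (morrey O).
Notation theta t := (rk N (Th N) t : rV -> R).
Notation psi t := (rk N (Ps N) t : rV -> R).
Implicit Types (u f h a:rV->R) (x y z e:rV) (g : 'I_N->rV->R).
Variables (c:R) (n:rV->rV).
Hypotheses (N_gt0:(0<N)%N) (c_gt0:0<c) (trapn:forall x0, boundary O x0->trap O c x0 (n x0)).

(** Twice the derivative along e, at x0, of the mollified zero extension of u. The factor 2 corrects
    for the half of the ball that lies outside O: for u = A height on a half-space the value is
    A. *)
Definition slope u e x0 t : R := -2 * \sum_i e ord0 i * conv u (pderiv i (psi t)) x0.

Lemma csm_dir (t:R) e (k:rV->R) : csm t k->csm t (fun z => \sum_i e ord0 i * pderiv i k z).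
move=> C; apply: (@csm_sum _ _ t (fun i z=>e ord0 i * pderiv i k z))=>i.
have [S Z]:=csm_pderiv i C; split=> [|z /Z ->]; [exact: smZ|by rewrite mulr0].
Qed.

Lemma sum_unit_bound e (a : 'I_N->R) (B:R) : dot e e = 1->(forall i, `|a i| <= B) ->
 `|\sum_i e ord0 i * a i| <= N%:R*B.
move=> e1 HB; apply: (le_trans (ler_norm_sum _ _ _)).
apply: (@le_trans _ _ (\sum_(i<N) B)); last by rewrite sumr_const card_ord mulr_natl.
by apply: ler_sum=>i _; rewrite normrM -[leRHS]mul1r; apply: ler_pM => //; exact: coord_unit.
Qed.

(** The scale derivative of the slope is -2 t conv u (Lap k), with k the derivative of theta_t along
    the normal. This k is odd in the height, hence zero on the tangent hyperplane; [slab_estimate]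
    bounds the derivative by a multiple of F t^(al-1) + L, which is integrable. *)
Lemma slope_estimate (al:R) : 0<al<=1->exists C t1 : R, [/\ 0<=C, 0<t1<=1 &
 forall u f F L x0, L2 u->L2 f->vsol u f->morrey f F al->0<=L->dist_bound O L u->boundary O x0 ->
 exists A : R, forall t, 0<t<=t1 -> `|slope u (n x0) x0 t-A| <= C*(F * t `^ al+L * t)].
move=> /[dup] al01 /andP[al0 al1].
have [C [t1 [C0 t11 _ _ HS]]]:=slab_estimate oO bO c_gt0 trapn al01 (lexx 1).
have PT := @prof_Th R N.
have [K1 K10 HK1] := @pderiv_rk_bound R N N _ PT.
have [K2 K20 HK2] := @pderiv2_rk_bound R N N _ PT.
have [K3 K30 HK3] := @lap_pderiv_rk_bound R N N _ PT.
pose K:=N%:R*(K1+K2+K3); have K0: 0<=K by rewrite /K; pos.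
exists (2*C*K/al+2*C*K), t1; split=> //; first by pos.
move=> u f F L x0 Lu Lf V M L0 HL bx; have F0:=morrey_ge0 M.
set e:=n x0; have e1: dot e e = 1 by exact: n_unit trapn _ bx.
pose k t z:=\sum_i e ord0 i * pderiv i (theta t) z.
have Ck (t:R) : 0<t->csm t (k t) by move=> t0; exact: csm_dir (csm_theta t0).
have Sk (t:R) : 0<t->sm (k t) by move=> /Ck[].
have lapk (t:R) : 0<t->forall z, lap (k t) z = \sum_i e ord0 i * lap (pderiv i (theta t)) z.
 by move=> t0 z; rewrite /k lap_lin// => i; apply/sm_pderiv; exact: (csm_theta t0).1.
have B (t:R) : 0<t<=t1 -> `|conv u (lap (k t)) x0| <= C*(K * t^-1)*(F * t `^ (al-1)+L).
 move=> t01; have /andP[t0 tt1]:=t01.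
 have tn m: 0<=t^-m by pos.
 have Kle (Ki:R) : 0<=Ki->Ki<=K1+K2+K3->N%:R*Ki<=K by move=> *; exact: ler_wpM2l.
 have tS m: t^-m.+1 = t^-1 * t^-m by rewrite exprS invfM.
 apply: (HS _ _ _ _ _ _ _ _ Lu Lf V M L0 HL bx t01) => //.
 - by pos.
 - by rewrite mul1r; exact: Ck.
 - move=> z ze; rewrite /k (eq_bigr (fun i=>z ord0 i * e ord0 i * rk N.+2 (fun s=>2 * derive1 (Th N) s) t z))=>[|i _].
   by rewrite -mulr_suml [X in X * _]ze mul0r.
  by rewrite (pderiv_rk i N t PT.1); ring.
 - move=> z; apply: (le_trans (sum_unit_bound e1 (fun i=>HK1 t i z t0))).
  rewrite tS !mulrA ler_wpM2r// ler_wpM2r ?invr_ge0 ?(ltW t0)// Kle//; lra.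
 - move=> j z; rewrite /k pderiv_lin=>[|i]; last by apply/sm_pderiv; exact: (csm_theta t0).1.
  apply: (le_trans (sum_unit_bound e1 (fun i=>HK2 t i j z t0))).
  rewrite tS !mulrA ler_wpM2r// ler_wpM2r ?invr_ge0 ?(ltW t0)// Kle//; lra.
 - move=> z; rewrite lapk//; apply: (le_trans (sum_unit_bound e1 (fun i=>HK3 t i z t0))).
  rewrite tS !mulrA ler_wpM2r// ler_wpM2r ?invr_ge0 ?(ltW t0)// Kle//; lra.
have D (t:R) : 0<t->is_derive t (1:R) (slope u e x0) (-2*(t * conv u (lap (k t)) x0)).
 move=> t0; apply: is_derive_cmul.
 have E i: is_derive t (1:R) (fun t=>e ord0 i * conv u (pderiv i (psi t)) x0) (e ord0 i*(t * conv u (lap (pderiv i (theta t))) x0)).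
  exact: is_derive_cmul (is_derive_conv_dpsi oO bO x0 i Lu t0).
 have -> : (fun t => \sum_i e ord0 i * conv u (pderiv i (psi t)) x0) = \sum_i (fun t=>e ord0 i * conv u (pderiv i (psi t)) x0).
  by apply/funext=>s; rewrite fct_sumE.
 apply: (is_derive_eq (is_derive_sum E)).
 under eq_bigr do rewrite mulrCA; rewrite -mulr_sumr; congr (_ * _).
 have I i: I1 (fun y=>u y * lap (pderiv i (theta t)) (y-x0)).
  exact: (conv_csm_I1 oO bO x0 Lu (csm_lap (csm_pderiv i (csm_theta t0)))).
 under eq_bigr do rewrite -(IntZ oO _ (I _)).
 rewrite -(Int_sum oO bO); last by move=> i; apply: (I1Z oO); exact: I.
 by apply: eq_Int=>y _; rewrite lapk// mulr_sumr; apply: eq_bigr=>i _; rewrite mulrCA.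
have [|s t|A HA] := @limit_exists R (fun t=>0<t<=t1) (slope u e x0) (fun t=>(2*C*K/al+2*C*K)*(F * t `^ al+L * t)).
- by exists t1; move: t11 => /andP[->]; rewrite lexx.
- move=> /andP[s0 st1] /andP[t0 tt1] st.
 apply: (@le_trans _ _ (2*C*K*F/al * t `^ al+2*C*K*L * t)).
  apply: (powR_mvt al0 s0 st)=>[||r /andP[sr _]|r /andP[sr rt]]; [by pos|by pos|exact: D (lt_le_trans s0 sr)|].
  have r0:=lt_le_trans s0 sr.
  have:=B r; rewrite r0 (le_trans rt tt1) => /(_ isT) Br.
  rewrite !normrM normrN (ger0_norm (ler0n R 2)) (gtr0_norm r0).
  apply: (@le_trans _ _ (2*(r*(C*(K * r^-1)*(F * r `^ (al-1)+L))))).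
   by rewrite ler_wpM2l// ler_wpM2l// ltW.
  by rewrite le_eqVlt; apply/orP; left; apply/eqP; field; rewrite gt_eqF.
 have -> : 2*C*K*F/al * t `^ al = 2*C*K/al*(F * t `^ al) by ring.
 rewrite -(mulrA (2*C*K) L t).
 have : 0<=2*C*K/al by pos.
 have : 0<=2*C*K by pos.
 have : 0<=F * t `^ al by pos.
 have : 0<=L * t by pos.
 move: (F * _) (L * t) (2*C*K/al) (2*C*K)=>p q a b p0 q0 a0 b0.
 rewrite mulrDl !mulrDr; have:=mulr_ge0 q0 a0; have:=mulr_ge0 b0 p0; lra.
by exists A.
Qed.

End normal_slope.

Lemma pderiv_diff_shift {R : realType} {N : nat} (f : 'rV[R]_N->R) a b i : sm f ->
 pderiv i (fun z=>f (z-a)-f (z-b)) = fun z=>pderiv i f (z-a)-pderiv i f (z-b).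
by move=> S; rewrite (pderivB i (sm_shift a S) (sm_shift b S)) !(pderiv_shift i _ S). Qed.

Lemma lap_diff_shift {R : realType} {N : nat} (f : 'rV[R]_N->R) a b z : sm f ->
 lap (fun z=>f (z-a)-f (z-b)) z = lap f (z-a)-lap f (z-b).
move=> S; rewrite /lap -sumrB; apply: eq_bigr=>i _.
by rewrite (pderiv_diff_shift a b i S) (pderiv_diff_shift a b i (sm_pderiv i S)).
Qed.

Section expansion.
Context {R : realType} {N : nat} (O:set 'rV[R]_N).
Hypotheses (oO:open O) (bO:bounded_set O).
Notation rV := 'rV[R]_N.
Notation dot := (@dotrv R N).
Notation Int := (Int O).
Notation I1 := (I1 O).
Notation L2 := (L2 O).
Notation conv := (conv O).
Notation vsol := (vsol O).
Notation morrey := (morrey O).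
Notation theta t := (rk N (Th N) t : rV -> R).
Notation psi t := (rk N (Ps N) t : rV -> R).
Implicit Types (u f h a:rV->R) (x y z e:rV) (g : 'I_N->rV->R).
Variables (c:R) (n:rV->rV).
Hypotheses (N_gt0:(0<N)%N) (c_gt0:0<c) (trapn:forall x0, boundary O x0->trap O c x0 (n x0)).

Definition reflect e z:=z-(2 * dot z e) *: e.

Lemma dot_reflect e z : dot e e = 1->dot (reflect e z) e = - dot z e.
by move=> e1; rewrite /reflect dotBl dotZl e1; ring. Qed.

Lemma nrm_reflect e z : dot e e = 1->nrm (reflect e z) = nrm z.
move=> e1; have ne: nrm e = 1 by rewrite /nrm e1 sqrtr1.
have : nrm (reflect e z)^+2 = nrm z^+2.
 by rewrite nrmB_sq nrmZ ne mulr1 real_normK ?num_real// dotZr; ring.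
by move=> /eqP; rewrite eqrXn2 ?nrm_ge0// => /eqP.
Qed.

Lemma rk_reflect p (Q:R->R) (t:R) e v z : dot e e = 1->dot z e = 0 ->
 rk p Q t (z-v) = rk p Q t (z-reflect e v).
move=> e1 ze; rewrite /rk -!nrm_sq [nrm (z-v)^+2]nrmB_sq nrmB_sq nrm_reflect// /reflect dotBr dotZr ze.
by rewrite mulr0 subr0.
Qed.

Lemma nrm_far (t:R) v z : nrm v<=12 * t->40 * t<=nrm z->0<t->t<=nrm (z-v).
by move=> h1 h2 t0; have:=nrmB_ge z v; lra. Qed.

(** The kernel theta_t(z - v) - theta_t(z - v'), with v' the mirror image of v, vanishes on the
    hyperplane by symmetry. Both balls fit in radius 40 t, which explains the choice ka = 40 in
    [slab_estimate]. *)
Lemma reflected_slab (al:R) : 0<al<=1->exists C t1 : R, [/\ 0<=C, 0<t1<=1 &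
 forall u f F L x0 x (t:R), L2 u->L2 f->vsol u f->morrey f F al->0<=L->dist_bound O L u ->
 boundary O x0->0<t<=t1->nrm (x-x0)<=12 * t ->
 `|conv u (lap (theta t)) x-conv u (lap (theta t)) (x0+reflect (n x0) (x-x0))| <= C*(F * t `^ (al-1)+L)].
move=> al01; have k40: 1<=40 :> R by lra.
have [C [t1 [C0 t11 _ _ HS]]]:=slab_estimate oO bO c_gt0 trapn al01 k40.
have PT := @prof_Th R N.
have [K0 K00 HK0] := @rk_bound' R N N _ PT.
have [K1 K10 HK1] := @pderiv_rk_bound R N N _ PT.
have [K2 K20 HK2] := @lap_rk_bound R N N _ PT.
pose K:=2*(K0+K1+K2); have Kge0: 0<=K by rewrite /K; pos.
have Ki0: 2*K0<=K by rewrite /K; lra.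
have Ki1: 2*K1<=K by rewrite /K; lra.
have Ki2: 2*K2<=K by rewrite /K; lra.
have two (a b Ki p:R) : `|a| <= Ki * p -> `|b| <= Ki * p->2*Ki<=K->0<=p -> `|a-b| <= K * p.
 move=> h1 h2 h3 p0; apply: (le_trans (ler_normB _ _)); apply: (@le_trans _ _ (2*Ki * p)); first by lra.
 by rewrite ler_wpM2r.
exists (C*K), t1; split=> //; first by pos.
move=> u f F L x0 x t Lu Lf V M L0 HL bx t01 xt; have /andP[t0 _]:=t01.
set e:=n x0; have e1: dot e e = 1 by exact: n_unit trapn _ bx.
have yv y: y-x0-(x-x0) = y-x by rewrite opprB addrA subrK.
move vE : (x-x0) xt yv=>v xt yv; move v'E : (reflect e v)=>v'.
have v't: nrm v'<=12 * t by rewrite -v'E nrm_reflect.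
have Ct: csm t (theta t) by exact: csm_theta.
pose k z:=theta t (z-v)-theta t (z-v').
have Sv w: sm (fun z=>theta t (z-w)) by exact: (sm_shift w Ct.1).
have pk i: pderiv i k = fun z=>pderiv i (theta t) (z-v)-pderiv i (theta t) (z-v'):=pderiv_diff_shift v v' i Ct.1.
have lk z: lap k z = lap (theta t) (z-v)-lap (theta t) (z-v'):=lap_diff_shift v v' z Ct.1.
have tn m: 0<=t^-m by pos.
have yv' y: y-x0-v' = y-(x0+v') by rewrite opprD addrA.
have E: conv u (lap k) x0 = conv u (lap (theta t)) x-conv u (lap (theta t)) (x0+v').
 rewrite -IntB//; [|exact: (conv_csm_I1 oO bO x Lu (csm_lap Ct))|exact: (conv_csm_I1 oO bO _ Lu (csm_lap Ct))].
 by apply: eq_Int=>y _; rewrite lk -mulrBr yv yv'.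
have Q: `|conv u (lap k) x0| <= C*K*(F * t `^ (al-1)+L).
 apply: (HS u f F L x0 k K t Lu Lf V M L0 HL bx t01 Kge0).
 - split=> [|z zt]; first exact: smB (Sv v) (Sv v').
  by rewrite /k !Ct.2 ?subrr//; exact: nrm_far zt t0.
 - by move=> z ze; rewrite /k -v'E (rk_reflect _ _ _ v e1 ze) subrr.
 - by move=> z; exact: (two _ _ _ _ (HK0 t _ t0) (HK0 t _ t0) Ki0 (tn _)).
 - by move=> i z; rewrite pk; exact: (two _ _ _ _ (HK1 t i _ t0) (HK1 t i _ t0) Ki1 (tn _)).
 - by move=> z; rewrite lk; exact: (two _ _ _ _ (HK2 t _ t0) (HK2 t _ t0) Ki2 (tn _)).
exact: (eq_ind _ (fun w => `|w| <= _) Q _ E).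
Qed.

(** The points x and its mirror image differ by 2 q along the normal, q being the height of x, so
    the difference of the means is the slope times q up to a second order remainder of psi_t,
    integrated against |u| <= 40 L t. *)
Lemma reflected_taylor : exists2 C : R, 0<=C & forall u L x0 x (t d:R), L2 u->0<=L->dist_bound O L u ->
 boundary O x0->0<t->0<d->nrm (x-x0)<=3 * d->3 * d<=12 * t ->
 `|conv u (psi t) x-conv u (psi t) (x0+reflect (n x0) (x-x0))-slope O u (n x0) x0 t * dot (x-x0) (n x0)|
  <= C*L*(d^+2/t).
have PP := @prof_Ps R N.
have [K K0 HK] := @pderiv2_rk_bound R N N _ PP.
exists (54*N%:R*N%:R*K*(40*80^+N)); first by pos.
move=> u L x0 x t d Lu L0 HL bx t0 d0 xd dt.
set e:=n x0; have e1: dot e e = 1 by exact: n_unit trapn _ bx.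
have ne: nrm e = 1 by exact: nrm_n trapn _ bx.
have yv y: y-x0-(x-x0) = y-x by rewrite opprB addrA subrK.
move vE : (x-x0) xd yv=>v xd yv; move v'E : (reflect e v)=>v'; move qE : (dot v e)=>q.
have qd: `|q| <= 3 * d.
 by rewrite -qE; have:=nrm_CS v e; rewrite ne mulr1=>h; exact: le_trans h xd.
have q6: `|2 * q| <= 6 * d by rewrite normrM ger0_norm//; lra.
have v't: nrm v'<=12 * t by rewrite -v'E nrm_reflect//; exact: le_trans dt.
have yv' y: y-x0-v' = y-(x0+v') by rewrite opprD addrA.
have vt: nrm v<=12 * t by exact: le_trans dt.
have Ct: csm t (psi t) by exact: csm_psi.
(* Minus the Taylor remainder of psi_t between z - v and z - v' with its gradient frozen at z; the
   constant 54 is 9 times 6, from the distance 9d to z and the displacement 6d. *)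
pose k z:=psi t (z-v)-psi t (z-v')+2 * q * \sum_i e ord0 i * pderiv i (psi t) z.
have kb z: `|k z| <= 54*N%:R*N%:R*K*(t^-N.+2 * d^+2).
 pose p:=z-v; pose p':=z-v'.
 have pp: p'-p = (2 * q) *: e by rewrite /p /p' -v'E /reflect qE; apply/rowP=>i; rewrite !mxE; ring.
 have npp: nrm (p'-p)<=6 * d by rewrite pp nrmZ ne mulr1.
 have -> : k z = - (psi t p'-psi t p - \sum_i pderiv i (psi t) z*(p' ord0 i-p ord0 i)).
  rewrite /k opprB addrC opprB; congr (_ + _); rewrite mulr_sumr; apply: eq_bigr=>i _.
  by have:=congr1 (fun w:rV=>w ord0 i) pp; rewrite !mxE => ->; ring.
 rewrite normrN.
 have := @mvt_box _ _ (psi t) p p' (fun i=>pderiv i (psi t) z) (K * t^-N.+2*(N%:R*(9 * d))).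
 move=> h; apply: (le_trans (h _)).
  move=> w i bw; split; first by apply: sm_derivable; exact: Ct.1.
  have wp: nrm (w-p)<=nrm (p'-p) by apply: nrm_mono=>j; rewrite !mxE; have:=bw j; rewrite /p /p' !mxE.
  have wz: nrm (w-z)<=9 * d.
   have:=nrm_tri w p z; have -> : p-z = - v by rewrite /p addrAC subrr add0r.
   by rewrite nrmN; lra.
  apply: (le_trans (lip_of_pderiv (sm_pderiv i Ct.1) (fun j y=>HK t i j y t0) w z)).
  by do 2 (apply: ler_wpM2l; first by pos).
 have sp: \sum_i `|p' ord0 i-p ord0 i| <= N%:R*(6 * d).
  have:=sum_coord_le_nrm (p'-p); under eq_bigr do rewrite !mxE.
  move=> h2; apply: (le_trans _ (ler_wpM2l (ler0n R N) npp)); apply: le_trans h2.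
  by rewrite le_eqVlt; apply/orP; left; apply/eqP; apply: eq_bigr=>i _; rewrite /p /p' !mxE.
 apply: (le_trans (ler_wpM2l _ sp)); first by pos.
 by rewrite le_eqVlt; apply/orP; left; apply/eqP; ring.
have k0 z: 40 * t<=nrm z->k z = 0.
 move=> zt; have z1: t<=nrm z by apply: le_trans zt; rewrite ler_peMl ?(ltW t0)//; lra.
 rewrite /k !Ct.2 ?(nrm_far _ zt)// subrr big1 ?mulr0 ?addr0// => i _.
 by rewrite (csm_pderiv i Ct).2// mulr0.
have E: conv u (psi t) x-conv u (psi t) (x0+v')-slope O u e x0 t * q = Int (fun y=>u y * k (y-x0)).
 rewrite /slope; have I i: I1 (fun y=>u y * pderiv i (psi t) (y-x0)) by exact: (conv_csm_I1 oO bO x0 Lu (csm_pderiv i Ct)).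
 have Ix y:=conv_csm_I1 oO bO y Lu Ct.
 have -> : - (-2*(\sum_i e ord0 i * conv u (pderiv i (psi t)) x0) * q) = Int (fun y=>2 * q * \sum_i e ord0 i*(u y * pderiv i (psi t) (y-x0))).
  have IS i: I1 (fun y=>e ord0 i*(u y * pderiv i (psi t) (y-x0))) by apply: (I1Z oO); exact: I.
  rewrite (IntZ oO); last exact: (I1_sum oO).
  rewrite (Int_sum oO bO)// (eq_bigr _ (fun i _=>IntZ oO (e ord0 i) (I i))) -[X in 2 * q*X]/(\sum_i e ord0 i * conv u (pderiv i (psi t)) x0).
  by move: (\sum_i _)=>S; ring.
 rewrite -IntB// -IntD//; [|exact: I1B|].
  have kE y: k (y-x0) = psi t (y-x)-psi t (y-(x0+v'))+2 * q * \sum_i e ord0 i * pderiv i (psi t) (y-x0).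
   by rewrite /k yv yv'.
  apply: eq_Int=>y _; rewrite kE mulrDr mulrBr; congr (_ + _).
  rewrite [RHS]mulrCA [in RHS]mulr_sumr; by congr (_ * _); apply: eq_bigr=>i _; rewrite mulrCA.
 by apply: (I1Z oO); apply: (I1_sum oO bO)=>i; apply: (I1Z oO); exact: I.
rewrite E; set B:=54 * _ * _*K * _ in kb.
have B0: 0<=B by exact: le_trans (kb 0).
have [nx0 _]:=boundaryP oO bx.
have t40: 0<=40 * t by pos.
have II: I1 (fun y => \1_(nball x0 (40 * t)) y).
 by apply: (I1_bounded oO bO (M:=1))=>[|y _]; [apply: measurable_indic; exact: measurable_nball|rewrite indicE ger0_norm; case: (_ \in _)].
have Mk: measurable_fun O (fun y=>u y * k (y-x0)).
 apply: measurable_funM; first exact: L2_meas Lu.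
 have Sk: sm k.
  apply: smD; first by apply: smB; exact: (sm_shift _ Ct.1).
  by apply: smZ; apply: sm_sum=>i _; apply/smZ/sm_pderiv; exact: Ct.1.
 exact: sm_meas (sm_shift x0 Sk).
apply: (le_trans (Int_abs_le oO Mk (I1Z oO (L*(40 * t)*B) II) _)).
 move=> y Oy; rewrite normrM indicE; have [yB|yB]:=pselect (nball x0 (40 * t) y).
  rewrite mem_set// mulr1; apply: ler_pM => //.
  by apply: (le_trans (HL y x0 Oy nx0)); rewrite ler_wpM2l.
 rewrite memNset// mulr0 k0 ?normr0 ?mulr0// leNgt; apply/negP=>h; apply: yB; exact: ltW.
rewrite (IntZ oO _ II); apply: (@le_trans _ _ (L*(40 * t)*B*(2*(40 * t))^+N)).
 by apply: ler_wpM2l; [pos|exact: (Int_nball oO bO x0 t40)].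
rewrite le_eqVlt; apply/orP; left; apply/eqP; rewrite /B (_:2*(40 * t) = 80 * t); last by ring.
rewrite exprMn [t^+N.+2]exprS [t^+N.+1]exprS; field; by rewrite expf_neq0 gt_eqF.
Qed.

End expansion.

(** With w = d^(al/4) and r = d^(1 - al/4), every error of the boundary expansion is at most w or d
    w; the exponent al/4 is not optimised. *)
Lemma power_scales {R : realType} (al d w r:R) : 0<al<=1->0<d<=1->w = d `^ (al/4)->r = d/w ->
 [/\ 0<w<=1, 0<r, d<=r, r<=w & [/\ r `^ al<=w, r * r `^ al<=d * w, r * r<=d * w, d^+2/r = d * w & (d/4) `^ al<=w]].
move=> /andP[al0 al1] /andP[d0 d1] wE rE.
have w0: 0<w by rewrite wE powR_gt0.
have w1: w<=1.
 by rewrite wE; have := @ger_powR R d _ 0 (al/4); rewrite powRr0; apply; rewrite ?d0 ?divr_ge0// ltW.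
have w4: w^+4 = d `^ al by rewrite wE -powR_mulrn ?powR_ge0// -powRrM divfK.
have dw4: d<=w^+4 by rewrite w4; apply: ger1_powR; rewrite ?d0.
have r0: 0<r by rewrite rE divr_gt0.
have rw: r * w = d by rewrite rE divfK// gt_eqF.
have dr: d<=r by rewrite -rw ger_pMr.
have w32: w^+3<=w^+2 by rewrite exprS ger_pMl ?exprn_gt0.
have w21: w^+2<=w by rewrite expr2 ger_pMl.
have rw3: r<=w^+3 by rewrite rE ler_pdivrMr// -exprSr.
have ral: r `^ al<=w^+3.
 rewrite rE powRM ?invr_ge0 ?(ltW d0) ?(ltW w0)// -w4.
 have : w^-1 `^ al<=w^-1 by apply: ler1_powR => //; rewrite invf_ge1.
 move=> h; apply: (@le_trans _ _ (w^+4 * w^-1)); first by rewrite ler_wpM2l// exprn_ge0// ltW.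
 by rewrite exprSr mulfK// gt_eqF.
have rww: r * w^+2 = d * w by rewrite expr2 mulrA rw.
split; rewrite ?w0 ?(le_trans rw3) ?(le_trans w32)//; split.
- exact: le_trans ral (le_trans w32 w21).
- by rewrite -rww ler_wpM2l ?(ltW r0)//; exact: le_trans ral w32.
- by rewrite -rww ler_wpM2l ?(ltW r0)//; exact: le_trans rw3 w32.
- by rewrite -rw; field; rewrite gt_eqF.
apply: (@le_trans _ _ (d `^ al)); first by apply: powR_mono; rewrite ?divr_ge0 ?(ltW al0) ?(ltW d0)//; lra.
rewrite -w4; apply: le_trans w21; apply: le_trans w32; by rewrite exprS ger_pMl ?exprn_gt0.
Qed.

Section boundary_taylor.
Context {R : realType} {N : nat} (O:set 'rV[R]_N).
Hypotheses (oO:open O) (bO:bounded_set O).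
Notation rV := 'rV[R]_N.
Notation dot := (@dotrv R N).
Notation Int := (Int O).
Notation I1 := (I1 O).
Notation L2 := (L2 O).
Notation conv := (conv O).
Notation vsol := (vsol O).
Notation morrey := (morrey O).
Notation theta t := (rk N (Th N) t : rV -> R).
Notation psi t := (rk N (Ps N) t : rV -> R).
Implicit Types (u f h a:rV->R) (x y z e:rV) (g : 'I_N->rV->R).
Variables (c:R) (n:rV->rV).
Hypotheses (N_gt0:(0<N)%N) (c_gt0:0<c) (trapn:forall x0, boundary O x0->trap O c x0 (n x0)).

(** The mirror image of x has height at most -d/2 by [cone_height], so the ball of radius d/4 around
    it lies below height -d/4 and within 4d of x0: outside O, because 100 d <= c. *)
Lemma reflected_zero u x0 x (d:R) : boundary O x0->0<d->100 * d<=c->(forall y, nrm (y-x)<d->O y) ->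
 nrm (x-x0)<=3 * d->conv u (psi (d/4)) (x0+reflect (n x0) (x-x0)) = 0.
move=> bx d0 dc Bx xd; have e1: dot (n x0) (n x0) = 1 by exact: n_unit trapn _ bx.
have ne: nrm (n x0) = 1 by exact: nrm_n trapn _ bx.
have d40: 0<d/4 by rewrite divr_gt0.
have hq: d/2<=dot (x-x0) (n x0) by apply: (cone_height c_gt0 trapn bx d0 _ Bx xd); lra.
rewrite -(Int0 O); apply: eq_Int=>y Oy; rewrite (csm_psi d40).2 ?mulr0// leNgt; apply/negP.
set v':=reflect _ _; rewrite opprD addrA=>yv.
have v'n: nrm v'<=3 * d by rewrite nrm_reflect.
have yn: nrm (y-x0)<=4 * d by have:=nrm_tri (y-x0) v' 0; rewrite !subr0; lra.
have yq: dot (y-x0) (n x0) <= - (d/4).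
 have:=nrm_CS (y-x0-v') (n x0); rewrite ne mulr1 dotBl dot_reflect// opprK ler_norml => /andP[_ h].
 by have:=le_lt_trans h yv; lra.
have [|_ T2]:=(trapn bx).2 y; first by apply: (le_trans yn); lra.
apply: T2 Oy; apply: (@le_lt_trans _ _ (c * - (d/4))); first by rewrite ler_wpM2l// ltW.
rewrite mulrN ltrN2; apply: (@le_lt_trans _ _ ((4 * d)^+2)); first by rewrite lerXn2r ?nnegrE ?nrm_ge0// mulr_ge0// ltW.
have : 100 * d * d<=c * d by rewrite ler_wpM2r// ltW.
have : 0<d * d by rewrite mulr_gt0.
lra.
Qed.

Lemma conv_Int_bound u (t B:R) (k:rV->R) x : L2 u->csm t k->(forall z, `|k z| <= B) ->
 `|conv u k x| <= B*Int (fun y => `|u y|).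
move=> Lu C HB; have Iu: I1 (fun y => `|u y|) by apply: (I1_norm oO); exact: (L2_I1 oO bO Lu).
rewrite -(IntZ oO _ Iu); apply: (Int_abs_le oO); [exact: I1_meas (conv_csm_I1 oO bO x Lu C)|exact: (I1Z oO)|].
by move=> y _; rewrite normrM mulrC ler_wpM2r.
Qed.

(** u(x) is close to its mean at scale d/4, the mean at the mirror image is zero, and the difference
    of the two means is carried up to the scale r, where it is the slope times the height. In the
    bound for |A| the constant L is multiplied by a free t, so that it can be absorbed later. *)
Lemma boundary_expansion (al:R) : 0<al<=1->exists C d0 : R, [/\ 0<=C, 0<d0<=1, 100 * d0<=c &
 forall u f F L x0, L2 u->L2 f->vsol u f->morrey f F al->0<=L->dist_bound O L u ->
 (forall x, O x -> {for x, continuous u})->boundary O x0 ->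
 exists A : R, (forall t, 0<t<=d0 -> `|A| <= C*(t^-N.+1*Int (fun y => `|u y|)+F+L * t)) /\
 forall x d, 0<d<=d0->(forall y, nrm (y-x)<d->O y)->nrm (x-x0)<=3 * d ->
 `|u x-A * dot (x-x0) (n x0)| <= C*(F+L)*(d * d `^ (al/4))].
have q4 (x:R) : 0<x->x/4<x by lra.
have q12 (d t:R) : d/4<=t->3 * d<=12 * t by lra.
have q12' (d t:R) : 0<d->d<=t->3 * d<=12 * t by lra.
have finA (A s X F Lt Ca K C:R) : `|s-A| <= Ca*(F+Lt) -> `|s| <= K*X->0<=C->0<=K->0<=Ca ->
  0<=X->0<=F->0<=Lt -> `|A| <= (C+(K+Ca))*(X+F+Lt).
 move=> h1 h2 C0 K0 Ca0 X0 F0 L0; have p1: 0<=C*(X+F+Lt) by pos.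
 have p2: 0<=K*(F+Lt) by pos.
 have p3: 0<=Ca*X by pos.
 by move: h1 h2; rewrite !ler_norml => /andP[? ?] /andP[? ?]; apply/andP; split; lra.
have fin (a b ux sq Aq Cr Cs Ct Ca Z F L:R) : `|a-ux| <= Cr*F -> `|b-a| <= Cs*(F+L) -> `|b-sq| <= Ct*L ->
  `|sq-Aq| <= 3*Ca*(F+L)->0<=Cr->0<=Cs->0<=Ct->0<=Ca->0<=Z->0<=F->0<=L ->
  `|ux-Aq| <= (Cr+Cs+Ct+3*Ca+Z)*(F+L).
 move=> h1 h2 h3 h4 r0 s0 t0 a0 z0 F0 L0.
 have p1: 0<=Cr*L by pos.
 have p2: 0<=Ct*F by pos.
 have p3: 0<=Z*(F+L) by pos.
 by move: h1 h2 h3 h4; rewrite !ler_norml => /andP[? ?] /andP[? ?] /andP[? ?] /andP[? ?]; apply/andP; split; lra.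
move=> al01; have /andP[al0 al1]:=al01.
have [Cs [ts [Cs0 /andP[ts0 ts1] HS]]]:=reflected_slab oO bO c_gt0 trapn al01.
have [Ca [ta [Ca0 /andP[ta0 ta1] HA]]]:=slope_estimate oO bO c_gt0 trapn al01.
have [Ct Ct0 HT]:=reflected_taylor oO bO trapn.
have [Cr Cr0 HR]:=exists_ireg oO bO al01.
have [K K0 HK] := @pderiv_rk_bound R N N _ (prof_Ps N).
have ep0: 0<al/4 by rewrite divr_gt0.
have m0: 0<Num.min ts ta by rewrite lt_min ts0.
have [d1 /andP[d10 d11] Hd1]:=powR_small ep0 m0.
pose d0:=Num.min (Num.min d1 ta) (c/100).
have d00: 0<d0 by rewrite !lt_min d10 ta0 divr_gt0.
have dd1: d0<=d1 by rewrite !ge_min lexx.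
have dta: d0<=ta by rewrite !ge_min lexx orbT.
have dc: 100 * d0<=c.
 have : d0<=c/100 by rewrite !ge_min lexx !orbT.
 lra.
exists (Cr+Cs+Ct+3*Ca+(2*N%:R*K+Ca)), d0; split=> //.
- by pos.
- by rewrite d00 (le_trans dd1).
move=> u f F L x0 Lu Lf V M L0 HL cu bx; have F0:=morrey_ge0 M.
have [A HAs]:=HA u f F L x0 Lu Lf V M L0 HL bx.
have e1: dot (n x0) (n x0) = 1 by exact: n_unit trapn _ bx.
have Iu0: 0<=Int (fun y => `|u y|) by apply: Int_ge0.
exists A; split.
 move=> t /andP[t0 td0]; have tt: 0<t<=ta by rewrite t0 (le_trans td0).
 have t01: 0<t<=1 by rewrite t0 (le_trans td0)// (le_trans dta).
 have h1:=HAs t tt; have [_ tal]:=powR_t t01 al0.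
 have h2: `|slope O u (n x0) x0 t| <= 2*N%:R*K*(t^-N.+1*Int (fun y => `|u y|)).
  rewrite /slope normrM normrN (ger0_norm (ler0n R 2)) -!mulrA ler_wpM2l//.
  apply: (sum_unit_bound e1)=>i; rewrite mulrA; apply: (conv_Int_bound x0 Lu (csm_pderiv i (csm_psi t0)))=>z.
  exact: HK.
 have h3: Ca*(F * t `^ al+L * t)<=Ca*(F+L * t) by rewrite ler_wpM2l// lerD2r -[leRHS]mulr1 ler_wpM2l.
 have a1: 0<=Cr+Cs+Ct+3*Ca by pos.
 have a2: 0<=2*N%:R*K by pos.
 have a3: 0<=t^-N.+1*Int (fun y => `|u y|) by pos.
 have a4: 0<=L * t by pos.
 exact: (finA _ _ _ _ _ _ _ _ (le_trans h1 h3) h2 a1 a2 Ca0 a3 F0 a4).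
move=> x d /andP[dp dd0] Bx xd; have d01: 0<d<=1 by rewrite dp (le_trans dd0)// (le_trans dd1).
(* The intermediate scale r = d/w is large enough for the Taylor error d^2/r and small enough for
   the error r^al of the slope. *)
have [w wE] : exists w, w = d `^ (al/4) by exists (d `^ (al/4)).
have [r rE] : exists r, r = d/w by exists (d/w).
have [/andP[w0 w1] r0 dr rw [ral rral rr ddr d4al]]:=power_scales al01 d01 wE rE.
have rm: r<=Num.min ts ta by apply: (le_trans rw); rewrite wE; apply: Hd1; rewrite dp (le_trans dd0).
have rts: r<=ts by apply: le_trans rm _; rewrite ge_min lexx.
have rta: r<=ta by apply: le_trans rm _; rewrite ge_min lexx orbT.
have d4r: d/4<=r by exact: le_trans (ltW (q4 _ dp)) dr.
have d40: 0<d/4 by rewrite divr_gt0.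
set xs:=x0+reflect (n x0) (x-x0); set q:=dot (x-x0) (n x0).
have [U [G reg]]:=HR u f F Lu Lf V M.
have Ox: O x by apply: Bx; rewrite subrr nrm0.
have gd: good O x (d/4).
 split; first by rewrite d40; apply: (le_trans d4r); apply: (le_trans rta).
 by move=> y yx; apply: Bx; exact: le_lt_trans yx (q4 _ dp).
have q3: `|q| <= 3 * d.
 by have:=nrm_CS (x-x0) (n x0); rewrite (nrm_n trapn bx) mulr1=>h; exact: le_trans h xd.
have Z: conv u (psi (d/4)) xs = 0.
 by apply: reflected_zero => //; apply: le_trans dc; rewrite ler_wpM2l.
have E1: `|conv u (psi (d/4)) x-conv u (psi (d/4)) xs-u x| <= Cr*(F*(d * w)).
 have [h _]:=reg x (d/4) gd; rewrite (ireg_eq oO bO Cr0 F0 al0 Lu reg Ox (cu x Ox)) in h.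
 rewrite Z subr0; apply: (le_trans h); rewrite -!mulrA ler_wpM2l// ler_wpM2l// mulrC.
 apply: ler_pM => //; [exact: ltW|exact: powR_ge0|].
 exact/ltW/q4.
(* From scale d/4 to scale r, by the mean value theorem in the scale with [reflected_slab] bounding
   the derivative. *)
have E2: `|(conv u (psi r) x-conv u (psi r) xs)-(conv u (psi (d/4)) x-conv u (psi (d/4)) xs)| <= Cs*((F+L)*(d * w)).
 pose dh t:=t * conv u (lap (theta t)) x-t * conv u (lap (theta t)) xs.
 have D t: d/4<=t<=r->is_derive t (1:R) (fun t=>conv u (psi t) x-conv u (psi t) xs) (dh t).
  move=> /andP[dt tr]; have t0:=lt_le_trans d40 dt.
  exact: is_deriveB (is_derive_conv_psi oO bO x Lu t0) (is_derive_conv_psi oO bO xs Lu t0).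
 have B t: d/4<=t<=r -> `|dh t| <= Cs*(F * r `^ al+L * r).
  move=> /andP[dt tr]; have t0:=lt_le_trans d40 dt.
  have tts: 0<t<=ts by rewrite t0 (le_trans tr).
  have t01: 0<t<=1 by rewrite t0 (le_trans tr)// (le_trans rts).
  have x12: nrm (x-x0)<=12 * t by exact: (le_trans xd (q12 _ _ dt)).
  have h:=HS u f F L x0 x t Lu Lf V M L0 HL bx tts x12.
  rewrite /dh -mulrBr normrM (gtr0_norm t0).
  apply: (@le_trans _ _ (t*(Cs*(F * t `^ (al-1)+L)))); first by rewrite ler_wpM2l// ltW.
  rewrite mulrCA ler_wpM2l// mulrDr; apply: lerD.
   by rewrite mulrCA (powR_t t01 al0).1 ler_wpM2l//; apply: powR_mono => //; exact: ltW.
  by rewrite mulrC ler_wpM2l.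
 apply: (le_trans (mvt_le d4r D B)); rewrite -mulrA ler_wpM2l//.
 apply: (@le_trans _ _ ((F * r `^ al+L * r) * r)).
  by rewrite ler_wpM2l ?addr_ge0 ?mulr_ge0 ?powR_ge0 ?(ltW r0)// gerBl; exact: ltW.
 rewrite mulrDl -!mulrA mulrDl; apply: lerD; rewrite ler_wpM2l//.
 by rewrite mulrC.
have E3: `|conv u (psi r) x-conv u (psi r) xs-slope O u (n x0) x0 r * q| <= Ct*(L*(d * w)).
 rewrite -ddr mulrA; apply: (HT u L x0 x r d Lu L0 HL bx r0 dp xd).
 exact: q12'.
have E4: `|slope O u (n x0) x0 r * q-A * q| <= 3*Ca*((F+L)*(d * w)).
 rewrite -mulrBl normrM; apply: (@le_trans _ _ (Ca*(F * w+L * w)*(3 * d))); last first.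
  by rewrite le_eqVlt; apply/orP; left; apply/eqP; ring.
 apply: ler_pM => //; apply: (le_trans (HAs r _)); first by rewrite r0.
 by rewrite ler_wpM2l//; apply: lerD; rewrite ler_wpM2l.
have D0: 0<=d * w by rewrite mulr_ge0 ?ltW.
have FD: 0<=F*(d * w) by exact: mulr_ge0.
have LD: 0<=L*(d * w) by exact: mulr_ge0.
rewrite -wE.
rewrite (mulrDl F L) in E2 E4; rewrite -mulrA (mulrDl F L).
have Z0: 0<=2*N%:R*K+Ca by pos.
exact: (fin _ _ _ _ _ _ _ _ _ _ _ _ E1 E2 E3 E4 Cr0 Cs0 Ct0 Ca0 Z0 FD LD).
Qed.

End boundary_taylor.

(** * Lipschitz bound at the boundary and C^1 regularity up to it *)

Section lipschitz_bound.
Context {R : realType} {N : nat} (O:set 'rV[R]_N).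
Hypotheses (oO:open O) (bO:bounded_set O).
Notation rV := 'rV[R]_N.
Notation dot := (@dotrv R N).
Notation Int := (Int O).
Notation L2 := (L2 O).
Notation H := (H O).
Notation wsol := (wsol O).
Notation vsol := (vsol O).
Notation morrey := (morrey O).
Implicit Types (u f h a:rV->R) (x y z e:rV) (g : 'I_N->rV->R).
Variables (c:R) (n:rV->rV).
Hypotheses (N_gt0:(0<N)%N) (c_gt0:0<c) (trapn:forall x0, boundary O x0->trap O c x0 (n x0)).

Lemma dist_bound_le L L' u : L<=L'->dist_bound O L u->dist_bound O L' u.
by move=> LL H y y' Oy ny; apply: (le_trans (H y y' Oy ny)); rewrite ler_wpM2r// nrm_ge0. Qed.

Lemma dist_bound_nearest L u : 0<=L->(forall x x0 d, boundary O x0->0<d->nrm (x-x0) = d ->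
  (forall y, nrm (y-x)<d->O y)->x = x0+d *: n x0 -> `|u x| <= L * d)->dist_bound O L u.
move=> L0 H y y' Oy ny; have [x0 [d [bx d0 yd Bd yE]]]:=nearest N_gt0 oO bO c_gt0 trapn Oy.
apply: (le_trans (H y x0 d bx d0 yd Bd yE)); rewrite ler_wpM2l// leNgt; apply/negP; rewrite nrm_distC => /Bd.
exact: ny.
Qed.

(** Near the boundary the expansion bounds |u| by (|A| + error) d, in which L appears with small
    factors; away from it, |u| <= S already suffices. *)
Lemma absorption_step (al:R) : 0<al<=1->exists2 K : R, 0<=K &
 forall u f F L S, L2 u->L2 f->vsol u f->morrey f F al->(forall x, O x -> {for x, continuous u}) ->
 0<=S->(forall x, O x -> `|u x| <= S)->0<=L->dist_bound O L u ->
 dist_bound O (L/2+K*(Int (fun x => `|u x|)+F+S)) u.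
move=> al01; have [C [d0 [C0 /andP[d00 d01] dc HB]]]:=boundary_expansion oO bO c_gt0 trapn al01.
have /andP[al0 _]:=al01; have ep0: 0<al/4 by rewrite divr_gt0.
(* Threshold for both t and d^(al/4): each of C t and C d^(al/4) is then at most 1/4, and together
   they account for the factor 1/2 in front of L. *)
have e0: 0<(4*(C+1))^-1 by rewrite invr_gt0 mulr_gt0// ltr_wpDl.
have Ce (x:R) : x<=(4*(C+1))^-1->C * x<=1/4.
 move=> h; apply: (@le_trans _ _ (C*(4*(C+1))^-1)); first by rewrite ler_wpM2l.
 by rewrite ler_pdivrMr ?mulr_gt0 ?ltr_wpDl//; lra.
have [d1 /andP[d10 d11] Hd1]:=powR_small ep0 e0.
pose de:=Num.min d0 d1; have de0: 0<de by rewrite lt_min d00.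
pose t:=Num.min d0 (4*(C+1))^-1; have t0: 0<t by rewrite lt_min d00.
have td0: t<=d0 by rewrite ge_min lexx.
have Ct: C * t<=1/4 by apply: Ce; rewrite ge_min lexx orbT.
have tn0: 0<=t^-N.+1 by pos.
have fin (I F L S d u A w:R) : 0<=I->0<=F->0<=L->0<=S->0<d->0<=w->C * w<=1/4 ->
  `|A| <= C*(t^-N.+1*I+F+L * t) -> `|u-A * d| <= C*(F+L)*(d * w) ->
  `|u| <= (L/2+(C * t^-N.+1+C+1/4+de^-1)*(I+F+S)) * d.
 move=> I0 F0 L0 S0 dp w0 Cw HA Hu.
 have p1: `|u| <= `|A| * d+C*(F+L)*(d * w).
  have:=ler_normD (u-A * d) (A * d); rewrite subrK normrM (gtr0_norm dp); lra.
 have p2: `|A| * d<=(C * t^-N.+1*I+C*F+L/4) * d.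
  rewrite ler_wpM2r ?(ltW dp)//; apply: (le_trans HA).
  have : L*(C * t)<=L*(1/4) by rewrite ler_wpM2l.
  lra.
 have p3: C*(F+L)*(d * w)<=(F+L)*(1/4) * d.
  have -> : C*(F+L)*(d * w) = (F+L)*(C * w) * d by ring.
  by rewrite ler_wpM2r ?(ltW dp)// ler_wpM2l// addr_ge0.
 have q1: 0<=C * t^-N.+1*(F+S) * d by pos.
 have q2: 0<=C*(I+S) * d by pos.
 have q3: 0<=(I+S) * d by pos.
 have q4: 0<=de^-1*(I+F+S) * d by pos.
 apply: (le_trans p1); apply: (le_trans (lerD p2 p3)).
 move: p1 p2 p3 q1 q2 q3 q4; move: (t^-N.+1) (de^-1)=>tn dn _ _ _ q1 q2 q3 q4.
 lra.
have K0: 0<=C * t^-N.+1+C+1/4+de^-1 by pos.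
exists (C * t^-N.+1+C+1/4+de^-1) => // u f F L S Lu Lf V M cu S0 HS L0 HL.
have F0:=morrey_ge0 M; have I0: 0<=Int (fun x => `|u x|) by exact: Int_ge0.
apply: dist_bound_nearest; first by pos.
move=> x x0 d bx dp xd Bd xE; have Ox: O x by apply: Bd; rewrite subrr nrm0.
have [dde|dde]:=leP d de; last first.
 apply: (le_trans (HS x Ox)); apply: (@le_trans _ _ (de^-1*S * d)).
  by rewrite mulrAC mulrC ler_peMr// ler_pdivlMl// mulr1 ltW.
 rewrite ler_wpM2r ?(ltW dp)//.
 apply: (@le_trans _ _ ((C * t^-N.+1+C+1/4+de^-1)*(Int (fun x => `|u x|)+F+S))); last by rewrite lerDr; pos.
 by apply: ler_pM; rewrite ?invr_ge0 ?(ltW de0)// ?lerDr ?addr_ge0//; pos.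
have [A [HA1 HA2]]:=HB u f F L x0 Lu Lf V M L0 HL cu bx.
have dd0: 0<d<=d0 by rewrite dp (le_trans dde)// ge_min lexx.
have xd3: nrm (x-x0)<=3 * d by rewrite xd; lra.
have tt: 0<t<=d0 by rewrite t0.
have:=HA2 x d dd0 Bd xd3.
have -> : dot (x-x0) (n x0) = d by rewrite {1}xE addrAC subrr add0r dotZl (n_unit trapn bx) mulr1.
apply: fin => //; [exact: powR_ge0| |exact: HA1].
by apply: Ce; apply: Hd1; rewrite dp (le_trans dde)// ge_min lexx orbT.
Qed.

(** The bound after j steps is 2 K + L0/2^j; the value of L0 disappears in the limit, only its
    finiteness matters. *)
Lemma dist_bound_iter (K L0:R) u : 0<=K->0<=L0->dist_bound O L0 u ->
 (forall L, 0<=L->dist_bound O L u->dist_bound O (L/2+K) u)->dist_bound O (2*K) u.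
move=> K0 L00 H0 step.
have Hk j: dist_bound O (2*K+L0/2^+j) u.
 elim: j=>[|j IH]; first by rewrite expr0 divr1; apply: dist_bound_le H0; rewrite lerDr mulr_ge0.
 have:=step _ _ IH; rewrite (_:(2*K+L0/2^+j)/2+K = 2*K+L0/2^+j.+1).
  by apply; pos.
 by rewrite exprS; field; rewrite expf_neq0.
move=> y y' Oy ny; apply/ler_addgt0Pr=>e e0.
pose b:=L0 * nrm (y-y')/e; have b0: 0<=b by rewrite /b; pos.
have:=archi_boundP b0; set j:=Num.bound b=>bj.
have bj2: b<=2^+j.
 apply: (le_trans (ltW bj)); rewrite -natrX ler_nat; exact/ltnW/ltn_expl.
apply: (le_trans (Hk j y y' Oy ny)); rewrite mulrDl lerD2l mulrAC ler_pdivrMr ?exprn_gt0//.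
by rewrite -ler_pdivrMl// mulrC.
Qed.
Variable c' : R.
Hypotheses (c'_gt0:0<c') (Rc:rayleigh O c').

(** For bounded f the exterior barrier provides a first finite slope, proportional to B. The
    iteration removes it, so that the final constant is independent of B, which is what allows
    truncation of f. *)
Lemma bounded_dist_bound (al:R) : 0<al<=1->exists2 K : R, 0<=K &
 forall u g f F S B, wsol u g f->L2 f->morrey f F al->(forall x, O x -> {for x, continuous u}) ->
 0<=S->(forall x, O x -> `|u x| <= S)->0<=B->(forall x, O x -> `|f x| <= B) ->
 dist_bound O (K*(Int (fun x => `|u x|)+F+S)) u.
move=> al01; have [K K0 HK]:=absorption_step al01.
have [L0 L00 HL0]:=exterior_bound oO bO N_gt0 c_gt0 trapn c'_gt0 Rc.
exists (2*K); first by pos.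
move=> u g f F S B W Lf M cu S0 HS B0 HB; have [Lu _ _]:=W.1; have F0:=morrey_ge0 M.
have I0: 0<=Int (fun x => `|u x|) by exact: Int_ge0.
have V:=wsol_vsol oO bO W; rewrite -mulrA; apply: (@dist_bound_iter _ (L0*B)); first by pos.
- by pos.
- apply: dist_bound_nearest; first by pos.
 move=> x x0 d bx dp xd Bd xE; rewrite -xd; have h:=HL0 u g f B W Lf B0 HB x0 bx.
 have Ox: O x by apply: Bd; rewrite subrr nrm0.
 apply: (ae_le_cont oO (f:=fun y => `|u y|) (V:=fun y=>L0*B * nrm (y-x0)) _ _ h Ox).
  by move=> y Oy; apply: continuous_comp; [exact: cu|exact: norm_continuous].
 by move=> y _; apply: continuousM; [exact: cst_continuous|exact: nrm_continuous].
- by move=> L Lp HL; exact: (HK u f F L S Lu Lf V M cu S0 HS Lp HL).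
Qed.

End lipschitz_bound.

Section general_rhs.
Context {R : realType} {N : nat} (O:set 'rV[R]_N).
Hypotheses (oO:open O) (bO:bounded_set O).
Notation rV := 'rV[R]_N.
Notation Int := (Int O).
Notation I1 := (I1 O).
Notation L2 := (L2 O).
Notation H := (H O).
Notation wsol := (wsol O).
Notation conv := (conv O).
Notation morrey := (morrey O).
Implicit Types (u f h a:rV->R) (x y z e:rV) (g : 'I_N->rV->R).
Notation n2 := (n2 O).
Variables (c:R) (n:rV->rV).
Hypotheses (N_gt0:(0<N)%N) (c_gt0:0<c) (trapn:forall x0, boundary O x0->trap O c x0 (n x0)).
Variable c' : R.
Hypotheses (c'_gt0:0<c') (Rc:rayleigh O c').

Definition trunc (j:nat) f x : R:=f x * \1_(`[- j%:R, j%:R]%classic) (f x).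

Lemma trunc_le j f x : `|trunc j f x| <= `|f x| /\ `|f x-trunc j f x| <= `|f x|.
by rewrite /trunc indicE; case: (_ \in _); rewrite ?mulr1 ?mulr0 ?subrr ?subr0 ?normr0. Qed.

Lemma trunc_bounded j f x : `|trunc j f x| <= j%:R.
rewrite /trunc indicE; have [h|h]:=pselect ((`[- j%:R, j%:R]%classic : set R) (f x)).
 by rewrite mem_set// mulr1 ler_norml; move: h; rewrite /= in_itv.
by rewrite memNset// mulr0 normr0.
Qed.

Lemma L2_trunc j f : L2 f->L2 (trunc j f).
move=> Lf; apply: (L2_le oO _ Lf)=>[|x _]; last exact: (trunc_le j f x).1.
apply: measurable_funM; first exact: L2_meas Lf.
by apply: measurableT_comp (L2_meas Lf); apply: measurable_indic; exact: measurable_itv.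
Qed.

Lemma trunc_cvg f (e:R) : L2 f->0<e->exists j, n2 (fun x=>f x-trunc j f x)<e.
move=> Lf e0; have mO:=open_measurable_rV oO.
have LB j: L2 (fun x=>f x-trunc j f x) by apply: L2B => //; exact: L2_trunc.
have I2 j: I1 (fun x=>(f x-trunc j f x)^+2) by exact: (LB j).2.
have C: (\int[lebesgue_rV R N]_(x in O) ((f x-trunc j f x)^+2)%:E)%E @[j --> \oo] --> (\int[lebesgue_rV R N]_(x in O) 0)%E.
 apply: (@dominated_cvg _ _ _ _ _ mO _ _ (fun x=>(f x^+2)%:E)) => //.
 - by move=> j; apply/measurable_EFinP; exact: (I1_meas (I2 j)).
 - move=> x Ox; have [m Hm] : exists m : nat, `|f x| <= m%:R by exists (Num.bound `|f x|); exact: ltW (archi_boundP (normr_ge0 _)).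
  apply: cvg_near_cst; exists m => // j /= mj.
  rewrite /trunc indicE mem_set ?mulr1 ?subrr ?expr0n//= in_itv/= -ler_norml.
  by apply: (le_trans Hm); rewrite ler_nat.
 - exact: Lf.2.
 - move=> j x Ox; rewrite lee_fin ger0_norm ?sqr_ge0// -real_normK ?num_real// -[leRHS]real_normK ?num_real//.
  by rewrite lerXn2r ?nnegrE//; exact: (trunc_le j f x).2.
rewrite integral0 in C.
have E: (fun j => \int[lebesgue_rV R N]_(x in O) ((f x-trunc j f x)^+2)%:E)%E = fun j=>(Int (fun x=>(f x-trunc j f x)^+2))%:E.
 by apply/funext=>j; rewrite (EFin_Int oO (I2 j)).
rewrite E in C; have /fine_cvg /= C' : (Int (fun x=>(f x-trunc j f x)^+2))%:E @[j --> \oo] --> 0%:E by exact: C.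
have e20: 0<e^+2 by rewrite exprn_gt0.
have /cvgrPdist_lt/(_ _ e20)[j _ /(_ j (leqnn j))]:=C'.
rewrite /= sub0r normrN ger0_norm ?Int_ge0// => [h|x _]; last exact: sqr_ge0.
exists j.
by rewrite -(@ltr_pXn2r _ 2)// ?nnegrE ?n2_ge0 ?(ltW e0)// n2_sq.
Qed.

(** The equation tested with u itself, together with the Rayleigh bound. *)
Lemma energy_bound (k:R) u g f : k<c'->wsol u g (fun x=>k * u x+f x)->L2 f->(c'-k) * n2 u<=n2 f.
move=> kc W Lf; have [Hu Su]:=W; have [Lu _ _]:=Hu.
have h1:=rayleigh_H oO bO (ltW c'_gt0) Rc Hu; rewrite (Su _ _ Hu) in h1.
have h2: Int (fun x=>(k * u x+f x) * u x) = k * n2 u^+2+Int (fun x=>f x * u x).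
 rewrite n2_sq -(IntZ oO _ Lu.2) -IntD//; [|exact: I1Z Lu.2|exact: L2_mul].
 by apply: eq_Int=>x _; ring.
have h3:=n2_CS oO Lf Lu; rewrite h2 in h1.
have [->|n0]:=eqVneq (n2 u) 0; first by rewrite mulr0 n2_ge0.
have np: 0<n2 u by rewrite lt_def n0 n2_ge0.
rewrite -(ler_pM2r np); have:=ler_norm (Int (fun x=>f x * u x)).
move: h1 h3; move: (Int _) (n2 u) (n2 f)=>I p q h1 h3 h4; lra.
Qed.

(** The representative is set to 0 off O, which supplies the boundary values when continuity on the
    closure is proved. *)
Lemma regular_rep (al:R) : 0<al<=1->exists2 C : R, 0<=C &
 forall u g f F, wsol u g f->L2 f->morrey f F al->exists U G,
 [/\ wsol U g f, ireg O C al F U U G, forall x, O x -> {for x, continuous U}, ae_in O (fun x=>U x = u x) & forall x, ~ O x->U x = 0].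
move=> al01; have /andP[al0 _]:=al01; have [C C0 HC]:=exists_ireg oO bO al01; exists C => // u g f F W Lf M.
have [Hu Su]:=W; have [Lu Lg _]:=Hu; have F0:=morrey_ge0 M.
have [U0 [G reg]]:=HC u f F Lu Lf (wsol_vsol oO bO W) M.
have ae0:=ireg_ae oO bO C0 F0 al0 Lu reg Hu.
pose U x:=if pselect (O x) then U0 x else 0.
have UO x: O x->U x = U0 x by rewrite /U; case: pselect.
have cU x: O x -> {for x, continuous U}.
 move=> Ox; have c0:=ireg_cont oO bO C0 F0 al0 Lu reg Ox.
 apply/continuous_nrmP=>e e0; have /continuous_nrmP/(_ e e0)[d d0 Hd]:=c0.
 have /open_nrmP/(_ x Ox)[d' d'0 Hd']:=oO; exists (Num.min d d'); first by rewrite lt_min d0.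
 by move=> y; rewrite lt_min => /andP[/Hd h /Hd' Oy]; rewrite !UO.
have aeU: ae_in O (fun x=>U x = u x) by apply: ae_in_impl ae0=>x Ox <-; exact: UO.
have mU: measurable_fun O U by apply: continuous_on_measurable.
have HU: H U g.
 by apply: (H_eq_ae oO bO Hu mU (fun i=>L2_meas (Lg i))); [apply: ae_in_impl aeU=>x _ ->|move=> i; exact: ae_inW].
exists U, G; split=> //; last by move=> x nO; rewrite /U; case: pselect.
have [LU _ _]:=HU.
have ce k x t: csm t k->conv U k x = conv u k x.
 move=> Ck; apply: (Int_ae_eq oO); [exact: (I1_meas (conv_csm_I1 oO bO x LU Ck))|exact: (I1_meas (conv_csm_I1 oO bO x Lu Ck))|].
 by apply: ae_in_impl aeU=>y _ ->.
move=> x t gt; have [/andP[t0 _] Bt]:=gt; have Ox: O x by apply: Bt; rewrite /nball/= subrr nrm0 ltW.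
have [h1 h2]:=reg x t gt; rewrite (ce _ _ _ (csm_psi t0)) UO//; split=> // i.
by rewrite (ce _ _ _ (csm_pderiv i (csm_psi t0))).
Qed.

Lemma ae_norm_le_cont u S : (forall x, O x -> {for x, continuous u})->(forall e:R, 0<e->ae_in O (fun x => `|u x| <= S+e)) ->
 forall x, O x -> `|u x| <= S.
move=> cu H x Ox; apply/ler_addgt0Pr=>e e0.
apply: (ae_le_cont oO (f:=fun y => `|u y|) (V:=fun=> S+e) _ _ (H e e0) Ox); last by move=> y _; exact: cst_continuous.
by move=> y Oy; apply: continuous_comp; [exact: cu|exact: norm_continuous].
Qed.

Lemma sup_cont (kap al:R) : 0<=kap->0<al<=1->exists2 C : R, 0<=C &
 forall u g h f F, wsol u g h->L2 h->L2 f->morrey f F al->(forall x, O x -> `|h x| <= kap * `|u x| + `|f x|) ->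
 (forall x, O x -> {for x, continuous u})->forall x, O x -> `|u x| <= C*(Int (fun x => `|u x|)+F).
move=> k0 al01; have [C C0 HC]:=sup_bound oO bO k0 al01; exists C => // u g h f F W Lh Lf M hf cu.
apply: ae_norm_le_cont => // e e0; have ec: 0<e/(C+1) by rewrite divr_gt0// ltr_wpDl.
apply: ae_in_impl (HC u g h f F W Lh Lf M hf _ ec)=>x _ hx; apply: (le_trans hx).
by rewrite mulrDr lerD2l mulrA ler_pdivrMr ?ltr_wpDl// mulrC ler_wpM2l ?(ltW e0)// lerDl.
Qed.

(** Truncated data give solutions Uj with a distance bound independent of the truncation level, and
    u - Uj is small in L2 by [energy_bound]. The bound is therefore proved for u first in integral
    form, at a fixed boundary point, and then pointwise by continuity. *)
Lemma solution_dist_bound (al:R) : 0<al<=1->exists2 K : R, 0<=K &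
 forall u g f F, wsol u g f->L2 f->morrey f F al->(forall x, O x -> {for x, continuous u}) ->
 (forall x, O x -> `|u x| <= K*(Int (fun x => `|u x|)+F)) /\ dist_bound O (K*(Int (fun x => `|u x|)+F)) u.
move=> al01; have [K K0 HK]:=bounded_dist_bound oO bO N_gt0 c_gt0 trapn c'_gt0 Rc al01.
have [C C0 HC]:=sup_cont (lexx 0) al01; have [Cr _ Hreg]:=regular_rep al01.
pose K1:=K*(1+C); have K10: 0<=K1 by rewrite /K1; pos.
have supb u g f F: wsol u g f->L2 f->morrey f F al->(forall x, O x -> {for x, continuous u}) ->
  forall x, O x -> `|u x| <= C*(Int (fun x => `|u x|)+F).
 by move=> W Lf M cu; apply: (HC u g f f F W Lf Lf M _ cu)=>x _; rewrite mul0r add0r.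
exists (C+K1); first exact: addr_ge0.
move=> u g f F W Lf M cu; have [Hu Su]:=W; have [Lu _ _]:=Hu; have F0:=morrey_ge0 M.
set I0:=Int (fun x => `|u x|); have I00: 0<=I0 by exact: Int_ge0.
split=> [x Ox|]; first by apply: (le_trans (supb u g f F W Lf M cu x Ox)); rewrite mulrDl lerDl; pos.
apply: (@dist_bound_le _ _ O (K1*(I0+F))); first by rewrite mulrDl lerDr; pos.
apply: (dist_bound_nearest oO bO N_gt0 c_gt0 trapn); first by pos.
move=> x x0 d bx dp xd Bd _; rewrite -xd; have Ox: O x by apply: Bd; rewrite subrr nrm0.
have [M0 HM]:=(bounded_nrmP O).1 bO.
pose m y:=K1*(I0+F) * nrm (y-x0).
have cm y: {for y, continuous m} by apply: continuousM; [exact: cst_continuous|exact: nrm_continuous].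
have mm: measurable_fun O m by apply: continuous_on_measurable => // y _; exact: cm.
have Lm: L2 m.
 apply: (L2_bounded oO bO mm (M:=K1*(I0+F)*(`|M0| + nrm x0)))=>y /HM yM.
 rewrite ger0_norm /m; last by pos.
 apply: ler_wpM2l; first by pos.
 by have:=nrmD y (- x0); rewrite nrmN; have:=ler_norm M0; lra.
have aeb: ae_in O (fun y => `|u y| - m y<=0).
 apply: (Int_le_ae oO bO)=>[|e e0]; first by apply: L2B => //; exact: L2_norm.
 pose D := `|M0| + nrm x0; pose v:=Num.sqrt (vol O).
 have D0: 0<=D by rewrite /D; pos.
 have v0: 0<=v by exact: sqrtr_ge0.
 (* E - 1 is the factor by which the L2 error of the truncated datum is amplified in the integral
    below. *)
 pose E:=v*(1+K1*D * vol O)/c'+1.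
 have V0:=vol_ge0 O.
 have E0: 0<E by apply: ltr_wpDl => //; pos.
 have [j Hj]:=trunc_cvg Lf (divr_gt0 e0 E0).
 pose fj:=trunc j f; have Lj: L2 fj by exact: L2_trunc.
 have [uj [gj Wj0]]:=exists_wsol oO bO N_gt0 c'_gt0 c'_gt0 Rc Lj.
 have Wj1: wsol uj gj fj by apply: (eq_wsol Wj0)=>y _; rewrite mul0r add0r.
 have Mj: morrey fj F al by apply: (morrey_le oO bO Lj Lf _ M)=>y _; exact: (trunc_le j f y).1.
 have [Uj [Gj [Wj _ cj _ _]]]:=Hreg uj gj fj F Wj1 Lj Mj.
 have [LUj _ _]:=Wj.1.
 pose w y:=u y + -1*Uj y; have Lw: L2 w by apply: L2D => //; exact: L2Z.
 have Ww:=wsol_lin oO bO (-1) W Wj Lf Lj.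
 have nw: c' * n2 w<=n2 (fun y=>f y-fj y).
  have := @energy_bound 0 w _ (fun y=>f y-fj y) c'_gt0.
  rewrite subr0; apply; last exact: L2B.
  by apply: (eq_wsol Ww)=>y _; rewrite mul0r add0r mulN1r.
 pose J:=Int (fun y => `|w y|); have J0: 0<=J by exact: Int_ge0.
 have Jw: J<=n2 w * v.
  have:=Int_n2 oO bO (L2_norm oO Lw); rewrite ger0_norm// => h; apply: (le_trans h).
  by rewrite n2_norm.
 have IUj: Int (fun y => `|Uj y|)<=I0+J.
  rewrite -IntD//; [|exact: (L2_I1 oO bO (L2_norm oO Lu))|exact: (L2_I1 oO bO (L2_norm oO Lw))].
  apply: Int_le => //; [exact: (L2_I1 oO bO (L2_norm oO LUj))|apply: I1D => //; exact: (L2_I1 oO bO (L2_norm oO _))|].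
  move=> y _; have -> : Uj y = u y-w y by rewrite /w mulN1r opprB addrCA subrr addr0.
  exact: ler_normB.
 have IUj0: 0<=Int (fun y => `|Uj y|) by exact: Int_ge0.
 have Sj:=supb Uj gj fj F Wj Lj Mj cj.
 have Sj0: 0<=C*(Int (fun y => `|Uj y|)+F) by pos.
 have dj:=HK Uj gj fj F _ j%:R Wj Lj Mj cj Sj0 Sj (ler0n R j) (fun y _=>trunc_bounded j f y).
 have pt y: O y -> `|u y| - m y<=`|w y| + K1*J*D.
  move=> Oy; have:=dj y x0 Oy (boundaryP oO bx).1.
  have yD: nrm (y-x0)<=D by have:=nrmD y (- x0); rewrite nrmN; have:=HM y Oy; have:=ler_norm M0; rewrite /D; lra.
  have uw: u y = w y+Uj y by rewrite /w mulN1r subrK.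
  have : `|u y| <= `|w y| + `|Uj y| by rewrite uw; exact: ler_normD.
  have -> : K*(Int (fun y => `|Uj y|)+F+C*(Int (fun y => `|Uj y|)+F)) = K1*(Int (fun y => `|Uj y|)+F) by rewrite /K1; ring.
  have q1: K1*(Int (fun y => `|Uj y|)+F) * nrm (y-x0)<=K1*(I0+J+F) * nrm (y-x0).
   by apply: ler_wpM2r; [exact: nrm_ge0|apply: ler_wpM2l => //; rewrite lerD2r].
  have q2: K1*J * nrm (y-x0)<=K1*J*D by apply: ler_wpM2l => //; pos.
  move: q1 q2; rewrite /m; move: (`|u y|) (`|w y|) (`|Uj y|) (nrm _) (Int _)=>a b e1 q i q1 q2 h1 h2; lra.
 have IJ: I1 (fun y => `|w y| + K1*J*D) by apply: I1D => //; [exact: (L2_I1 oO bO (L2_norm oO Lw))|exact: (I1_cst oO bO)].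
 apply: (@le_trans _ _ (Int (fun y => `|w y| + K1*J*D))).
  apply: Int_le => //.
   apply: (L2_I1 oO bO); apply: (L2_le oO _ (L2B oO (L2_norm oO Lu) Lm)).
    by apply: measurable_maxr => //; exact: (L2_meas (L2B oO (L2B oO (L2_norm oO Lu) Lm) (L2_cst oO bO 0))).
   by move=> y _; rewrite subr0; case: (leP (`|u y| - m y) 0); rewrite ?normr0.
  move=> y Oy; rewrite subr0 ge_max pt//=; have : 0<=K1*J*D by pos.
  by move=> h; exact: addr_ge0.
 rewrite IntD//; [|exact: (L2_I1 oO bO (L2_norm oO Lw))|exact: (I1_cst oO bO)].
 rewrite (Int_cst oO) -/J.
 have nj: n2 w<=n2 (fun y=>f y-fj y)/c' by rewrite ler_pdivlMr// mulrC.
 have nj2: n2 w<=e/E/c' by apply: (le_trans nj); rewrite ler_wpM2r ?invr_ge0 ?(ltW c'_gt0)// ltW.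
 apply: (@le_trans _ _ (e/E/c' * v*(1+K1*D * vol O))).
  have -> : J+K1*J*D * vol O = J*(1+K1*D * vol O) by ring.
  apply: ler_wpM2r; first by pos.
  by apply: (le_trans Jw); rewrite ler_wpM2r.
 have EE: E-1 = v*(1+K1*D * vol O)/c' by rewrite /E addrK.
 have -> : e/E/c' * v*(1+K1*D * vol O) = e*((E-1)/E) by rewrite EE; ring.
 by rewrite ger_pMr// ler_pdivrMr// mul1r gerBl.
apply: (ae_le_cont oO (f:=fun y => `|u y|) (V:=m) _ _ _ Ox).
- by move=> y Oy; apply: continuous_comp; [exact: cu|exact: norm_continuous].
- by move=> y _; exact: cm.
by apply: ae_in_impl aeb=>y _; rewrite subr_le0.
Qed.

End general_rhs.

Section regularity.
Context {R : realType} {N : nat} (O:set 'rV[R]_N).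
Hypotheses (oO:open O) (bO:bounded_set O).
Notation rV := 'rV[R]_N.
Notation dot := (@dotrv R N).
Notation Int := (Int O).
Notation I1 := (I1 O).
Notation L2 := (L2 O).
Notation H := (H O).
Notation wsol := (wsol O).
Notation conv := (conv O).
Notation morrey := (morrey O).
Notation psi t := (rk N (Ps N) t : rV -> R).
Implicit Types (u f h a:rV->R) (x y z e:rV) (g : 'I_N->rV->R).
Variables (c:R) (n:rV->rV).
Hypotheses (N_gt0:(0<N)%N) (c_gt0:0<c) (trapn:forall x0, boundary O x0->trap O c x0 (n x0)).

Lemma conv_height x x0 e (t:R) i : 0<t->nball x t `<=` O ->
 conv (fun y=>dot (y-x0) e) (pderiv i (psi t)) x = - e ord0 i.
move=> t0 Bt; have Ct: csm t (psi t):=csm_psi t0; have T:=tf_csm Ct Bt.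
have Se: sm (fun y:rV=>dot (y-x0) e) by exact: (sm_shift x0 (sm_dot e)).
have:=H_ibp oO bO i (H_tf oO bO T) Se.
rewrite (pderiv_shift i x0 (sm_dot e)) pderiv_dot (pderiv_shift i x Ct.1).
have -> : Int (fun y=>psi t (y-x) * e ord0 i) = e ord0 i.
 rewrite -[RHS]mulr1 -(Int_psi oO bO t0 Bt) -IntZ//; first by apply: eq_Int=>y _; rewrite mulrC.
 exact: (L2_I1 oO bO (sm_L2 oO bO (sm_shift x Ct.1))).
by move=> ->; rewrite opprK; apply: eq_Int=>y _; rewrite mulrC.
Qed.

(** The gradient of the mean at scale d/4 is computed for u - A height, which is O(d^(1+al/4)) on
    the ball of radius d/4; dividing by the scale leaves d^(al/4). Points of that ball still have
    balls of radius 3d/4 inside O, to which the expansion applies. *)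
Lemma gradient_taylor : exists2 K : R, 0<=K & forall (al C F E A d0:R) u U (G : 'I_N->rV->R) x0,
 0<al<=1->L2 u->0<=C->0<=F->0<=E->d0<=1->ireg O C al F u U G ->
 (forall x d, 0<d<=d0->(forall y, nrm (y-x)<d->O y)->nrm (x-x0)<=3 * d ->
  `|u x-A * dot (x-x0) (n x0)| <= E*(d * d `^ (al/4))) ->
 forall x d i, 0<d<=d0->(forall y, nrm (y-x)<d->O y)->nrm (x-x0)<=2 * d ->
  `|G i x-A * n x0 ord0 i| <= K*(C*F+E) * d `^ (al/4).
have [K K0 HK] := @pderiv_rk_bound R N N _ (prof_Ps N).
have q4 (d:R) : 0<d->d/4<d by lra.
have q34 (a b d:R) : 0<d->a<=b/4->b<=d->0<3/4 * b->a<b by lra.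
have tri (a b d p:R) : p<=a+b->a<=d/4->b<=2 * d->p<=3*(3/4 * d) by lra.
have tri2 (a b d p:R) : p<=a+b->a<3/4 * d->b<=d/4->p<d by lra.
have d34 (d d0:R) : 0<d<=d0->0<3/4 * d<=d0 by move=> /andP[? ?]; apply/andP; split; lra.
have d34' (d:R) : 0<d->3/4 * d<=d by lra.
have fin (a b w p q:R) : `|a| <= p * w -> `|b| <= K*4*2^+N*(q * w)->0<=p * w->0<=q * w -> `|b-a| <= (1+K*4*2^+N)*(p+q) * w.
 move=> h1 h2 p0 q0; apply: (le_trans (ler_normB _ _)).
 have k0: 0<=K*4*2^+N by pos.
 have:=mulr_ge0 k0 p0; move: h1 h2; move: (K*4*2^+N)=>k; lra.
exists (1+K*4*2^+N); first by pos.
move=> al C F E A d0 u U G x0 al01 Lu C0 F0 E0 d01 reg HT x d i dd Bx xd.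
have /andP[dp dd0]:=dd; have d1: 0<d<=1 by rewrite dp (le_trans dd0).
have [/andP[w0 _] _ _ _ [_ _ _ _ d4al]]:=power_scales al01 d1 erefl erefl.
have t0: 0<d/4 by rewrite divr_gt0.
have Bt: nball x (d/4) `<=` O by move=> y yx; apply: Bx; exact: le_lt_trans yx (q4 _ dp).
have gd: good O x (d/4) by split=> //; rewrite t0 (le_trans (ltW (q4 _ dp)))//; case/andP: d1.
have [_ /(_ i) h1]:=reg x _ gd.
have Ct: csm (d/4) (psi (d/4)) by exact: csm_psi.
pose h y:=dot (y-x0) (n x0).
have Lh: L2 h by apply: (sm_L2 oO bO); exact: (sm_shift x0 (sm_dot (n x0))).
pose w y:=u y + - A * h y; have Lw: L2 w by apply: (L2D oO) => //; exact: (L2Z oO).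
have E1: conv w (pderiv i (psi (d/4))) x = conv u (pderiv i (psi (d/4))) x+A * n x0 ord0 i.
 rewrite -[A * _]opprK -mulrN -(conv_height x0 (n x0) i t0 Bt) -mulNr.
 have I1' v: L2 v->I1 (fun y=>v y * pderiv i (psi (d/4)) (y-x)).
  by move=> Lv; exact: (conv_csm_I1 oO bO x Lv (csm_pderiv i Ct)).
 rewrite -(IntZ oO _ (I1' h Lh)) -(IntD oO (I1' u Lu) (I1Z oO _ (I1' h Lh))).
 by apply: eq_Int=>y _; rewrite /w mulrDl mulrA.
have S0: 0<=E*(d * d `^ (al/4)) by pos.
have h2: `|conv w (pderiv i (psi (d/4))) x| <= K*(d/4)^-N.+1*(E*(d * d `^ (al/4)))*(2*(d/4))^+N.
 apply: (conv_le_ball oO bO Lw t0 (csm_pderiv i Ct)) => //; first by move=> z; exact: HK.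
 apply: ae_inW=>y Oy yx; rewrite /w mulNr.
 apply: (le_trans (HT y (3/4 * d) (d34 _ _ dd) _ _)).
 - by move=> z zy; apply: Bx; exact: tri2 (nrm_tri z y x) zy yx.
 - exact: tri (nrm_tri y x x0) yx xd.
 apply: ler_wpM2l => //; apply: ler_pM => //; [by pos|by pos|exact: d34'|].
 by apply: powR_mono; [by have /andP[/ltW ? _]:=al01; pos|by pos|exact: d34'].
have E2: K*(d/4)^-N.+1*(E*(d * d `^ (al/4)))*(2*(d/4))^+N = K*4*2^+N*(E * d `^ (al/4)).
 by rewrite [(2 * _)^+N]exprMn exprS; field; rewrite !gt_eqF ?exprn_gt0.
rewrite E2 E1 in h2.
have h3: `|- conv u (pderiv i (psi (d/4))) x-G i x| <= C*F * d `^ (al/4).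
 by apply: (le_trans h1); apply: ler_wpM2l => //; exact: mulr_ge0.
have -> : G i x-A * n x0 ord0 i = - (conv u (pderiv i (psi (d/4))) x+A * n x0 ord0 i - - (- conv u (pderiv i (psi (d/4))) x-G i x)) by ring.
rewrite normrN; apply: fin => //; [by rewrite normrN|by pos|by pos].
Qed.

Lemma within_cont_nrm {W : normedModType R} (A:set rV) (f:rV->W) :
 (forall x, A x->forall e : R, 0<e->exists2 d : R, 0<d & forall y, A y->nrm (y-x)<d -> `|f x-f y| <= e) ->
 {within A, continuous f}.
move=> H; apply/subspace_continuousP=>x Ax; apply/cvgrPdist_le=>e e0; have [d d0 Hd]:=H x Ax e e0.
by rewrite near_withinE; apply/nbhs_nrmP; exists d => // y yx Ay; exact: Hd.
Qed.

Lemma norm_row_le (v:rV) (e:R) : 0<=e->(forall i, `|v ord0 i| <= e/(N%:R+1)) -> `|v| <= e.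
move=> e0 H; apply: (le_trans (norm_le_nrm v)); apply: (le_trans (nrm_le_sum v)).
apply: (@le_trans _ _ (\sum_(i<N) e/(N%:R+1))); first exact: ler_sum.
by rewrite sumr_const card_ord -[_ *+ N]mulr_natl mulrA ler_pdivrMr ?ltr_wpDl// mulrC ler_wpM2l// lerDl.
Qed.
Variable c' : R.
Hypotheses (c'_gt0:0<c') (Rc:rayleigh O c').

(** The gradient tends to A(x0) n(x0) at each boundary point, at a rate uniform in x0, which gives
    continuity on the closure. The last clause says that linear growth of s U away from the boundary
    forces the sign of the normal derivative, the outward normal being -n. *)
Lemma C1_boundary (al:R) : 0<al<=1->exists2 C : R, 0<=C & forall u g f F, wsol u g f->L2 f->morrey f F al ->
 exists U (DU:rV->rV), [/\ wsol U g f, ae_in O (fun x=>U x = u x) & forall x, O x -> {for x, continuous U}] /\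
 [/\ forall x, O x -> `|U x| <= C*(Int (fun x => `|u x|)+F), dist_bound O (C*(Int (fun x => `|u x|)+F)) U,
  C1_upto_boundary O U DU &
  forall k s : R, 0<k->(forall x d, O x->(forall y, nrm (y-x)<d->O y)->k * d<=s*U x) ->
   forall x0 nu, boundary O x0->outward_unit_normal O x0 nu->s * normal_derivative DU x0 nu<0].
have two (a b q v w:R) : `|q-b| <= v -> `|q-a| <= v->v<=w -> `|a-b| <= 2 * w.
 by rewrite !ler_norml => /andP[? ?] /andP[? ?] ?; apply/andP; split; lra.
have three (a b q v w:R) : `|q-a| <= v -> `|a-b| <= 2 * w->v<=w -> `|b-q| <= 3 * w.
 by rewrite !ler_norml => /andP[? ?] /andP[? ?] ?; apply/andP; split; lra.
have l2r (p r d:R) : p<=d+r->d<=r->p<=2 * r by lra.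
have m8 (r d:R) : 8 * r<=d->0<r->0<4 * r<=d by move=> *; apply/andP; split; lra.
have m4 (r:R) : 0<r->4 * r<=2*(4 * r) by lra.
have m5 (r z:R) : 0<r->z<=4 * r+r->z<=2*(4 * r) by lra.
have m48 (r:R) : 0<r->4 * r<=8 * r by lra.
have p8 (p r d:R) : p<=2 * r->8*(2 * r)<=d->8 * p<=d by lra.
have e8 (p r:R) : p<=2 * r->8 * p<=8*(2 * r) by lra.
have r2r (r:R) : 0<=r->r<=2 * r by lra.
have w3 (w a:R) : 0<=w->a<=2 * w->a<=3 * w by lra.
have d16 (d r:R) : 0<d->d<=r->d<=8*(2 * r) by lra.
have t16 (t r:R) : r<t/16->8*(2 * r)<=t by lra.
have b4 (d0 r:R) : 100 * d0<=c->8 * r<=d0->0<r->4 * r<=c/2 by lra.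
have fin (a b k:R) : `|a-b| <= k/2->k<=a->k/2<=b.
 by rewrite ler_norml => /andP[? ?] ?; lra.
have d3 (d:R) : 0<d->d<=3 * d by lra.
move=> al01; have /andP[al0 al1]:=al01; have ep0: 0<al/4 by rewrite divr_gt0.
have [Cr Cr0 Hreg]:=regular_rep oO bO al01.
have [K K0 HK]:=solution_dist_bound oO bO N_gt0 c_gt0 trapn c'_gt0 Rc al01.
have [Cb [d0 [Cb0 d01 dc HB]]]:=boundary_expansion oO bO c_gt0 trapn al01; have /andP[d0p d0le1]:=d01.
have [Kg Kg0 HG]:=gradient_taylor.
exists K => // u g f F W Lf M; have F0:=morrey_ge0 M.
have [U [G [WU reg cU aeU U0]]]:=Hreg u g f F W Lf M.
have [LU LG _]:=WU.1; have [Lu _ _]:=W.1.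
have IU: Int (fun x => `|U x|) = Int (fun x => `|u x|).
 apply: (Int_ae_eq oO); [exact: (L2_meas (L2_norm oO LU))|exact: (L2_meas (L2_norm oO Lu))|].
 by apply: ae_in_impl aeU=>x _ ->.
have [Ub Ud]:=HK U g f F WU Lf M cU; rewrite IU in Ub Ud.
set L:=K*(Int (fun x => `|u x|)+F) in Ub Ud.
have I0: 0<=Int (fun x => `|u x|) by exact: Int_ge0.
have L0: 0<=L by rewrite /L; pos.
have /choice[A HA] : forall x0, exists A : R, boundary O x0->forall x d, 0<d<=d0->(forall y, nrm (y-x)<d->O y) ->
  nrm (x-x0)<=3 * d -> `|U x-A * dot (x-x0) (n x0)| <= Cb*(F+L)*(d * d `^ (al/4)).
 move=> x0; have [bx|nb]:=pselect (boundary O x0); last by exists 0.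
 by have [A [_ HA]]:=HB U f F L x0 LU Lf (wsol_vsol oO bO WU) M L0 Ud cU bx; exists A.
have E0: 0<=Cb*(F+L) by pos.
pose E:=Kg*(Cr*F+Cb*(F+L)); have E'0: 0<=E by rewrite /E; pos.
have GT x0 x d i: boundary O x0->0<d<=d0->(forall y, nrm (y-x)<d->O y)->nrm (x-x0)<=2 * d ->
  `|G i x-A x0 * n x0 ord0 i| <= E * d `^ (al/4).
 by move=> bx; exact: (HG _ _ _ _ _ _ _ _ _ _ al01 LU Cr0 F0 E0 d0le1 reg (HA x0 bx)).
pose DU x : rV:=\row_i (if pselect (O x) then G i x else A x * n x ord0 i).
have DUO x i: O x->DU x ord0 i = G i x by rewrite mxE; case: pselect.
have DUb x i: boundary O x->DU x ord0 i = A x * n x ord0 i by move=> /(boundaryP oO)[nO _]; rewrite mxE; case: pselect.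
have clO x: closure O x -> ~ O x->boundary O x by move=> cx nO; split=> // /interior_subset.
have bb x1 p i: boundary O x1->boundary O p->p != x1->8 * nrm (p-x1)<=d0 ->
  `|A p * n p ord0 i-A x1 * n x1 ord0 i| <= 2*(E*(8 * nrm (p-x1)) `^ (al/4)).
 move=> b1 bp px; set r:=nrm (p-x1)=>rd; have r0: 0<r by apply: nrm_gt0; rewrite subr_eq0.
 (* Two boundary points at distance r are compared through this interior point: the ball of radius
    4r around it lies in O and both points are within 8r, so its gradient approximates both boundary
    values. *)
 pose z:=x1+(4 * r) *: n x1.
 have r40: 0<4 * r by rewrite mulr_gt0.
 have r4d: 0<4 * r<=d0 by exact: m8.
 have Bz y: nrm (y-z)<4 * r->O y by apply: (interior_ball trapn b1); rewrite r40; exact: (b4 d0 r dc rd r0).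
 have zx: nrm (z-x1) = 4 * r by rewrite /z addrAC subrr add0r nrmZ (nrm_n trapn b1) mulr1 gtr0_norm.
 have zx2: nrm (z-x1)<=2*(4 * r) by rewrite zx m4.
 have zp2: nrm (z-p)<=2*(4 * r) by have:=nrm_tri z x1 p; rewrite zx (nrm_distC x1) -/r; exact: m5.
 have h1:=GT x1 z _ i b1 r4d Bz zx2; have h2:=GT p z _ i bp r4d Bz zp2.
 have h3: E*(4 * r) `^ (al/4)<=E*(8 * r) `^ (al/4).
  by apply: ler_wpM2l => //; apply: powR_mono; [exact: ltW|exact: ltW|exact: m48].
 exact: two h1 h2 h3.
have main x1 y i: boundary O x1->closure O y->8*(2 * nrm (y-x1))<=d0 ->
  `|DU x1 ord0 i-DU y ord0 i| <= 3*(E*(8*(2 * nrm (y-x1))) `^ (al/4)).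
 move=> b1 cy; set r:=nrm (y-x1)=>rd; have r0: 0<=r by exact: nrm_ge0.
 have W0: 0<=E*(8*(2 * r)) `^ (al/4) by pos.
 have bb' p: boundary O p->nrm (p-x1)<=2 * r ->
   `|A p * n p ord0 i-A x1 * n x1 ord0 i| <= 2*(E*(8*(2 * r)) `^ (al/4)).
  move=> bp pr; have [->|px]:=eqVneq p x1; first by rewrite subrr normr0 mulr_ge0.
  have pd: 8 * nrm (p-x1)<=d0 by exact: p8 rd.
  apply: (le_trans (bb x1 p i b1 bp px pd)); apply: ler_wpM2l => //; apply: ler_wpM2l => //.
  by apply: powR_mono; [exact: ltW|by rewrite mulr_ge0// nrm_ge0|exact: e8].
 rewrite (DUb x1)//; have [Oy|nOy]:=pselect (O y); last first.
  rewrite (DUb y _ (clO y cy nOy)) distrC; have h:=bb' y (clO y cy nOy); rewrite -/r in h.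
  by apply: w3 => //; apply: h; exact: r2r.
 have [p [d [bp dp yp By yE]]]:=nearest N_gt0 oO bO c_gt0 trapn Oy.
 have dr: d<=r.
  rewrite leNgt; apply/negP; rewrite /r nrm_distC => /By; exact: (boundaryP oO b1).1.
 have px: nrm (p-x1)<=2 * r by have:=nrm_tri p y x1; rewrite (nrm_distC p y) yp -/r=>h; exact: l2r h dr.
 have dd: 0<d<=d0 by rewrite dp (le_trans (d16 _ _ dp dr)).
 have yp2: nrm (y-p)<=2 * d by rewrite yp r2r// ltW.
 have h1:=GT p y d i bp dd By yp2; have h2:=bb' p bp px.
 have h3: E * d `^ (al/4)<=E*(8*(2 * r)) `^ (al/4).
  by apply: ler_wpM2l => //; apply: powR_mono; [exact: ltW|exact: ltW|exact: d16].
 by rewrite (DUO y _ Oy); exact: three h1 h2 h3.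
exists U, DU; split=> //; split=> //.
- split.
 + apply: within_cont_nrm=>x cx e e0; have [Ox|nOx]:=pselect (O x).
   have /continuous_nrmP/(_ e e0)[d dp Hd]:=cU x Ox.
   by exists d => // y _ /Hd h; rewrite distrC ltW.
  exists (e/(L+1)); first by rewrite divr_gt0// ltr_wpDl.
  move=> y cy yx; rewrite (U0 x nOx) sub0r normrN.
  have [Oy|nOy]:=pselect (O y); last by rewrite (U0 y nOy) normr0 ltW.
  apply: (le_trans (Ud y x Oy nOx)); apply: (@le_trans _ _ ((L+1) * nrm (y-x))).
   by apply: ler_wpM2r; [exact: nrm_ge0|rewrite lerDl].
  by rewrite mulrC -ler_pdivlMr ?ltr_wpDl// ltW.
 + apply: within_cont_nrm=>x cx e e0; have e'0: 0<e/(N%:R+1) by rewrite divr_gt0// ltr_wpDl.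
  have [Ox|nOx]:=pselect (O x).
   have : \forall y \near nbhs x, forall i, O y -> `|G i y-G i x| <= e/(N%:R+1).
    apply: filter_forall=>i; have [d dp Hd]:=ireg_G_cont oO bO Cr0 F0 al0 LU reg i Ox e'0.
    by apply/nbhs_nrmP; exists d => // y yx _; exact: Hd.
   move=> /nbhs_nrmP[d dp Hd]; have /open_nrmP/(_ x Ox)[d2 d2p Hd2]:=oO.
   exists (Num.min d d2); first by rewrite lt_min dp.
   move=> y cy; rewrite lt_min => /andP[/Hd h /Hd2 Oy]; apply: norm_row_le=>[|i]; first exact: ltW.
   have -> : (DU x-DU y) ord0 i = DU x ord0 i-DU y ord0 i by rewrite !mxE.
   by rewrite !DUO// distrC; exact: h.
  have e3: 0<e/(N%:R+1)/(3*E+1) by rewrite divr_gt0// ltr_wpDl// mulr_ge0.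
  have [t /andP[t0 _] Ht]:=powR_small ep0 e3.
  pose t1:=Num.min t d0; have t10: 0<t1 by rewrite lt_min t0.
  exists (t1/16)=>[|y cy yx]; first by rewrite divr_gt0.
  apply: norm_row_le=>[|i]; first exact: ltW.
  have -> : (DU x-DU y) ord0 i = DU x ord0 i-DU y ord0 i by rewrite !mxE.
  have r16: 8*(2 * nrm (y-x))<=t1 by exact: t16.
  have rd: 8*(2 * nrm (y-x))<=d0 by apply: (le_trans r16); rewrite ge_min lexx orbT.
  apply: (le_trans (main x y i (clO x cx nOx) cy rd)).
  have [yx0|yx0]:=eqVneq (nrm (y-x)) 0.
   by rewrite yx0 !mulr0 powR0 ?gt_eqF// !mulr0 ltW.
  have r00: 0<nrm (y-x) by rewrite lt_def yx0 nrm_ge0.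
  have r0: 0<8*(2 * nrm (y-x)) by rewrite !mulr_gt0.
  have h: (8*(2 * nrm (y-x))) `^ (al/4)<=e/(N%:R+1)/(3*E+1).
   by apply: Ht; rewrite r0 (le_trans r16)// ge_min lexx.
  rewrite mulrA; apply: (@le_trans _ _ ((3*E+1)*(8*(2 * nrm (y-x))) `^ (al/4))).
   by apply: ler_wpM2r; [exact: powR_ge0|rewrite lerDl].
  by rewrite mulrC -ler_pdivlMr ?ltr_wpDl// mulr_ge0.
 + move=> x Ox; have [D1 D2]:=ireg_diff oO bO Cr0 F0 al0 LU reg Ox; split=> //.
  by apply/rowP=>i; rewrite mxE DUO// /pderiv derive_val.
move=> k s k0 Hk x0 nu bx onu; have nuE:=unit_normalE oO c_gt0 trapn bx onu.
have -> : normal_derivative DU x0 nu = - A x0.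
 rewrite /normal_derivative nuE (_:DU x0 = A x0 *: n x0); last by apply/rowP=>i; rewrite DUb// mxE.
 by rewrite dotZl dotNr (n_unit trapn bx) mulrN1.
rewrite mulrN oppr_lt0.
(* At distance d the expansion errs by O(d d^(al/4)); for d small this is at most k d/2, and s A >=
   k/2 follows. *)
have s1: 0<k/2/(`|s| * (Cb*(F+L))+1) by rewrite !divr_gt0// ltr_wpDl// mulr_ge0.
have [t /andP[t0 _] Ht]:=powR_small ep0 s1.
pose d:=Num.min (Num.min t d0) (c/2); have dp: 0<d by rewrite !lt_min t0 d0p divr_gt0.
have dt: d<=t by rewrite !ge_min lexx.
have dd0: d<=d0 by rewrite !ge_min lexx orbT.
have dc2: d<=c/2 by rewrite ge_min lexx orbT.
pose x:=x0+d *: n x0.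
have Bx y: nrm (y-x)<d->O y by apply: (interior_ball trapn bx); rewrite dp.
have Ox: O x by apply: Bx; rewrite subrr nrm0.
have xx0: x-x0 = d *: n x0 by rewrite /x addrAC subrr add0r.
have nx: nrm (x-x0) = d by rewrite xx0 nrmZ (nrm_n trapn bx) mulr1 gtr0_norm.
have:=HA x0 bx x d; rewrite dp dd0 nx => /(_ isT Bx) h.
have /h:=d3 _ dp.
rewrite xx0 dotZl (n_unit trapn bx) mulr1 => {}h.
have h2:=Hk x d Ox Bx.
have h3: `|s| * (Cb*(F+L)) * d `^ (al/4)<=k/2.
 have h4: d `^ (al/4)<=k/2/(`|s| * (Cb*(F+L))+1) by apply: Ht; rewrite dp.
 apply: (@le_trans _ _ ((`|s| * (Cb*(F+L))+1) * d `^ (al/4))).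
  by apply: ler_wpM2r; [exact: powR_ge0|rewrite lerDl].
 by rewrite mulrC -ler_pdivlMr ?ltr_wpDl// mulr_ge0.
have h5: `|s*U x-s*A x0 * d| <= k * d/2.
 rewrite -mulrA -mulrBr normrM; apply: (le_trans (ler_wpM2l (normr_ge0 s) h)).
 rewrite (_ : `|s| * _ = `|s| * (Cb*(F+L)) * d `^ (al/4) * d); last by ring.
 by rewrite (mulrAC k) ler_wpM2r// ltW.
have:=fin _ _ _ h5 h2.
by rewrite mulrAC ler_pM2r// => h6; apply: lt_le_trans h6; rewrite divr_gt0.
Qed.

End regularity.

(** * L^q data and the scalar equation with a zero order term *)

Section system.
Context {R : realType} {N : nat} (O:set 'rV[R]_N).
Hypotheses (oO:open O) (bO:bounded_set O).
Notation rV := 'rV[R]_N.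
Notation dot := (@dotrv R N).
Notation Int := (Int O).
Notation I1 := (I1 O).
Notation L2 := (L2 O).
Notation H := (H O).
Notation Dg := (Dg O).
Notation wsol := (wsol O).
Notation morrey := (morrey O).
Implicit Types (u f h a:rV->R) (x y z:rV) (g : 'I_N->rV->R).
Variables (c:R) (n:rV->rV).
Hypotheses (N_gt0:(0<N)%N) (c_gt0:0<c) (trapn:forall x0, boundary O x0->trap O c x0 (n x0)).

Lemma Lq_I1 (q:R) f : 1<=q->in_Lp O q f->I1 (fun x => `|f x| `^ q).
move=> q1 [mf fin]; have q0: 0<q by exact: lt_le_trans q1.
have mp: measurable_fun O (fun x => `|f x| `^ q).
 by apply: (measurableT_comp (measurable_powR q)); exact: measurableT_comp.
apply/integrableP; split; first exact/measurable_EFinP.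
have E: (\int[lebesgue_rV R N]_(x in O) `|(`|f x| `^ q)%:E| = Lp_norm O q f `^ q)%E.
 rewrite /Lp_norm powR_Lnorm// ?gt_eqF// [LHS]integral_mkcond; apply: eq_integral=>x _ /=.
 rewrite !patchE; case: ifPn=>_; last by rewrite normr0 powR0// gt_eqF.
 by rewrite (ger0_norm (powR_ge0 _ _)).
by rewrite /comp E poweR_lty.
Qed.

Lemma Lq_L2 (q:R) f : 2<=q->in_Lp O q f->L2 f.
move=> q2 Lf; have q1: 1<=q by apply: le_trans q2; rewrite ler1n.
split; first by case: Lf.
apply: (@I1_le _ _ _ oO _ (fun x=>1 + `|f x| `^ q)).
- by apply: measurable_funX; case: Lf.
- by apply: (I1D oO); [exact: (I1_cst oO bO)|exact: Lq_I1].
move=> x _; rewrite ger0_norm ?sqr_ge0// -real_normK ?num_real//.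
have [h|h]:=leP (`|f x|) 1.
 by apply: (@le_trans _ _ 1); rewrite ?exprn_ile1// lerDl powR_ge0.
apply: (@le_trans _ _ (`|f x| `^ q)); last by rewrite lerDr.
by rewrite -powR_mulrn// ler_powR// ltW.
Qed.

(** Hoelder's inequality on small balls, with al = 1 - N/q; it is replaced by the pointwise
    splitting |f| <= s + s^(1-q) |f|^q. *)
Lemma Lq_morrey (q:R) : N%:R<q->2<=q->exists2 al : R, 0<al<=1 &
 forall f, in_Lp O q f->exists F, morrey f F al.
move=> Nq q2; have q1: 1<=q by apply: le_trans q2; rewrite ler1n.
have q0: 0<q by exact: lt_le_trans q1.
exists (1-N%:R/q).
 by rewrite subr_gt0 ltr_pdivrMr// mul1r Nq gerBl divr_ge0// ltW.
move=> f Lf; have L2f:=Lq_L2 q2 Lf; have If:=Lq_I1 q1 Lf.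
exists (2^+N+Int (fun x => `|f x| `^ q))=>x t t01; have /andP[t0 t1]:=t01.
have L1: L2 (fun=> 1 : R) by exact: (L2_cst oO bO).
have /(_ x t t01) M1 : morrey (fun=> 1) (1*2^+N) 1.
 by apply: (morrey_bounded oO bO) => // y _; rewrite normr1.
rewrite subrr powRr0 mul1r mulr1 in M1.
(* This level balances the two terms of the splitting: both are of order t^(N - N/q). *)
pose s:=t `^ (- (N%:R/q)); have s0: 0<s by exact: powR_gt0.
have I1x:=indic_I1 oO bO x t L1.
apply: (@le_trans _ _ (Int (fun y=>s*(\1_(nball x t) y * `|1|)+s `^ (1-q) * `|f y| `^ q))).
 apply: (Int_le oO); [exact: (indic_I1 oO bO)|by apply: (I1D oO); exact: (I1Z oO)|move=> y _].
 rewrite normr1 mulr1 indicE; case: (_ \in _) => /=; last by rewrite mul0r mulr0 add0r mulr_ge0// powR_ge0.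
 rewrite mul1r mulr1; have [h|h]:=leP (`|f y|) s.
  by apply: (le_trans h); rewrite lerDl mulr_ge0// powR_ge0.
 apply: (@le_trans _ _ (s `^ (1-q) * `|f y| `^ q)); last by rewrite lerDr ltW.
 have f0: 0 < `|f y| by exact: lt_trans h.
 have -> : s `^ (1-q) = (s `^ (q-1))^-1 by rewrite -powRN opprB.
 rewrite mulrC ler_pdivlMr ?powR_gt0//.
 rewrite (_ : `|f y| `^ q = `|f y| `^ 1 * `|f y| `^ (q-1)); last first.
  by rewrite -powRD ?(gt_eqF f0) ?implybT// addrC subrK.
 by rewrite powRr1// ler_wpM2l// ge0_ler_powR// ?nnegrE ?subr_ge0// ltW.
rewrite (IntD oO (I1Z oO s I1x) (I1Z oO _ If)) (IntZ oO _ I1x) (IntZ oO _ If).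
have -> : 1-N%:R/q-1 = - (N%:R/q) by ring.
rewrite -/s mulrDl mulrDl; apply: lerD.
 by rewrite mulrC ler_wpM2r// ltW.
rewrite mulrC -mulrA ler_wpM2l//; first by apply: (Int_ge0)=>y _; exact: powR_ge0.
rewrite /s -powRrM -powR_mulrn; last exact: ltW.
rewrite -powRD; last by rewrite (gt_eqF t0) /= implybT.
rewrite le_eqVlt; apply/orP; left; apply/eqP; congr (t `^ _); field.
by rewrite gt_eqF.
Qed.

Lemma weak_solutionP u f : weak_dirichlet_solution O u f <-> exists g, wsol u g f.
split=> [[G /(in_H10P oO bO) HG S]|[g [HG S]]].
 exists (fun i x=>G x ord0 i); split=> // v k Hv.
 have Hv': H v (fun i x=>(\row_j k j x) ord0 i).
  by apply: (H_eq oO bO Hv) => // i x _; rewrite mxE.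
 have /(in_H10P oO bO)/S E:=Hv'.
 transitivity (Int (fun x=>dot (G x) (\row_j k j x))); last exact: E.
 rewrite /Dg -(Int_sum oO bO); last first.
  by move=> i; apply: (L2_mul oO); [case: HG|case: Hv].
 by apply: eq_Int=>x _; apply: eq_bigr=>i _; rewrite mxE.
have HG': H u (fun i x=>(\row_j g j x) ord0 i) by apply: (H_eq oO bO HG) => // i x _; rewrite mxE.
exists (fun x => \row_i g i x); first exact/(in_H10P oO bO).
move=> v gv /(in_H10P oO bO) Hv; have E:=S _ _ Hv.
transitivity (Dg (fun i x=>(\row_j g j x) ord0 i) (fun i x=>gv x ord0 i)); last first.
 by rewrite -[RHS]E; apply: eq_bigr=>i _; apply: eq_Int=>x _; rewrite mxE.
rewrite /Dg -(Int_sum oO bO); last first.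
 by move=> i; apply: (L2_mul oO); [case: HG'|case: Hv].
by apply: eq_Int=>x _; apply: eq_bigr=>i _.
Qed.

(** The best Rayleigh constant is an eigenvalue by [first_eigenfunction], hence at least l; an
    eigenfunction for l, tested with itself, shows that it is at most l. *)
Lemma smallest_rayleigh (l:R) : O !=set0->smallest_dirichlet_eigenvalue O l ->
 [/\ 0<l, rayleigh O l & exists e g, [/\ wsol e g (fun x=>l * e x), ae_in O (fun x=>0<=e x) & ~ ae_in O (fun x=>e x = 0)]].
move=> O0 [[phi phi0 /weak_solutionP[g W]] min].
have [l' [l'0 ray sup]]:=rayleigh_sup oO bO N_gt0 O0.
have [e [k [We e0 en]]]:=first_eigenfunction oO bO N_gt0 l'0 ray sup.
have ne: ~ ae_in O (fun x=>e x = 0).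
 move=> ae0; suff E : n2 O e = 0 by rewrite E ltxx in en.
 rewrite /n2; have -> : Int (fun x=>e x^+2) = 0; last by rewrite sqrtr0.
 rewrite -(Int0 O); apply: (Int_ae_eq oO) => //.
  by apply: measurable_funX; case: We => -[[]].
 by apply: ae_in_impl ae0=>x _ ->; rewrite expr0n.
have ll': l<=l' by apply: min; exists e => //; apply/weak_solutionP; exists k.
have [Hphi Sphi]:=W; have [Lphi _ _]:=Hphi.
have l'l: l'<=l.
 have:=rayleigh_H oO bO (ltW l'0) ray Hphi; rewrite (Sphi _ _ Hphi).
 have -> : Int (fun x=>l * phi x * phi x) = l * n2 O phi^+2.
  by rewrite (n2_sq O) -(IntZ oO); [apply: eq_Int=>x _; rewrite -mulrA|case: Lphi].
 rewrite ler_pM2r// exprn_gt0// lt_def sqrtr_ge0 andbT; apply/eqP=>E0; apply: phi0.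
 exact: (n2_ae0 oO).
have -> : l = l' by apply/le_anti; rewrite ll' l'l.
by split=> //; exists e, k.
Qed.

Lemma morrey_ae_le f h F al : L2 f->L2 h->ae_in O (fun x => `|f x| <= `|h x|)->morrey h F al->morrey f F al.
move=> Lf Lh fh M x t t01; apply: le_trans (M x t t01).
apply: (Int_ae_le oO); [exact: (indic_I1 oO bO)|exact: (indic_I1 oO bO)|].
by apply: ae_in_impl fh=>y _ h'; rewrite ler_wpM2l.
Qed.

Lemma wsol_ae_rhs u g f h : wsol u g f->L2 f->L2 h->ae_in O (fun x=>f x = h x)->wsol u g h.
move=> [Hu Su] Lf Lh fh; split=> // v k Hv; rewrite (Su v k Hv); have [Lv _ _]:=Hv.
apply: (Int_ae_eq oO); [exact: (I1_meas (L2_mul oO Lf Lv))|exact: (I1_meas (L2_mul oO Lh Lv))|].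
by apply: ae_in_impl fh=>x _ ->.
Qed.

Lemma wsol_sum (I:Type) (r:seq I) (a:I->R) (u:I->rV->R) (h:I->rV->R) :
 (forall i, L2 (h i))->(forall i, exists g, wsol (u i) g (h i)) ->
 exists g, wsol (fun x => \sum_(i <- r) a i * u i x) g (fun x => \sum_(i <- r) a i * h i x).
move=> Lh W; elim: r=>[|i r [g IH]].
 exists (fun _ _=>0); have -> : (fun x:rV => \sum_(i <- [::]) a i * u i x) = fun=> 0.
  by apply/funext=>x; rewrite big_nil.
 have -> : (fun x:rV => \sum_(i <- [::]) a i * h i x) = fun=> 0 by apply/funext=>x; rewrite big_nil.
 exact: (wsol0 oO bO).
have [k Wk]:=W i.
have Ls: L2 (fun x => \sum_(i <- r) a i * h i x) by apply: (L2_sum oO bO)=>j; exact: (L2Z oO).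
exists (fun j x=>g j x+a i * k j x); have:=wsol_lin oO bO (a i) IH Wk Ls (Lh i).
have -> : (fun x => \sum_(i <- r) a i * u i x+a i * u i x) = fun x => \sum_(i <- i :: r) a i * u i x.
 by apply/funext=>x; rewrite big_cons addrC.
by have -> : (fun x => \sum_(i <- r) a i * h i x+a i * h i x) = fun x => \sum_(i <- i :: r) a i * h i x;
 [apply/funext=>x; rewrite big_cons addrC|].
Qed.

(** One constant controls both the Morrey bound, for regularity, and the L2 norm, for the energy
    estimate. It is stable under linear combinations, so solutions can serve as data for the next
    equation of a chain. *)
Definition datum (al:R) f (F:R) := [/\ L2 f, morrey f F al & n2 O f<=F].

Lemma datum_ge0 al f F : datum al f F->0<=F.
by move=> [_ /morrey_ge0]. Qed.

Lemma datum_lin al f h (F G a:R) : datum al f F->datum al h G->datum al (fun x=>f x+a * h x) (F + `|a| * G).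
move=> [Lf Mf nf] [Lh Mh nh]; have Lah:=L2Z oO a Lh; split.
- exact: (L2D oO).
- apply: (morreyD oO bO) => //; exact: (morreyZ oO bO).
- apply: (le_trans (n2D oO Lf Lah)); rewrite (n2Z oO)//; apply: lerD => //.
 exact: ler_wpM2l.
Qed.

Lemma datum_sum al (I:Type) (r:seq I) (a:I->R) (h:I->rV->R) : al<=1 ->
 (forall i, exists F, datum al (h i) F)->exists F, datum al (fun x => \sum_(i <- r) a i * h i x) F.
move=> al1 D; elim: r=>[|i r [F IH]].
 have -> : (fun x:rV => \sum_(i <- [::]) a i * h i x) = fun=> 0 by apply/funext=>x; rewrite big_nil.
 have L0: L2 (fun=> 0 : R) by exact: (L2_cst oO bO).
 exists (0*2^+N); split=> //; first by apply: (morrey_bounded oO bO) => // y _; rewrite normr0.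
 by rewrite mul0r /n2; under eq_Int do rewrite expr0n; rewrite Int0 sqrtr0.
have [G HG]:=D i; exists (F + `|a i| * G).
have -> : (fun x => \sum_(i <- i :: r) a i * h i x) = fun x => \sum_(i <- r) a i * h i x+a i * h i x.
 by apply/funext=>x; rewrite big_cons addrC.
exact: datum_lin.
Qed.

Lemma datum_bounded (al:R) : al<=1->exists2 C : R, 0<=C & forall f K, measurable_fun O f->0<=K ->
 (forall x, O x -> `|f x| <= K)->datum al f (C*K).
move=> al1; exists (2^+N+Num.sqrt (vol O)); first by rewrite addr_ge0// sqrtr_ge0.
move=> f K mf K0 fK; have Lf:=L2_bounded oO bO mf fK; have n0: 0<=(2^+N : R) by exact: exprn_ge0.
split=> //.
 move=> x t t01; have /andP[t0 _]:=t01.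
 have /(_ x t t01)/le_trans:=morrey_bounded oO bO Lf al1 fK K0; apply.
 by rewrite !ler_wpM2r ?powR_ge0 ?exprn_ge0 ?(ltW t0)// mulrC ler_wpM2r// lerDl sqrtr_ge0.
apply: (@le_trans _ _ (K*Num.sqrt (vol O))).
 rewrite -[K in X in _<=X](ger0_norm K0) -sqrtr_sqr -sqrtrM ?sqr_ge0// ler_wsqrtr//.
 rewrite -(Int_cst oO); apply: (Int_le oO); [by case: Lf|exact: (I1_cst oO bO)|].
 by move=> x Ox; rewrite -real_normK ?num_real// ler_pXn2r// ?nnegrE// fK.
by rewrite mulrC ler_wpM2r// lerDr.
Qed.
Variable c' : R.
Hypotheses (c'_gt0:0<c') (Rc:rayleigh O c').

Lemma ae_eq_cont (u v:rV->R) : (forall x, O x -> {for x, continuous u})->(forall x, O x -> {for x, continuous v}) ->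
 ae_in O (fun x=>u x = v x)->forall x, O x->u x = v x.
move=> cu cv uv x Ox; apply/le_anti/andP; split.
 by apply: (ae_le_cont oO cu cv) => //; apply: ae_in_impl uv=>y _ ->.
by apply: (ae_le_cont oO cv cu) => //; apply: ae_in_impl uv=>y _ ->.
Qed.

(** Two passes. A qualitative supremum bound first makes k u + f a Morrey function and provides a
    continuous representative U; the estimates are then redone for U with constants depending only
    on its L2 norm and F. *)
Lemma regularize (kap al:R) : 0<=kap->0<al<=1->exists2 C : R, 0<=C & forall u g k f F, `|k| <= kap ->
 wsol u g (fun x=>k * u x+f x)->datum al f F ->
 exists U, [/\ wsol U g (fun x=>k*U x+f x), ae_in O (fun x=>U x = u x), forall x, O x -> {for x, continuous U},
  forall x, O x -> `|U x| <= C*(n2 O U+F) & dist_bound O (C*(n2 O U+F)) U].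
move=> kap0 al01; have /andP[_ al1]:=al01.
have [C1 C10 H1]:=sup_bound oO bO kap0 al01; have [C2 C20 H2]:=sup_cont oO bO kap0 al01.
have [Cr _ H3]:=regular_rep oO bO al01.
have [K K0 HK]:=solution_dist_bound oO bO N_gt0 c_gt0 trapn c'_gt0 Rc al01.
have [Cd Cd0 Hd]:=datum_bounded al1; pose V:=Num.sqrt (vol O); have V0: 0<=V by exact: sqrtr_ge0.
pose M:=C2*(V+1); have M0: 0<=M by rewrite /M; pos.
have fin (v m F:R) : 0<=v->0<=F->0<=m->K*(V * v+(F+kap*(Cd*(M*(v+F)))))<=K*(V+1+kap*(Cd*M))*(v+F).
 move=> v0 F0 m0; rewrite -mulrA ler_wpM2l// mulrDl mulrA (mulrA kap) addrA lerD//; last by rewrite !mulrA.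
 by rewrite mulrDl mul1r mulrDr; apply: lerD; [rewrite lerDl mulr_ge0|rewrite lerDr].
have fin2 (v F:R) : 0<=v->0<=F->C2*(V * v+F)<=M*(v+F).
 move=> v0 F0; rewrite /M -mulrA ler_wpM2l// mulrDl mul1r mulrDr; apply: lerD; [rewrite lerDl mulr_ge0//|by rewrite lerDr].
exists (M+K*(V+1+kap*(Cd*M))); first by pos.
move=> u g k f F kk W [Lf Mf nf]; have F0:=morrey_ge0 Mf; have [Lu _ _]:=W.1.
have Lh: L2 (fun x=>k * u x+f x) by apply: (L2D oO) => //; exact: (L2Z oO).
have hb (w:rV->R) x : O x -> `|k * w x+f x| <= kap * `|w x| + `|f x|.
 by move=> _; apply: (le_trans (ler_normD _ _)); rewrite normrM lerD2r ler_wpM2r.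
have ub:=H1 u g _ f F W Lh Lf Mf (hb u) 1 ltr01.
pose B:=C1*(Int (fun x => `|u x|)+F+1).
have IN0: 0<=Int (fun x => `|u x|) by exact: Int_ge0.
have B0: 0<=B by rewrite /B; pos.
have MB: morrey (fun=> B) (B*2^+N) al.
 by apply: (morrey_bounded oO bO) => //; [exact: (L2_cst oO bO)|move=> x _; rewrite ger0_norm].
have Mu: morrey u (B*2^+N) al.
 apply: (morrey_ae_le Lu (L2_cst oO bO B) _ MB).
 by apply: ae_in_impl ub=>x _ h; rewrite (ger0_norm B0).
have Mh: morrey (fun x=>k * u x+f x) (`|k| * (B*2^+N)+F) al.
 by apply: (morreyD oO bO) => //; [exact: (L2Z oO)|exact: (morreyZ oO bO)].
have [U [_ [WU _ cU aeU _]]]:=H3 _ _ _ _ W Lh Mh; have [LU _ _]:=WU.1.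
have LkU: L2 (fun x=>k*U x+f x) by apply: (L2D oO) => //; exact: (L2Z oO).
have WU': wsol U g (fun x=>k*U x+f x).
 by apply: (wsol_ae_rhs WU Lh LkU); apply: ae_in_impl aeU=>x _ ->.
have IU: Int (fun x => `|U x|)<=V * n2 O U.
 have:=Int_n2 oO bO (L2_norm oO LU); rewrite (n2_norm O) mulrC; apply: le_trans; exact: ler_norm.
have U1 x: O x -> `|U x| <= M*(n2 O U+F).
 move=> Ox; apply: le_trans (fin2 _ _ (n2_ge0 O U) F0).
 apply: (le_trans (H2 U g _ f F WU' LkU Lf Mf (hb U) cU x Ox)); apply: ler_wpM2l => //; by rewrite lerD2r.
have B1: 0<=M*(n2 O U+F) by rewrite mulr_ge0// addr_ge0// n2_ge0.
have DU:=Hd U _ (L2_meas LU) B1 U1.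
have [_ MkU _]:=datum_lin k (And3 Lf Mf nf) DU.
have MkU': morrey (fun x=>k*U x+f x) (F + `|k| * (Cd*(M*(n2 O U+F)))) al.
 by move: MkU; congr (morrey _ _ _); apply/funext=>x; rewrite addrC.
have [_ Ud]:=HK _ _ _ _ WU' LkU MkU' cU.
have A0: 0<=n2 O U+F by rewrite addr_ge0// n2_ge0.
exists U; split=> //.
 by move=> x Ox; apply: (le_trans (U1 x Ox)); rewrite [leRHS]mulrDl lerDl; pos.
move=> y y' Oy nO; apply: (le_trans (Ud y y' Oy nO)); apply: ler_wpM2r; first exact: nrm_ge0.
apply: (@le_trans _ _ (K*(V+1+kap*(Cd*M))*(n2 O U+F))); last by rewrite mulrDl lerDr mulr_ge0.
apply: le_trans (fin _ 0 F (n2_ge0 O U) F0 (lexx 0)); apply: ler_wpM2l => //; apply: lerD => //.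
by rewrite lerD2l ler_wpM2r//; pos.
Qed.

Lemma datum_le al f (F G:R) : F<=G->datum al f F->datum al f G.
move=> FG [Lf Mf nf]; split=> //; last exact: le_trans FG.
move=> x t t01; have /andP[t0 _]:=t01; apply: (le_trans (Mf x t t01)).
by rewrite !ler_wpM2r ?powR_ge0 ?exprn_ge0 ?(ltW t0).
Qed.

(** The gap c' - k1 bounds the L2 norm uniformly in k <= k1; this is why the components other than
    the first stay bounded as mu approaches mu11. *)
Lemma resolvent_bound (kap k1 al:R) : 0<=kap->k1<c'->0<al<=1->exists2 C : R, 0<=C &
 forall k f F, `|k| <= kap->k<=k1->datum al f F ->
 exists u g, [/\ wsol u g (fun x=>k * u x+f x), forall x, O x -> {for x, continuous u}, datum al u (C*F) & dist_bound O (C*F) u].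
move=> kap0 k1c al01; have [C1 C10 H1]:=regularize kap0 al01; have /andP[_ al1]:=al01.
have [Cd Cd0 Hd]:=datum_bounded al1; have c1: 0<c'-k1 by rewrite subr_gt0.
pose S:=C1*((c'-k1)^-1+1); have S0: 0<=S by rewrite mulr_ge0// addr_ge0// invr_ge0 ltW.
exists (Cd*S+S)=>[|k f F kk kk1 D]; first by rewrite addr_ge0// mulr_ge0.
have F0:=datum_ge0 D; have [Lf _ nf]:=D; have kc: k<c' by exact: le_lt_trans k1c.
have [u [g W]]:=exists_wsol oO bO N_gt0 c'_gt0 kc Rc Lf.
have [U [WU _ cU bU dU]]:=H1 u g k f F kk W D; have [LU _ _]:=WU.1.
have nU: n2 O U<=(c'-k1)^-1*F.
 rewrite ler_pdivlMl//; apply: le_trans nf; apply: le_trans (energy_bound oO bO c'_gt0 Rc kc WU Lf).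
 by rewrite ler_wpM2r ?n2_ge0// lerD2l lerN2.
have nS: C1*(n2 O U+F)<=S*F.
 by rewrite -mulrA ler_wpM2l// mulrDl mul1r lerD2r.
have SF: 0<=S*F by exact: mulr_ge0.
exists U, g; split=> //.
 apply: (@datum_le _ _ (Cd*(S*F))); first by rewrite mulrA ler_wpM2r// lerDl.
 by apply: Hd => // [|x Ox]; [exact: L2_meas LU|apply: le_trans nS; exact: bU].
move=> y y' Oy nO; apply: (le_trans (dU y y' Oy nO)); rewrite ler_wpM2r ?nrm_ge0//.
by apply: (le_trans nS); rewrite ler_wpM2r// lerDr mulr_ge0.
Qed.

Lemma hopf_positive (al:R) u g h F : 0<al<=1->connected O->wsol u g h->datum al h F ->
 (forall x, O x -> {for x, continuous u})->ae_in O (fun x=>0<=h x)->ae_in O (fun x=>0<=u x) ->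
 ~ ae_in O (fun x=>u x = 0) ->
 exists2 k : R, 0<k & forall x d, O x->(forall y, nrm (y-x)<d->O y)->k * d<=u x.
move=> al01 cO W [Lh Mh _] cu h0 u0 un0; have [C C0 HC]:=regular_rep oO bO al01; have /andP[al0 _]:=al01.
have [U [G [WU reg cU aeU _]]]:=HC _ _ _ _ W Lh Mh; have UO:=ae_eq_cont cU cu aeU.
have [LU _ _]:=WU.1; have F0:=morrey_ge0 Mh.
have pos: forall x, O x->0<U x.
 apply: (strong_maximum oO bO cO LU Lh (wsol_vsol oO bO WU) C0 F0 al0 reg) => //.
 - exact: ae_inW.
 - by apply: ae_in_impl u0=>x Ox; rewrite UO.
 - by move=> U0; apply: un0; apply: ae_in_impl U0=>x Ox; rewrite UO.
apply: (hopf_bound oO bO N_gt0 c_gt0 trapn c'_gt0 Rc W Lh h0 cu); first exact: ae_inW.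
by move=> x Ox; rewrite -UO// pos.
Qed.

(** The comparison function is v + s Ph, with v the solution for a = 0 and Ph the continuous
    eigenfunction. The factor 1/(c' - a) is the resonance of the first eigenvalue and produces the
    threshold delta of the theorem. *)
Lemma principal_bound (al:R) phi gphi f F : 0<al<=1->connected O ->
 wsol phi gphi (fun x=>c' * phi x)->ae_in O (fun x=>0<=phi x) -> ~ ae_in O (fun x=>phi x = 0) ->
 datum al f F->ae_in O (fun x=>0<=f x) -> ~ ae_in O (fun x=>f x = 0) ->
 exists2 k : R, 0<k & forall (a:R) u g, c'/2<=a<c'->wsol u g (fun x=>a * u x+f x) ->
  (forall x, O x -> {for x, continuous u}) ->
  forall x d, O x->0<=d->(forall y, nrm (y-x)<d->O y)->k/(c'-a) * d<=u x.
move=> al01 cO Wp p0 pn0 Df f0 fn0; have /andP[_ al1]:=al01; have [Lf _ _]:=Df.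
have L0: L2 (fun=> 0 : R) by exact: (L2_cst oO bO).
have [Cd Cd0 Hd]:=datum_bounded al1.
have [C1 C10 H1]:=regularize (ltW c'_gt0) al01.
have D0: datum al (fun=> 0) (Cd*0) by apply: Hd => // x _; rewrite normr0.
have Wp': wsol phi gphi (fun x=>c' * phi x+0) by apply: (eq_wsol Wp)=>x _; rewrite addr0.
have cc: `|c'| <= c' by rewrite gtr0_norm.
have [Ph [WP aeP cP bP dP]]:=H1 _ _ _ _ _ cc Wp' D0; have [LP _ _]:=WP.1.
pose K:=C1*(n2 O Ph+Cd*0); have K0: 0<=K by rewrite mulr_ge0// mulr0 addr0 n2_ge0.
have DP: datum al (fun x=>c'*Ph x+0) (Cd*(c'*K)).
 apply: Hd=>[||x Ox]; [exact: (L2_meas (L2D oO (L2Z oO c' LP) L0))|by rewrite mulr_ge0// ltW|by rewrite addr0 normrM (gtr0_norm c'_gt0); apply: ler_wpM2l; [exact: ltW|exact: bP]].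
have P0: ae_in O (fun x=>0<=Ph x) by apply: ae_in_impl2 aeP p0=>x _ ->.
have [kP kP0 HP] : exists2 k : R, 0<k & forall x d, O x->(forall y, nrm (y-x)<d->O y)->k * d<=Ph x.
 apply: (hopf_positive al01 cO WP DP cP) => //.
  by apply: ae_in_impl P0=>x _ h; rewrite addr0 mulr_ge0// ltW.
 by move=> P00; apply: pn0; apply: ae_in_impl2 aeP P00=>x _ ->.
have Ppos x: O x->0<Ph x.
 move=> Ox; have [x0 [d [_ d0 _ Bd _]]]:=nearest N_gt0 oO bO c_gt0 trapn Ox.
 by apply: lt_le_trans (HP x d Ox Bd); exact: mulr_gt0.
have z0: `|0 : R| <= 0 by rewrite normr0.
have [Cv Cv0 Hv]:=resolvent_bound (lexx 0) c'_gt0 al01.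
have [v [gv [Wv cv _ _]]]:=Hv 0 f F z0 (lexx 0) Df; have [Lv _ _]:=Wv.1.
have v0: ae_in O (fun x=>0<=v x).
 apply: (wsol_comparison oO bO c'_gt0 c'_gt0 Rc L0 Lf _ Wv f0).
 by apply: (eq_wsol (wsol0 oO bO))=>x _; rewrite mul0r addr0.
(* If v vanished, testing its equation with Ph and that of Ph with v would give Int f Ph = 0
   although Ph > 0, forcing f = 0 almost everywhere. *)
have vn0: ~ ae_in O (fun x=>v x = 0).
 move=> v00; apply: fn0.
 have E1:=Wv.2 _ _ WP.1; have:=WP.2 _ _ Wv.1; rewrite DgC E1.
 rewrite (_:Int (fun x=>(c'*Ph x+0) * v x) = 0); last first.
  rewrite -[RHS](Int0 O); apply: (Int_ae_eq oO) => //.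
   exact: (I1_meas (L2_mul oO (L2D oO (L2Z oO c' LP) L0) Lv)).
  by apply: ae_in_impl v00=>x _ ->; rewrite mulr0.
 move=> E2; have E3: Int (fun x => `|f x| * Ph x) = 0.
  rewrite -E2; apply: (Int_ae_eq oO).
  - exact: (I1_meas (L2_mul oO (L2_norm oO Lf) LP)).
  - exact: (I1_meas (L2_mul oO (L2D oO (L2Z oO 0 Lv) Lf) LP)).
  - by apply: ae_in_impl f0=>x _ h; rewrite ger0_norm// mul0r add0r.
 have:=Int_ae0 oO (L2_mul oO (L2_norm oO Lf) LP) _ E3 => /(_ (fun x Ox=>mulr_ge0 (normr_ge0 _) (ltW (Ppos x Ox)))).
 by apply: ae_in_impl=>x Ox /eqP; rewrite mulf_eq0 (gt_eqF (Ppos x Ox)) orbF normr_eq0 => /eqP.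
have D0f: datum al (fun x=>0 * v x+f x) F.
 by move: Df; congr (datum _ _ _); apply/funext=>x; rewrite mul0r add0r.
have [kv kv0 HV] : exists2 k : R, 0<k & forall x d, O x->(forall y, nrm (y-x)<d->O y)->k * d<=v x.
 apply: (hopf_positive al01 cO Wv D0f cv) => //.
 by apply: ae_in_impl f0=>x _ h; rewrite mul0r add0r.
have vpos x: O x->0<=v x.
 by move=> Ox; have:=HV x 0 Ox; rewrite mulr0; apply=>y; rewrite ltNge nrm_ge0.
have K1: 0<K+1 by rewrite ltr_wpDl.
(* Hopf's bound gives v >= kv d and the Lipschitz bound gives Ph <= K d, so e Ph <= v; K + 1 avoids
   a division by zero. *)
pose e:=kv/(K+1); have e0: 0<e by rewrite divr_gt0.
have eP x: O x->e*Ph x<=v x.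
 move=> Ox; have [x0 [d [bx d0 xd Bd _]]]:=nearest N_gt0 oO bO c_gt0 trapn Ox.
 apply: le_trans (HV x d Ox Bd); rewrite mulrAC ler_pdivrMr// -mulrA ler_wpM2l ?(ltW kv0)//.
 have:=dP x x0 Ox (boundaryP oO bx).1; rewrite xd -/K=>h.
 apply: (le_trans (ler_norm _)); apply: (le_trans h); rewrite mulrDr mulr1 mulrC lerDl; exact: ltW.
have c20: 0<c'/2 by rewrite divr_gt0.
exists (c'/2 * e * kP)=>[|a u g /andP[a1 a2] Wu cu]; first exact: (mulr_gt0 (mulr_gt0 c20 e0) kP0).
have a0: 0<a by exact: lt_le_trans a1.
have ca: 0<c'-a by rewrite subr_gt0.
(* Chosen so that the surplus (c' - a) s Ph of the eigenfunction equals a e Ph, which is at most the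
   deficit a v; hence h <= f. *)
pose s:=a * e/(c'-a); have s0: 0<s by rewrite divr_gt0// mulr_gt0.
pose h x:=f x+(a * e*Ph x-a * v x).
have Lh: L2 h by apply: (L2D oO) => //; apply: (L2B oO); exact: (L2Z oO).
have WW: wsol (fun x=>v x+s*Ph x) (fun i x=>gv i x+s * gphi i x) (fun x=>a*(v x+s*Ph x)+h x).
 apply: (eq_wsol (wsol_lin oO bO s Wv WP (L2D oO (L2Z oO 0 Lv) Lf) (L2D oO (L2Z oO c' LP) L0)))=>x _.
 have E: s*(c'-a) = a * e by rewrite /s divfK// gt_eqF.
 by rewrite /h -E; ring.
have le1: ae_in O (fun x=>v x+s*Ph x<=u x).
 apply: (wsol_comparison oO bO c'_gt0 a2 Rc Lh Lf WW Wu); apply: ae_inW=>x Ox.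
 by rewrite /h gerDl subr_le0 -mulrA ler_wpM2l ?(ltW a0)// eP.
have cW x: O x -> {for x, continuous (fun x=>v x+s*Ph x)}.
 move=> Ox; apply: (@cvgD _ _ _ _ _ v _ _ _ (cv x Ox)).
 by apply: cvgM; [exact: cvg_cst|exact: cP].
move=> x d Ox d0 Bd; apply: le_trans (ae_le_cont oO cW cu le1 Ox).
apply: (@le_trans _ _ (s*Ph x)); last by rewrite lerDr vpos.
apply: (@le_trans _ _ (s*(kP * d))); last by rewrite ler_wpM2l ?(ltW s0)// HP.
have -> : c'/2 * e * kP/(c'-a) * d = c'/2 * e/(c'-a)*(kP * d) by ring.
rewrite ler_wpM2r ?mulr_ge0 ?(ltW kP0)// ler_wpM2r ?invr_ge0 ?(ltW ca)// ler_wpM2r//; exact: ltW.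
Qed.

End system.

(** * The Jordan chain and the proof of the theorem *)

Lemma lower_jordan_entry (R:realType) n (J : 'M[R]_n) : lower_jordan_form J ->
 forall i j : 'I_n, i != j->J i j != 0->(i = j.+1 :> nat) /\ J i i = J j j.
move=> [k [p [a [e EJ]]]]; case: n/e J EJ=>J->i j; rewrite /mxdiag !mxE.
move=> ij; rewrite !eqxx !conform_mx_id !mxE !eqxx; case: (tagnat.sig1 i =P tagnat.sig1 j)=>[e|_]; last by rewrite mxE eqxx.
move: (tagnat.rect i) (tagnat.rect j) ij; move: (tagnat.sig2 i) (tagnat.sig2 j) e.
move: (tagnat.sig1 i) (tagnat.sig1 j)=>b b' x y e; case: _/e y=>y ri rj ij.
rewrite conform_mx_id mxE; case: (x =P y)=>[xy|_]; first by case/eqP: ij; apply/val_inj; rewrite /= ri xy.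
by case: (x =P y.+1 :> nat)=>[xy _|]; rewrite ?eqxx//; split=> //; rewrite ri rj xy addnS.
Qed.

Lemma lower_jordan_mulmx (R:realType) n (J : 'M[R]_n.+1) (w : 'cV[R]_n.+1) i : lower_jordan_form J ->
 (J *m w) i ord0 = J i i * w i ord0+(if i == ord0 then 0 else J i (inord i.-1)) * w (inord i.-1) ord0.
move=> /lower_jordan_entry EJ; rewrite mxE (bigD1 i)//=; congr (_ + _).
have Z (k : 'I_n.+1) : k != i->i != k.+1 :> nat->J i k * w k ord0 = 0.
 move=> ki ik; have [->|nz]:=eqVneq (J i k) 0; first by rewrite mul0r.
 have ik': i != k by rewrite eq_sym.
 by have [/eqP]:=EJ i k ik' nz; rewrite (negbTE ik).
case: eqP=>[i0|/eqP i0].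
 by rewrite mul0r big1// => k ki; apply: Z => //; rewrite i0.
have ipos: (0<i)%N by rewrite lt0n.
have iv: (inord i.-1 : 'I_n.+1) = i.-1 :> nat by rewrite inordK// prednK// ltnW.
rewrite (bigD1 (inord i.-1))/=; last by rewrite -val_eqE /= iv -(prednK ipos) /= neq_ltn ltnSn.
rewrite big1 ?addr0// => k /andP[ki ki']; apply: Z => //; apply: contraNneq ki'=>E.
by rewrite -val_eqE /= iv E.
Qed.

Lemma continuous_at_lin (R:realType) (T:topologicalType) (I:Type) (r:seq I) (a:I->R) (w:I->T->R) x :
 (forall i, {for x, continuous (w i)}) -> {for x, continuous (fun y => \sum_(i <- r) a i * w i y)}.
move=> cw; elim: r=>[|i r IH].
 by rewrite (_:(fun y=>_) = fun=> 0); [exact: cst_continuous|apply/funext=>y; rewrite big_nil].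
rewrite (_:(fun y=>_) = fun y=>a i * w i y + \sum_(j <- r) a j * w j y); last by apply/funext=>y; rewrite big_cons.
apply: (@cvgD _ _ _ _ _ (fun y=>a i * w i y)) => //.
by apply: cvgM; [exact: cvg_cst|exact: cw].
Qed.

Section chain.
Context {R : realType} {N : nat} (O:set 'rV[R]_N).
Hypotheses (oO:open O) (bO:bounded_set O).
Notation rV := 'rV[R]_N.
Notation L2 := (L2 O).
Notation H := (H O).
Notation wsol := (wsol O).
Implicit Types (u f h a:rV->R) (x y z:rV) (g : 'I_N->rV->R).
Variables (c:R) (n:rV->rV).
Hypotheses (N_gt0:(0<N)%N) (c_gt0:0<c) (trapn:forall x0, boundary O x0->trap O c x0 (n x0)).
Variable c' : R.
Hypotheses (c'_gt0:0<c') (Rc:rayleigh O c').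

Lemma dist_bound_weaken u (L L':R) : L<=L'->dist_bound O L u->dist_bound O L' u.
by move=> LL D y y' Oy Oy'; apply: (le_trans (D y y' Oy Oy')); rewrite ler_wpM2r// nrm_ge0. Qed.

(** Induction along the Jordan chain: the solution at step j enters the datum of step j + 1. Since s
    1 = 0, the chain is decoupled from [u0], and its bounds involve neither [u0] nor the distance of
    the first coefficient to c'. *)
Lemma chain_bound (kap k1 al:R) m : 0<=kap->k1<c'->0<al<=1->exists2 C : R, 0<=C &
 forall (k s:nat->R) (f:nat->rV->R) F u0, (forall j, (0<j<=m)%N -> [/\ `|k j| <= kap, k j<=k1 & `|s j| <= kap]) ->
 s 1%N = 0->(forall j, datum O al (f j) F) ->
 exists u : nat->rV->R, u 0%N = u0 /\ forall j, (j<m)%N ->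
  [/\ exists g, wsol (u j.+1) g (fun x=>k j.+1 * u j.+1 x+(f j.+1 x+s j.+1 * u j x)),
    forall x, O x -> {for x, continuous (u j.+1)}, datum O al (u j.+1) (C*F) & dist_bound O (C*F) (u j.+1)].
move=> kap0 k1c al01; have [Cr Cr0 HC]:=resolvent_bound oO bO N_gt0 c_gt0 trapn c'_gt0 Rc kap0 k1c al01.
elim: m=>[|m [C C0 IH]]; first by exists 0 => // k s f F u0 _ _ _; exists (fun=> u0).
exists (C+Cr*(1+kap*C))=>[|k s f F u0 ks s1 Df]; first by rewrite addr_ge0// mulr_ge0// addr_ge0// mulr_ge0.
have F0:=datum_ge0 (Df 0%N).
have ks' j: (0<j<=m)%N -> [/\ `|k j| <= kap, k j<=k1 & `|s j| <= kap].
 by move=> /andP[j0 jm]; apply: ks; rewrite j0 ltnW.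
have [u [u00 Hu]]:=IH k s f F u0 ks' s1 Df.
have [kk kk1 sk]:=ks m.+1 (leqnn _).
have Dr: datum O al (fun x=>f m.+1 x+s m.+1 * u m x) ((1+kap*C)*F).
 case: m s1 Hu sk {IH ks ks' kk kk1} => [|m] s1 Hu sk.
  have -> : (fun x=>f 1%N x+s 1%N * u 0%N x) = f 1%N by apply/funext=>x; rewrite s1 mul0r addr0.
  by apply: datum_le (Df 1%N); rewrite mulrDl mul1r lerDl !mulr_ge0.
 have [_ _ Du _]:=Hu m (leqnn _); apply: datum_le (datum_lin oO bO (s m.+2) (Df m.+2) Du).
 by rewrite mulrDl mul1r lerD2l -mulrA ler_wpM2r// mulr_ge0.
have [v [g [Wv cv Dv dv]]]:=HC _ _ _ kk kk1 Dr.
have B1: C*F<=(C+Cr*(1+kap*C))*F by rewrite ler_wpM2r// lerDl mulr_ge0// addr_ge0// mulr_ge0.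
have B2: Cr*((1+kap*C)*F)<=(C+Cr*(1+kap*C))*F by rewrite mulrA ler_wpM2r// lerDr.
exists (fun i=>if i == m.+1 then v else u i); split=> // j; rewrite ltnS=>jm.
rewrite (ltn_eqF (_:(j<m.+1)%N))// eqSS; have [->|jn]:=eqVneq j m.
 split; [by exists g|exact: cv|exact: datum_le Dv|exact: dist_bound_weaken dv].
have jm': (j<m)%N by rewrite ltn_neqAle jn.
by have [W cu Du du]:=Hu j jm'; split; [exact: W|exact: cu|exact: datum_le Du|exact: dist_bound_weaken du].
Qed.

Lemma wsol_unique (k:R) u g v l f f' : k<c'->L2 f->L2 f'->ae_in O (fun x=>f x = f' x) ->
 wsol u g (fun x=>k * u x+f x)->wsol v l (fun x=>k * v x+f' x)->ae_in O (fun x=>u x = v x).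
move=> kc Lf Lf' ff Wu Wv.
have le1: ae_in O (fun x=>u x<=v x).
 by apply: (wsol_comparison oO bO c'_gt0 kc Rc Lf Lf' Wu Wv); apply: ae_in_impl ff=>x _ ->.
have le2: ae_in O (fun x=>v x<=u x).
 by apply: (wsol_comparison oO bO c'_gt0 kc Rc Lf' Lf Wv Wu); apply: ae_in_impl ff=>x _ ->.
by apply: ae_in_impl2 le1 le2=>x _ a b; apply/le_anti; rewrite a.
Qed.

Lemma wsol_mulmx m (M : 'M[R]_m) (U H:rV -> 'cV[R]_m) : (forall i, L2 (fun x=>H x i ord0)) ->
 (forall i, exists g, wsol (fun x=>U x i ord0) g (fun x=>H x i ord0)) ->
 forall i, exists g, wsol (fun x=>(M *m U x) i ord0) g (fun x=>(M *m H x) i ord0).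
move=> LH WU i; have [g W]:=wsol_sum oO bO (index_enum 'I_m) (M i) LH WU.
by exists g; move: W; congr (wsol _ _ _); apply/funext=>x; rewrite mxE.
Qed.

End chain.

Theorem theorem2 (R : realType) (N n : nat) (N_gt0 : (0 < N)%N)
    (Omega : set 'rV[R]_N) (Omega_dom : smooth_bounded_domain Omega)
    (lambda1 : R) (lambda1P : smallest_dirichlet_eigenvalue Omega lambda1)
    (A P J : 'M[R]_n.+1) (xi : 'I_n.+1 -> R)
    (A_eigen : char_poly A = \prod_i ('X - (xi i)%:P))
    (xi_gt : forall i, i != ord0 -> xi i < xi ord0)
    (xi_dec : forall i j : 'I_n.+1, (i <= j)%N -> xi j <= xi i)
    (xi1_gt0 : 0 < xi ord0)
    (xi1_alg_simple : mup (xi ord0) (char_poly A) = 1%N)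
    (xi1_geo_simple : \rank (kermx (A - (xi ord0)%:M)^T) = 1%N)
    (X1_neq0 : forall X : 'cV[R]_n.+1, X != 0 -> A *m X = xi ord0 *: X ->
       forall i, X i ord0 != 0)
    (P_unit : P \in unitmx) (A_PJ : A = P *m J *m invmx P)
    (J_jordan : lower_jordan_form J) (J_diag : forall i, J i i = xi i)
    (q : R) (q_cond : if N == 1%N then q = 2 else N%:R < q)
    (F : 'rV[R]_N -> 'cV[R]_n.+1)
    (F_Lq : forall i, in_Lp Omega q (fun x => F x i ord0))
    (F1_ge0 : ae_in Omega (fun x => 0 <= (invmx P *m F x) ord0 ord0))
    (F1_neq0 : ~ ae_in Omega (fun x => (invmx P *m F x) ord0 ord0 = 0))
    (mu11 : R) (mu11E : mu11 = lambda1 - xi ord0) :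
  exists2 delta : R, 0 < delta &
    forall mu : R, mu11 - delta < mu < mu11 ->
    exists (U : 'rV[R]_N -> 'cV[R]_n.+1)
           (DU : 'I_n.+1 -> 'rV[R]_N -> 'rV[R]_N),
      [/\ weak_system_solution Omega A mu F U,
          forall V, weak_system_solution Omega A mu F V ->
            ae_in Omega (fun x => V x = U x) &
          forall i,
            [/\ C1_upto_boundary Omega (fun x => U x i ord0) (DU i),
                forall x, Omega x -> 0 < P i ord0 * U x i ord0 &
                forall x nu, boundary Omega x ->
                  outward_unit_normal Omega x nu ->
                  P i ord0 * normal_derivative (DU i) x nu < 0]].
Proof.
have fin (a b s t:R) : - s<=a->t+s<=b->t<=b+a by lra.
have [ne0 oO cO bO sO]:=Omega_dom.
have [c c0 [nu trapn]]:=uniform_trap oO bO sO.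
have [l0 ray [phi [gphi [Wphi phi0 phin0]]]]:=smallest_rayleigh oO bO N_gt0 ne0 lambda1P.
have [Nq q2] : N%:R<q /\ 2<=q.
 move: q_cond; case: eqP=>[-> ->|/eqP N1 Nq]; first by rewrite ltr1n.
 split=> //; apply: le_trans (ltW Nq); rewrite ler_nat; by case: (N) N_gt0 N1=>[|[|?]].
have [al al01 HM]:=Lq_morrey oO bO Nq q2; have /andP[_ al1]:=al01.
have DF i: exists G, datum Omega al (fun x=>F x i ord0) G.
 have [G M]:=HM _ (F_Lq i); exists (Num.max G (n2 Omega (fun x=>F x i ord0))).
 split; [exact: (Lq_L2 oO bO q2 (F_Lq i))| |by rewrite le_max lexx orbT].
 move=> x t t01; have /andP[t0 _]:=t01; apply: (le_trans (M x t t01)).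
 by rewrite !ler_wpM2r ?powR_ge0 ?exprn_ge0 ?(ltW t0)// le_max lexx.
have /choice[G HG] : forall i, exists G, datum Omega al (fun x=>(invmx P *m F x) i ord0) G.
 move=> i; have [G HG]:=datum_sum oO bO (index_enum 'I_n.+1) (invmx P i) al1 DF; exists G.
 by move: HG; congr (datum _ _ _ _); apply/funext=>x; rewrite mxE.
have G0 i: 0<=G i:=datum_ge0 (HG i).
pose F0:=\sum_i G i; have F00: 0<=F0 by exact: sumr_ge0.
have DFt i: datum Omega al (fun x=>(invmx P *m F x) i ord0) F0.
 by apply: datum_le (HG i) => //; rewrite /F0 (bigD1 i)//= lerDl sumr_ge0.
have Ji0 i: i != ord0->J i ord0 = 0.
 move=> i0; have [//|nz]:=eqVneq (J i ord0) 0.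
 have [_]:=lower_jordan_entry J_jordan i0 nz; rewrite !J_diag=>E.
 by have:=xi_gt i i0; rewrite E ltxx.
have JM (w : 'cV[R]_n.+1) i : (J *m w) i ord0 = xi i * w i ord0+(if i == ord0 then 0 else J i (inord i.-1)) * w (inord i.-1) ord0.
 by rewrite lower_jordan_mulmx// J_diag.
have P0 i: P i ord0 != 0.
 pose e : 'cV[R]_n.+1:=delta_mx ord0 ord0.
 have PX: A *m (P *m e) = xi ord0 *: (P *m e).
  rewrite A_PJ -!mulmxA (mulmxA (invmx P)) mulVmx// mul1mx scalemxAr; congr (P *m _).
  apply/colP=>j; rewrite -colE !mxE eqxx andbT; have [->|j0]:=eqVneq j ord0; first by rewrite J_diag mulr1.
  by rewrite Ji0// mulr0.
 have Pe: P *m e != 0.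
  apply/eqP=>E; have:=congr1 (mulmx (invmx P)) E; rewrite mulmxA mulVmx// mul1mx mulmx0.
  by move=> /matrixP/(_ ord0 ord0); rewrite !mxE eqxx => /eqP; rewrite oner_eq0.
 by have:=X1_neq0 _ Pe PX i; rewrite -colE mxE.
(* The other coefficients at mu11 are at most xi_2 + mu11 = lambda1 - (xi_1 - xi_2), which keeps
   them away from lambda1. When n = 0 there are none, and 0 serves. *)
have [k1 k1l Hk1] : exists2 k1 : R, k1<lambda1 & forall i, i != ord0->xi i+mu11<=k1.
 case: (posnP n)=>[n0|n0].
  exists 0 => // i /negP[]; apply/eqP/val_inj => /=; case: i=>[[|m]]//=; by rewrite n0.
 have v1: (inord 1 : 'I_n.+1) = 1%N :> nat by rewrite inordK.
 exists (xi (inord 1)+mu11)=>[|i i0].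
  rewrite mu11E addrCA gtrDl subr_lt0; apply: xi_gt; by rewrite -val_eqE /= v1.
 by rewrite lerD2r; apply: xi_dec; rewrite v1 lt0n.
(* A common bound for all diagonal coefficients with |mu| <= |mu11| + 1 and for all entries of J. *)
pose kap:=\sum_i `|xi i| + (`|mu11| + 1) + \sum_i \sum_j `|J i j|.
have xi_kap i: `|xi i| + (`|mu11| + 1)<=kap.
 rewrite /kap -addrA (bigD1 i)//= -addrA lerD2l addrCA lerDl.
 by rewrite addr_ge0 ?sumr_ge0// => j _; exact: sumr_ge0.
have J_kap i j: `|J i j| <= kap.
 apply: (@le_trans _ _ (\sum_i0 \sum_j0 `|J i0 j0|)); last by rewrite /kap lerDr !addr_ge0 ?sumr_ge0.
 rewrite (bigD1 i)//= (bigD1 j)//= -addrA lerDl.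
 by rewrite addr_ge0 ?sumr_ge0// => i' _; exact: sumr_ge0.
have kap0: 0<=kap by exact: le_trans (J_kap ord0 ord0).
have [C C0 HC]:=chain_bound oO bO N_gt0 c0 trapn l0 ray n kap0 k1l al01.
have Df0:=DFt ord0.
have [k k0 Hk]:=principal_bound oO bO N_gt0 c0 trapn l0 ray al01 cO Wphi phi0 phin0 Df0 F1_ge0 F1_neq0.
have [Cb Cb0 HCb]:=C1_boundary oO bO N_gt0 c0 trapn l0 ray al01.
(* At distance r from the boundary, Q i r bounds the contribution of the components j >= 1 to P_i1
   u_i, while K i r/(mu11 - mu), with K i as defined next, bounds that of the first component from
   below. *)
pose Q i:=\sum_j `|P i ord0*P i j| * (C*F0).
have Q0 i: 0<=Q i by apply: sumr_ge0=>j _; rewrite !mulr_ge0.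
pose K i:=P i ord0^+2 * k; have K0 i: 0<K i.
 by rewrite mulr_gt0// lt_def sqr_ge0 sqrf_eq0 P0.
(* With delta = 1/D, the three terms ensure in turn |mu| <= |mu11| + 1, then xi_1 + mu >= lambda1/2
   as [principal_bound] requires, and finally K i/(mu11 - mu) >= K i + Q i. *)
pose D:=1+2/lambda1 + \sum_i Q i/K i.
have QK0 i: 0<=Q i/K i by pos.
have l20: 0<=2/lambda1 by pos.
have D1: 1<=D by rewrite /D -addrA lerDl addr_ge0// sumr_ge0.
have Dl: 2/lambda1<=D by rewrite /D addrAC lerDr addr_ge0// sumr_ge0.
have DQ i: 1+Q i/K i<=D.
 rewrite /D (bigD1 i)//= -(addrA 1) lerD2l [leRHS]addrCA lerDl.
 by rewrite addr_ge0// sumr_ge0.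
have D0: 0<D by exact: lt_le_trans D1.
exists D^-1; first by rewrite invr_gt0.
move=> mu /andP[mu_gt mu_lt].
have e0: 0<mu11-mu by rewrite subr_gt0.
have eD: mu11-mu<D^-1 by rewrite ltrBlDr -ltrBlDl.
have De: D<=(mu11-mu)^-1 by rewrite -[D]invrK lef_pV2 ?posrE ?invr_gt0// ltW.
pose kn j:=xi (inord j)+mu.
(* The subdiagonal entry of row j. In row 0 the value 0 neutralises the predecessor, since 0.-1 is
   0. *)
pose sn j:=if (inord j : 'I_n.+1) == ord0 then 0 else J (inord j) (inord j.-1).
pose fn j x:=(invmx P *m F x) (inord j) ord0.
have i0E: (inord 0 : 'I_n.+1) = ord0 by apply/val_inj; rewrite /= inordK.
have la: lambda1-kn 0%N = mu11-mu by rewrite /kn i0E mu11E; ring.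
have al_lt: lambda1/2<=kn 0%N<lambda1.
 rewrite -subr_gt0 la e0 andbT -[kn _](subKr lambda1) la.
 have : mu11-mu<=lambda1/2.
  by apply: (le_trans (ltW eD)); rewrite -[leRHS]invrK invf_div lef_pV2 ?posrE ?divr_gt0.
 by rewrite lerBrDr -lerBrDl=>h; apply: (le_trans h); rewrite [X in _<=X - _]splitr addrK.
have mu_le: `|mu| <= `|mu11| + 1.
 have Di: D^-1<=1 by rewrite invf_le1.
 have -> : mu = mu11-(mu11-mu) by rewrite subKr.
 apply: (le_trans (ler_normB _ _)); rewrite lerD2l gtr0_norm//.
 exact: le_trans (ltW eD) Di.
have kn_kap j: `|kn j| <= kap.
 by apply: le_trans (xi_kap (inord j)); apply: (le_trans (ler_normD _ _)); rewrite lerD2l.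
have sn_kap j: `|sn j| <= kap by rewrite /sn; case: ifP=>_; rewrite ?normr0.
have s0: sn 0%N = 0 by rewrite /sn i0E.
have s1: sn 1%N = 0 by rewrite /sn; case: eqP => // /eqP n1; rewrite i0E Ji0.
have Dfn j: datum Omega al (fn j) F0 by exact: DFt.
have al_lt2: kn 0%N<lambda1 by case/andP: al_lt.
have [C' _ HC']:=resolvent_bound oO bO N_gt0 c0 trapn l0 ray kap0 al_lt2 al01.
have [u0 [g0 [W0 c_u0 D_u0 _]]]:=HC' _ _ _ (kn_kap 0%N) (lexx _) (Dfn 0%N).
have W0': wsol Omega u0 g0 (fun x=>kn 0%N * u0 x+(invmx P *m F x) ord0 ord0).
 by apply: (eq_wsol W0)=>x _; rewrite /fn i0E.
have kn_k1 j: (0<j<=n)%N->kn j<=k1.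
 move=> /andP[j0 jn]; apply: le_trans (Hk1 (inord j) _); first by rewrite lerD2l ltW.
 by rewrite -val_eqE /= inordK// -lt0n.
have kn_l (i : 'I_n.+1) : kn i<lambda1.
 have [->//|i0]:=eqVneq i ord0; apply: le_lt_trans k1l; apply: kn_k1.
 by rewrite lt0n -ltnS ltn_ord andbT; move: i0; rewrite -val_eqE.
have [u [u0E Hu]]:=HC kn sn fn F0 u0 (fun j jn=>And3 (kn_kap j) (kn_k1 j jn) (sn_kap j)) s1 Dfn.
have uW (i : 'I_n.+1) : [/\ exists g, wsol Omega (u i) g (fun x=>kn i * u i x+(fn i x+sn i * u i.-1 x)),
  forall x, Omega x -> {for x, continuous (u i)} & exists G, datum Omega al (u i) G].
 have [->|i0]:=eqVneq i ord0.
  rewrite u0E; split=> //; last by eexists; exact: D_u0.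
  by exists g0; apply: (eq_wsol W0)=>x _; rewrite /= s0 mul0r addr0.
 have ip: (0<i)%N by rewrite lt0n; move: i0; rewrite -val_eqE.
 have [|Wi ci Di _]:=Hu i.-1; first by rewrite prednK// -ltnS.
 by rewrite prednK// in Wi ci Di; split=> //; eexists; exact: Di.
have ud (i : 'I_n.+1) : i != ord0->dist_bound Omega (C*F0) (u i).
 move=> i0; have ip: (0<i)%N by rewrite lt0n; move: i0; rewrite -val_eqE.
 by have [|_ _ _]:=Hu i.-1; [rewrite prednK// -ltnS|rewrite prednK].
pose ut x : 'cV[R]_n.+1:=\col_i u i x.
pose ht x:=J *m ut x+mu *: ut x+invmx P *m F x.
have eqE (w : 'cV[R]_n.+1) (i : 'I_n.+1) x : (J *m w+mu *: w+invmx P *m F x) i ord0 =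
  kn i * w i ord0+(fn i x+sn i * w (inord i.-1) ord0).
 have addE (a b : 'cV[R]_n.+1) : (a+b) i ord0 = a i ord0+b i ord0 by rewrite mxE.
 by rewrite !addE [(mu *: w) _ _]mxE JM /kn /sn /fn inord_val; ring.
have htE (i : 'I_n.+1) x : ht x i ord0 = kn i * u i x+(fn i x+sn i * u i.-1 x).
 rewrite eqE !mxE inordK//; apply: leq_ltn_trans (ltn_ord i); exact: leq_pred.
have dat_rhs (i : 'I_n.+1) : exists G, datum Omega al (fun x=>fn i x+sn i * u i.-1 x) G.
 have im: (i.-1<n.+1)%N by apply: leq_ltn_trans (ltn_ord i); exact: leq_pred.
 by have [_ _ [H2 DH]]:=uW (Ordinal im); eexists; apply: (datum_lin oO bO _ (Dfn i) DH).
have dat_ht i: exists G, datum Omega al (fun x=>ht x i ord0) G.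
 have [H1 D1']:=dat_rhs i; have [_ _ [H2 D2']]:=uW i.
 exists (H1 + `|kn i| * H2); move: (datum_lin oO bO (kn i) D1' D2'); congr (datum _ _ _ _).
 by apply/funext=>x; rewrite htE addrC.
have L_ht i: L2 Omega (fun x=>ht x i ord0) by have [? []]:=dat_ht i.
have W_ut i: exists g, wsol Omega (fun x=>ut x i ord0) g (fun x=>ht x i ord0).
 have [[g Wg] _ _]:=uW i; exists g.
 rewrite (_:(fun x=>ut x i ord0) = u i); last by apply/funext=>x; rewrite mxE.
 by apply: (eq_wsol Wg)=>x _; rewrite htE.
have W_s:=wsol_mulmx oO bO P L_ht W_ut.
have PhtE x: P *m ht x = A *m (P *m ut x)+mu *: (P *m ut x)+F x.
 by rewrite /ht !mulmxDr -scalemxAr A_PJ !mulmxA mulmxKV// mulmxV// mul1mx.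
have dat_s i: exists G, datum Omega al (fun x=>(P *m ht x) i ord0) G.
 have [H HH]:=datum_sum oO bO (index_enum 'I_n.+1) (P i) al1 dat_ht; exists H.
 by move: HH; congr (datum _ _ _ _); apply/funext=>x; rewrite mxE.
(* P ut already solves the system; what is added here is, for each component, a representative that
   is C^1 up to the boundary. By continuity it agrees with P ut everywhere in Omega. *)
have /choice[UD HUD] : forall i, exists UD : ('rV[R]_N->R)*('rV[R]_N -> 'rV[R]_N),
  [/\ exists g, wsol Omega UD.1 g (fun x=>(P *m ht x) i ord0), ae_in Omega (fun x=>UD.1 x = (P *m ut x) i ord0),
   forall x, Omega x -> {for x, continuous UD.1}, C1_upto_boundary Omega UD.1 UD.2 &
   forall k s : R, 0<k->(forall x d, Omega x->(forall y, nrm (y-x)<d->Omega y)->k * d<=s*UD.1 x) ->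
   forall x0 nu, boundary Omega x0->outward_unit_normal Omega x0 nu->s * normal_derivative UD.2 x0 nu<0].
 move=> i; have [g W]:=W_s i; have [H [LH MH _]]:=dat_s i.
 have [U [DU [[WU aeU cU] [_ _ C1 HN]]]]:=HCb _ _ _ _ W LH MH.
 by exists (U, DU); split=> //; exists g.
have cs i x: Omega x -> {for x, continuous (fun x=>(P *m ut x) i ord0)}.
 move=> Ox; rewrite (_:(fun x=>_) = fun x => \sum_j P i j * u j x); last first.
  by apply/funext=>y; rewrite mxE; apply: eq_bigr=>j _; rewrite mxE.
 by apply: continuous_at_lin=>j; have [_ cu _]:=uW j; exact: cu.
pose U x : 'cV[R]_n.+1:=\col_i (UD i).1 x.
have UE x: Omega x->U x = P *m ut x.
 move=> Ox; apply/colP=>i; rewrite mxE; have [_ aeU cU _ _]:=HUD i.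
 exact: (ae_eq_cont oO cU (cs i) aeU Ox).
have Ui i: (fun x=>U x i ord0) = (UD i).1 by apply/funext=>x; rewrite mxE.
exists U, (fun i=>(UD i).2); split.
- move=> i; apply/(weak_solutionP oO bO); have [[g W] _ _ _ _]:=HUD i; exists g; rewrite Ui.
 by apply: (eq_wsol W)=>x Ox; rewrite UE// PhtE.
- move=> V HV.
 have WV i: exists g, wsol Omega (fun x=>V x i ord0) g (fun x=>(A *m V x+mu *: V x+F x) i ord0).
  exact/(weak_solutionP oO bO)/HV.
 have LV i: L2 Omega (fun x=>V x i ord0) by have [g [[]]]:=WV i.
 have LR i: L2 Omega (fun x=>(A *m V x+mu *: V x+F x) i ord0).
  have LAV: L2 Omega (fun x => \sum_j A i j*V x j ord0).
   by apply: (L2_sum oO bO)=>j; exact: (L2Z oO).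
  have [? [LF _ _]]:=DF i.
  move: (L2D oO (L2D oO LAV (L2Z oO mu (LV i))) LF); congr (L2 _ _).
  by apply/funext=>x; rewrite !mxE.
 pose vt x:=invmx P *m V x.
 have Wvt i: exists g, wsol Omega (fun x=>vt x i ord0) g
   (fun x=>kn i * vt x i ord0+(fn i x+sn i * vt x (inord i.-1) ord0)).
  have [g W]:=wsol_mulmx oO bO (invmx P) LR WV i; exists g; apply: (eq_wsol W)=>x _.
  rewrite -eqE; congr (fun_of_matrix _ i ord0).
  by rewrite !mulmxDr -scalemxAr A_PJ /vt !mulmxA mulVmx// mul1mx.
 (* Uniqueness climbs the chain: once the components of index i - 1 agree almost everywhere, the
    data of component i agree and [wsol_unique] applies. *)
 have key m (i : 'I_n.+1) : (i<=m)%N->ae_in Omega (fun x=>vt x i ord0 = u i x).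
  elim: m i=>[|m IH] i im.
   have i0: i = ord0 by apply/val_inj/eqP; rewrite /= -leqn0.
   have [g Wg]:=Wvt i; have [[h Wh] _ _]:=uW i; have [? [Lr _ _]]:=dat_rhs i; move: Wg Wh Lr; rewrite i0 s0=>Wg Wh Lr.
   have E: (fun x=>fn (@ord0 n) x+0 * vt x (inord (@ord0 n).-1) ord0) = (fun x=>fn (@ord0 n) x+0 * u (@ord0 n).-1 x).
    by apply/funext=>x; rewrite !mul0r.
   by apply: (wsol_unique oO bO l0 ray (kn_l ord0) _ Lr _ Wg Wh); rewrite ?E//; apply: ae_inW=>x _; rewrite !mul0r.
  have ip: (i.-1<=m)%N by case: (nat_of_ord i) im.
  have im': (i.-1<n.+1)%N by apply: leq_ltn_trans (ltn_ord i); exact: leq_pred.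
  have IHi:=IH (Ordinal im') ip.
  have iv: inord i.-1 = Ordinal im' by apply/val_inj; rewrite /= inordK.
  have [g Wg]:=Wvt i; have [[h Wh] _ _]:=uW i; have [? [Lr _ _]]:=dat_rhs i.
  have Lv: L2 Omega (fun x=>vt x (inord i.-1) ord0) by have [? [[]]]:=Wvt (inord i.-1).
  have [Lf _ _]:=Dfn i.
  apply: (wsol_unique oO bO l0 ray (kn_l i) (L2D oO Lf (L2Z oO (sn i) Lv)) Lr _ Wg Wh).
  by apply: ae_in_impl IHi=>x _; rewrite iv => ->.
 have : ae_in Omega (fun x=>forall i, vt x i ord0 = u i x).
  have : {ae lebesgue_rV R N, forall x, forall i : 'I_n.+1, Omega x->vt x i ord0 = u i x}.
   by apply: filter_forall=>i; exact: (key n i (leq_ord i)).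
  by apply: filterS=>x h Ox i; exact: h.
 apply: ae_in_impl=>x Ox h; rewrite UE// -[V x](mulKVmx P_unit); congr (P *m _).
 by apply/colP=>i; rewrite h mxE.
move=> i; rewrite Ui; have [_ _ _ C1 HN]:=HUD i.
(* The witness is the distance r to the nearest boundary point, hence at least d. The first
   component contributes at least (K i + Q i) r and the others at least -Q i r, which leaves K i
   r. *)
have near x d: Omega x->(forall y, nrm (y-x)<d->Omega y) ->
  exists2 d', 0<d' & K i * d'<=P i ord0*(UD i).1 x /\ d<=d'.
 move=> Ox Bd; have [x0 [r [bx r0 xr Br _]]]:=nearest N_gt0 oO bO c0 trapn Ox.
 have nOx:=(boundaryP oO bx).1.
 exists r => //; split; last first.
  by rewrite leNgt; apply/negP=>dr; apply: nOx; apply: Bd; rewrite nrm_distC xr.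
 have -> : (UD i).1 x = (P *m ut x) i ord0 by rewrite -UE// mxE.
 rewrite mxE mulr_sumr (bigD1 ord0)//= mxE u0E mulrA -expr2.
 have c1: k/(mu11-mu) * r<=u0 x.
  by rewrite -la; apply: (Hk _ _ _ al_lt W0' c_u0 x r Ox (ltW r0) Br).
 have c2: `|\sum_(j | j != ord0) P i ord0*(P i j * ut x j ord0)| <= Q i * r.
  rewrite /Q mulr_suml; apply: (le_trans (ler_norm_sum _ _ _)).
  rewrite [leRHS](bigID (fun j=>j != ord0))/=.
  apply: ler_wpDr; first by apply: sumr_ge0=>j _; rewrite !mulr_ge0// ltW.
  apply: ler_sum=>j j0; rewrite mulrA normrM -mulrA; apply: ler_wpM2l => //; rewrite mxE.
  by have:=ud j j0 x x0 Ox nOx; rewrite xr.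
 have c3: (K i+Q i) * r<=P i ord0^+2 * u0 x.
  apply: (@le_trans _ _ (P i ord0^+2*(k/(mu11-mu) * r))); last by rewrite ler_wpM2l// sqr_ge0.
  rewrite !mulrA -/(K i); apply: ler_wpM2r; first exact: ltW.
  have -> : K i+Q i = K i*(1+Q i/K i) by rewrite mulrDr mulr1 mulrC divfK// gt_eqF.
  by apply: ler_wpM2l; [exact: ltW|exact: le_trans (DQ i) De].
 move: c2 c3; rewrite mulrDl ler_norml => /andP[+ _].
 by move=> h1 h2; exact: fin h1 h2.
split=> //.
- move=> x Ox; have [|d d0 [h _]]:=near x 0 Ox; first by move=> y; rewrite ltNge nrm_ge0.
 by rewrite mxE; apply: lt_le_trans h; exact: mulr_gt0.
- apply: (HN (K i) (P i ord0) (K0 i))=>x d Ox Bd; have [r r0 [h dr]]:=near x d Ox Bd.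
 by apply: le_trans h; rewrite ler_wpM2l// ltW.
Qed.
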